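(* Let $-1<\alpha,\beta<+\infty$ with $\beta=\beta_0+m$, $m\in\mathbb N$ and $\beta_0\in\mathcal J_\alpha$, and let $p$ satisfy $$\frac{2(\beta+1)}{2(\beta+1)-m}<p<\frac{2(\beta+1)}{m}$$ (which means $1<p<+\infty$ if $m=0$). Let $\varphi\in C(\overline{\mathbb D})$. Then $T_\varphi$ is a compact operator on $\mathcal A^p_{\alpha,\beta}$ if and only if $\varphi|_{\partial\mathbb D}=0$.
   Context: $\mathbb D$ is the open unit disc in $\mathbb C$, $\mathbb D^*=\mathbb D\setminus\{0\}$, $dA$ is the area measure on $\mathbb D$ normalized so that $\mathbb D$ has measure $1$, $\mathrm B(\cdot,\cdot)$ is the Euler beta function, and $\mathbb N=\{0,1,2,\dots\}$. For $-1<\alpha,\beta<+\infty$, $$d\mu_{\alpha,\beta}(z)=\frac{1}{\mathrm B(\alpha+1,\beta+1)}|z|^{2\beta}(1-|z|^2)^\alpha\,dA(z),$$ and $\mathcal A^p_{\alpha,\beta}$ is the space of holomorphic functions $f$ on $\mathbb D^*$ with $\|f\|_{\alpha,\beta,p}=\left(\int_{\mathbb D}|f|^p\,d\mu_{\alpha,\beta}\right)^{1/p}<+\infty$. Every $\beta>-1$ is written uniquely as $\beta=\beta_0+m$ with $m\in\mathbb N$ and $-1<\beta_0\le 0$. For $\xi\in\mathbb D$, $$Q_{\alpha,\beta}(\xi)=\begin{cases}(\alpha+1)\mathrm B(\alpha+1,\beta+1) & \text{if }\beta\in\mathbb N,\\[4pt] \dfrac{\mathrm B(\alpha+1,\beta+1)}{\mathrm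 B(\alpha+1,\beta_0+1)}\displaystyle\sum_{n=0}^{+\infty}\frac{\beta_0(-\xi)^n}{n+\beta_0}\binom{\alpha+1}{n} & \text{if }\beta\notin\mathbb N.\end{cases}$$ $\mathcal J_\alpha$ denotes the set of $\beta\in(-1,0]$ such that $Q_{\alpha,\beta}$ has no zero in $\mathbb D$. The projection $\mathbb P_{\alpha,\beta}$ from $L^p(\mathbb D,d\mu_{\alpha,\beta})$ onto $\mathcal A^p_{\alpha,\beta}$ is $$\mathbb P_{\alpha,\beta}f(z)=\int_{\mathbb D}f(w)\frac{Q_{\alpha,\beta}(z\overline w)}{(z\overline w)^m(1-z\overline w)^{2+\alpha}}\,d\mu_{\alpha,\beta}(w).$$ For $\varphi\in L^\infty(\mathbb D)$ the Toeplitz operator is $T_\varphi f=\mathbb P_{\alpha,\beta}(\varphi f)$, $f\in\mathcal A^p_{\alpha,\beta}$. *)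

(* Defs.v *)
From HB Require Import structures.
From mathcomp Require Import all_boot all_order all_algebra.
From mathcomp Require Import complex.
From mathcomp Require Import all_classical all_reals all_analysis.

Set Implicit Arguments.
Unset Strict Implicit.
Unset Printing Implicit Defensive.

Import Order.TTheory GRing.Theory Num.Theory.
Import numFieldNormedType.Exports.

Local Open Scope classical_set_scope.
Local Open Scope ring_scope.
Local Open Scope complex_scope.

Section ComplexPlane.
Context {R : realType}.

Definition cabs (z : R[i]) : R := complex.Re `|z|.

Definition disc : set R[i] := [set z | cabs z < 1].

Definition punctured_disc : set R[i] := [set z | disc z /\ z != 0].

Definition closed_disc : set R[i] := [set z | cabs z <= 1].

Definition unit_circle : set R[i] := [set z | cabs z = 1].

(** Complex differentiability; the regular module [R[i]^o] carries the norm
    topology of the field [R[i]], so the difference quotient ranges over complex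
    increments.  Meant for open [U]. *)
Definition holomorphic_on (U : set R[i]) (f : R[i] -> R[i]) : Prop :=
  forall z : R[i], U z -> derivable (f : R[i]^o -> R[i]^o) (z : R[i]^o) (1 : R[i]^o).

(** Principal argument, with values in ]-pi, pi] for [z != 0]. *)
Definition Arg (z : R[i]) : R :=
  let t := acos (complex.Re z / cabs z) in
  if 0 <= complex.Im z then t else - t.

(** Principal branch of the power [z ^ s], [z != 0], with real exponent. *)
Definition cpow (z : R[i]) (s : R) : R[i] :=
  (cabs z `^ s)%:C * (cos (s * Arg z) +i* sin (s * Arg z)).

End ComplexPlane.

Section BergmanSpaces.
Context {R : realType}.
Implicit Types (a b p : R) (f phi : R[i] -> R[i]).

Definition Beta (x y : R) : R :=
  \int[@lebesgue_measure R]_(t in `]0, 1[) (t `^ (x - 1) * (1 - t) `^ (y - 1)).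

Definition gbinom (s : R) (n : nat) : R :=
  (\prod_(i < n) (s - i%:R)) / n`!%:R.

(** The decomposition [b = frac_part b + int_part b] of [b > -1] with
    [int_part b] a natural number and [-1 < frac_part b <= 0]. *)
Definition int_part b : nat := `|Num.ceil b|%N.

Definition frac_part b : R := b - (int_part b)%:R.

Lemma int_partE (b0 : R) (m : nat) :
  -1 < b0 -> b0 <= 0 -> int_part (b0 + m%:R) = m.
Proof.
move=> h1 h2; rewrite /int_part (_ : Num.ceil _ = m%:Z) ?absz_nat//.
apply: ceil_def; rewrite rmorphB/= mulr1z; apply/andP; split.
  by rewrite [ltLHS]addrC ltrD2r.
by rewrite gerDr.
Qed.

(** Density, with respect to Lebesgue measure on the plane, of the probability
    measure [mu_(a,b)] on the unit disc; the factor [pi^-1] normalizes area. *)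
Definition density a b (w : R[i]) : R :=
  (Beta (a + 1) (b + 1))^-1 * cabs w `^ (2 * b) * (1 - cabs w ^+ 2) `^ a / pi.

Definition plane (w : R * R) : R[i] := w.1 +i* w.2.

Local Notation area := (@lebesgue_measure R \x @lebesgue_measure R)%E.

Definition disc_xy : set (R * R) := plane @^-1` disc.

Definition bnorm a b p f : \bar R :=
  ((\int[area]_(w in disc_xy)
      (cabs (f (plane w)) `^ p * density a b (plane w))%:E) `^ p^-1)%E.

(** Integral of a complex-valued function against [mu_(a,b)]. *)
Definition cintegral a b (g : R[i] -> R[i]) : R[i] :=
  (\int[area]_(w in disc_xy)
     (complex.Re (g (plane w)) * density a b (plane w)))
  +i*
  (\int[area]_(w in disc_xy)
     (complex.Im (g (plane w)) * density a b (plane w))).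

Definition Q a b (xi : R[i]) : R[i] :=
  if b \is a Num.nat then ((a + 1) * Beta (a + 1) (b + 1))%:C
  else
    let b0 := frac_part b in
    (Beta (a + 1) (b + 1) / Beta (a + 1) (b0 + 1))%:C *
    limn (fun N : nat => (\sum_(0 <= n < N)
      (b0%:C * (- xi) ^+ n / (n%:R + b0%:C) * (gbinom (a + 1) n)%:C) : R[i]^o)).

Definition J a : set R :=
  [set b | [/\ -1 < b, b <= 0 & forall xi, disc xi -> Q a b xi != 0]].

Definition projection a b f (z : R[i]) : R[i] :=
  cintegral a b (fun w =>
    f w * (Q a b (z * w^*) /
      ((z * w^*) ^+ int_part b * cpow (1 - z * w^*) (2 + a)))).

(** A function on the punctured disc is represented by its extension by [0], so
    that Leibniz equality is equality of functions on the punctured disc. *)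
Record bergman a b p := Bergman {
  bergman_fun :> R[i] -> R[i];
  _ : holomorphic_on punctured_disc bergman_fun;
  _ : (bnorm a b p bergman_fun < +oo)%E;
  _ : forall z, ~ punctured_disc z -> bergman_fun z = 0 }.

HB.instance Definition _ a b p := gen_eqMixin (bergman a b p).
HB.instance Definition _ a b p := gen_choiceMixin (bergman a b p).

(** The topology of the space is the one defined by its norm. *)
Definition bergman_ball a b p (f : bergman a b p) (e : R) : set (bergman a b p) :=
  [set g : bergman a b p | (bnorm a b p (fun z => (g z - f z)%R) < e%:E)%E].

Definition bergman_open a b p : set_system (bergman a b p) :=
  [set U : set (bergman a b p) |
    forall f : bergman a b p, U f -> exists2 e : R, 0 < e & bergman_ball f e `<=` U].

Lemma bergman_openT a b p : bergman_open (a := a) (b := b) (p := p) setT.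
Proof. by move=> f _; exists 1. Qed.

Lemma bergman_openI a b p : setI_closed (bergman_open (a := a) (b := b) (p := p)).
Proof.
move=> U V oU oV f [/oU[e e0 eU] /oV[d d0 dV]].
exists (Num.min e d); first by rewrite lt_min e0 d0.
move=> g; rewrite /bergman_ball/= => hg; split.
  by apply: eU; apply: (lt_le_trans hg); rewrite lee_fin ge_min lexx.
by apply: dV; apply: (lt_le_trans hg); rewrite lee_fin ge_min lexx orbT.
Qed.

Lemma bergman_open_bigU a b p (I : Type) (F : I -> set (bergman a b p)) :
  (forall i, bergman_open (F i)) -> bergman_open (\bigcup_i F i).
Proof.
move=> oF f [i _ /oF[e e0 eF]]; exists e => // g /eF Fg.
by exists i.
Qed.

HB.instance Definition _ a b p := isOpenTopological.Build (bergman a b p)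
  (@bergman_openT a b p) (@bergman_openI a b p) (@bergman_open_bigU a b p).

Definition compact_operator a b p (T : bergman a b p -> bergman a b p) : Prop :=
  compact (closure (T @` [set f : bergman a b p | (bnorm a b p f <= 1)%E])).

Definition is_toeplitz a b p phi (T : bergman a b p -> bergman a b p) : Prop :=
  forall (f : bergman a b p) (z : R[i]), punctured_disc z ->
    T f z = projection a b (fun w => phi w * f w) z.

(** [is_toeplitz] determines [T]; its existence says that the formula maps the
    space into itself. *)
Definition toeplitz_compact a b p phi : Prop :=
  exists2 T : bergman a b p -> bergman a b p,
    is_toeplitz phi T & compact_operator T.

End BergmanSpaces.

(* Main.v *)
From HB Require Import structures.
From mathcomp Require Import all_boot all_order all_algebra.
From mathcomp Require Import complex ring lra.
From mathcomp Require Import all_classical all_reals all_analysis measurable_realfun.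
Require Import Defs.

Set Implicit Arguments.
Unset Strict Implicit.
Unset Printing Implicit Defensive.

Import Order.TTheory GRing.Theory Num.Theory.
Import numFieldNormedType.Exports.

Local Open Scope classical_set_scope.
Local Open Scope ring_scope.
Local Open Scope complex_scope.

(** Below [a] and [b0] stand for [alpha] and [beta0], and [b = b0 + m]. The proof rests on three facts about the projection.

    The kernel. The quotient of [Q] by [(1 - x) ^ (2 + a)] is, up to a positive
    constant, a power series with positive explicit coefficients [hcoef]
    ([Q_kernel]): along each ray both sides solve the same first order equation
    with a regular singular point at [0]. Moreover [Q] is bounded on the disc.
    So the kernel is dominated by [absker], the product of [|z w| ^ (- m)] and
    [|1 - z conj(w)| ^ (- (2 + a))].

    Boundedness. Schur's test for [absker], with a power of [|w|] times a power
    of [1 - |w| ^ 2] as comparison function and the Forelli-Rudin estimates as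
    input, gives an [L^p] bound when [m p] and [m q] are below [2 (b + 1)],
    [q] being the conjugate exponent; these are the two bounds on [p]
    ([bergman_schur], [projection_norm]).

    Series. Integrating the kernel termwise, the projection of [F] is
    [z ^ (- m)] times the power series with coefficients [hcoef] times the
    moments of [F] ([projection_series]). It multiplies every polynomial by one
    and the same positive constant [l] ([projection_poly]), by orthogonality of
    the monomials and because the recursions of [hcoef] and of the moments
    compensate each other.

    Sufficiency. Let the symbol vanish on the circle and cut it at [|w| = rho].
    The part with [|w| > rho] is uniformly small, hence contributes little in
    norm. The moments of the part with [|w| <= rho] decay like [rho ^ n], so that
    finitely many of them determine the image up to a small error. This makes the
    image of the unit ball totally bounded ([toeplitz_totally_bounded]). Its
    elements are Laurent series with uniformly controlled coefficients; from a
    Cauchy sequence one extracts coefficientwise limits, and Fatou's lemma turns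
    this into convergence in norm ([toeplitz_complete]).

    Necessity. For [zeta] on the circle the powers of [(1 + conj(zeta) z) / 2],
    normalized to [e_n] of norm one, concentrate at [zeta] and tend to [0]
    pointwise. As they are polynomials, [T e_n] is [l phi(zeta) e_n] up to an
    error that tends to [0] in norm. If [T] is compact, these images accumulate
    in norm at some [g], and [g] has norm zero by Fatou's lemma; since [e_n] has
    norm one, [phi zeta = 0] ([toeplitz_compact_necessary]).

    All estimates are made for the [p]-th power [npow] of the norm. Its triangle
    inequality holds with the constant [2 ^ p], which is enough for the topology
    and for the compactness argument ([compact_closure_image]). *)

(** * The modulus of complex numbers *)
Section Cabs.
Context {R : realType}.
Implicit Types (z w : R[i]) (x y t : R).

Lemma cabsE z : cabs z = Num.sqrt (complex.Re z ^+ 2 + complex.Im z ^+ 2).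
Proof. by rewrite /cabs normc_def. Qed.

Lemma normCabs z : `|z| = (cabs z)%:C.
Proof. by rewrite /cabs normc_def. Qed.

Lemma cabs_ge0 z : 0 <= cabs z.
Proof. by rewrite cabsE sqrtr_ge0. Qed.
Hint Resolve cabs_ge0 : core.

Lemma cabsM z w : cabs (z * w) = cabs z * cabs w.
Proof. by apply: complexI; rewrite -normCabs normrM !normCabs rmorphM. Qed.

Lemma cabsD z w : cabs (z + w) <= cabs z + cabs w.
Proof. by rewrite -lecR rmorphD /= -!normCabs ler_normD. Qed.

Lemma cabsN z : cabs (- z) = cabs z.
Proof. by apply: complexI; rewrite -!normCabs normrN. Qed.

Lemma cabsBC z w : cabs (z - w) = cabs (w - z).
Proof. by rewrite -cabsN opprB. Qed.

Lemma cabs0 : cabs (0 : R[i]) = 0.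
Proof. by apply: complexI; rewrite -normCabs normr0. Qed.

Lemma cabs1 : cabs (1 : R[i]) = 1.
Proof. by apply: complexI; rewrite -normCabs normr1. Qed.

Lemma cabs_eq0 z : (cabs z == 0) = (z == 0).
Proof. by rewrite -(inj_eq (@complexI R)) -normCabs normr_eq0. Qed.

Lemma cabs_gt0 z : (0 < cabs z) = (z != 0).
Proof. by rewrite lt_neqAle cabs_ge0 andbT eq_sym cabs_eq0. Qed.

Lemma cabsV z : cabs z^-1 = (cabs z)^-1.
Proof. by apply: complexI; rewrite -normCabs normfV normCabs fmorphV. Qed.

Lemma cabsX z n : cabs (z ^+ n) = cabs z ^+ n.
Proof. by apply: complexI; rewrite -normCabs normrX normCabs rmorphXn. Qed.

Lemma cabsJ z : cabs (z^*) = cabs z.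
Proof. by rewrite !cabsE; case: z => a b /=; rewrite sqrrN. Qed.

Lemma cabsR x : cabs (x%:C) = `|x|.
Proof. by rewrite cabsE /= expr0n /= addr0 sqrtr_sqr. Qed.

Lemma cabs_nat n : cabs (n%:R : R[i]) = n%:R.
Proof. by rewrite -(rmorph_nat (real_complex R)) cabsR ger0_norm. Qed.

Lemma cabsi : cabs ('i : R[i]) = 1.
Proof. by rewrite cabsE /= expr0n /= add0r expr1n sqrtr1. Qed.

Lemma cabs_Re z : `|complex.Re z| <= cabs z.
Proof.
by rewrite cabsE -sqrtr_sqr ler_wsqrtr// lerDl sqr_ge0.
Qed.

Lemma cabs_Im z : `|complex.Im z| <= cabs z.
Proof.
by rewrite cabsE -sqrtr_sqr ler_wsqrtr// lerDr sqr_ge0.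
Qed.

Lemma cabs_ReIm z : cabs z <= `|complex.Re z| + `|complex.Im z|.
Proof.
case: z => a b /=; have -> : a +i* b = a%:C + 'i * b%:C.
  by apply/eqP; rewrite eq_complex /=; apply/andP; split; apply/eqP; ring.
by apply: (le_trans (cabsD _ _)); rewrite cabsM cabsi mul1r !cabsR.
Qed.

Lemma cabs_sqr z : cabs z ^+ 2 = complex.Re z ^+ 2 + complex.Im z ^+ 2.
Proof. by rewrite cabsE sqr_sqrtr// addr_ge0// sqr_ge0. Qed.

Lemma mulzJ z : z * z^* = (cabs z ^+ 2)%:C.
Proof.
rewrite cabs_sqr; case: z => a b; apply/eqP; rewrite eq_complex /=.
by apply/andP; split; apply/eqP; ring.
Qed.

Lemma cabsB_ge z w : cabs z - cabs w <= cabs (z - w).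
Proof. by rewrite lerBlDr -[X in cabs X <= _](subrK w) cabsD. Qed.

Lemma cabs_sum (I : Type) (r : seq I) (P : pred I) (F : I -> R[i]) :
  cabs (\sum_(i <- r | P i) F i) <= \sum_(i <- r | P i) cabs (F i).
Proof.
elim/big_rec2: _ => [|i x z _ h]; first by rewrite cabs0.
by apply: (le_trans (cabsD _ _)); rewrite lerD2l.
Qed.

Lemma ReD z w : complex.Re (z + w) = complex.Re z + complex.Re w.
Proof. by case: z; case: w. Qed.
Lemma ImD z w : complex.Im (z + w) = complex.Im z + complex.Im w.
Proof. by case: z; case: w. Qed.
Lemma ReB z w : complex.Re (z - w) = complex.Re z - complex.Re w.
Proof. by case: z; case: w. Qed.
Lemma ImB z w : complex.Im (z - w) = complex.Im z - complex.Im w.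
Proof. by case: z; case: w. Qed.
Lemma ReM z w : complex.Re (z * w) =
  complex.Re z * complex.Re w - complex.Im z * complex.Im w.
Proof. by case: z; case: w. Qed.
Lemma ImM z w : complex.Im (z * w) =
  complex.Re z * complex.Im w + complex.Im z * complex.Re w.
Proof. by case: z => ? ?; case: w => ? ? /=; ring. Qed.

Lemma Re_sum (I : Type) (r : seq I) (P : pred I) (F : I -> R[i]) :
  complex.Re (\sum_(i <- r | P i) F i) = \sum_(i <- r | P i) complex.Re (F i).
Proof. by elim/big_rec2: _ => // i x z _ <-; rewrite ReD. Qed.
Lemma Im_sum (I : Type) (r : seq I) (P : pred I) (F : I -> R[i]) :
  complex.Im (\sum_(i <- r | P i) F i) = \sum_(i <- r | P i) complex.Im (F i).
Proof. by elim/big_rec2: _ => // i x z _ <-; rewrite ImD. Qed.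

Lemma complex_eq z w : complex.Re z = complex.Re w -> complex.Im z = complex.Im w ->
  z = w.
Proof. by move=> h1 h2; apply/eqP; rewrite eq_complex h1 h2 !eqxx. Qed.

End Cabs.
#[export] Hint Resolve cabs_ge0 : core.

(** * Complex series *)
Section CSeries.
Context {R : realType}.
Implicit Types (u v : nat -> R[i]).

Lemma gt0_complexR (e : R[i]) : 0 < e -> exists2 d : R, 0 < d & e = d%:C.
Proof.
case: e => a b; rewrite ltcE /= => /andP[/eqP h1 h2]; exists a => //.
by rewrite -[RHS]complexr0 h1.
Qed.

Lemma squeeze0 (a b : nat -> R) : (forall n, 0 <= a n <= b n) ->
  b @ \oo --> (0 : R) -> a @ \oo --> (0 : R).
Proof.
move=> h hb; apply: (@squeeze_cvgr _ _ _ _ (fun=> 0) b) => //.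
- exact: nearW.
- exact: cvg_cst.
Qed.

Lemma cvg0D (a b : nat -> R) : a @ \oo --> (0 : R) -> b @ \oo --> (0 : R) ->
  (fun n => a n + b n) @ \oo --> (0 : R).
Proof. by move=> ha hb; rewrite -[X in _ --> X]addr0; exact: cvgD. Qed.

(** Real and imaginary parts are summed separately, so that convergence results for
    real series apply. *)
Definition csum u : R[i] :=
  limn (series (fun n => complex.Re (u n))) +i* limn (series (fun n => complex.Im (u n))).

Definition abs_summable u : Prop := cvgn (series (fun n => cabs (u n))).

Lemma abs_summable_Re u : abs_summable u -> cvgn (series (fun n => complex.Re (u n))).
Proof.
move=> h; apply: normed_cvg; apply: (series_le_cvg _ _ _ h) => //= n.
by rewrite cabs_Re.
Qed.

Lemma abs_summable_Im u : abs_summable u -> cvgn (series (fun n => complex.Im (u n))).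
Proof.
move=> h; apply: normed_cvg; apply: (series_le_cvg _ _ _ h) => //= n.
by rewrite cabs_Im.
Qed.

Lemma abs_summable_le u (b : nat -> R) : (forall n, cabs (u n) <= b n) ->
  cvgn (series b) -> abs_summable u.
Proof.
move=> h hb; apply: (series_le_cvg _ _ h hb) => n //.
exact: le_trans (cabs_ge0 _) (h n).
Qed.

Lemma seriesRe u N : complex.Re (\sum_(0 <= n < N) u n) = series (fun n => complex.Re (u n)) N.
Proof. by rewrite Re_sum. Qed.
Lemma seriesIm u N : complex.Im (\sum_(0 <= n < N) u n) = series (fun n => complex.Im (u n)) N.
Proof. by rewrite Im_sum. Qed.

Lemma cvg_dist0 (a : nat -> R) : cvgn a -> (fun N => `|a N - limn a|) @ \oo --> (0 : R).
Proof.
move=> h; rewrite -(normr0 R); apply: cvg_norm.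
by rewrite -(subrr (limn a)); apply: cvgB; [exact: h | exact: cvg_cst].
Qed.

Lemma csum_cvg u : abs_summable u ->
  (fun N => cabs (\sum_(0 <= n < N) u n - csum u)) @ \oo --> (0 : R).
Proof.
move=> hu.
have h3 := cvg0D (cvg_dist0 (abs_summable_Re hu)) (cvg_dist0 (abs_summable_Im hu)).
apply: (squeeze0 _ h3) => N; rewrite cabs_ge0 /=.
by apply: (le_trans (cabs_ReIm _)); rewrite ReB ImB /= seriesRe seriesIm.
Qed.

Lemma csum_unique u s : abs_summable u ->
  (fun N => cabs (\sum_(0 <= n < N) u n - s)) @ \oo --> (0 : R) -> csum u = s.
Proof.
move=> hu hs.
have h := cvg0D (csum_cvg hu) hs.
have h2 : (fun N : nat => cabs (csum u - s)) @ \oo --> (0:R).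
  apply: (squeeze0 _ h) => N; rewrite cabs_ge0 /=.
  rewrite [cabs (_ - csum u)]cabsBC.
  by apply: le_trans (cabsD _ _); rewrite addrA subrK.
have h1 : (fun N : nat => cabs (csum u - s)) @ \oo --> cabs (csum u - s).
  exact: cvg_cst.
have /eqP : cabs (csum u - s) = 0 by exact: (cvg_unique (@Rhausdorff R) h1 h2).
by rewrite cabs_eq0 subr_eq0 => /eqP.
Qed.

Lemma csum_ge u s (b : R) : abs_summable u ->
  (forall N, cabs (\sum_(0 <= n < N) u n - s) <= b) -> cabs (csum u - s) <= b.
Proof.
move=> hu hb.
have h : (fun N => cabs (\sum_(0 <= n < N) u n - csum u) + b) @ \oo --> 0 + b.
  by apply: cvgD; [exact: csum_cvg | exact: cvg_cst].
rewrite add0r in h; rewrite -(cvg_lim (@Rhausdorff R) h).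
apply: limr_ge; first by apply/cvg_ex; exists b.
near=> N.
have -> : csum u - s = (csum u - \sum_(0 <= n < N) u n) + (\sum_(0 <= n < N) u n - s).
  by rewrite addrA subrK.
by apply: (le_trans (cabsD _ _)); rewrite [cabs (csum u - _)]cabsBC lerD2l.
Unshelve. all: by end_near. Qed.

Lemma csum_le u (b : nat -> R) : (forall n, cabs (u n) <= b n) -> cvgn (series b) ->
  cabs (csum u) <= limn (series b).
Proof.
move=> h hb; rewrite -[csum u]subr0; apply: csum_ge => [|N].
  exact: abs_summable_le h hb.
rewrite subr0; apply: (le_trans (cabs_sum _ _ _)).
apply: (le_trans (ler_sum _ (fun i _ => h i))).
apply: nondecreasing_cvgn_le => //; apply: nondecreasing_series => n _ _.
exact: le_trans (cabs_ge0 _) (h n).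
Qed.

Lemma csum_leM u (b : nat -> R) (c : R) : 0 <= c -> (forall n, cabs (u n) <= b n * c) ->
  cvgn (series b) -> cabs (csum u) <= limn (series b) * c.
Proof.
move=> c0 h hb; have E : (fun n => b n * c) = c *: b.
  by apply/funext => n; rewrite mulrC.
have hb' : cvgn (series (fun n => b n * c)) by rewrite E; exact: is_cvg_seriesZ.
by apply: (le_trans (csum_le h hb')); rewrite E lim_seriesZ// -[_ *: _]/(_ * _) mulrC.
Qed.

Lemma csumZ u c : abs_summable u -> csum (fun n => c * u n) = c * csum u.
Proof.
move=> hu; apply: csum_unique.
  have h : cvgn (series (fun n => cabs c * cabs (u n))) by exact: is_cvg_seriesZ.
  by apply: abs_summable_le h => n; rewrite cabsM.
have h : (fun N => cabs c * cabs (\sum_(0 <= n < N) u n - csum u)) @ \oo --> cabs c * 0.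
  by apply: cvgM; [exact: cvg_cst | exact: csum_cvg].
rewrite mulr0 in h; apply: (squeeze0 _ h) => N; rewrite cabs_ge0 /=.
by rewrite -big_distrr -mulrBr cabsM.
Qed.

Lemma csumB u v : abs_summable u -> abs_summable v ->
  csum (fun n => u n - v n) = csum u - csum v.
Proof.
move=> hu hv; apply: csum_unique.
  have h : cvgn (series (fun n => cabs (u n) + cabs (v n))).
    by have := is_cvg_seriesD hu hv.
  by apply: abs_summable_le h => n; apply: (le_trans (cabsD _ _)); rewrite cabsN.
have h := cvg0D (csum_cvg hu) (csum_cvg hv).
apply: (squeeze0 _ h) => N; rewrite cabs_ge0 /=.
rewrite sumrB (_ : _ - _ - _ = (\sum_(0 <= n < N) u n - csum u)
  - (\sum_(0 <= n < N) v n - csum v)); last by ring.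
by apply: (le_trans (cabsD _ _)); rewrite cabsN.
Qed.

(** [Q] is defined by a limit in the topology of the field [R[i]]. *)
Lemma csum_limn u : abs_summable u ->
  limn (fun N : nat => (\sum_(0 <= n < N) u n : R[i]^o)) = csum u.
Proof.
move=> hu.
suff h : (fun N : nat => (\sum_(0 <= n < N) u n : R[i]^o)) @ \oo --> (csum u : R[i]^o).
  exact: (cvg_lim (@norm_hausdorff _ _) h).
apply/cvgrPdist_lt => e /gt0_complexR[d d0 ->].
have /cvgrPdist_lt/(_ _ d0) [N _ hN] := csum_cvg hu.
exists N => // n /hN; rewrite /= sub0r normrN ger0_norm ?cabs_ge0//.
by rewrite cabsBC normCabs ltcR.
Qed.

Lemma csum_term u k : (forall n, n != k -> u n = 0) -> csum u = u k.
Proof.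
move=> h.
have hs : forall N, (k < N)%N -> \sum_(0 <= n < N) u n = u k.
  move=> N hN; rewrite big_mkord (bigD1 (Ordinal hN)) //= big1 ?addr0// => i hi.
  by apply: h; move: hi; rewrite -(inj_eq val_inj).
have hu : abs_summable u.
  apply/cvg_ex; exists (cabs (u k)); apply/cvgrPdist_lt => e e0.
  exists k.+1 => // N hN /=; rewrite /series /= big_mkord (bigD1 (Ordinal hN)) //=.
  rewrite big1 ?addr0 ?subrr ?normr0// => i hi.
  by rewrite h ?cabs0//; move: hi; rewrite -(inj_eq val_inj).
apply: csum_unique => //; apply/cvgrPdist_lt => e e0.
by exists k.+1 => // N hN /=; rewrite hs// subrr cabs0 subrr normr0.
Qed.

End CSeries.

(** * Power series in the unit disc *)
Section PowerSeries.
Context {R : realType}.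
Implicit Types (a : nat -> R[i]) (z w : R[i]).

(** Radius of convergence at least one, as a family of Cauchy bounds. *)
Definition subexp a : Prop :=
  forall r : R, 0 < r < 1 -> exists C : R, forall k, cabs (a k) * r ^+ k <= C.

Lemma subexp_ge0 a r : subexp a -> 0 < r < 1 ->
  exists2 C : R, 0 <= C & forall k, cabs (a k) * r ^+ k <= C.
Proof.
move=> ha hr; have [C hC] := ha r hr; exists C => //.
by apply: le_trans (hC 0%N); rewrite expr0 mulr1 cabs_ge0.
Qed.

Lemma cvg_geom (C q : R) : 0 <= q < 1 -> cvgn (series (fun k => C * q ^+ k)).
Proof.
by move=> /andP[q0 q1]; apply: is_cvg_geometric_series; rewrite ger0_norm.
Qed.

Lemma subexp_geom a r : subexp a -> 0 <= r < 1 -> exists2 q : R, 0 < q < 1 &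
  exists2 C : R, 0 <= C & forall k, cabs (a k) * r ^+ k <= C * q ^+ k.
Proof.
move=> ha /andP[r0 r1]; set s := (1 + r) / 2.
have s0 : 0 < s by rewrite /s; lra.
have s1 : s < 1 by rewrite /s; lra.
have rs : r < s by rewrite /s; lra.
set q := (1 + r / s) / 2.
have rs0 : 0 <= r / s by rewrite divr_ge0// ltW.
have rs1 : r / s < 1 by rewrite ltr_pdivrMr// mul1r.
have [C C0 hC] := subexp_ge0 ha (introT andP (conj s0 s1)).
exists q; first by apply/andP; split; rewrite /q; lra.
exists C => // k.
have -> : r = s * (r / s) by rewrite mulrCA divff ?mulr1// gt_eqF.
rewrite exprMn mulrA; apply: ler_pM => //.
- by rewrite mulr_ge0 ?cabs_ge0// exprn_ge0// ltW.
- by rewrite exprn_ge0.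
- by rewrite lerXn2r// ?nnegrE//; rewrite /q; lra.
Qed.

Lemma subexp_abs_summable a z : subexp a -> cabs z < 1 ->
  abs_summable (fun k => a k * z ^+ k).
Proof.
move=> ha z1; have [q hq [C C0 hC]] := subexp_geom ha (introT andP (conj (cabs_ge0 z) z1)).
have hq' : 0 <= q < 1 by lra.
by apply: (@abs_summable_le _ _ (fun k => C * q ^+ k)) => [k|]; [rewrite cabsM cabsX | exact: cvg_geom].
Qed.

(** With [r] inside the disc the right side is summable against the coefficients
    of a power series, which allows differentiation term by term. *)
Lemma expr_taylor2 (z h : R[i]) (r : R) k : cabs z + cabs h <= r ->
  cabs ((z + h) ^+ k - z ^+ k - k%:R * z ^+ k.-1 * h) * r ^+ 2 <=
    k%:R ^+ 2 * r ^+ k * cabs h ^+ 2.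
Proof.
move=> zr; have z0 := cabs_ge0 z; have h0 := cabs_ge0 h.
have r0 : 0 <= r by lra.
elim: k => [|k IH].
  by rewrite !expr0 subrr !mul0r subr0 cabs0 mul0r expr0n /= !mul0r.
case: k IH => [_|k IH].
  rewrite !expr1 expr0 (_ : z + h - z - 1 * 1 * h = 0); last by ring.
  by rewrite cabs0 mul0r !mulr_ge0// exprn_ge0.
have -> : (z + h) ^+ k.+2 - z ^+ k.+2 - k.+2%:R * z ^+ k.+2.-1 * h =
   (z + h) * ((z + h) ^+ k.+1 - z ^+ k.+1 - k.+1%:R * z ^+ k.+1.-1 * h)
   + k.+1%:R * z ^+ k * h ^+ 2.
  rewrite /= -(natr1 k.+1) !exprS; ring.
apply: (@le_trans _ _ ((r * (k.+1%:R ^+ 2 * r ^+ k.+1 * cabs h ^+ 2))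
   + k.+1%:R * r ^+ k.+2 * cabs h ^+ 2)).
  apply: (le_trans (ler_wpM2r (exprn_ge0 _ r0) (cabsD _ _))).
  rewrite mulrDl; apply: lerD.
    rewrite cabsM -(mulrA (cabs (z + h))); apply: ler_pM => //; rewrite ?cabs_ge0//.
      by rewrite mulr_ge0 ?cabs_ge0// exprn_ge0.
    exact: le_trans (cabsD _ _) zr.
  rewrite !cabsM cabs_nat !cabsX -[k.+2]addn2 exprD.
  have -> : k.+1%:R * cabs z ^+ k * cabs h ^+ 2 * r ^+ 2 =
     cabs z ^+ k * (k.+1%:R * cabs h ^+ 2 * r ^+ 2) by ring.
  have -> : k.+1%:R * (r ^+ k * r ^+ 2) * cabs h ^+ 2 =
     r ^+ k * (k.+1%:R * cabs h ^+ 2 * r ^+ 2) by ring.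
  rewrite ler_wpM2r ?mulr_ge0 ?exprn_ge0//.
  by rewrite lerXn2r// ?nnegrE//; lra.
have -> : r * (k.+1%:R ^+ 2 * r ^+ k.+1 * cabs h ^+ 2)
   + k.+1%:R * r ^+ k.+2 * cabs h ^+ 2 =
   (k.+1%:R ^+ 2 + k.+1%:R) * (r ^+ k.+2 * cabs h ^+ 2) by rewrite !exprS; ring.
have rk : 0 <= r ^+ k.+2 * cabs h ^+ 2 by rewrite mulr_ge0// exprn_ge0.
rewrite -[leRHS]mulrA ler_wpM2r//.
by rewrite -(natr1 k.+1); have := ler0n R k.+1; nra.
Qed.

Definition pser a z := csum (fun k => a k * z ^+ k).

Lemma subexp_natmul a : subexp a -> subexp (fun k => k%:R * a k).
Proof.
move=> ha r /andP[r0 r1]; have r0' := ltW r0.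
have [q /andP[q0 q1] [C C0 hC]] := subexp_geom ha (introT andP (conj r0' r1)).
have hs : cvgn (series (fun k => C * q ^+ k)) by apply: cvg_geom; rewrite ltW.
exists (C / (1 - q)) => k.
rewrite cabsM cabs_nat -mulrA; apply: (le_trans (ler_wpM2l (ler0n _ _) (hC k))).
have h : k%:R * q ^+ k * (1 - q) <= 1 - q ^+ k.
  elim: k => [|k IH]; first by rewrite !mul0r expr0 subrr.
  rewrite -natr1 !exprS; have /andP[] : 0 <= q ^+ k <= 1.
    by rewrite exprn_ge0 ?exprn_ile1// ltW.
  set Y := q ^+ k in IH *; move=> Y0 Y1.
  have -> : (k%:R + 1) * (q * Y) * (1 - q) = q * (k%:R * Y * (1 - q)) + q * Y * (1 - q) by ring.
  have h1 : q * (k%:R * Y * (1 - q)) <= q * (1 - Y) by rewrite ler_wpM2l// ltW.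
  have h2 : 0 <= (1 - q) * (1 - q * Y) by apply: mulr_ge0; nra.
  by nra.
have q1' : 0 < 1 - q by lra.
rewrite ler_pdivlMr//.
have -> : k%:R * (C * q ^+ k) * (1 - q) = C * (k%:R * q ^+ k * (1 - q)) by ring.
rewrite ler_piMr//.
by apply: (le_trans h); rewrite gerBl exprn_ge0// ltW.
Qed.

Lemma pser_cderiv a z : subexp a -> cabs z < 1 -> exists2 C : R, 0 <= C &
  exists2 d : R, 0 < d & forall h, cabs h < d ->
  cabs (pser a (z + h) - pser a z - csum (fun k => k%:R * a k * z ^+ k.-1) * h) <= C * cabs h ^+ 2.
Proof.
move=> ha z1; have z0 := cabs_ge0 z; set s := (1 + cabs z) / 2.
have zs : cabs z < s by rewrite /s; lra.
have s1 : s < 1 by rewrite /s; lra.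
have s0 : 0 < s by lra.
have a1 := subexp_natmul ha; have a2 := subexp_natmul a1.
have [q hq [C C0 hC]] := subexp_geom a2 (introT andP (conj (ltW s0) s1)).
have hq' : 0 <= q < 1 by lra.
set b := fun k => C / s ^+ 2 * q ^+ k.
have hb : cvgn (series b) by exact: cvg_geom.
have b0 k : 0 <= b k by rewrite /b !mulr_ge0 ?invr_ge0 ?exprn_ge0// ltW//; lra.
exists (limn (series b)).
  apply: le_trans (nondecreasing_cvgn_le (nondecreasing_series (fun n _ _ => b0 n)) hb 0%N).
  by rewrite /series /= big_nil.
exists (s - cabs z); first by lra.
move=> h hh; have zh : cabs z + cabs h <= s by lra.
have zh1 : cabs (z + h) < 1 by apply: le_lt_trans (cabsD _ _) _; lra.
have su1 := subexp_abs_summable ha zh1.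
have su2 := subexp_abs_summable ha z1.
have su12 : abs_summable (fun k => a k * (z + h) ^+ k - a k * z ^+ k).
  have H : cvgn (series (fun n => cabs (a n * (z + h) ^+ n) + cabs (a n * z ^+ n))).
    by have := is_cvg_seriesD su1 su2.
  by apply: abs_summable_le H => n; apply: (le_trans (cabsD _ _)); rewrite cabsN.
have su3 : abs_summable (fun k => k%:R * a k * z ^+ k.-1).
  have [q' hq1 [C' C0' hC']] := subexp_geom a1 (introT andP (conj (ltW s0) s1)).
  have hq1' : 0 <= q' < 1 by lra.
  apply: (abs_summable_le _ (@cvg_geom (C' / s) q' hq1')) => k.
  rewrite [leRHS]mulrAC ler_pdivlMr// cabsM cabsX -mulrA.
  apply: le_trans (hC' k); rewrite ler_wpM2l ?cabs_ge0//.
  case: k => [|k] /=; first by rewrite !expr0 mul1r; lra.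
  rewrite exprSr ler_wpM2r ?(ltW s0)// lerXn2r// ?nnegrE//; lra.
have su4 : abs_summable (fun k => h * (k%:R * a k * z ^+ k.-1)).
  have H : cvgn (series (fun n => cabs h * cabs (n%:R * a n * z ^+ n.-1))) by exact: is_cvg_seriesZ.
  by apply: abs_summable_le H => n; rewrite cabsM.
rewrite /pser -csumB// mulrC -csumZ// -csumB//.
apply: csum_leM => //; first by rewrite exprn_ge0// cabs_ge0.
move=> k; have -> : a k * (z + h) ^+ k - a k * z ^+ k - h * (k%:R * a k * z ^+ k.-1)
   = a k * ((z + h) ^+ k - z ^+ k - k%:R * z ^+ k.-1 * h) by ring.
have s2 : 0 < s ^+ 2 by rewrite exprn_gt0.
rewrite cabsM /b -(ler_pM2r s2).
have -> : C / s ^+ 2 * q ^+ k * cabs h ^+ 2 * s ^+ 2 = C * q ^+ k * cabs h ^+ 2.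
  by field; rewrite gt_eqF.
rewrite -(mulrA (cabs (a k))); apply: (le_trans (ler_wpM2l (cabs_ge0 _) (expr_taylor2 k zh))).
rewrite mulrA ler_wpM2r ?exprn_ge0 ?cabs_ge0//; apply: le_trans (hC k).
by rewrite !cabsM cabs_nat expr2 le_eqVlt; apply/orP; left; apply/eqP; ring.
Qed.

Lemma cderiv_derivable (f : R[i] -> R[i]) z (l : R[i]) :
  (forall e : R, 0 < e -> exists2 d : R, 0 < d & forall h, h != 0 -> cabs h < d ->
    cabs (f (z + h) - f z - l * h) <= e * cabs h) ->
  derivable (f : R[i]^o -> R[i]^o) (z : R[i]^o) (1 : R[i]^o).
Proof.
move=> hf; apply/cvg_ex; exists l; apply/cvgrPdist_le => _ /gt0_complexR[e e0 ->].
have [d d0 hd] := hf e e0.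
exists d%:C; first by rewrite /= ltcR.
move=> h /=; rewrite sub0r normrN !normCabs ltcR => hhd h0.
rewrite lecR; have ch : 0 < cabs h by rewrite cabs_gt0.
rewrite -(ler_pM2r ch) -cabsM.
have -> : (l - h^-1 *: ((f : R[i]^o -> R[i]^o) (h *: (1 : R[i]^o) + z) - f z)) * h =
    - (f (z + h) - f z - l * h).
  rewrite -[_ *: (_ - _)]/(_ * _) -[h *: 1]/(h * 1) mulr1 [h + z]addrC.
  by field.
by rewrite cabsN; exact: hd.
Qed.

Lemma derivable_cderiv (f : R[i] -> R[i]) z :
  derivable (f : R[i]^o -> R[i]^o) (z : R[i]^o) (1 : R[i]^o) ->
  exists l : R[i], forall e : R, 0 < e -> exists2 d : R, 0 < d & forall h, cabs h < d ->
    cabs (f (z + h) - f z - l * h) <= e * cabs h.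
Proof.
move=> /cvg_ex[l /cvgrPdist_le hl]; exists l => e e0.
have e0' : 0 < e%:C :> R[i] by rewrite ltcR.
have [_ /gt0_complexR[d d0 ->] hd] := hl _ e0'.
exists d => // h hhd; have [->|h0] := eqVneq h 0.
  by rewrite addr0 subrr mulr0 subr0 cabs0 mulr0.
have ch : 0 < cabs h by rewrite cabs_gt0.
have := hd h; rewrite /= sub0r normrN !normCabs ltcR lecR => /(_ hhd h0).
rewrite -(ler_pM2r ch) -cabsM.
have -> : (l - h^-1 *: ((f : R[i]^o -> R[i]^o) (h *: (1 : R[i]^o) + z) - f z)) * h =
    - (f (z + h) - f z - l * h).
  rewrite -[_ *: (_ - _)]/(_ * _) -[h *: 1]/(h * 1) mulr1 [h + z]addrC.
  by field.
by rewrite cabsN.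
Qed.

Lemma pser_derivable a z : subexp a -> cabs z < 1 ->
  derivable (pser a : R[i]^o -> R[i]^o) (z : R[i]^o) (1 : R[i]^o).
Proof.
move=> ha z1; have [C C0 [d d0 hd]] := pser_cderiv ha z1.
apply: (@cderiv_derivable _ _ (csum (fun k => k%:R * a k * z ^+ k.-1))) => e e0.
exists (Num.min d (e / (C + 1))).
  by rewrite lt_min d0 divr_gt0//; lra.
move=> h h0; rewrite lt_min => /andP[h1 h2].
apply: (le_trans (hd h h1)); rewrite expr2 mulrA ler_wpM2r ?cabs_ge0//.
move: h2; rewrite ltr_pdivlMr; last by lra.
by have := cabs_ge0 h; nra.
Qed.

End PowerSeries.

(** * Invariance properties of Lebesgue measure on the line and on the plane *)
Section Lebesgue1.
Context {R : realType}.
Local Open Scope ereal_scope.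
Notation leb := (@lebesgue_measure R).

(** Measure preservation is only ever used through nonnegative integrals. *)
Lemma integral_preserved d (T : measurableType d) (mu : {measure set T -> \bar R})
    (phi : T -> T) :
  (forall f : T -> \bar R, measurable_fun setT f -> (forall x, 0 <= f x) ->
     \int[mu]_x f (phi x) = \int[mu]_x f x) ->
  forall f : T -> \bar R, measurable_fun setT f -> \int[mu]_x f (phi x) = \int[mu]_x f x.
Proof.
move=> h f mf; rewrite [LHS]integralE [RHS]integralE; congr (_ - _).
  rewrite -(h f^\+ (measurable_funepos mf) (fun x => funepos_ge0 f x)).
  by apply: eq_integral => x _; rewrite !funeposE.
rewrite -(h f^\- (measurable_funeneg mf) (fun x => funeneg_ge0 f x)).
by apply: eq_integral => x _; rewrite !funenegE.
Qed.

(** Lebesgue measure is determined by its values on intervals. *)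
Lemma lebesgue_measure_shift (c : R) (A : set R) : measurable A ->
  pushforward leb ((fun x => x + c)%R : _ -> measurableTypeR R) A = leb A.
Proof.
move=> mA; apply/esym.
have mf : measurable_fun setT ((fun x => x + c)%R : measurableTypeR R -> measurableTypeR R).
  by apply: measurable_funD => //; exact: measurable_cst.
apply: (@lebesgue_measure_unique _ (pushforward leb ((fun x => x + c)%R : _ -> measurableTypeR R))) => //= _ [[a b]] _ <-.
rewrite /pushforward [X in _ = _ X](_ : _ = `](a - c)%R, (b - c)%R]%classic).
  rewrite !lebesgue_measure_itv/= !lte_fin ltrD2r; case: ifP => // _.
  by rewrite -!EFinB; congr (_%:E); ring.
by apply/seteqP; split=> x /=; rewrite !in_itv /= ltrBlDr lerBrDr.
Qed.

Lemma integral_shift (c : R) (f : R -> \bar R) : measurable_fun setT f ->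
  (forall x, 0 <= f x) -> \int[leb]_x f (x + c)%R = \int[leb]_x f x.
Proof.
move=> mf f0.
have mphi : measurable_fun setT ((fun x => x + c)%R : measurableTypeR R -> measurableTypeR R).
  by apply: measurable_funD => //; exact: measurable_cst.
have := @ge0_integral_pushforward _ _ _ _ _ _ mphi leb setT f measurableT mf (fun y _ => f0 y).
rewrite preimage_setT => <-.
by apply: eq_measure_integral => A mA _; exact: lebesgue_measure_shift.
Qed.

Lemma lebesgue_measure_scale (c : R) (c0 : (0 < c)%R) (A : set R) : measurable A ->
  c%:E * pushforward leb ((fun x => c * x)%R : _ -> measurableTypeR R) A = leb A.
Proof.
move=> mA; apply/esym.
have mf : measurable_fun setT ((fun x => c * x)%R : measurableTypeR R -> measurableTypeR R).
  by apply: measurable_funM => //; exact: measurable_cst.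
pose mu := mscale (NngNum (ltW c0)) (pushforward leb ((fun x => c * x)%R : _ -> measurableTypeR R)).
have -> : c%:E * pushforward leb ((fun x => c * x)%R : _ -> measurableTypeR R) A = mu mf A by [].
apply: (@lebesgue_measure_unique _ (mu mf)) => //= _ [[a b]] _ <-.
have E : (fun x => c * x)%R @^-1` `]a, b] = `](c^-1 * a)%R, (c^-1 * b)%R]%classic.
  by apply/seteqP; split=> x /=; rewrite !in_itv /= ltr_pdivrMl// ler_pdivlMl.
rewrite -[RHS]/(c%:E * leb ((fun x => c * x)%R @^-1` `]a, b])) E /=.
  rewrite !lebesgue_measure_itv/= !lte_fin ltr_pM2l ?invr_gt0//; case: ifP => // _; last by rewrite mule0.
  by rewrite -!EFinB -EFinM; congr (_%:E); field; rewrite gt_eqF.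
Qed.

Lemma integral_scale (c : R) (f : R -> \bar R) : (0 < c)%R -> measurable_fun setT f ->
  (forall x, 0 <= f x) -> \int[leb]_x f (c * x)%R = c^-1%:E * \int[leb]_x f x.
Proof.
move=> c0 mf f0.
have mphi : measurable_fun setT ((fun x => c * x)%R : measurableTypeR R -> measurableTypeR R).
  by apply: measurable_funM => //; exact: measurable_cst.
have := @ge0_integral_pushforward _ _ _ _ _ _ mphi leb setT f measurableT mf (fun y _ => f0 y).
rewrite preimage_setT => <-.
pose nu := mscale (NngNum (ltW c0)) (pushforward leb ((fun x => c * x)%R : _ -> measurableTypeR R)).
have -> : \int[leb]_x f x = \int[nu mphi]_x f x.
  by apply: eq_measure_integral => A mA _; apply/esym/lebesgue_measure_scale.
rewrite /nu.
by rewrite ge0_integral_mscale//= muleA -EFinM mulVf ?mul1e// gt_eqF.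
Qed.

Lemma integral_opp (f : R -> \bar R) : measurable_fun setT f ->
  (forall x, 0 <= f x) -> \int[leb]_x f (- x)%R = \int[leb]_x f x.
Proof.
move=> mf f0.
have mphi : measurable_fun setT ((fun x => - x)%R : measurableTypeR R -> measurableTypeR R).
  exact: oppr_measurable.
have := @ge0_integral_pushforward _ _ _ _ _ _ mphi leb setT f measurableT mf (fun y _ => f0 y).
rewrite preimage_setT => <-.
by apply: eq_measure_integral => A mA _; exact: lebesgue_measureN.
Qed.

(** The next lemmas fix the measurable structure of the domain once and for all. *)
Lemma leb_integralZl (k : R) (f : R -> \bar R) : (0 <= k)%R -> measurable_fun setT f ->
  (forall x, 0 <= f x) -> \int[leb]_x (k%:E * f x) = k%:E * \int[leb]_x f x.
Proof. by move=> k0 mf f0; apply: ge0_integralZl => //; rewrite lee_fin. Qed.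

Lemma leb_integralD (f g : R -> \bar R) : measurable_fun setT f -> (forall x, 0 <= f x) ->
  measurable_fun setT g -> (forall x, 0 <= g x) ->
  \int[leb]_x (f x + g x) = \int[leb]_x f x + \int[leb]_x g x.
Proof. by move=> mf f0 mg g0; apply: ge0_integralD. Qed.

Lemma leb_le_integral (f g : R -> \bar R) : measurable_fun setT f -> (forall x, 0 <= f x) ->
  measurable_fun setT g -> (forall x, f x <= g x) ->
  \int[leb]_x f x <= \int[leb]_x g x.
Proof.
by move=> mf f0 mg fg; apply: ge0_le_integral => // x _; exact: le_trans (fg x).
Qed.

End Lebesgue1.

Notation area := (@lebesgue_measure _ \x @lebesgue_measure _)%E (only parsing).

Section Lebesgue2.
Context {R : realType}.
Local Open Scope ereal_scope.
Notation leb := (@lebesgue_measure R).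
Notation area := (@lebesgue_measure R \x @lebesgue_measure R)%E.
Implicit Types (F : R * R -> \bar R).

Lemma integral_area F : measurable_fun setT F -> (forall z, 0 <= F z) ->
  \int[area]_z F z = \int[leb]_x \int[leb]_y F (x, y).
Proof. by move=> mF F0; rewrite fubini_tonelli1. Qed.

Lemma integral_area2 F : measurable_fun setT F -> (forall z, 0 <= F z) ->
  \int[area]_z F z = \int[leb]_y \int[leb]_x F (x, y).
Proof.
move=> mF F0; rewrite (integral_area mF F0).
by have := @fubini_tonelli _ _ _ _ _ leb leb F mF F0.
Qed.

Lemma area_integralZl (k : R) F : (0 <= k)%R -> measurable_fun setT F ->
  (forall z, 0 <= F z) -> \int[area]_z (k%:E * F z) = k%:E * \int[area]_z F z.
Proof. by move=> k0 mf f0; apply: ge0_integralZl => //; rewrite lee_fin. Qed.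

Lemma area_integralD F G : measurable_fun setT F -> (forall z, 0 <= F z) ->
  measurable_fun setT G -> (forall z, 0 <= G z) ->
  \int[area]_z (F z + G z) = \int[area]_z F z + \int[area]_z G z.
Proof. by move=> mf f0 mg g0; apply: ge0_integralD. Qed.

Lemma area_le_integral F G : measurable_fun setT F -> (forall z, 0 <= F z) ->
  measurable_fun setT G -> (forall z, F z <= G z) ->
  \int[area]_z F z <= \int[area]_z G z.
Proof.
by move=> mf f0 mg fg; apply: ge0_le_integral => // x _; exact: le_trans (fg x).
Qed.

Lemma tonelli_swap F : measurable_fun setT F -> (forall z, 0 <= F z) ->
  \int[leb]_x \int[leb]_y F (x, y) = \int[leb]_y \int[leb]_x F (x, y).
Proof. by move=> mF F0; exact: (etrans (esym (integral_area mF F0)) (integral_area2 mF F0)). Qed.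

Lemma measurable_fun_x F y : measurable_fun setT F -> measurable_fun setT (fun x => F (x, y)).
Proof. by move=> mF; exact: measurableT_comp. Qed.

Lemma measurable_fun_y F x : measurable_fun setT F -> measurable_fun setT (fun y => F (x, y)).
Proof. by move=> mF; exact: measurableT_comp. Qed.

Definition linmap (a b c d : R) (z : R * R) : R * R :=
  (a * z.1 + b * z.2, c * z.1 + d * z.2)%R.

Lemma measurable_linmap a b c d : measurable_fun setT (linmap a b c d).
Proof.
apply: measurable_fun_pair; apply: measurable_funD; apply: measurable_funM => //;
  try exact: measurable_cst; try exact: measurable_fst; exact: measurable_snd.
Qed.

Definition preserving (phi : R * R -> R * R) := forall F,
  measurable_fun setT F -> (forall z, 0 <= F z) -> \int[area]_z F (phi z) = \int[area]_z F z.

Lemma preserving_comp phi psi : measurable_fun setT phi ->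
  preserving phi -> preserving psi -> preserving (phi \o psi).
Proof.
move=> mphi h1 h2 F mF F0; rewrite -(h1 F mF F0) -(h2 (F \o phi))//.
  exact: measurableT_comp.
by move=> z; exact: F0.
Qed.

Lemma preserving_shear_x (s : R) : preserving (linmap 1 s 0 1).
Proof.
move=> F mF F0; have G0 : forall z, 0 <= (F \o linmap 1 s 0 1) z by move=> z; exact: F0.
have mG : measurable_fun setT (F \o linmap 1 s 0 1).
  by apply: measurableT_comp => //; exact: measurable_linmap.
rewrite (integral_area2 mF)//; transitivity (\int[area]_z (F \o linmap 1 s 0 1) z) => //;
rewrite (integral_area2 mG G0);
 apply: eq_integral => y _.
rewrite -(integral_shift (s * y) (measurable_fun_x y mF))//.
by apply: eq_integral => x _; rewrite /linmap /= !mul1r mul0r add0r.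
Qed.

Lemma preserving_shear_y (s : R) : preserving (linmap 1 0 s 1).
Proof.
move=> F mF F0; have G0 : forall z, 0 <= (F \o linmap 1 0 s 1) z by move=> z; exact: F0.
have mG : measurable_fun setT (F \o linmap 1 0 s 1).
  by apply: measurableT_comp => //; exact: measurable_linmap.
rewrite (integral_area mF)//; transitivity (\int[area]_z (F \o linmap 1 0 s 1) z) => //;
rewrite (integral_area mG G0);
 apply: eq_integral => x _.
rewrite -(integral_shift (s * x) (measurable_fun_y x mF))//.
by apply: eq_integral => y _; rewrite /linmap /= !mul1r mul0r addr0 addrC.
Qed.

Definition rot (c s : R) := linmap c (- s) s c.

(** A rotation is a product of three shears, or a product of two quarter turns. *)
Lemma preserving_rot (c s : R) : (c ^+ 2 + s ^+ 2 = 1)%R -> preserving (rot c s).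
Proof.
move=> cs.
have H (c' s' : R) : (c' ^+ 2 + s' ^+ 2 = 1)%R -> s' != 0%R -> preserving (rot c' s').
  move=> cs' s0; pose a := ((c' - 1) / s')%R.
  have -> : rot c' s' = linmap 1 a 0 1 \o (linmap 1 0 s' 1 \o linmap 1 a 0 1).
    apply/funext => -[x y]; rewrite /rot /linmap /=; congr pair; rewrite /a.
      have -> : (- s' = (c' ^+ 2 - 1) / s')%R.
        by rewrite -cs' opprD addrA subrr add0r expr2 mulNr mulfK.
      by field.
    by field.
  apply: preserving_comp; [exact: measurable_linmap|exact: preserving_shear_x|].
  apply: preserving_comp; [exact: measurable_linmap|exact: preserving_shear_y|].
  exact: preserving_shear_x.
have [s0|s0] := eqVneq s 0%R; last exact: H.
have /orP[/eqP c1|/eqP c1] : (c == 1)%R || (c == -1)%R.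
  by rewrite -sqrf_eq1; apply/eqP; rewrite -cs s0 expr0n addr0.
  have -> : rot c s = id.
    by apply/funext => -[x y]; rewrite /rot /linmap s0 c1 /= oppr0 !mul0r !mul1r addr0 add0r.
  by move=> F.
have -> : rot c s = rot 0 1 \o rot 0 1.
  by apply/funext => -[x y]; rewrite /rot /linmap s0 c1 /=; congr pair; ring.
apply: preserving_comp; first exact: measurable_linmap.
  by apply: H; rewrite ?oner_eq0// expr0n add0r expr1n.
by apply: H; rewrite ?oner_eq0// expr0n add0r expr1n.
Qed.

Lemma integral_area_scale (c : R) F : (0 < c)%R -> measurable_fun setT F -> (forall z, 0 <= F z) ->
  \int[area]_z F (c * z.1, c * z.2)%R = (c ^- 2)%:E * \int[area]_z F z.
Proof.
move=> c0 mF F0; have c0' : (0 <= c^-1)%R by rewrite invr_ge0 ltW.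
have G0 : forall z, 0 <= (F \o linmap c 0 0 c) z by move=> z; exact: F0.
have mG : measurable_fun setT (F \o linmap c 0 0 c).
  by apply: measurableT_comp => //; exact: measurable_linmap.
transitivity (\int[area]_z (F \o linmap c 0 0 c) z).
  by apply: eq_integral => z _; rewrite /= /linmap !mul0r addr0 add0r.
rewrite (integral_area mF)// (integral_area mG G0).
transitivity (\int[leb]_x ((c^-1)%:E * \int[leb]_y F ((c * x)%R, y))).
  apply: eq_integral => x _.
  rewrite -(integral_scale c0 (measurable_fun_y _ mF))//.
  by apply: eq_integral => y _; rewrite /linmap /= !mul0r addr0 add0r.
have mFF : measurable_fun setT (fubini_F leb F) by exact: measurable_fun_fubini_tonelli_F.
have mFc : measurable_fun setT (fun x => \int[leb]_y F ((c * x)%R, y)).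
  apply: (measurableT_comp mFF).
  by apply: measurable_funM => //; exact: measurable_cst.
have ic0 : (0 <= c^-1)%R by rewrite invr_ge0 ltW.
rewrite (leb_integralZl ic0 mFc); last by move=> x; exact: integral_ge0.
have F0' x : 0 <= fubini_F leb F x by apply: integral_ge0.
have := integral_scale c0 mFF F0'.
rewrite /fubini_F => ->.
by rewrite muleA -EFinM expr2 invfM.
Qed.

(** ** Radial integrals *)

Definition sqnorm (z : R * R) : R := (z.1 ^+ 2 + z.2 ^+ 2)%R.

Lemma measurable_sqnorm : measurable_fun setT sqnorm.
Proof.
by apply: measurable_funD; apply: measurable_funX; [exact: measurable_fst|exact: measurable_snd].
Qed.

Definition disc_area : \bar R := area [set z | (sqnorm z < 1)%R].

Lemma measurable_lt_sqnorm (t : R) : measurable [set z | (sqnorm z < t)%R].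
Proof.
have -> : [set z | (sqnorm z < t)%R] = sqnorm @^-1` `]-oo, t[%classic.
  by apply/seteqP; split=> z /=; rewrite in_itv.
by rewrite -[X in measurable X]setTI; apply: measurable_sqnorm => //; exact: measurable_itv.
Qed.

Lemma disc_area_gt0 : 0 < disc_area.
Proof.
apply: (@lt_le_trans _ _ (area (`[0%R, 2^-1%R]%classic `*` `[0%R, 2^-1%R]%classic))).
  rewrite product_measure1E; [|exact: measurable_itv|exact: measurable_itv].
  rewrite /= !lebesgue_measure_itv /= !lte_fin invr_gt0 ltr0n /= -!EFinB -EFinM lte_fin.
  by rewrite subr0 mulr_gt0.
apply: le_measure; rewrite ?inE.
- by apply: measurableX; exact: measurable_itv.
- exact: measurable_lt_sqnorm.
- move=> [x y] /=; rewrite !in_itv /= => -[/andP[x0 x1] /andP[y0 y1]].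
  by rewrite /sqnorm /=; nra.
Qed.

Lemma disc_area_lty : disc_area < +oo.
Proof.
apply: (@le_lt_trans _ _ (area (`[(-1)%R, 1%R]%classic `*` `[(-1)%R, 1%R]%classic))).
  apply: le_measure; rewrite ?inE.
  - exact: measurable_lt_sqnorm.
  - by apply: measurableX; exact: measurable_itv.
  - by move=> [x y] /=; rewrite /sqnorm /= !in_itv /= => h; split; apply/andP; split; nra.
rewrite product_measure1E; [|exact: measurable_itv|exact: measurable_itv].
rewrite /= !lebesgue_measure_itv /=; case: ifP => _; rewrite -?EFinD -?EFinB -?EFinM ?mule0 ?ltry//.
Qed.

Lemma area_lt_sqnorm (t : R) : area [set z | (sqnorm z < t)%R] =
  (Num.max t 0)%:E * disc_area.
Proof.
have [t0|t0] := leP t 0%R.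
  rewrite mul0e (_ : [set z | _] = set0) ?measure0//.
  apply/seteqP; split=> z //=; rewrite /sqnorm => h.
  by have := sqr_ge0 z.1; have := sqr_ge0 z.2; lra.
have c0 : (0 < (Num.sqrt t)^-1)%R by rewrite invr_gt0 sqrtr_gt0.
pose E : set (R * R) := [set z | (sqnorm z < 1)%R].
have mE : measurable E by exact: measurable_lt_sqnorm.
have mi : measurable_fun setT (fun z => (\1_E z)%:E : \bar R).
  by apply/measurable_EFinP; exact: measurable_indic.
have i0 : forall z, 0 <= (\1_E z)%:E :> \bar R by move=> z; rewrite lee_fin.
have := integral_area_scale c0 mi i0.
rewrite [X in _ = _ * X -> _]integral_indic// setIT.
rewrite -/disc_area exprVn invrK sqr_sqrtr ?(ltW t0)// => <-.
rewrite -[LHS](congr1 area (setIT _)) -integral_indic//; last exact: measurable_lt_sqnorm.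
apply: eq_integral => z _; congr (_%:E); rewrite !indicE; congr (_%:R); congr nat_of_bool.
apply/idP/idP; rewrite !inE /E /= /sqnorm /= !exprMn exprVn sqr_sqrtr ?(ltW t0)//;
  by rewrite -mulrDr ltr_pdivrMl// mulr1.
Qed.

Lemma pushforward_sqnorm (A : set R) : measurable A ->
  area (sqnorm @^-1` A) = disc_area * leb (A `&` `[0%R, +oo[).
Proof.
have dfin : disc_area \is a fin_num.
  by rewrite ge0_fin_numE ?disc_area_lty// ltW// disc_area_gt0.
have d0 : (0 <= fine disc_area)%R by rewrite fine_ge0// ltW// disc_area_gt0.
have mD : measurable (`[0%R, +oo[%classic : set (measurableTypeR R)) by exact: measurable_itv.
pose m1 := pushforward area (sqnorm : _ -> measurableTypeR R).
pose m2 := mscale (NngNum d0) (mrestr leb mD).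
have ms : measurable_fun setT (sqnorm : _ -> measurableTypeR R) := measurable_sqnorm.
have m12 (x : R) : m1 `]-oo, x[%classic = m2 `]-oo, x[%classic.
  rewrite /m1 /m2 /pushforward /mscale /mrestr /=.
  have -> : sqnorm @^-1` `]-oo, x[%classic = [set z | (sqnorm z < x)%R].
    by apply/seteqP; split=> z /=; rewrite in_itv.
  rewrite area_lt_sqnorm fineK// muleC; congr (_ * _).
  rewrite /mrestr; have -> : `]-oo, x[%classic `&` `[0%R, +oo[%classic = `[0%R, x[%classic :> set R.
    by apply/seteqP; split=> z /=; rewrite !in_itv /= andbT; [case=> -> ->|case/andP].
  rewrite lebesgue_measure_itv /= lte_fin; have [x0|x0] := leP x 0%R.
    by [].
  by rewrite oppr0 adde0.
move=> mA.
have -> : disc_area * leb (A `&` `[0%R, +oo[) = m2 A by rewrite /m2 /mscale /= fineK.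
apply: (@measure_unique _ R (measurableTypeR R) [set B | exists x, B = `]-oo, x[%classic]
  (fun n => `]-oo, n%:R[%classic) _ _ _ _ (pushforward area (sqnorm : _ -> measurableTypeR R)) m2) => //.
- exact: RGenInftyO.measurableE.
- move=> _ _ [x ->] [y ->]; exists (Num.min x y).
  by apply/seteqP; split=> z /=; rewrite !in_itv /= lt_min; [case=> -> ->|case/andP].
- by move=> i; exists i%:R.
- apply/seteqP; split=> // x _; exists (Num.truncn `|x|).+1 => //=; rewrite in_itv /=.
  by apply: (le_lt_trans (ler_norm x)); rewrite truncnS_gt.
- by move=> _ [x ->]; exact: m12.
- move=> n; rewrite [X in X < _]m12 /m2 /mscale /= /mrestr.
  rewrite lte_mul_pinfty//.
  apply: (@le_lt_trans _ _ (leb `[0%R, n%:R[%classic)); last by rewrite lebesgue_measure_itv /=; case: ifP; rewrite ?ltry// -EFinB ltry.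
  apply: le_measure; rewrite ?inE.
  + by apply: measurableI; exact: measurable_itv.
  + exact: measurable_itv.
  + by move=> z /=; rewrite !in_itv /= andbT => -[-> ->].
Qed.

(** The image of area under [sqnorm] is a multiple of Lebesgue measure, because the
    disc of squared radius [t] has area proportional to [t]. *)
Lemma integral_radial (g : R -> \bar R) : measurable_fun setT g -> (forall x, 0 <= g x) ->
  \int[area]_z g (sqnorm z) = disc_area * \int[leb]_(t in `[0%R, +oo[) g t.
Proof.
move=> mg g0.
have dfin : disc_area \is a fin_num.
  by rewrite ge0_fin_numE ?disc_area_lty// ltW// disc_area_gt0.
have d0 : (0 <= fine disc_area)%R by rewrite fine_ge0// ltW// disc_area_gt0.
have mD : measurable (`[0%R, +oo[%classic : set (measurableTypeR R)) by exact: measurable_itv.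
have ms : measurable_fun (setT : set (measurableTypeR R * measurableTypeR R)) (sqnorm : _ -> measurableTypeR R) := measurable_sqnorm.
have mgD : measurable_fun (`[0%R, +oo[%classic : set (measurableTypeR R)) g by exact: measurable_funTS.
have := @ge0_integral_pushforward _ _ _ _ _ _ ms (@lebesgue_measure R \x @lebesgue_measure R) _ g mD mgD (fun y _ => g0 y).
have -> : sqnorm @^-1` `[0%R, +oo[ = setT.
  by apply/seteqP; split=> // z _ /=; rewrite in_itv /= andbT /sqnorm addr_ge0// sqr_ge0.
move=> <-.
transitivity (\int[mscale (NngNum d0) leb]_(x in `[0%R, +oo[) g x).
  apply: eq_measure_integral => A mA AD; rewrite /= /pushforward pushforward_sqnorm// /mscale /= fineK//.
  by congr (_ * leb _); apply/setIidl.
by rewrite ge0_integral_mscale//= fineK.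
Qed.

End Lebesgue2.

(** * Power integrals and the Euler beta integral *)
Section Gates.
Context {R : realType}.
Local Open Scope ereal_scope.
Notation leb := (@lebesgue_measure R).

Lemma integral_gate d (T : measurableType d) (mu : {measure set T -> \bar R}) (D : set T) (g : T -> R) :
  \int[mu]_(x in D) (g x)%:E = \int[mu]_x ((x \in D)%:R * g x)%:E.
Proof.
rewrite integral_mkcond; apply: eq_integral => x _; rewrite patchE.
by case: ifP => _; rewrite ?mul1r ?mul0r.
Qed.

Lemma measurable_gate d (T : measurableType d) (b : T -> bool) : measurable_fun setT b ->
  measurable_fun setT (fun x => (b x)%:R : R).
Proof.
move=> mb; have -> : (fun x => (b x)%:R : R) = (fun x => if b x then 1 else 0)%R.
  by apply/funext => x; case: (b x).
by apply: measurable_fun_ifT => //; exact: measurable_cst.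
Qed.

Lemma measurable_powR_comp d (T : measurableType d) (f : T -> R) (p : R) :
  measurable_fun setT f -> measurable_fun setT (fun x => f x `^ p)%R.
Proof. by move=> mf; apply: (measurableT_comp (measurable_powR p)). Qed.

Lemma integral_reflect (c : R) (f : R -> \bar R) : measurable_fun setT f ->
  (forall x, 0 <= f x) -> \int[leb]_x f (c - x)%R = \int[leb]_x f x.
Proof.
move=> mf f0; rewrite -(integral_shift c mf f0).
have mg : measurable_fun setT (fun x : R => f (x + c)%R).
  by apply: (measurableT_comp mf); apply: measurable_funD => //; exact: measurable_cst.
rewrite -(integral_opp mg (fun x => f0 _)).
by apply: eq_integral => x _; rewrite addrC.
Qed.

End Gates.

(** Measurability of real expressions built from gates, powers and ring operations. *)
Ltac mfun := repeat lazymatch goal with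
  | |- measurable_fun _ (fun _ => _ * _)%R => apply: measurable_funM
  | |- measurable_fun _ (fun _ => _ - _)%R => apply: measurable_funB
  | |- measurable_fun _ (fun _ => _ + _)%R => apply: measurable_funD
  | |- measurable_fun _ (fun _ => _ ^+ _)%R => apply: measurable_funX
  | |- measurable_fun _ (fun _ => _ `^ _)%R => apply: measurable_powR_comp
  | |- measurable_fun _ (fun _ => (nat_of_bool _)%:R)%R => apply: measurable_gate
  | |- measurable_fun _ (fun _ => _ && _) => apply: measurable_and
  | |- measurable_fun _ (fun _ => _ < _)%R => apply: measurable_fun_ltr
  | |- measurable_fun _ (fun _ => _ <= _)%R => apply: measurable_fun_ler
  | |- measurable_fun _ _ => first [ assumption | exact: measurable_cst | exact: measurable_fst
      | exact: measurable_snd | exact: measurable_id | apply: measurable_fun_ltr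
      | apply: measurable_fun_ler | done | apply: measurable_powR_comp | apply: measurable_funM
      | apply: measurable_funB | apply: measurable_funD | apply: measurable_funX ]
  end.

Section PowerIntegrals.
Context {R : realType}.
Notation leb := (@lebesgue_measure R).

Lemma is_derive_powR (e x : R) : 0 < x -> is_derive x 1 (@powR R ^~ e) (e * x `^ (e - 1)).
Proof.
move=> x0; have xin : x \in `]0, +oo[ by rewrite in_itv /= x0.
apply: DeriveDef; first exact: derivable_powR.
by rewrite -derive1E powR_derive1.
Qed.

Lemma continuous_powR (e x : R) : 0 < x -> {for x, continuous (@powR R ^~ e)}.
Proof.
move=> x0; apply: differentiable_continuous; apply/derivable1_diffP.
by have [] := is_derive_powR e x0.
Qed.

Lemma integral_powR_seg (e a b : R) : 0 < a -> a <= b -> e != -1 ->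
  (\int[leb]_(s in `[a, b]) (s `^ e)%:E = ((b `^ (e + 1) - a `^ (e + 1)) / (e + 1))%:E)%E.
Proof.
move=> a0; rewrite le_eqVlt => /orP[/eqP <- e1|ab e1].
  by rewrite subrr mul0r set_itv1 integral_set1.
have e10 : e + 1 != 0 by rewrite addr_eq0.
have dF (x : R) : 0 < x -> is_derive x 1 (fun s : R => s `^ (e + 1) / (e + 1)) (x `^ e).
  move=> x0; have h := is_derive_powR (e + 1) x0.
  apply: is_derive_eq; rewrite addrK.
  by rewrite -[_ *: _]/(_ * _) -?[_ *: _]/(_ * _); field.
rewrite (@continuous_FTC2 _ _ (fun s => s `^ (e + 1) / (e + 1)) a b) //.
- by rewrite -EFinB mulrBl.
- apply: continuous_in_subspaceT => x; rewrite inE /= in_itv /= => /andP[ax _].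
  by apply: continuous_powR; exact: lt_le_trans ax.
- have cF (x : R) : 0 < x -> {for x, continuous (fun s : R => s `^ (e + 1) / (e + 1))}.
    move=> x0; apply: differentiable_continuous; apply/derivable1_diffP.
    by have [] := dF x x0.
  split.
  + move=> x; rewrite in_itv /= => /andP[ax _].
    by have [] := dF x (lt_trans a0 ax).
  + by apply: cvg_at_right_filter; exact: cF.
  + by apply: cvg_at_left_filter; apply: cF; exact: lt_trans ab.
- move=> x; rewrite in_itv /= => /andP[ax _]; rewrite derive1E.
  exact: (@derive_val _ _ _ _ _ _ _ (dF x (lt_trans a0 ax))).
Qed.

Lemma measurable_powR_fun (D : set R) (e : R) : measurable D ->
  measurable_fun D (fun s : R => (s `^ e)%:E).
Proof.
by move=> mD; apply: measurable_funTS; apply/measurable_EFinP; exact: measurable_powR.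
Qed.

Lemma integral_powR0 (e t : R) : -1 < e -> 0 < t ->
  (\int[leb]_(s in `]0%R, t]) (s `^ e)%:E = (t `^ (e + 1) / (e + 1))%:E)%E.
Proof.
move=> e1 t0; have e0 : 0 < e + 1 by lra.
pose F n := `[t * n.+1%:R^-1, t]%classic : set R.
have FU : \bigcup_n F n = `]0, t]%classic.
  apply/seteqP; split=> x /=.
    move=> [n _]; rewrite /F /= !in_itv /= => /andP[h ->]; rewrite andbT.
    by apply: lt_le_trans h; rewrite mulr_gt0// invr_gt0.
  rewrite in_itv /= => /andP[x0 xt]; exists (Num.truncn (t / x)) => //.
  rewrite /F /= in_itv /= xt andbT ler_pdivrMr// mulrC -ler_pdivrMr//.
  by apply: ltW; rewrite truncnS_gt.
have mF n : measurable (F n) by exact: measurable_itv.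
have ndF : {homo F : n m / (n <= m)%N >-> (n <= m)%O}.
  move=> n m nm; apply/subsetPset => x; rewrite /F /= !in_itv /= => /andP[h ->].
  rewrite andbT; apply: le_trans h; rewrite ler_wpM2l ?(ltW t0)// lef_pV2 ?posrE//.
  by rewrite ler_nat ltnS.
have pos n s : F n s -> (0 <= (s `^ e)%:E)%E by move=> _; rewrite lee_fin powR_ge0.
have H := @ge0_nondecreasing_set_cvg_integral _ (measurableTypeR R) R F (fun s : R => (s `^ e)%:E) leb ndF mF
  (fun i => measurable_powR_fun e (mF i)) pos.
rewrite FU in H; symmetry; apply: (cvg_unique _ _ H); first exact: ereal_hausdorff.
have -> : (fun n => \int[leb]_(x in F n) (x `^ e)%:E)%E =
     (fun n => ((t `^ (e + 1) - (t * n.+1%:R^-1) `^ (e + 1)) / (e + 1))%:E).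
  apply/funext => n; rewrite integral_powR_seg//.
  + by rewrite mulr_gt0// invr_gt0.
  + by rewrite ler_piMr ?(ltW t0)// invf_le1// ler1n.
  + by rewrite gt_eqF.
have h : (fun n : nat => (t * n.+1%:R^-1) `^ (e + 1)) @ \oo --> (0:R).
  have /cvg_at_rightP/(_ (fun n : nat => t * n.+1%:R^-1)) := powR_cvg0 e0; apply.
  split; first by move=> n; rewrite mulr_gt0// invr_gt0.
  rewrite -[X in _ --> X](mulr0 t); apply: cvgM; first exact: cvg_cst.
  exact: cvg_harmonic.
have h2 : (fun n : nat => (t `^ (e + 1) - (t * n.+1%:R^-1) `^ (e + 1)) / (e + 1)) @ \oo -->
    ((t `^ (e + 1) - 0) / (e + 1)).
  by apply: cvgM; [apply: cvgB => //; exact: cvg_cst | exact: cvg_cst].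
rewrite subr0 in h2.
by apply: cvg_EFin => //; exact: nearW.
Qed.

Lemma integral_powRy (e a : R) : e < -1 -> 0 < a ->
  (\int[leb]_(s in `[a, +oo[) (s `^ e)%:E <= (a `^ (e + 1) / - (e + 1))%:E)%E.
Proof.
move=> e1 a0; have e0 : 0 < - (e + 1) by lra.
pose F n := `[a, a + n%:R]%classic : set R.
have FU : \bigcup_n F n = `[a, +oo[%classic.
  apply/seteqP; split=> x /=.
    by move=> [n _]; rewrite /F /= !in_itv /= andbT => /andP[->].
  rewrite in_itv /= andbT => ax; exists (Num.truncn (x - a)).+1 => //.
  rewrite /F /= in_itv /= ax -lerBlDl.
  by apply: ltW; rewrite truncnS_gt.
have mF n : measurable (F n) by exact: measurable_itv.
have ndF : {homo F : n m / (n <= m)%N >-> (n <= m)%O}.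
  move=> n m nm; apply/subsetPset => x; rewrite /F /= !in_itv /= => /andP[-> h] /=.
  by apply: (le_trans h); rewrite lerD2l ler_nat.
have pos n s : F n s -> (0 <= (s `^ e)%:E)%E by move=> _; rewrite lee_fin powR_ge0.
have H := @ge0_nondecreasing_set_cvg_integral _ (measurableTypeR R) R F (fun s : R => (s `^ e)%:E) leb ndF mF
  (fun i => measurable_powR_fun e (mF i)) pos.
rewrite FU in H; rewrite -(cvg_lim (@ereal_hausdorff R) H).
apply: lime_le; first by apply/cvg_ex; eexists; exact: H.
apply: nearW => n; rewrite integral_powR_seg// ?lerDl//; last by rewrite lt_eqF.
rewrite lee_fin -[X in X <= _]opprK -mulrN -invrN -mulNr opprB.
by rewrite ler_pM2r ?invr_gt0// gerBl powR_ge0.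
Qed.

Lemma integral_powR0_gate (e t : R) : -1 < e -> 0 < t ->
  (\int[leb]_s ((0 < s < t)%R%:R * s `^ e)%R%:E = (t `^ (e + 1) / (e + 1))%:E)%E.
Proof.
move=> e1 t0; rewrite -integral_powR0//.
rewrite -(@integral_itv_bndo_bndc R (BRight 0) t (fun s => (s `^ e)%:E)); last exact: measurable_powR_fun.
rewrite [RHS]integral_gate; apply: eq_integral => s _.
by rewrite mem_setE in_itv.
Qed.

End PowerIntegrals.

Section BetaIntegral.
Context {R : realType}.
Notation leb := (@lebesgue_measure R).
Local Open Scope ereal_scope.

Definition betaint (b a : R) : \bar R :=
  \int[leb]_(t in `]0%R, 1%R[) (t `^ b * (1 - t) `^ a)%:E.

Lemma betaintE b a : betaint b a =
  \int[leb]_t ((0 < t < 1)%R%:R * (t `^ b * (1 - t) `^ a))%:E.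
Proof.
rewrite /betaint integral_gate; apply: eq_integral => t _.
by rewrite mem_setE in_itv.
Qed.

Lemma measurable_beta_body (b a : R) :
  measurable_fun setT (fun t : R => (t `^ b * (1 - t) `^ a)%R).
Proof.
apply: measurable_funM; first exact: measurable_powR.
apply: measurable_powR_comp; apply: measurable_funB => //; exact: measurable_cst.
Qed.

Lemma betaint_ge0 b a : 0 <= betaint b a.
Proof. by apply: integral_ge0 => t _; rewrite lee_fin mulr_ge0// powR_ge0. Qed.

(** Both sides are the double integral of [s ^ b * (1 - t) ^ a] over the
    triangle [0 < s < t < 1]. *)
Lemma betaint_parts (b a : R) : (-1 < b)%R -> (-1 < a)%R ->
  (b + 1)%:E * betaint b (a + 1) = (a + 1)%:E * betaint (b + 1) a.
Proof.
move=> b1 a1.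
pose Phi (z : R * R) : \bar R :=
  ((0 < z.1 < z.2)%R%:R * (z.2 < 1)%R%:R * (z.1 `^ b * (1 - z.2) `^ a))%:E.
have mPhi : measurable_fun setT Phi.
  by apply/measurable_EFinP; rewrite /=; mfun.
have Phi0 z : 0 <= Phi z by rewrite lee_fin !mulr_ge0// powR_ge0.
have e0 (c : R) : (-1 < c)%R -> (c + 1 != 0)%R by move=> h; rewrite gt_eqF//; lra.
have inner1 (s : R) : \int[leb]_t Phi (s, t) =
   ((a + 1)^-1)%:E * ((0 < s < 1)%R%:R * (s `^ b * (1 - s) `^ (a + 1)))%:E.
  have [s01|s01] := boolP (0 < s < 1)%R; last first.
    rewrite mul0r mule0 -[RHS](@integral0 _ _ _ leb setT); apply: eq_integral => t _.
    rewrite /Phi /=; have [h|h] := boolP (0 < s < t)%R; last by rewrite !mul0r.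
    have [t1|t1] := boolP (t < 1)%R; last by rewrite mulr0 mul0r.
    by exfalso; move/negP: s01; apply; lra.
  have s1 : (0 < 1 - s)%R by lra.
  transitivity (\int[leb]_t ((s `^ b)%:E * ((0 < 1 - t < 1 - s)%R%:R * (1 - t) `^ a)%:E)).
    apply: eq_integral => t _; rewrite /Phi /= -EFinM; congr (_%:E).
    rewrite mulrCA [in RHS]mulrA -mulrA; congr (_ * _)%R; first last.
    have -> : (0 < 1 - t < 1 - s)%R = (s < t)%R && (t < 1)%R by apply/idP/idP; lra.
    have -> : (0 < s)%R by lra.
    by rewrite /= -natrM mulnb.
  have mu1 : measurable_fun setT (fun u : R => ((0 < u < 1 - s)%R%:R * u `^ a)%:E).
    by apply/measurable_EFinP; mfun.
  have mu2 : measurable_fun setT (fun t : R => ((0 < 1 - t < 1 - s)%R%:R * (1 - t) `^ a)%:E).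
    by apply/measurable_EFinP; mfun.
  have u0 (u : R) : 0 <= ((0 < u < 1 - s)%R%:R * u `^ a)%:E by rewrite lee_fin mulr_ge0// powR_ge0.
  rewrite (leb_integralZl (powR_ge0 _ _) mu2 (fun t => u0 _)) (integral_reflect 1 mu1 u0).
  by rewrite integral_powR0_gate// -!EFinM; congr (_%:E); rewrite mul1r; field; exact: e0.
have inner2 (t : R) : \int[leb]_s Phi (s, t) =
   ((b + 1)^-1)%:E * ((0 < t < 1)%R%:R * (t `^ (b + 1) * (1 - t) `^ a))%:E.
  have [t01|t01] := boolP (0 < t < 1)%R; last first.
    rewrite mul0r mule0 -[RHS](@integral0 _ _ _ leb setT); apply: eq_integral => s _.
    rewrite /Phi /=; have [h|h] := boolP (0 < s < t)%R; last by rewrite !mul0r.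
    have [t1|t1] := boolP (t < 1)%R; last by rewrite mulr0 mul0r.
    by exfalso; move/negP: t01; apply; lra.
  have t0 : (0 < t)%R by lra.
  have t1 : (t < 1)%R by lra.
  transitivity (\int[leb]_s (((1 - t) `^ a)%:E * ((0 < s < t)%R%:R * s `^ b)%:E)).
    apply: eq_integral => s _; rewrite /Phi /= -EFinM; congr (_%:E).
    by rewrite t1 mulr1; ring.
  have mu1 : measurable_fun setT (fun u : R => ((0 < u < t)%R%:R * u `^ b)%:E).
    by apply/measurable_EFinP; mfun.
  have u0 (u : R) : 0 <= ((0 < u < t)%R%:R * u `^ b)%:E by rewrite lee_fin mulr_ge0// powR_ge0.
  rewrite (leb_integralZl (powR_ge0 _ _) mu1 u0) integral_powR0_gate// -!EFinM.
  by congr (_%:E); rewrite mul1r; field; exact: e0.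
have E1 : \int[leb]_s \int[leb]_t Phi (s, t) =
    \int[leb]_s (((a + 1)^-1)%:E * ((0 < s < 1)%R%:R * (s `^ b * (1 - s) `^ (a + 1)))%:E).
  by apply: eq_integral => s _; exact: inner1.
have E2 : \int[leb]_t \int[leb]_s Phi (s, t) =
    \int[leb]_t (((b + 1)^-1)%:E * ((0 < t < 1)%R%:R * (t `^ (b + 1) * (1 - t) `^ a))%:E).
  by apply: eq_integral => t _; exact: inner2.
have := etrans (esym E1) (etrans (tonelli_swap mPhi Phi0) E2).
have mB (c d : R) : measurable_fun setT (fun t : R => ((0 < t < 1)%R%:R * (t `^ c * (1 - t) `^ d))%:E).
  by apply/measurable_EFinP; mfun.
have B0 (c d t : R) : 0 <= ((0 < t < 1)%R%:R * (t `^ c * (1 - t) `^ d))%:E.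
  by rewrite lee_fin !mulr_ge0// powR_ge0.
have V0 (c : R) : (-1 < c)%R -> (0 <= (c + 1)^-1)%R by move=> h; rewrite invr_ge0; lra.
rewrite (leb_integralZl (V0 a a1) (mB b (a + 1)%R) (B0 b (a + 1)%R)).
rewrite (leb_integralZl (V0 b b1) (mB (b + 1)%R a) (B0 (b + 1)%R a)).
rewrite -!betaintE; move: (betaint b (a + 1)) (betaint (b + 1) a) => X Y E.
have cancelE (c : R) (x : \bar R) : (-1 < c)%R -> (c + 1)%:E * (((c + 1)^-1)%:E * x) = x.
  by move=> h; rewrite muleA -EFinM mulfV ?mul1e// e0.
by rewrite -[X](cancelE a)// E muleCA cancelE.
Qed.

(** Integrate [1 = (1 - t) + t]. *)
Lemma betaint_split (b a : R) : (-1 < b)%R -> (-1 < a)%R ->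
  betaint b (a + 1) + betaint (b + 1) a = betaint b a.
Proof.
move=> b1 a1; rewrite !betaintE -leb_integralD.
- apply: eq_integral => t _; rewrite -EFinD; congr (_%:E).
  have [/andP[t0 t1]|] := boolP (0 < t < 1)%R; last by rewrite !mul0r addr0.
  have E (c x : R) : (0 < x)%R -> (x `^ (c + 1) = x `^ c * x)%R.
    by move=> x0; rewrite powRD ?powRr1 ?(ltW x0)// (gt_eqF x0) implybT.
  by rewrite !E; [ring | lra | lra].
- by apply/measurable_EFinP; mfun.
- by move=> t; rewrite lee_fin !mulr_ge0// powR_ge0.
- by apply/measurable_EFinP; mfun.
- by move=> t; rewrite lee_fin !mulr_ge0// powR_ge0.
Qed.

(** Away from one endpoint the other factor is bounded by this constant. *)
Lemma powR_half_le (c x : R) : (2^-1 <= x <= 1 -> x `^ c <= 1 + 2^-1 `^ c)%R.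
Proof.
move=> /andP[x1 x2]; have x0 : (0 < x)%R by lra.
have [c0|c0] := leP 0%R c.
  apply: (@le_trans _ _ (1 `^ c)%R); first by rewrite ge0_ler_powR// ?nnegrE; lra.
  by rewrite powR1 lerDl powR_ge0.
apply: (@le_trans _ _ (2^-1 `^ c)%R); last by rewrite lerDr.
rewrite -[c]opprK !(powRN _ (- c)) lef_pV2 ?posrE ?powR_gt0//.
by rewrite ge0_ler_powR// ?nnegrE; lra.
Qed.

Lemma betaint_lty (b a : R) : (-1 < b)%R -> (-1 < a)%R -> betaint b a < +oo.
Proof.
move=> b1 a1.
pose g (c t : R) : \bar R := ((0 < t < 1)%R%:R * t `^ c)%:E.
have mg c : measurable_fun setT (g c) by apply/measurable_EFinP; mfun.
have g0 c t : 0 <= g c t by rewrite lee_fin mulr_ge0// powR_ge0.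
pose A := (1 + 2^-1 `^ a)%R; pose B := (1 + 2^-1 `^ b)%R.
have A0 : (0 <= A)%R by rewrite addr_ge0// powR_ge0.
have B0 : (0 <= B)%R by rewrite addr_ge0// powR_ge0.
have mg1 : measurable_fun setT (fun t : R => g a (1 - t)%R).
  by apply/measurable_EFinP; mfun.
apply: (@le_lt_trans _ _ (\int[leb]_t (A%:E * g b t + B%:E * g a (1 - t)%R))).
  rewrite betaintE; apply: leb_le_integral.
  - by apply/measurable_EFinP; mfun.
  - by move=> t; rewrite lee_fin !mulr_ge0// powR_ge0.
  - have -> : (fun t : R => A%:E * g b t + B%:E * g a (1 - t)%R) = (fun t : R => (A * ((0 < t < 1)%R%:R * t `^ b) +
       B * ((0 < 1 - t < 1)%R%:R * (1 - t) `^ a))%:E).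
      by apply/funext => t; rewrite /g -!EFinM.
    by apply/measurable_EFinP; mfun.
  move=> t; rewrite /g -!EFinM -EFinD lee_fin.
  have -> : (0 < 1 - t < 1)%R = (0 < t < 1)%R by apply/idP/idP; lra.
  have [/andP[t0 t1]|] := boolP (0 < t < 1)%R; last by rewrite !mul0r !mulr0 addr0.
  rewrite !mul1r; have [th|th] := leP t 2^-1%R.
    apply: (@le_trans _ _ (A * t `^ b)%R); last by rewrite lerDl mulr_ge0// powR_ge0.
    by rewrite mulrC ler_wpM2r ?powR_ge0//; apply: powR_half_le; lra.
  apply: (@le_trans _ _ (B * (1 - t) `^ a)%R); last by rewrite lerDr mulr_ge0// powR_ge0.
  by rewrite ler_wpM2r ?powR_ge0//; apply: powR_half_le; lra.
have mA : measurable_fun setT (fun t => A%:E * g b t) by apply: measurable_funeM; exact: mg.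
have mB : measurable_fun setT (fun t : R => B%:E * g a (1 - t)%R) by apply: measurable_funeM.
rewrite (leb_integralD mA _ mB) => [|t|t]; try by rewrite mule_ge0// lee_fin.
rewrite (leb_integralZl A0 (mg b) (g0 b)) (leb_integralZl B0 mg1 (fun t => g0 a _)).
by rewrite (integral_reflect 1 (mg a) (g0 a)) !integral_powR0_gate// -!EFinM -EFinD ltry.
Qed.

Lemma betaint_gt0 (b a : R) : (-1 < b)%R -> (-1 < a)%R -> 0 < betaint b a.
Proof.
move=> b1 a1; rewrite lt0e betaint_ge0 andbT; apply/eqP => h.
have mD : measurable (`]0%R, 1%R[%classic : set (measurableTypeR R)) by exact: measurable_itv.
have mf : measurable_fun (`]0%R, 1%R[%classic : set (measurableTypeR R))
    (fun t : R => (t `^ b * (1 - t) `^ a)%:E).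
  by apply: measurable_funTS; apply/measurable_EFinP; exact: measurable_beta_body.
have /(ae_eq_integral_abs leb mD mf) [N [mN N0 hN]] :
   \int[leb]_(t in `]0%R, 1%R[) `|(t `^ b * (1 - t) `^ a)%:E| = 0.
  rewrite -[RHS]h; apply: eq_integral => t _.
  by rewrite gee0_abs// lee_fin mulr_ge0// powR_ge0.
have : leb (`]0%R, 1%R[%classic : set R) <= leb N.
  apply: le_measure; rewrite ?inE//.
  move=> t /= tin; apply: hN => /= /(_ tin) [] /esym h0.
  move: tin; rewrite in_itv /= => /andP[t0 t1].
  have : (0 < t `^ b * (1 - t) `^ a)%R by rewrite mulr_gt0// powR_gt0//; lra.
  by rewrite -h0 ltxx.
by rewrite N0 lebesgue_measure_itv /= lte_fin ltr01 -EFinB subr0 leNgt lte_fin ltr01.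
Qed.

End BetaIntegral.

(** * Complex-valued functions of a real variable and the binomial series *)
Section CDer.
Context {R : realType}.
Implicit Types (F G : R -> R[i]) (t : R) (l m : R[i]).

Definition cder F t l : Prop :=
  is_derive t (1 : R) (fun x => complex.Re (F x)) (complex.Re l) /\
  is_derive t (1 : R) (fun x => complex.Im (F x)) (complex.Im l).

Lemma cder_eq F t l m : cder F t l -> l = m -> cder F t m.
Proof. by move=> h <-. Qed.

Lemma cderM F G t l m : cder F t l -> cder G t m ->
  cder (fun x => F x * G x) t (l * G t + F t * m).
Proof.
move=> [f1 f2] [g1 g2]; split.
  have -> : (fun x => complex.Re (F x * G x)) =
     (fun x => complex.Re (F x) * complex.Re (G x) - complex.Im (F x) * complex.Im (G x)).
    by apply/funext => x; rewrite ReM.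
  apply: is_derive_eq; rewrite ReD !ReM -![_ *: _]/(_ * _); ring.
have -> : (fun x => complex.Im (F x * G x)) =
     (fun x => complex.Re (F x) * complex.Im (G x) + complex.Im (F x) * complex.Re (G x)).
  by apply/funext => x; rewrite ImM.
apply: is_derive_eq; rewrite ImD !ImM -![_ *: _]/(_ * _); ring.
Qed.

Lemma cderB F G t l m : cder F t l -> cder G t m -> cder (fun x => F x - G x) t (l - m).
Proof.
move=> [f1 f2] [g1 g2]; split.
  have -> : (fun x => complex.Re (F x - G x)) = (fun x => complex.Re (F x) - complex.Re (G x)).
    by apply/funext => x; rewrite ReB.
  by apply: is_derive_eq; rewrite ReB.
have -> : (fun x => complex.Im (F x - G x)) = (fun x => complex.Im (F x) - complex.Im (G x)).
  by apply/funext => x; rewrite ImB.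
by apply: is_derive_eq; rewrite ImB.
Qed.

Lemma cder_real (g : R -> R) t (d : R) : is_derive t (1 : R) g d -> cder (fun x => (g x)%:C) t d%:C.
Proof. by move=> h; split => //=; exact: is_derive_cst. Qed.

Lemma derive0_seg (f : R -> R) (a b : R) : a <= b ->
  (forall t, a <= t <= b -> is_derive t (1 : R) f 0) -> f a = f b.
Proof.
move=> ab h.
have H1 : forall x, x \in `]a, b[ -> is_derive x (1:R) f 0.
  by move=> x; rewrite in_itv /= => /andP[h1 h2]; apply: h; rewrite !ltW.
have H2 : {within `[a, b], continuous f}.
  apply: continuous_in_subspaceT => x; rewrite inE /= in_itv /= => hx.
  apply: differentiable_continuous; apply/derivable1_diffP.
  by have [] := h x hx.
have [c _] := MVT_segment ab H1 H2.
by rewrite mul0r => /eqP; rewrite subr_eq0 => /eqP.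
Qed.

Lemma cder0_seg F (a b : R) : a <= b -> (forall t, a <= t <= b -> cder F t 0) -> F a = F b.
Proof.
move=> ab h; apply: complex_eq.
  by apply: (derive0_seg (f := fun x => complex.Re (F x)) ab) => t /h[].
by apply: (derive0_seg (f := fun x => complex.Im (F x)) ab) => t /h[].
Qed.

Lemma is_derive_bound (g : R -> R) (t l C d : R) : 0 < d -> 0 <= C ->
  (forall h, `|h| < d -> `|g (t + h) - g t - l * h| <= C * h ^+ 2) -> is_derive t (1 : R) g l.
Proof.
move=> d0 C0 H.
suff hc : h^-1 *: (g (h *: (1 : R) + t) - g t) @[h --> 0^'] --> l.
  apply: DeriveDef; first by apply/cvg_ex; exists l.
  by apply: cvg_lim => //; exact: Rhausdorff.
apply/cvgrPdist_le => e e0; exists (Num.min d (e / (C + 1))).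
  by rewrite /= lt_min d0 divr_gt0//; lra.
move=> h /=; rewrite sub0r normrN lt_min => /andP[h1 h2] h0.
have ch : 0 < `|h| by rewrite normr_gt0.
rewrite -(ler_pM2r ch) -normrM.
have -> : (l - h^-1 *: (g (h *: 1 + t) - g t)) * h = - (g (t + h) - g t - l * h).
  rewrite -[_ *: (_ - _)]/(_ * _) -[h *: 1]/(h * 1) mulr1 [h + t]addrC; by field.
rewrite normrN; apply: (le_trans (H h h1)).
rewrite -real_normK ?num_real// expr2 mulrA ler_wpM2r//.
by move: h2; rewrite ltr_pdivlMr; [nra | lra].
Qed.

Definition dpser (a : nat -> R[i]) (z : R[i]) : R[i] := csum (fun k => k%:R * a k * z ^+ k.-1).

Lemma cder_pser (a : nat -> R[i]) (xi : R[i]) t : subexp a -> cabs (t%:C * xi) < 1 ->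
  cder (fun x => pser a (x%:C * xi)) t (dpser a (t%:C * xi) * xi).
Proof.
move=> ha h1; have [C C0 [d d0 H]] := pser_cderiv ha h1.
have c0 := cabs_ge0 xi.
have key h : `|h| < d / (cabs xi + 1) ->
   cabs (pser a ((t + h)%:C * xi) - pser a (t%:C * xi) - dpser a (t%:C * xi) * xi * h%:C)
     <= (C * cabs xi ^+ 2) * h ^+ 2.
  rewrite ltr_pdivlMr; last lra; move=> hd.
  have := H (h%:C * xi); rewrite cabsM cabsR.
  have -> : t%:C * xi + h%:C * xi = (t + h)%:C * xi by rewrite rmorphD /= mulrDl.
  have -> : dpser a (t%:C * xi) * xi * h%:C = dpser a (t%:C * xi) * (h%:C * xi) by ring.
  have hh : `|h| * cabs xi < d by have := normr_ge0 h; nra.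
  move=> /(_ hh) /le_trans; apply.
  by rewrite exprMn real_normK ?num_real// mulrA mulrAC.
have d0' : 0 < d / (cabs xi + 1) by rewrite divr_gt0//; lra.
have C0' : 0 <= C * cabs xi ^+ 2 by rewrite mulr_ge0// exprn_ge0.
split; apply: (is_derive_bound d0' C0') => h hd; apply: le_trans (key h hd).
  apply: le_trans (cabs_Re _).
  by rewrite !ReB [complex.Re (_ * h%:C)]ReM /= mulr0 subr0.
apply: le_trans (cabs_Im _).
by rewrite !ImB [complex.Im (_ * h%:C)]ImM /= mulr0 add0r.
Qed.

End CDer.

Section Cpow.
Context {R : realType}.
Implicit Types (z xi : R[i]) (s t : R).

Lemma cos_sin_cabs (u : R) : cabs (cos u +i* sin u) = 1.
Proof. by rewrite cabsE /= cos2Dsin2 sqrtr1. Qed.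

Lemma cabs_cpow z s : cabs (cpow z s) = cabs z `^ s.
Proof. by rewrite /cpow cabsM cos_sin_cabs mulr1 cabsR ger0_norm// powR_ge0. Qed.

Lemma cpow_neq0 z s : z != 0 -> cpow z s != 0.
Proof. by move=> z0; rewrite -cabs_gt0 cabs_cpow powR_gt0// cabs_gt0. Qed.

Lemma Arg_atan (x y : R) : 0 < x -> Arg (x +i* y) = atan (y / x).
Proof.
move=> x0.
have E (v : R) : 0 <= v -> acos (x / Num.sqrt (x ^+ 2 + v ^+ 2)) = atan (v / x).
  move=> v0; have -> : x / Num.sqrt (x ^+ 2 + v ^+ 2) = cos (atan (v / x)).
    rewrite cos_atan; have -> : 1 + (v / x) ^+ 2 = (x ^+ 2 + v ^+ 2) / x ^+ 2.
      by field; rewrite gt_eqF.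
    have q0 : 0 < x ^+ 2 + v ^+ 2 by have := sqr_ge0 v; have := exprn_gt0 2 x0; lra.
    rewrite sqrtrM ?(ltW q0)// sqrtrV ?exprn_ge0 ?(ltW x0)// sqrtr_sqr gtr0_norm//.
    by rewrite invfM invrK mulrC.
  apply: cosK; rewrite in_itv /=.
  have a0 : 0 <= atan (v / x).
    by rewrite -atan0; apply: le_atan; rewrite divr_ge0// ltW.
  rewrite a0 /=; have := atan_ltpi2 (v / x); have := pi_gt0 R; lra.
rewrite /Arg cabsE /=; case: ifP => y0; first exact: E.
have y0' : 0 <= - y by rewrite oppr_ge0 ltW// ltNge y0.
by rewrite -[y ^+ 2]sqrrN E// mulNr atanN opprK.
Qed.

(** The function [t |-> (1 - t xi) ^ s] on the ray through [xi]; [xi] in the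
    disc keeps the base in the right half plane. *)
Definition cpow_ray xi s t : R[i] :=
  let x := 1 - t * complex.Re xi in let y := - (t * complex.Im xi) in
  (expR (s / 2 * ln (x ^+ 2 + y ^+ 2)))%:C *
  (cos (s * atan (y / x)) +i* sin (s * atan (y / x))).

Lemma ray_pos xi t : cabs (t%:C * xi) < 1 -> 0 < 1 - t * complex.Re xi.
Proof.
move=> h; have := le_lt_trans (cabs_Re (t%:C * xi)) h.
by rewrite ReM /= mul0r subr0 ltr_norml; lra.
Qed.

Lemma cpow_rayE xi s t : cabs (t%:C * xi) < 1 -> cpow (1 - t%:C * xi) s = cpow_ray xi s t.
Proof.
move=> h; have x0 := ray_pos h.
have -> : 1 - t%:C * xi = (1 - t * complex.Re xi) +i* (- (t * complex.Im xi)).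
  by case: xi h x0 => a b h x0; apply: complex_eq => /=; ring.
rewrite /cpow Arg_atan// /cpow_ray cabsE /=; congr (_%:C * _).
set q := _ + _; have q0 : 0 < q.
  by rewrite /q; have := sqr_ge0 (- (t * complex.Im xi)); have := exprn_gt0 2 x0; lra.
rewrite /powR gt_eqF ?sqrtr_gt0// -powR12_sqrt ?(ltW q0)// ln_powR.
by congr expR; ring.
Qed.

Lemma cpow_ray0 xi s : cpow_ray xi s 0 = 1.
Proof.
rewrite /cpow_ray !mul0r subr0 oppr0 mul0r expr1n expr0n /= addr0 ln1 mulr0 expR0.
by rewrite atan0 mulr0 cos0 sin0 mul1r; apply: complex_eq.
Qed.

Lemma cpow_rayD xi s s' t : cpow_ray xi s t * cpow_ray xi s' t = cpow_ray xi (s + s') t.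
Proof.
rewrite /cpow_ray; set L := ln _; set A := atan _.
rewrite mulrACA -rmorphM /= -expRD; congr (_%:C * _).
  by congr expR; rewrite -mulrDl; congr (_ * _); ring.
by rewrite (mulrDl s s') cosD sinD; apply: complex_eq => /=; ring.
Qed.

Lemma cder_cpow_ray xi s t : cabs (t%:C * xi) < 1 ->
  cder (cpow_ray xi s) t (s%:C * (- xi / (1 - t%:C * xi)) * cpow_ray xi s t).
Proof.
move=> h; have x0 := ray_pos h.
case: xi h x0 => a b /= h x0.
set x := 1 - t * a; set y := - (t * b); pose q := x ^+ 2 + y ^+ 2.
have q0 : 0 < q by rewrite /q; have := sqr_ge0 y; have := exprn_gt0 2 x0; rewrite -/x; lra.
have w : - (a +i* b) / (1 - t%:C * (a +i* b)) = ((- a * x - b * y) / q) +i* (- b / q).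
  have z0 : 1 - t%:C * (a +i* b) != 0.
    by rewrite eq_complex /= negb_and; apply/orP; left; rewrite -/x gt_eqF//; move: x0; rewrite /x; lra.
  apply: (canLR (mulfK z0)); apply: complex_eq => /=; rewrite /q /x /y.
    by field; rewrite -/x -/y -/q gt_eqF.
  by field; rewrite -/x -/y -/q gt_eqF.
have dx : is_derive t (1:R) (fun t : R => 1 - t * a) (- a).
  by apply: is_derive_eq; rewrite -![_ *: _]/(_ * _); ring.
have dy : is_derive t (1:R) (fun t : R => - (t * b)) (- b).
  by apply: is_derive_eq; rewrite -![_ *: _]/(_ * _); ring.
have dq : is_derive t (1:R) (fun t : R => (1 - t * a) ^+ 2 + (- (t * b)) ^+ 2) (2 * (- a * x - b * y)).
  by apply: is_derive_eq; rewrite -![_ *: _]/(_ * _) /x /y; ring.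
have dL : is_derive t (1:R) (fun t : R => ln ((1 - t * a) ^+ 2 + (- (t * b)) ^+ 2)) (2 * ((- a * x - b * y) / q)).
  have h1 := @is_derive1_comp _ (@ln R) (fun t : R => (1 - t * a) ^+ 2 + (- (t * b)) ^+ 2) t _ _ (is_derive1_ln q0) dq.
  by apply: (is_derive_eq h1); ring.
have dV : is_derive t (1:R) (fun t : R => (1 - t * a)^-1) (a / x ^+ 2).
  have x1 : 1 - t * a != 0 by rewrite gt_eqF.
  have h1 := @is_deriveV R (fun u : R => 1 - u * a) t _ _ x1 dx.
  by apply: (is_derive_eq h1); rewrite -![_ *: _]/(_ * _) -/x; ring.
have dyx : is_derive t (1:R) (fun t : R => - (t * b) / (1 - t * a)) (- b / x ^+ 2).
  have h1 := is_deriveM dy dV.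
  apply: (is_derive_eq h1); rewrite -![_ *: _]/(_ * _) -/x -/y.
  by rewrite /y /x; field; rewrite gt_eqF.
have dA : is_derive t (1:R) (fun t : R => atan (- (t * b) / (1 - t * a))) (- b / q).
  have h1 := @is_derive1_comp _ (@atan R) (fun t : R => - (t * b) / (1 - t * a)) t _ _ (is_derive1_atan _) dyx.
  apply: (is_derive_eq h1); rewrite -/x -/y /q; field.
  by rewrite -/q !gt_eqF//; rewrite -/q.
rewrite w /cpow_ray /=.
set L := fun t : R => ln ((1 - t * a) ^+ 2 + (- (t * b)) ^+ 2).
set A := fun t : R => atan (- (t * b) / (1 - t * a)).
have hL : is_derive t (1:R) L (2 * ((- a * x - b * y) / q)) := dL.
have hA : is_derive t (1:R) A (- b / q) := dA.
have d1 : is_derive t (1:R) (fun t => expR (s / 2 * L t)) (s * ((- a * x - b * y) / q) * expR (s / 2 * L t)).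
  have hsL : is_derive t (1:R) (fun t => s / 2 * L t) (s * ((- a * x - b * y) / q)).
    by apply: is_derive_eq; rewrite -![_ *: _]/(_ * _); field; rewrite gt_eqF.
  have h1 := @is_derive1_comp _ (@expR R) (fun t => s / 2 * L t) t _ _ (is_derive_expR _) hsL.
  by apply: (is_derive_eq h1); rewrite mulrC.
have hsA : is_derive t (1:R) (fun t => s * A t) (s * (- b / q)).
  by apply: is_derive_eq; rewrite -![_ *: _]/(_ * _); ring.
have d2 : is_derive t (1:R) (fun t => cos (s * A t)) (- sin (s * A t) * (s * (- b / q))).
  exact: (@is_derive1_comp _ (@cos R) (fun t => s * A t) t _ _ (is_derive_cos _) hsA).
have d3 : is_derive t (1:R) (fun t => sin (s * A t)) (cos (s * A t) * (s * (- b / q))).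
  exact: (@is_derive1_comp _ (@sin R) (fun t => s * A t) t _ _ (is_derive_sin _) hsA).
have c1 := cder_real d1.
have c2 : cder (fun t => cos (s * A t) +i* sin (s * A t)) t
   ((- sin (s * A t) * (s * (- b / q))) +i* (cos (s * A t) * (s * (- b / q)))) by split.
apply: (cder_eq (cderM c1 c2)); rewrite -/(L t) -/(A t).
by apply: complex_eq => /=; ring.
Qed.

(** ** The binomial series *)

(** The ratio bound tends to [1], so it is at most [1 / r] from some index on. *)
Lemma subexp_ratio (a : nat -> R[i]) (c d : R) : 0 < c -> 0 <= d ->
  (forall n, cabs (a n.+1) * (n%:R + c) <= cabs (a n) * (n%:R + d)) -> subexp a.
Proof.
move=> c0 d0 h r /andP[r0 r1].
pose N := (Num.truncn (d * r / (1 - r))).+1.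
have hN n : (N <= n)%N -> (n%:R + d) * r <= n%:R + c.
  move=> Nn; have : d * r / (1 - r) < n%:R.
    by apply: (lt_le_trans (truncnS_gt _)); rewrite ler_nat.
  by rewrite ltr_pdivrMr; [nra | lra].
exists (\sum_(k < N.+1) cabs (a k)).
have h1 k : (k <= N)%N -> cabs (a k) * r ^+ k <= \sum_(k < N.+1) cabs (a k).
  move=> kN; rewrite (bigD1 (Ordinal (kN : (k < N.+1)%N))) //=.
  apply: (@le_trans _ _ (cabs (a k))).
    by rewrite ler_piMr ?cabs_ge0// exprn_ile1// ltW.
  by rewrite lerDl; apply: sumr_ge0 => i _; exact: cabs_ge0.
move=> k; have [kN|Nk] := leqP k N; first exact: h1.
rewrite -(subnK (ltnW Nk)); elim: (k - N)%N => [|j IH]; first by rewrite add0n; exact: h1.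
apply: le_trans IH; rewrite addSn; set n := (j + N)%N.
have n0 : 0 < n%:R + c by rewrite ltr_wpDl.
rewrite -(ler_pM2r n0).
have hn := hN n (leq_addl _ _); have hh := h n.
have rn : 0 <= r ^+ n by rewrite exprn_ge0// ltW.
have -> : cabs (a n.+1) * r ^+ n.+1 * (n%:R + c) = (cabs (a n.+1) * (n%:R + c)) * (r * r ^+ n).
  by rewrite exprS; ring.
apply: (@le_trans _ _ (cabs (a n) * (n%:R + d) * (r * r ^+ n))).
  by rewrite ler_wpM2r// mulr_ge0// ltW.
have -> : cabs (a n) * (n%:R + d) * (r * r ^+ n) = (cabs (a n) * r ^+ n) * ((n%:R + d) * r) by ring.
by rewrite ler_wpM2l// mulr_ge0// cabs_ge0.
Qed.

Lemma gbinom0 s : gbinom s 0 = 1.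
Proof. by rewrite /gbinom big_ord0 fact0 divr1. Qed.

Lemma gbinomS s n : n.+1%:R * gbinom s n.+1 = (s - n%:R) * gbinom s n.
Proof.
rewrite /gbinom big_ord_recr /= factS natrM.
have h1 : n.+1%:R != 0 :> R by rewrite pnatr_eq0.
have h2 : n`!%:R != 0 :> R by rewrite pnatr_eq0 -lt0n fact_gt0.
by move: h1 h2; move: n.+1%:R n`!%:R => X Y h1 h2; field; rewrite h1 h2.
Qed.

(** Coefficients of the power series of [(1 - x) ^ s]. *)
Definition binc s (n : nat) : R[i] := ((-1) ^+ n * gbinom s n)%:C.

Lemma bincS s n : n.+1%:R * binc s n.+1 = (n%:R - s)%:C * binc s n.
Proof.
rewrite /binc -(rmorph_nat (real_complex R)) -!rmorphM /=; congr (_%:C).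
by rewrite mulrCA gbinomS exprS; ring.
Qed.

Lemma subexp_binc s : subexp (binc s).
Proof.
apply: (@subexp_ratio _ 1 `|s|) => // n.
rewrite natr1 -(cabs_nat n.+1) mulrC -cabsM bincS cabsM mulrC ler_wpM2l ?cabs_ge0//.
by rewrite cabsR (le_trans (ler_normB _ _))// normr_nat.
Qed.

Lemma csum_shift (u : nat -> R[i]) : abs_summable u -> abs_summable (fun n => u n.+1) ->
  csum u = u 0%N + csum (fun n => u n.+1).
Proof.
move=> hu hs; apply: csum_unique => //.
have h := csum_cvg hs.
rewrite -cvg_shiftS /=.
apply: (squeeze0 _ h) => N; rewrite cabs_ge0 /= big_nat_recl//.
by rewrite opprD addrACA subrr add0r.
Qed.

Lemma subexp_shift (a : nat -> R[i]) : subexp a -> subexp (fun k => a k.+1).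
Proof.
move=> ha r hr; have [C hC] := ha r hr; have /andP[r0 r1] := hr.
exists (C / r) => k; rewrite ler_pdivlMr// -mulrA -exprSr; exact: hC.
Qed.

Lemma subexp_scale (a : nat -> R[i]) (b : nat -> R[i]) (C : R) : subexp a ->
  (forall k, cabs (b k) <= C * cabs (a k)) -> subexp b.
Proof.
move=> ha h r hr; have [K hK] := ha r hr; exists (`|C| * K) => k.
have r0 : 0 <= r ^+ k by rewrite exprn_ge0//; have /andP[/ltW] := hr.
apply: (le_trans (ler_wpM2r r0 (h k))); rewrite -mulrA.
apply: (@le_trans _ _ (`|C| * (cabs (a k) * r ^+ k))).
  by rewrite ler_wpM2r ?ler_norm// mulr_ge0// cabs_ge0.
by rewrite ler_wpM2l.
Qed.

Lemma pser0 (a : nat -> R[i]) : pser a 0 = a 0%N.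
Proof.
rewrite /pser (@csum_term _ _ 0%N) ?expr0 ?mulr1// => n n0.
by rewrite expr0n (negbTE n0) mulr0.
Qed.

Lemma pser_shift (a : nat -> R[i]) (z : R[i]) : subexp a -> cabs z < 1 ->
  pser a z = a 0%N + z * pser (fun k => a k.+1) z.
Proof.
move=> ha z1; rewrite /pser csum_shift ?expr0 ?mulr1; first last.
- have h := subexp_abs_summable (subexp_shift ha) z1.
  have h2 : cvgn (series (fun n => cabs z * cabs (a n.+1 * z ^+ n))) by exact: is_cvg_seriesZ.
  by apply: (abs_summable_le _ h2) => n; rewrite exprS mulrCA [cabs (z * _)]cabsM lexx.
- exact: subexp_abs_summable.
congr (_ + _); rewrite -csumZ; last exact: subexp_abs_summable (subexp_shift ha) z1.
by congr csum; apply/funext => n; rewrite exprS mulrCA.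
Qed.

Lemma pserD (a b : nat -> R[i]) (z : R[i]) (c : R[i]) : subexp a -> subexp b -> cabs z < 1 ->
  pser (fun k => a k - c * b k) z = pser a z - c * pser b z.
Proof.
move=> ha hb z1; have ua := subexp_abs_summable ha z1; have ub := subexp_abs_summable hb z1.
rewrite /pser -csumZ// -csumB//.
  by congr csum; apply/funext => n; rewrite mulrBl mulrA.
have h2 : cvgn (series (fun n => cabs c * cabs (b n * z ^+ n))) by exact: is_cvg_seriesZ.
by apply: (abs_summable_le _ h2) => n; rewrite cabsM.
Qed.

Lemma abs_summableS (u : nat -> R[i]) : abs_summable (fun n => u n.+1) -> abs_summable u.
Proof.
move=> hs; apply/cvg_ex; exists (cabs (u 0%N) + limn (series (fun n => cabs (u n.+1)))).
rewrite -cvg_shiftS /=.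
have -> : (fun n => series (fun n => cabs (u n)) n.+1) =
   (fun n => cabs (u 0%N) + series (fun n => cabs (u n.+1)) n).
  by apply/funext => n; rewrite /series /= big_nat_recl.
by apply: cvgD; [exact: cvg_cst | exact: hs].
Qed.

Lemma dpser_shift (a : nat -> R[i]) (z : R[i]) : subexp a -> cabs z < 1 ->
  dpser a z = pser (fun k => k.+1%:R * a k.+1) z.
Proof.
move=> ha z1; have hs := subexp_abs_summable (subexp_shift (subexp_natmul ha)) z1.
rewrite /dpser csum_shift ?mul0r ?add0r//.
exact: (@abs_summableS (fun k => k%:R * a k * z ^+ k.-1)).
Qed.

Lemma dpserE (a : nat -> R[i]) (z : R[i]) : subexp a -> cabs z < 1 ->
  z * dpser a z = pser (fun k => k%:R * a k) z.
Proof.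
move=> ha z1; rewrite dpser_shift// (pser_shift (subexp_natmul ha) z1).
by rewrite mul0r add0r.
Qed.

Lemma eq_pser (a b : nat -> R[i]) z : (forall k, a k = b k) -> pser a z = pser b z.
Proof. by move=> /funext ->. Qed.

Lemma binom_ode s z : cabs z < 1 ->
  (1 - z) * dpser (binc s) z = - s%:C * pser (binc s) z.
Proof.
move=> z1; have hb := subexp_binc s.
have E : dpser (binc s) z = z * dpser (binc s) z - s%:C * pser (binc s) z.
  rewrite {1}dpser_shift// dpserE// -pserD//; last exact: subexp_natmul.
  by apply: eq_pser => k; rewrite bincS rmorphB /= rmorph_nat mulrBl.
by rewrite mulrBl mul1r {1}E; ring.
Qed.

Lemma ray_lt1 xi t : cabs xi < 1 -> 0 <= t <= 1 -> cabs (t%:C * xi) < 1.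
Proof.
move=> x1 /andP[t0 t1]; rewrite cabsM cabsR ger0_norm//.
by apply: le_lt_trans x1; rewrite ler_piMl// cabs_ge0.
Qed.

Lemma one_minus_neq0 z : cabs z < 1 -> 1 - z != 0.
Proof. by move=> z1; rewrite subr_eq0; apply: contraTneq z1 => <-; rewrite cabs1 ltxx. Qed.

Lemma cpow_rayK xi s t : cpow_ray xi s t * cpow_ray xi (- s) t = 1.
Proof.
rewrite cpow_rayD subrr /cpow_ray !mul0r expR0 cos0 sin0.
by rewrite mul1r; apply: complex_eq.
Qed.

(** The product of the series with [(1 - t xi) ^ (- s)] has derivative zero along
    the ray. *)
Lemma binomial_ray s xi t : cabs xi < 1 -> 0 <= t <= 1 ->
  pser (binc s) (t%:C * xi) = cpow_ray xi s t.
Proof.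
move=> x1 /andP[t0 t1]; have hb := subexp_binc s.
have : pser (binc s) (0%:C * xi) * cpow_ray xi (- s) 0 = pser (binc s) (t%:C * xi) * cpow_ray xi (- s) t.
  apply: (@cder0_seg _ (fun t => pser (binc s) (t%:C * xi) * cpow_ray xi (- s) t) 0 t t0) => u /andP[u0 ut].
  have u1 : cabs (u%:C * xi) < 1 by apply: ray_lt1 => //; rewrite u0 (le_trans ut).
  apply: (cder_eq (cderM (cder_pser hb u1) (cder_cpow_ray (- s) u1))).
  have z0 := one_minus_neq0 u1; have E := binom_ode s u1.
  apply: (mulfI z0); rewrite mulr0.
  transitivity (xi * cpow_ray xi (- s) u * ((1 - u%:C * xi) * dpser (binc s) (u%:C * xi)
     + s%:C * pser (binc s) (u%:C * xi))).
    by rewrite rmorphN /=; field.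
  by rewrite E; ring.
rewrite rmorph0 mul0r pser0 /binc expr0 gbinom0 mul1r cpow_ray0 mulr1 => /(congr1 (fun w => w * cpow_ray xi s t)).
by rewrite mul1r -mulrA [cpow_ray xi (- s) t * _]mulrC cpow_rayK mulr1 => ->.
Qed.

Lemma cpow_ray1 xi t : cabs xi < 1 -> 0 <= t <= 1 -> cpow_ray xi 1 t = 1 - t%:C * xi.
Proof.
move=> x1 /andP[t0 t1].
have : (1 - 0%:C * xi) * cpow_ray xi (- 1) 0 = (1 - t%:C * xi) * cpow_ray xi (- 1) t.
  apply: (@cder0_seg _ (fun t => (1 - t%:C * xi) * cpow_ray xi (- 1) t) 0 t t0) => u /andP[u0 ut].
  have u1 : cabs (u%:C * xi) < 1 by apply: ray_lt1 => //; rewrite u0 (le_trans ut).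
  have dl : cder (fun t => 1 - t%:C * xi) u (- xi).
    case: (xi) => a b; split.
      have -> : (fun x => complex.Re (1 - x%:C * (a +i* b))) = (fun x => 1 - x * a).
        by apply/funext => x /=; ring.
      by apply: is_derive_eq; rewrite -![_ *: _]/(_ * _) /=; ring.
    have -> : (fun x => complex.Im (1 - x%:C * (a +i* b))) = (fun x => - (x * b)).
      by apply/funext => x /=; ring.
    by apply: is_derive_eq; rewrite -![_ *: _]/(_ * _) /=; ring.
  apply: (cder_eq (cderM dl (cder_cpow_ray (- 1) u1))).
  by have z0 := one_minus_neq0 u1; rewrite rmorphN rmorph1 /=; field.
rewrite rmorph0 mul0r subr0 cpow_ray0 mulr1 => /(congr1 (fun w => w * cpow_ray xi 1 t)).
by rewrite mul1r -mulrA [cpow_ray xi (- 1) t * _]mulrC cpow_rayK mulr1 => ->.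
Qed.

(** ** The kernel as a power series *)

(** The function [t ^ b0 f(t)] is constant on [0 < t <= 1], and it is [O(t ^ (b0 + 1))]
    at the origin, where [f] is differentiable. *)
Lemma euler_ode0 (f : R -> R) (f' : R -> R) (l b0 : R) : -1 < b0 -> f 0 = 0 ->
  is_derive 0 (1 : R) f l ->
  (forall t, 0 < t <= 1 -> is_derive t (1 : R) f (f' t) /\ t * f' t + b0 * f t = 0) -> f 1 = 0.
Proof.
move=> b1 f00 df0 df.
have const e : 0 < e <= 1 -> f 1 = e `^ b0 * f e.
  move=> /andP[e0 e1].
  suff -> : e `^ b0 * f e = 1 `^ b0 * f 1 by rewrite powR1 mul1r.
  apply: (@derive0_seg _ (fun t => t `^ b0 * f t) e 1 e1) => t /andP[et t1]; have t0 : 0 < t by exact: lt_le_trans et.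
  have /df [d E] : 0 < t <= 1 by rewrite t0.
  have hp : is_derive t (1:R) (@powR R ^~ b0) (b0 * t `^ (b0 - 1)) by exact: is_derive1_powR.
  have h1 := is_deriveM hp d.
  apply: (is_derive_eq h1); rewrite -![_ *: _]/(_ * _).
  have -> : t `^ b0 = t `^ (b0 - 1) * t.
    by rewrite -[X in _ = _ * X](powRr1 (ltW t0)) -powRD ?subrK// (gt_eqF t0) implybT.
  rewrite (_ : _ + _ = t `^ (b0 - 1) * (t * f' t + b0 * f t)); last by ring.
  by rewrite E mulr0.
have lim1 : (fun e : R => e `^ (b0 + 1) * (e^-1 * (f e - f 0))) @ 0^'+ --> (0 * l : R).
  apply: cvgM; first by apply: powR_cvg0; lra.
  have [/cvg_ex[l' hl'] hl] := df0.
  have ll' : l' = l by rewrite -hl; apply/esym/cvg_lim => //; exact: Rhausdorff.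
  rewrite ll' in hl'.
  have hr : (fun h : R => h^-1 *: ((f \o shift 0) (h *: (1 : R)) - f 0)) @ 0^'+ --> l.
    have sub : (0 : R)^'+ --> (0 : R)^'.
      by move=> A [e e0 hA]; exists e => // x xe x0; apply: hA => //; rewrite gt_eqF.
    exact: (cvg_comp _ _ sub hl').
  apply: cvg_trans hr; apply: near_eq_cvg; near=> h.
  by rewrite /= -[_ *: (_ - _)]/(_ * _) -[h *: 1]/(h * 1) mulr1 addr0.
rewrite mul0r in lim1.
have lim2 : (fun e : R => e `^ (b0 + 1) * (e^-1 * (f e - f 0))) @ 0^'+ --> f 1.
  apply: (@cvg_trans _ ((fun _ : R => f 1) @ 0^'+)); last exact: cvg_cst.
  apply: near_eq_cvg; near=> e.
  have e0 : 0 < e by near: e; exact: nbhs_right_gt.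
  have e1 : e <= 1 by near: e; apply: nbhs_right_le.
  rewrite (const e) ?e0// f00 subr0 powRD ?(gt_eqF e0) ?implybT// powRr1 ?(ltW e0)//.
  by rewrite mulrA -(mulrA (e `^ b0)) mulfV ?mulr1// gt_eqF.
exact: (cvg_unique (@Rhausdorff R) lim2 lim1).
Unshelve. all: by end_near. Qed.

(** A quotient of Pochhammer symbols, [(a + b0 + 2)_n / (b0 + 1)_n]. *)
Definition hcoef (a b0 : R) (n : nat) : R :=
  \prod_(i < n) ((i%:R + a + b0 + 2) / (i%:R + 1 + b0)).

Lemma hcoefS (a b0 : R) n : -1 < b0 ->
  (n%:R + 1 + b0) * hcoef a b0 n.+1 = (n%:R + a + b0 + 2) * hcoef a b0 n.
Proof.
move=> b1; rewrite /hcoef big_ord_recr /=; field.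
by rewrite gt_eqF//; have := ler0n R n; lra.
Qed.

Lemma hcoef_gt0 (a b0 : R) n : -1 < a -> -1 < b0 -> 0 < hcoef a b0 n.
Proof.
move=> a1 b1; apply: prodr_gt0 => i _; have := ler0n R i => i0.
by rewrite divr_gt0//; lra.
Qed.

Lemma subexp_hcoef (a b0 : R) : -1 < a -> -1 < b0 -> subexp (fun n => (hcoef a b0 n)%:C).
Proof.
move=> a1 b1; apply: (@subexp_ratio _ (1 + b0) (a + b0 + 2)); [lra|lra|move=> n].
rewrite !cabsR !gtr0_norm ?hcoef_gt0// mulrC addrA hcoefS// mulrC.
by rewrite -!addrA.
Qed.

End Cpow.

Section KernelSeries.
Context {R : realType}.
Variables (a b0 : R).
Hypotheses (a1 : -1 < a) (b1 : -1 < b0) (b00 : b0 <= 0).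
Implicit Types (z xi : R[i]).

Local Notation h := (fun n : nat => (hcoef a b0 n)%:C : R[i]).

(** Coefficients of the series that defines [Q]. *)
Definition qcoef (n : nat) : R[i] := b0%:C / (n%:R + b0%:C) * binc (a + 1) n.

Let denom_neq0 (n : nat) : b0 != 0 -> n%:R + b0 != 0.
Proof.
case: n => [|n] h0; first by rewrite add0r.
by move: b1 => b1'; rewrite gt_eqF// -(natr1 n); have := ler0n R n; lra.
Qed.

Let qcoefE n : b0 != 0 -> (n%:R + b0%:C) * qcoef n = b0%:C * binc (a + 1) n.
Proof.
move=> h0; rewrite /qcoef mulrA mulrCA mulfV ?mulr1//.
rewrite -(rmorph_nat (real_complex R)) -rmorphD /=.
by rewrite -(rmorph0 (real_complex R)) (inj_eq (@complexI R)) denom_neq0.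
Qed.

Lemma qcoef_le : b0 != 0 -> exists2 K : R, 0 <= K & forall n, cabs (qcoef n) <= K * cabs (binc (a + 1) n).
Proof.
have b1' : 0 < 1 + b0 by move: b1 => ?; lra.
move=> h0; exists (1 + `|b0| / (1 + b0)).
  by rewrite addr_ge0// divr_ge0// ltW.
move=> n; rewrite /qcoef cabsM ler_wpM2r ?cabs_ge0//.
rewrite -(rmorph_nat (real_complex R)) -rmorphD /= cabsM cabsV !cabsR.
case: n => [|n].
  by rewrite add0r mulfV ?normr_eq0// lerDl divr_ge0// ltW.
apply: ler_wpDl => //; rewrite ler_wpM2l// lef_pV2 ?posrE//.
  by move: b1 => b2; rewrite ger0_norm -(natr1 n); have := ler0n R n; lra.
by rewrite normr_gt0 denom_neq0.
Qed.

Lemma subexp_qcoef : b0 != 0 -> subexp qcoef.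
Proof. by move=> /qcoef_le[K _ hK]; apply: (subexp_scale (subexp_binc (a + 1)) hK). Qed.

Lemma h_ode z : cabs z < 1 ->
  (1 - z) * (z * dpser h z + b0%:C * pser h z) = b0%:C + (a + 2)%:C * (z * pser h z).
Proof.
move=> z1; have hh := subexp_hcoef a1 b1.
rewrite dpserE//; set u := fun k => k%:R * h k - (- b0%:C) * h k.
have -> : pser (fun k => k%:R * h k) z + b0%:C * pser h z = pser u z.
  by rewrite pserD//; [ring | exact: subexp_natmul].
have su : subexp u.
  move=> r hr; have [C hC] := subexp_natmul hh hr; have [C' hC'] := hh r hr.
  exists (C + `|b0| * C') => k.
  have r0 : 0 <= r ^+ k by rewrite exprn_ge0//; have /andP[/ltW] := hr.
  apply: (le_trans (ler_wpM2r r0 (cabsD _ _))); rewrite mulrDl lerD//.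
  by rewrite cabsN cabsM cabsN (cabsR b0) -mulrA; apply: ler_wpM2l => //; exact: hC'.
have E : pser u z = b0%:C + z * (pser u z + (a + 2)%:C * pser h z).
  rewrite {1}pser_shift//; congr (_ + z * _).
    by rewrite /u /hcoef big_ord0 rmorph1; ring.
  have -> : pser u z + (a + 2)%:C * pser h z = pser u z - (- (a + 2)%:C) * pser h z by ring.
  rewrite -pserD//; apply: eq_pser => k; rewrite /u.
  have -> : k.+1%:R * (hcoef a b0 k.+1)%:C - - b0%:C * (hcoef a b0 k.+1)%:C =
     ((k%:R + 1 + b0) * hcoef a b0 k.+1)%:C :> R[i].
    by rewrite !rmorphM !rmorphD /= rmorph_nat rmorph1 -natr1; ring.
  rewrite hcoefS// !rmorphM !rmorphD /= !rmorph_nat; ring.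
by rewrite {1}mulrBl mul1r {1}E; ring.
Qed.

Lemma q_ode z : b0 != 0 -> cabs z < 1 ->
  z * dpser qcoef z + b0%:C * pser qcoef z = b0%:C * pser (binc (a + 1)) z.
Proof.
move=> h0 z1; have sq := subexp_qcoef h0; rewrite dpserE//.
have -> : pser (fun k => k%:R * qcoef k) z + b0%:C * pser qcoef z =
   pser (fun k => k%:R * qcoef k - (- b0%:C) * qcoef k) z.
  by rewrite pserD//; [ring | exact: subexp_natmul].
rewrite -[RHS]csumZ; last exact: subexp_abs_summable (subexp_binc _) z1.
congr csum; apply/funext => k; rewrite mulrA -qcoefE//; ring.
Qed.

(** Multiplying the rational recursion of [h] by [(1 - z) ^ (a + 2)] gives [q]:
    both sides solve the same Euler equation along each ray. *)
Lemma kernel_seriesN xi : b0 != 0 -> cabs xi < 1 ->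
  pser h xi * cpow (1 - xi) (a + 2) = pser qcoef xi.
Proof.
move=> h0 x1; have hh := subexp_hcoef a1 b1; have sq := subexp_qcoef h0.
pose D t := pser h (t%:C * xi) * cpow_ray xi (a + 2) t - pser qcoef (t%:C * xi).
pose D' t := dpser h (t%:C * xi) * xi * cpow_ray xi (a + 2) t +
   pser h (t%:C * xi) * ((a + 2)%:C * (- xi / (1 - t%:C * xi)) * cpow_ray xi (a + 2) t)
   - dpser qcoef (t%:C * xi) * xi.
have dD t : 0 <= t <= 1 -> cder D t (D' t).
  move=> ht; have u1 := ray_lt1 x1 ht.
  by apply: cderB; [apply: cderM; [exact: cder_pser | exact: cder_cpow_ray] | exact: cder_pser].
have D0 : D 0 = 0.
  rewrite /D rmorph0 mul0r !pser0 cpow_ray0 mulr1 /hcoef big_ord0 /qcoef.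
  rewrite /binc expr0 gbinom0 mul1r add0r mulr1 mulfV ?subrr//.
  by rewrite -(rmorph0 (real_complex R)) (inj_eq (@complexI R)).
have ode t : 0 <= t <= 1 -> t%:C * D' t + b0%:C * D t = 0.
  move=> ht; have u1 := ray_lt1 x1 ht; have z0 := one_minus_neq0 u1.
  have Eh := h_ode u1; have Eq := q_ode h0 u1.
  have Eb := binomial_ray (a + 1) x1 ht.
  have EG : cpow_ray xi (a + 2) t = (1 - t%:C * xi) * cpow_ray xi (a + 1) t.
    rewrite -(cpow_ray1 x1 ht) cpow_rayD; congr (cpow_ray xi _ t); ring.
  have -> : t%:C * D' t + b0%:C * D t =
    cpow_ray xi (a + 2) t * (t%:C * xi * dpser h (t%:C * xi) + b0%:C * pser h (t%:C * xi))
    - (a + 2)%:C * (t%:C * xi / (1 - t%:C * xi)) * cpow_ray xi (a + 2) t * pser h (t%:C * xi)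
    - (t%:C * xi * dpser qcoef (t%:C * xi) + b0%:C * pser qcoef (t%:C * xi)).
    by rewrite /D /D'; ring.
  rewrite Eq Eb EG.
  have -> : (1 - t%:C * xi) * cpow_ray xi (a + 1) t *
     (t%:C * xi * dpser h (t%:C * xi) + b0%:C * pser h (t%:C * xi)) =
     cpow_ray xi (a + 1) t * ((1 - t%:C * xi) *
     (t%:C * xi * dpser h (t%:C * xi) + b0%:C * pser h (t%:C * xi))) by ring.
  rewrite Eh; by field.
have z01 : 0 <= (0:R) <= 1 by rewrite lexx ler01.
have D1 : D 1 = 0.
  apply: complex_eq.
    apply: (@euler_ode0 _ (fun t => complex.Re (D t)) (fun t => complex.Re (D' t)) (complex.Re (D' 0)) b0 b1).
    - by rewrite D0.
    - by have [] := dD 0 z01.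
    - move=> t /andP[t0 t1]; have ht : 0 <= t <= 1 by rewrite ltW.
      split; first by have [] := dD t ht.
      by have := congr1 (@complex.Re R) (ode t ht); rewrite ReD !ReM /= !mul0r !subr0.
  apply: (@euler_ode0 _ (fun t => complex.Im (D t)) (fun t => complex.Im (D' t)) (complex.Im (D' 0)) b0 b1).
  - by rewrite D0.
  - by have [] := dD 0 z01.
  - move=> t /andP[t0 t1]; have ht : 0 <= t <= 1 by rewrite ltW.
    split; first by have [] := dD t ht.
    by have := congr1 (@complex.Im R) (ode t ht); rewrite ImD !ImM /= !mul0r !addr0.
have h1 : 0 <= (1:R) <= 1 by rewrite ler01 lexx.
have u1 := ray_lt1 x1 h1.
move: D1; rewrite /D -cpow_rayE// rmorph1 mul1r => /eqP; rewrite subr_eq0 => /eqP.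
by [].
Qed.

End KernelSeries.

Section KernelSeries0.
Context {R : realType}.

(** For [b0 = 0] the coefficients are those of [(1 - x) ^ (- (a + 2))]. *)
Lemma kernel_series0 (a : R) (xi : R[i]) : -1 < a -> cabs xi < 1 ->
  pser (fun n => (hcoef a 0 n)%:C) xi * cpow (1 - xi) (a + 2) = 1.
Proof.
move=> a1 x1; have -> : pser (fun n => (hcoef a 0 n)%:C) xi = pser (binc (- (a + 2))) xi.
  apply: eq_pser; elim=> [|n IH]; first by rewrite /hcoef big_ord0 /binc expr0 gbinom0 mul1r.
  have n0 : n.+1%:R != 0 :> R[i] by rewrite pnatr_eq0.
  apply: (mulfI n0); rewrite bincS -IH -(rmorph_nat (real_complex R)) -!rmorphM /=; congr (_%:C).
  have := @hcoefS R a 0 n (ltrN10 R); rewrite !addr0 natr1 => ->.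
  by congr (_ * _); ring.
have h1 : 0 <= (1:R) <= 1 by rewrite ler01 lexx.
have u1 := ray_lt1 x1 h1.
have := binomial_ray (- (a + 2)) x1 h1; rewrite rmorph1 mul1r => ->.
have := cpow_rayE (a + 2) u1; rewrite rmorph1 mul1r => ->.
by rewrite mulrC cpow_rayK.
Qed.

(** The coefficients of [(1 - z) ^ s] are summable for [s > 0]: with
    [c_n] their moduli, [s * c_n = n * c_n - (n + 1) * c_(n + 1)] once [n >= s]. *)
Lemma binc_summable (s : R) : 0 < s -> cvgn (series (fun n => cabs (binc s n))).
Proof.
move=> s0; pose c n := cabs (binc s n).
pose N := (Num.truncn s).+1.
have tel n : (N <= n)%N -> s * c n = n%:R * c n - n.+1%:R * c n.+1.
  move=> Nn; have sn : s < n%:R by apply: (lt_le_trans (truncnS_gt _)); rewrite ler_nat.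
  rewrite /c -(cabs_nat n.+1) -cabsM bincS cabsM cabsR ger0_norm; last by lra.
  by ring.
have bound n : \sum_(N <= k < N + n) s * c k <= N%:R * c N.
  suff : \sum_(N <= k < N + n) s * c k = N%:R * c N - (N + n)%:R * c (N + n)%N.
    by move=> ->; rewrite gerBl mulr_ge0// cabs_ge0.
  elim: n => [|n IH]; first by rewrite addn0 big_geq// subrr.
  rewrite addnS big_nat_recr ?leq_addr//= IH tel ?leq_addr//; ring.
apply: nondecreasing_is_cvgn; first by apply: nondecreasing_series => n _ _; exact: cabs_ge0.
exists (\sum_(0 <= k < N) c k + N%:R * c N / s) => _ [n _ <-].
apply: (@le_trans _ _ (series c (N + n)%N)).
  by apply: nondecreasing_series => [k _ _|]; [exact: cabs_ge0 | exact: leq_addl].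
rewrite /series /= (@big_cat_nat _ _ _ N) ?leq_addr//= lerD2l ler_pdivlMr// mulrC.
by rewrite big_distrr /=; exact: bound.
Qed.

End KernelSeries0.

(** * Forelli-Rudin estimates and the Schur test *)
Section ForelliRudin.
Context {R : realType}.
Notation leb := (@lebesgue_measure R).
Notation area := (@lebesgue_measure R \x @lebesgue_measure R)%E.
Implicit Types (x y t u r : R) (z w : R * R).

Lemma powR_anti (x y e : R) : 0 < x -> x <= y -> 0 <= e -> y `^ (- e) <= x `^ (- e).
Proof.
move=> x0 xy e0; have y0 : 0 < y by exact: lt_le_trans xy.
rewrite !powRN lef_pV2 ?posrE ?powR_gt0//.
by rewrite ge0_ler_powR// nnegrE ltW.
Qed.

Lemma powR_sqr (x e : R) : 0 <= x -> (x ^+ 2) `^ e = x `^ (2 * e).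
Proof. by move=> x0; rewrite powRrM -(powR_mulrn 2 x0). Qed.

Lemma powR_le_two (s v : R) : 1 <= v <= 2 -> v `^ s <= 1 + 2 `^ s.
Proof.
move=> /andP[v1 v2]; have [s0|s0] := leP 0 s.
  apply: (@le_trans _ _ (2 `^ s)); last by rewrite lerDr.
  by rewrite ge0_ler_powR// ?nnegrE; lra.
apply: (@le_trans _ _ (1 `^ s)); last by rewrite powR1 lerDl powR_ge0.
by rewrite -[s]opprK; apply: powR_anti => //; lra.
Qed.

Lemma powR_quarter_le (c q : R) : 4^-1 <= q <= 1 -> q `^ c <= 1 + 4^-1 `^ c.
Proof.
move=> /andP[q1 q2]; have [c0|c0] := leP 0 c.
  apply: (@le_trans _ _ (1 `^ c)); first by rewrite ge0_ler_powR// ?nnegrE; lra.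
  by rewrite powR1 lerDl powR_ge0.
apply: (@le_trans _ _ (4^-1 `^ c)); last by rewrite lerDr.
by rewrite -[c]opprK; apply: powR_anti => //; lra.
Qed.

(** [u ^ s * (d + u) ^ - (s + 1 + eta)] over the half line, up to a constant. *)
Lemma integral_cusp (s eta d : R) : -1 < s -> 0 < eta -> 0 < d ->
  (\int[leb]_u ((0 < u)%R%:R * (u `^ s * (d + u) `^ (- (s + 1 + eta))))%:E
    <= (((s + 1)^-1 + eta^-1) * d `^ (- eta))%:E)%E.
Proof.
move=> s1 eta0 d0; set A := s + 1 + eta.
have A0 : 0 < A by rewrite /A; lra.
pose g1 u : \bar R := ((0 < u < d)%R%:R * u `^ s)%:E.
pose g2 u : \bar R := ((d <= u)%R%:R * u `^ (s - A))%:E.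
have mg1 : measurable_fun setT g1 by apply/measurable_EFinP; mfun.
have mg2 : measurable_fun setT g2 by apply/measurable_EFinP; mfun.
have g10 u : (0 <= g1 u)%E by rewrite lee_fin mulr_ge0// powR_ge0.
have g20 u : (0 <= g2 u)%E by rewrite lee_fin mulr_ge0// powR_ge0.
have mg1' : measurable_fun setT (fun u => (d `^ (- A))%:E * g1 u)%E.
  by apply: measurable_funeM.
have p0 := powR_ge0 d (- A).
apply: (@le_trans _ _ (\int[leb]_u ((d `^ (- A))%:E * g1 u + g2 u))%E).
  apply: leb_le_integral.
  - by apply/measurable_EFinP; mfun.
  - by move=> u; rewrite lee_fin !mulr_ge0// powR_ge0.
  - by apply: emeasurable_funD.
  move=> u; rewrite /g1 /g2 -EFinM -EFinD lee_fin.
  have [u0|u0] := ltP 0 u; last by rewrite mul0r addr_ge0// ?mulr_ge0// powR_ge0.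
  rewrite mul1r; have [ud|du] := ltP u d.
    rewrite /= mul1r mul0r addr0 mulrC ler_wpM2r ?powR_ge0//.
    by apply: powR_anti; lra.
  rewrite /= mul0r mulr0 add0r mul1r powRD ?(gt_eqF u0) ?implybT//.
  by rewrite ler_wpM2l ?powR_ge0//; apply: powR_anti; lra.
have g1p u : (0 <= (d `^ (- A))%:E * g1 u)%E by rewrite mule_ge0// lee_fin.
rewrite (leb_integralD mg1' g1p mg2 g20) (leb_integralZl p0 mg1 g10).
rewrite integral_powR0_gate// -EFinM mulrDl EFinD; apply: leeD.
  rewrite lee_fin mulrA [leRHS]mulrC ler_pM2r ?invr_gt0; last by lra.
  by rewrite -powRD ?(gt_eqF d0) ?implybT// le_eqVlt; apply/orP; left; apply/eqP; congr (_ `^ _); rewrite /A; ring.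
have -> : (\int[leb]_u g2 u = \int[leb]_(u in `[d, +oo[) (u `^ (s - A))%:E)%E.
  by rewrite [RHS]integral_gate; apply: eq_integral => u _; rewrite mem_setE in_itv /= andbT.
apply: (le_trans (integral_powRy _ d0)); first by rewrite /A; lra.
rewrite lee_fin mulrC (_ : - (s - A + 1) = eta); last by rewrite /A; ring.
by rewrite (_ : s - A + 1 = - eta); last by rewrite /A; ring.
Qed.

Lemma integral_shifted_tail (eta d : R) : 0 < eta -> 0 < d ->
  (\int[leb]_y ((0 <= y)%R%:R * (d + y) `^ (- (1 + eta)))%:E <= (eta^-1 * d `^ (- eta))%:E)%E.
Proof.
move=> eta0 d0.
have mg : measurable_fun setT (fun u : R => ((d <= u)%R%:R * u `^ (- (1 + eta)))%:E).
  by apply/measurable_EFinP; mfun.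
have := integral_shift d mg (fun u => mulr_ge0 (ler0n R _) (powR_ge0 _ _)).
have -> : (\int[leb]_x ((d <= x + d)%R%:R * (x + d) `^ (- (1 + eta)))%:E =
   \int[leb]_y ((0 <= y)%R%:R * (d + y) `^ (- (1 + eta)))%:E)%E.
  by apply: eq_integral => y _; rewrite addrC lerDl.
move=> ->.
have -> : (\int[leb]_x ((d <= x)%R%:R * x `^ (- (1 + eta)))%:E = \int[leb]_(u in `[d, +oo[) (u `^ (- (1 + eta)))%:E)%E.
  by rewrite [RHS]integral_gate; apply: eq_integral => u _; rewrite mem_setE in_itv /= andbT.
apply: (le_trans (integral_powRy _ d0)); first by lra.
rewrite lee_fin mulrC (_ : - (- (1 + eta) + 1) = eta); last by ring.
by rewrite (_ : - (1 + eta) + 1 = - eta); last by ring.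
Qed.

Lemma integral_abs_tail (eta d : R) : 0 < eta -> 0 < d ->
  (\int[leb]_y ((d + `|y|) `^ (- (1 + eta)))%:E <= (2 * (eta^-1 * d `^ (- eta)))%:E)%E.
Proof.
move=> eta0 d0; have H := integral_shifted_tail eta0 d0.
pose g y : \bar R := ((0 <= y)%R%:R * (d + y) `^ (- (1 + eta)))%:E.
have mg : measurable_fun setT g by apply/measurable_EFinP; mfun.
have g0 y : (0 <= g y)%E by rewrite lee_fin mulr_ge0// powR_ge0.
have mgN : measurable_fun setT (fun y => g (- y)).
  by apply: (measurableT_comp mg); exact: oppr_measurable.
apply: (@le_trans _ _ (\int[leb]_y (g y + g (- y)%R))%E).
  apply: leb_le_integral.
  - apply/measurable_EFinP; apply: measurable_powR_comp.
    by apply: measurable_funD; [exact: measurable_cst | exact: normr_measurable].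
  - by move=> y; rewrite lee_fin powR_ge0.
  - exact: emeasurable_funD.
  move=> y; rewrite /g -EFinD lee_fin; have [y0|y0] := leP 0 y.
    by rewrite (ger0_norm y0) mul1r lerDl mulr_ge0// powR_ge0.
  rewrite (ltr0_norm y0).
  have -> : (0 <= - y)%R by rewrite oppr_ge0 ltW.
  by rewrite mul0r add0r mul1r.
rewrite (leb_integralD mg g0 mgN (fun y => g0 _)) (integral_opp mg g0).
by rewrite mulr_natl mulr2n EFinD; apply: leeD.
Qed.

(** The quantity [|1 - r z| ^ 2] in real coordinates. *)
Definition ray_dist r z : R := (1 - r * z.1) ^+ 2 + (r * z.2) ^+ 2.

Lemma integrable_weight (c s : R) : c < 1 -> -1 < s ->
  exists2 K : R, 0 <= K &
  (\int[area]_z ((sqnorm z < 1)%R%:R * (sqnorm z `^ (- c) * (1 - sqnorm z) `^ s))%:E <= K%:E)%E.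
Proof.
move=> c1 s1.
have c2 : -1 < - c by lra.
have bfin : betaint (- c) s \is a fin_num.
  by rewrite ge0_fin_numE ?betaint_ge0// betaint_lty.
have dfin : @disc_area R \is a fin_num.
  by rewrite ge0_fin_numE ?disc_area_lty// ltW// disc_area_gt0.
exists (fine (@disc_area R) * fine (betaint (- c) s)).
  by rewrite mulr_ge0// fine_ge0// ?betaint_ge0// ltW// disc_area_gt0.
have mg : measurable_fun setT (fun t : R => ((t < 1)%R%:R * (t `^ (- c) * (1 - t) `^ s))%:E).
  by apply/measurable_EFinP; mfun.
rewrite (integral_radial mg); last by move=> t; rewrite lee_fin !mulr_ge0// powR_ge0.
rewrite EFinM !fineK//; apply: lee_wpmul2l; first by rewrite ltW// disc_area_gt0.
have mg0 : measurable_fun (`]0, +oo[%classic : set R) (fun t : R => ((t < 1)%R%:R * (t `^ (- c) * (1 - t) `^ s))%:E).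
  exact: measurable_funTS.
rewrite -(@integral_itv_obnd_cbnd R 0 +oo%O _ mg0) betaintE integral_gate.
rewrite le_eqVlt; apply/orP; left; apply/eqP.
apply: eq_integral => t _; rewrite mem_setE in_itv /= andbT mulrA -natrM mulnb.
by [].
Qed.

Lemma ray_distE r z : ray_dist r z = cabs (1 - r%:C * plane z) ^+ 2.
Proof. by rewrite cabs_sqr /ray_dist /plane /=; ring. Qed.

Lemma powR_split (V u v k A B : R) : 0 < k -> 0 < u -> 0 < v -> k * u <= V -> k * v <= V ->
  0 <= A -> 0 <= B -> V `^ (- (A + B)) <= k `^ (- (A + B)) * (v `^ (- B) * u `^ (- A)).
Proof.
move=> k0 u0 v0 ku kv A0 B0; have ku0 := mulr_gt0 k0 u0; have kv0 := mulr_gt0 k0 v0.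
have V0 := lt_le_trans ku0 ku.
have pD x : 0 < x -> x `^ (- (A + B)) = x `^ (- A) * x `^ (- B).
  by move=> x0; rewrite opprD powRD// (gt_eqF x0) implybT.
rewrite (pD V V0) (pD k k0).
have -> : k `^ (- A) * k `^ (- B) * (v `^ (- B) * u `^ (- A)) = (k * u) `^ (- A) * (k * v) `^ (- B).
  by rewrite (powRM _ (ltW k0) (ltW u0)) (powRM _ (ltW k0) (ltW v0)); ring.
by apply: ler_pM; rewrite ?powR_ge0//; exact: powR_anti.
Qed.

(** Near the boundary point [1]: [X] is the abscissa of the arc at height [y], and [V]
    stands for the modulus of the denominator of the kernel. *)
Lemma arc_facts (x y d V X : R) : 0 <= X -> X ^+ 2 = 1 - y ^+ 2 -> x ^+ 2 + y ^+ 2 < 1 -> V < 4^-1 ->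
  d <= V -> 1 - x <= 2 * V -> `|y| <= 2 * V ->
  [/\ 0 < X - x, 3^-1 * (d + (X - x)) <= V, 3^-1 * (d + `|y|) <= V, 4^-1 <= x ^+ 2 + y ^+ 2 &
      1 <= X + x <= 2].
Proof.
move=> X0 X2 xy hB Vd Vx Vy; have y2 := sqr_ge0 y.
have xh : 2^-1 < x by lra.
have yh2 : y ^+ 2 < 4^-1 by rewrite -real_normK ?num_real//; have := normr_ge0 y; nra.
have Xx : x < X by nra.
have X1 : X <= 1 by nra.
by split; [lra | lra | lra | nra | apply/andP; split; lra].
Qed.

(** The pointwise bound behind [forelli_rudin_real]: away from the boundary
    point [1] the kernel is bounded; near it, [X - x] is the horizontal distance
    to the circle and the kernel is split as a product in [X - x] and [y]. *)
Lemma forelli_rudin_pointwise (a c s r x y eta d X : R) : -1 < s -> s < a -> 0 <= r < 1 ->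
  eta = (a - s) / 2 -> d = 1 - r -> X = (1 - y ^+ 2) `^ 2^-1 ->
  (sqnorm (x, y) < 1)%R%:R * (sqnorm (x, y) `^ (- c) * (1 - sqnorm (x, y)) `^ s * ray_dist r (x, y) `^ (- (1 + a / 2))) <=
  4^-1 `^ (- (2 + a)) * ((sqnorm (x, y) < 1)%R%:R * (sqnorm (x, y) `^ (- c) * (1 - sqnorm (x, y)) `^ s))
  + (1 + 4^-1 `^ (- c)) * (1 + 2 `^ s) * 3^-1 `^ (- (2 + a)) *
    ((d + `|y|) `^ (- (1 + eta)) * ((0 < X - x)%R%:R * ((X - x) `^ s * (d + (X - x)) `^ (- (s + 1 + eta))))).
Proof.
move=> s1 sa /andP[r0 r1] etaE dE XE.
have eta0 : 0 < eta by lra.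
have d0 : 0 < d by lra.
set T1 := _ * (_ * (_ * _)) in |- *; set T2 := _ * _ * _ * _.
have T10 : 0 <= 4^-1 `^ (- (2 + a)) * ((sqnorm (x, y) < 1)%R%:R * (sqnorm (x, y) `^ (- c) * (1 - sqnorm (x, y)) `^ s)).
  by rewrite !mulr_ge0// ?powR_ge0.
have T20 : 0 <= T2 by rewrite /T2 !mulr_ge0// ?addr_ge0// powR_ge0.
rewrite /T1 {T1}.
have [q1|q1] := ltP (sqnorm (x, y)) 1; last first.
  by move: T10; rewrite ltNge q1 /= !mul0r mulr0 add0r.
move: T10; rewrite q1 !mul1r => T10.
have xy1 : x ^+ 2 + y ^+ 2 < 1 := q1.
have x2 := sqr_ge0 x; have y2 := sqr_ge0 y.
have x1 : x < 1 by nra.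
set q := sqnorm (x, y) in q1 T10 *; have qE : q = x ^+ 2 + y ^+ 2 by [].
pose w : R[i] := x +i* y; pose V := cabs (1 - r%:C * w).
have wsq : cabs w ^+ 2 < 1 by rewrite cabs_sqr.
have w0 := cabs_ge0 w; have w1 : cabs w < 1 by nra.
have Vd : d <= V.
  have := cabsB_ge 1 (r%:C * w); rewrite cabs1 cabsM cabsR ger0_norm// -/V.
  by nra.
have V0 : 0 < V by exact: lt_le_trans Vd.
have V1 : cabs (1 - w) <= 2 * V.
  have -> : 1 - w = (1 - r%:C * w) + (r%:C * w - w) by ring.
  apply: (le_trans (cabsD _ _)); rewrite -/V (_ : r%:C * w - w = - ((1 - r)%:C * w)); last first.
    by rewrite rmorphB /= rmorph1; ring.
  rewrite cabsN cabsM cabsR ger0_norm; last by lra.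
  by nra.
have Vx : 1 - x <= 2 * V.
  apply: le_trans V1; have := cabs_Re (1 - w); rewrite /= => h.
  by apply: le_trans h; exact: ler_norm.
have Vy : `|y| <= 2 * V.
  by apply: le_trans V1; have := cabs_Im (1 - w); rewrite /= sub0r normrN.
have -> : ray_dist r (x, y) `^ (- (1 + a / 2)) = V `^ (- (2 + a)).
  rewrite ray_distE -/V powR_sqr ?(ltW V0)//; congr (_ `^ _); by field.
have [hA|hB] := leP 4^-1 V.
  apply: (@le_trans _ _ (4^-1 `^ (- (2 + a)) * (q `^ (- c) * (1 - q) `^ s))); last by rewrite lerDl.
  rewrite mulrC ler_wpM2r// ?mulr_ge0 ?powR_ge0//.
  by apply: powR_anti => //; lra.
have X0 : 0 <= X by rewrite XE powR_ge0.
have X2 : X ^+ 2 = 1 - y ^+ 2.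
  rewrite XE -powR_mulrn ?powR_ge0// -powRrM mulVf ?powRr1// ?pnatr_eq0//.
  by rewrite subr_ge0 (le_trans _ (ltW xy1))// lerDr.
have [u0 V3x V3y q4 X12] := arc_facts X0 X2 xy1 hB Vd Vx Vy.
rewrite -[leLHS]add0r; apply: lerD => //.
rewrite /T2 u0 mul1r.
have E1 : 1 - q = (X - x) * (X + x) by rewrite qE -subr_sqr X2; ring.
have E2 : V `^ (- (2 + a)) <= 3^-1 `^ (- (2 + a)) * ((d + `|y|) `^ (- (1 + eta)) * (d + (X - x)) `^ (- (s + 1 + eta))).
  have -> : 2 + a = (s + 1 + eta) + (1 + eta) by rewrite etaE; field.
  have k0 : (0 : R) < 3^-1 by rewrite invr_gt0.
  have dx0 : 0 < d + (X - x) by exact: addr_gt0.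
  have dy0 : 0 < d + `|y| by rewrite ltr_pwDl.
  have A0 : 0 <= s + 1 + eta by lra.
  have B0 : 0 <= 1 + eta by lra.
  exact: powR_split.
have [X1' X2'] : 0 <= X - x /\ 0 <= X + x by move/andP: X12 => [? _]; split; [exact: ltW | exact: le_trans ler01 _].
rewrite E1 (powRM _ X1' X2').
have hq : q `^ (- c) <= 1 + 4^-1 `^ (- c) by apply: powR_quarter_le; rewrite qE q4 ltW.
have hX : (X + x) `^ s <= 1 + 2 `^ s by exact: powR_le_two.
apply: (@le_trans _ _ ((1 + 4^-1 `^ (- c)) * ((X - x) `^ s * (1 + 2 `^ s)) *
   (3^-1 `^ (- (2 + a)) * ((d + `|y|) `^ (- (1 + eta)) * (d + (X - x)) `^ (- (s + 1 + eta)))))).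
  apply: ler_pM => //; rewrite ?mulr_ge0 ?powR_ge0//.
  apply: ler_pM => //; rewrite ?mulr_ge0 ?powR_ge0//.
  by rewrite ler_wpM2l ?powR_ge0.
by rewrite le_eqVlt; apply/orP; left; apply/eqP; ring.
Qed.

Lemma measurable_ray_dist r : measurable_fun setT (ray_dist r).
Proof. by rewrite /ray_dist; mfun. Qed.

(** The bound of [forelli_rudin_pointwise] is a product in the coordinates [X - x] and
    [y], so the integral over the plane is iterated. *)
Lemma forelli_rudin_real (a c s : R) : c < 1 -> -1 < s -> s < a -> exists2 K : R, 0 <= K &
  forall r, 0 <= r < 1 ->
  (\int[area]_z ((sqnorm z < 1)%R%:R * (sqnorm z `^ (- c) * (1 - sqnorm z) `^ s * ray_dist r z `^ (- (1 + a / 2))))%:E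
    <= (K * (1 - r ^+ 2) `^ (s - a))%:E)%E.
Proof.
move=> c1 s1 sa; have [K0 K00 hK0] := integrable_weight c1 s1.
pose eta := (a - s) / 2; have eta0 : 0 < eta by rewrite /eta; lra.
pose CA := (4^-1 : R) `^ (- (2 + a)); pose CB := (1 + 4^-1 `^ (- c)) * (1 + 2 `^ s) * 3^-1 `^ (- (2 + a)).
pose D := ((s + 1)^-1 + eta^-1) * (2 * eta^-1).
have CA0 : 0 <= CA by exact: powR_ge0.
have CB0 : 0 <= CB by rewrite /CB !mulr_ge0 ?addr_ge0 ?powR_ge0.
have i1 : 0 <= (s + 1)^-1 by rewrite invr_ge0; lra.
have i2 : 0 <= eta^-1 by rewrite invr_ge0 ltW.
have D0 : 0 <= D by rewrite /D mulr_ge0 ?addr_ge0 ?mulr_ge0.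
exists (CA * K0 + CB * D * 2^-1 `^ (s - a)).
  apply: addr_ge0; first exact: mulr_ge0.
  by apply: mulr_ge0; [exact: mulr_ge0 | exact: powR_ge0].
move=> r /andP[r0 r1]; pose d := 1 - r; have d0 : 0 < d by rewrite /d; lra.
pose X (y : R) := (1 - y ^+ 2) `^ 2^-1.
pose F1 z : \bar R := ((sqnorm z < 1)%R%:R * (sqnorm z `^ (- c) * (1 - sqnorm z) `^ s))%:E.
pose I1 (u : R) : R := (0 < u)%R%:R * (u `^ s * (d + u) `^ (- (s + 1 + eta))).
pose F2 z : \bar R := ((d + `|z.2|) `^ (- (1 + eta)) * I1 (X z.2 - z.1))%:E.
have msq := @measurable_sqnorm R.
have mF1 : measurable_fun setT F1.
  by apply/measurable_EFinP; mfun.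
have F10 z : (0 <= F1 z)%E by rewrite lee_fin !mulr_ge0// powR_ge0.
have mn2 : measurable_fun setT (fun z : R * R => `|z.2|).
  by apply: (measurableT_comp (normr_measurable (D := setT))); exact: measurable_snd.
have mX : measurable_fun setT (fun z : R * R => X z.2) by rewrite /X; mfun.
have mI1 : measurable_fun setT I1 by rewrite /I1; mfun.
have I10 u : 0 <= I1 u by rewrite /I1 !mulr_ge0// powR_ge0.
have mF2 : measurable_fun setT F2.
  apply/measurable_EFinP; apply: measurable_funM; first by mfun.
  by apply: (measurableT_comp mI1); mfun.
have F20 z : (0 <= F2 z)%E by rewrite lee_fin mulr_ge0// powR_ge0.
have mF1' : measurable_fun setT (fun z => CA%:E * F1 z)%E by apply: measurable_funeM.
have mF2' : measurable_fun setT (fun z => CB%:E * F2 z)%E by apply: measurable_funeM.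
have F1p z : (0 <= CA%:E * F1 z)%E by rewrite mule_ge0.
have F2p z : (0 <= CB%:E * F2 z)%E by rewrite mule_ge0.
apply: (@le_trans _ _ (\int[area]_z (CA%:E * F1 z + CB%:E * F2 z))%E).
  apply: area_le_integral.
  - by have mr := measurable_ray_dist r; apply/measurable_EFinP; mfun.
  - by move=> z; rewrite lee_fin !mulr_ge0// powR_ge0.
  - exact: emeasurable_funD.
  have r01 : 0 <= r < 1 by rewrite r0.
  move=> [x y]; rewrite /F1 /F2 -!EFinM -EFinD lee_fin /I1 /=.
  exact: (@forelli_rudin_pointwise a c s r x y eta d (X y) s1 sa r01 erefl erefl erefl).
rewrite (area_integralD mF1' F1p mF2' F2p) (area_integralZl CA0 mF1 F10) (area_integralZl CB0 mF2 F20).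
have hr : 1 <= (1 - r ^+ 2) `^ (s - a).
  apply: (@le_trans _ _ (1 `^ (s - a))); first by rewrite powR1.
  rewrite -[s - a]opprK; apply: powR_anti; nra.
have hd : d `^ (s - a) <= 2^-1 `^ (s - a) * (1 - r ^+ 2) `^ (s - a).
  rewrite -powRM ?invr_ge0//; last by nra.
  by rewrite -[s - a]opprK; apply: powR_anti; rewrite /d; nra.
have H2 : (\int[area]_z F2 z <= (D * d `^ (s - a))%:E)%E.
  rewrite (integral_area2 mF2 F20).
  apply: (@le_trans _ _ (\int[leb]_y ((((s + 1)^-1 + eta^-1) * d `^ (- eta))%:E * ((d + `|y|) `^ (- (1 + eta)))%:E))%E).
    apply: leb_le_integral.
    - exact: measurable_fun_fubini_tonelli_G.
    - by move=> y; exact: integral_ge0.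
    - apply: measurable_funeM; apply/measurable_EFinP; apply: measurable_powR_comp.
      by apply: measurable_funD; [exact: measurable_cst | exact: normr_measurable].
    move=> y; rewrite /F2 /=.
    have mIe : measurable_fun setT (fun x : R => (I1 (X y - x))%:E).
      by apply/measurable_EFinP; apply: (measurableT_comp mI1); mfun.
    have mIe' : measurable_fun setT (fun u : R => (I1 u)%:E) by apply/measurable_EFinP.
    have p0 : 0 <= (d + `|y|) `^ (- (1 + eta)) by exact: powR_ge0.
    have := leb_integralZl p0 mIe (fun u => I10 _).
    have -> : (\int[leb]_x (((d + `|y|) `^ (- (1 + eta)))%:E * (I1 (X y - x))%:E) =
       \int[leb]_x ((d + `|y|) `^ (- (1 + eta)) * I1 (X y - x))%:E)%E.
      by apply: eq_integral => x _; rewrite EFinM.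
    move=> ->; rewrite (integral_reflect (X y) mIe' (fun u => I10 u)) muleC.
    by apply: lee_wpmul2r; [rewrite lee_fin | exact: integral_cusp].
  have c0 : 0 <= ((s + 1)^-1 + eta^-1) * d `^ (- eta) by rewrite mulr_ge0 ?addr_ge0 ?powR_ge0.
  have mt : measurable_fun setT (fun y : R => ((d + `|y|) `^ (- (1 + eta)))%:E).
    apply/measurable_EFinP; apply: measurable_powR_comp.
    by apply: measurable_funD; [exact: measurable_cst | exact: normr_measurable].
  have t0 y : (0 <= ((d + `|y|) `^ (- (1 + eta)))%:E)%E by rewrite lee_fin powR_ge0.
  rewrite (leb_integralZl c0 mt t0).
  apply: (le_trans (lee_wpmul2l _ (integral_abs_tail eta0 d0))); first by rewrite lee_fin.
  rewrite -EFinM lee_fin (_ : s - a = - eta + - eta); last by rewrite /eta; field.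
  rewrite powRD ?(gt_eqF d0) ?implybT// /D le_eqVlt; apply/orP; left; apply/eqP; ring.
apply: (@le_trans _ _ (CA%:E * K0%:E + CB%:E * (D * d `^ (s - a))%:E)%E).
  by apply: leeD; apply: lee_wpmul2l => //; rewrite lee_fin.
rewrite -!EFinM -EFinD lee_fin mulrDl; apply: lerD.
  by rewrite ler_peMr// mulr_ge0.
by rewrite mulrA -[leRHS]mulrA ler_wpM2l// mulr_ge0.
Qed.

End ForelliRudin.

(** * The Schur test *)
Section Schur.
Context {R : realType} d (T : measurableType d) (mu : {sigma_finite_measure set T -> \bar R}).
Implicit Types (k : T * T -> R) (w h F : T -> R) (p q : R).

Lemma ge0_integral_powR_fin (f : T -> R) p : (forall x, 0 <= f x) ->
  (\int[mu]_x `|(f x)%:E| `^ p = \int[mu]_x (f x `^ p)%:E)%E.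
Proof. by move=> f0; apply: eq_integral => x _; rewrite gee0_abs ?lee_fin// poweR_EFin. Qed.

Lemma mono_integral (f g : T -> \bar R) : measurable_fun setT f -> (forall x, 0 <= f x)%E ->
  measurable_fun setT g -> (forall x, f x <= g x)%E -> (\int[mu]_x f x <= \int[mu]_x g x)%E.
Proof. by move=> mf f0 mg fg; apply: ge0_le_integral => // x _; exact: fg. Qed.

Lemma measurable_inner_integral (G : T * T -> \bar R) : measurable_fun setT G ->
  (forall z, 0 <= G z)%E -> measurable_fun setT (fun y => \int[mu]_x G (x, y))%E.
Proof.
move=> mG G0; pose G' (z : T * T) := G (z.2, z.1).
have mG' : measurable_fun setT G'.
  by apply: (measurableT_comp mG); exact: measurable_swap.
have G'0 z : (0 <= G' z)%E by exact: G0.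
have := @measurable_fun_fubini_tonelli_F _ _ _ _ _ mu _ mG' G'0; exact.
Qed.

Lemma scale_integral (c : R) (f : T -> \bar R) : 0 <= c -> measurable_fun setT f ->
  (forall x, 0 <= f x)%E -> (\int[mu]_x (c%:E * f x) = c%:E * \int[mu]_x f x)%E.
Proof. by move=> c0 mf f0; apply: ge0_integralZl => //; rewrite lee_fin. Qed.

Lemma measurable_slice k x : measurable_fun setT k -> measurable_fun setT (fun y => k (x, y)).
Proof. by move=> mk; exact: (measurableT_comp mk). Qed.

Lemma measurable_slice' k y : measurable_fun setT k -> measurable_fun setT (fun x => k (x, y)).
Proof. by move=> mk; exact: (measurableT_comp mk). Qed.

(** Hoelder's inequality for the splitting
    [w k F = ((w k)^(1/q) h) ((w k)^(1/p) h^-1 F)]. *)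
Lemma schur_pointwise (k w h F : T -> R) p q :
  0 < p -> 0 < q -> p^-1 + q^-1 = 1 ->
  measurable_fun setT k -> measurable_fun setT w -> measurable_fun setT h -> measurable_fun setT F ->
  (forall y, 0 <= k y) -> (forall y, 0 <= w y) -> (forall y, 0 <= h y) -> (forall y, 0 <= F y) ->
  (forall y, h y = 0 -> k y = 0) ->
  ((\int[mu]_y (w y * k y * F y)%:E) `^ p <=
   (\int[mu]_y (w y * k y * h y `^ q)%:E) `^ (p / q) * \int[mu]_y (w y * k y * (F y / h y) `^ p)%:E)%E.
Proof.
move=> p0 q0 pq mk mw mh mF k0 w0 h0 F0 hk.
have mwk : measurable_fun setT (fun y => w y * k y) by exact: measurable_funM.
pose f1 y := (w y * k y) `^ q^-1 * h y.
pose f2 y := (w y * k y) `^ p^-1 * (F y / h y).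
have mf1 : measurable_fun setT f1 by apply: measurable_funM => //; exact: measurable_powR_comp.
have mi : measurable_fun setT (fun y => F y / h y).
  apply: measurable_funM => //.
  have -> : (fun y => (h y)^-1) = (fun y => h y `^ (-1)).
    by apply/funext => y; rewrite powR_inv1.
  exact: measurable_powR_comp.
have mf2 : measurable_fun setT f2 by apply: measurable_funM => //; exact: measurable_powR_comp.
have f10 y : 0 <= f1 y by rewrite /f1 mulr_ge0 ?powR_ge0.
have f20 y : 0 <= f2 y by rewrite /f2 mulr_ge0 ?powR_ge0 ?divr_ge0.
have qp : q^-1 + p^-1 = 1 by rewrite addrC.
have := hoelder mu mf1 mf2 q0 p0 qp.
have -> : ('N[mu]_1[EFin \o (f1 \* f2)%R] = \int[mu]_y (w y * k y * F y)%:E)%E.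
  rewrite Lnorm1; apply: eq_integral => y _.
  have -> : (`|(EFin \o (f1 \* f2)%R) y| = (f1 y * f2 y)%:E)%E by rewrite gee0_abs//= lee_fin mulr_ge0.
  apply: congr1.
  rewrite /f1 /f2; have [hy|hy] := eqVneq (h y) 0.
    by rewrite (hk _ hy) hy !(mulr0, mul0r).
  rewrite mulrACA -powRD; last by rewrite qp oner_eq0.
  by rewrite qp powRr1 ?mulr_ge0//; field.
move=> H.
apply: (@le_trans _ _ (('N[mu]_q%:E[EFin \o f1] * 'N[mu]_p%:E[EFin \o f2]) `^ p)%E).
  have p1 := ltW p0.
  apply: gt0_ler_poweR => //; rewrite in_itv /= leey andbT ?mule_ge0 ?Lnorm_ge0//.
  by apply: integral_ge0 => y _; rewrite lee_fin !mulr_ge0.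
rewrite poweRM ?Lnorm_ge0//.
have -> : (('N[mu]_q%:E[EFin \o f1]) `^ p = (('N[mu]_q%:E[EFin \o f1]) `^ q) `^ (p / q))%E.
  by rewrite -poweRrM; congr (_ `^ _)%E; field; rewrite gt_eqF.
rewrite !powR_Lnorm ?gt_eqF// !ge0_integral_powR_fin//.
have -> : (\int[mu]_y (f1 y `^ q)%:E = \int[mu]_y (w y * k y * h y `^ q)%:E)%E.
  apply: eq_integral => y _; congr (_%:E).
  by rewrite /f1 powRM ?powR_ge0 ?mulr_ge0// -powRrM mulVf ?gt_eqF// powRr1 ?mulr_ge0.
have -> : (\int[mu]_y (f2 y `^ p)%:E = \int[mu]_y (w y * k y * (F y / h y) `^ p)%:E)%E.
  apply: eq_integral => y _; congr (_%:E).
  rewrite /f2 powRM; [|exact: powR_ge0 | exact: divr_ge0].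
  by rewrite -powRrM mulVf ?gt_eqF// powRr1 ?mulr_ge0.
by [].
Qed.

(** [schur_pointwise] for each [x], then Tonelli's theorem. *)
Theorem schur_test (k : T * T -> R) w h F p q C1 C2 :
  0 < p -> 0 < q -> p^-1 + q^-1 = 1 -> 0 <= C1 -> 0 <= C2 ->
  measurable_fun setT k -> measurable_fun setT w -> measurable_fun setT h -> measurable_fun setT F ->
  (forall z, 0 <= k z) -> (forall y, 0 <= w y) -> (forall y, 0 <= h y) -> (forall y, 0 <= F y) ->
  (forall x y, h y = 0 -> k (x, y) = 0) ->
  (forall x, (\int[mu]_y (w y * k (x, y) * h y `^ q)%:E <= (C1 * h x `^ q)%:E)%E) ->
  (forall y, (\int[mu]_x (w x * k (x, y) * h x `^ p)%:E <= (C2 * h y `^ p)%:E)%E) ->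
  (\int[mu]_x ((w x)%:E * (\int[mu]_y (w y * k (x, y) * F y)%:E) `^ p) <=
   (C1 `^ (p / q) * C2)%:E * \int[mu]_y (w y * F y `^ p)%:E)%E.
Proof.
move=> p0 q0 pq C10 C20 mk mw mh mF k0 w0 h0 F0 hk H1 H2.
have mi : measurable_fun setT (fun y => (F y / h y) `^ p).
  apply: measurable_powR_comp; apply: measurable_funM => //.
  have -> : (fun y => (h y)^-1) = (fun y => h y `^ (-1)).
    by apply/funext => y; rewrite powR_inv1.
  exact: measurable_powR_comp.
have ms1 : measurable_fun setT (fun z : T * T => z.1) by exact: measurable_fst.
have ms2 : measurable_fun setT (fun z : T * T => z.2) by exact: measurable_snd.
pose G (z : T * T) : \bar R := ((w z.1 * h z.1 `^ p) * (w z.2 * k z * (F z.2 / h z.2) `^ p))%:E.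
have mG : measurable_fun setT G.
  apply/measurable_EFinP; apply: measurable_funM.
    apply: measurable_funM; first exact: (measurableT_comp mw ms1).
    by apply: measurable_powR_comp; exact: (measurableT_comp mh ms1).
  apply: measurable_funM; first by apply: measurable_funM => //; exact: (measurableT_comp mw ms2).
  exact: (measurableT_comp mi ms2).
have G0 z : (0 <= G z)%E by rewrite lee_fin !mulr_ge0 ?powR_ge0.
pose c := C1 `^ (p / q).
have c0 : (0 <= c%:E)%E by rewrite lee_fin powR_ge0.
have mwF : measurable_fun setT (fun y => (w y * F y `^ p)%:E).
  by apply/measurable_EFinP; apply: measurable_funM => //; exact: measurable_powR_comp.
have mwkF : measurable_fun setT (fun z : T * T => (w z.2 * k z * F z.2)%:E).
  apply/measurable_EFinP; apply: measurable_funM; last exact: (measurableT_comp mF ms2).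
  by apply: measurable_funM => //; exact: (measurableT_comp mw ms2).
have pw x : ((w x)%:E * (\int[mu]_y (w y * k (x, y) * F y)%:E) `^ p <= c%:E * \int[mu]_y G (x, y))%E.
  have := schur_pointwise p0 q0 pq (measurable_slice x mk) mw mh mF
     (fun y => k0 (x, y)) w0 h0 F0 (hk x).
  move=> /(lee_wpmul2l (w0 x : (0 <= (w x)%:E)%E)) /le_trans; apply.
  have -> : (\int[mu]_y G (x, y) = (w x * h x `^ p)%:E * \int[mu]_y (w y * k (x, y) * (F y / h y) `^ p)%:E)%E.
    rewrite -ge0_integralZl//.
    - by apply/measurable_EFinP; apply: measurable_funM => //; apply: measurable_funM => //; exact: measurable_slice.
    - by move=> y _; rewrite lee_fin !mulr_ge0 ?powR_ge0.
    - by rewrite lee_fin mulr_ge0 ?powR_ge0.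
  rewrite !muleA; apply: lee_wpmul2r.
    by apply: integral_ge0 => y _; rewrite lee_fin !mulr_ge0 ?powR_ge0.
  rewrite (_ : c%:E * (w x * h x `^ p)%:E = (w x)%:E * (C1 * h x `^ q)%:E `^ (p / q))%E; last first.
    rewrite poweR_EFin powRM ?powR_ge0// -powRrM -!EFinM; congr (_%:E).
    have -> : q * (p / q) = p by field; rewrite gt_eqF.
    by rewrite /c; ring.
  apply: lee_wpmul2l; first by rewrite lee_fin.
  have r0 : 0 <= p / q by rewrite divr_ge0 ?ltW.
  apply: gt0_ler_poweR => //; rewrite in_itv /= leey andbT.
    by apply: integral_ge0 => y _; rewrite lee_fin !mulr_ge0 ?powR_ge0.
  by rewrite lee_fin mulr_ge0 ?powR_ge0.
have mGx : measurable_fun setT (fun x => \int[mu]_y G (x, y))%E.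
  have := @measurable_fun_fubini_tonelli_F _ _ _ _ _ mu _ mG; exact.
apply: (@le_trans _ _ (\int[mu]_x (c%:E * \int[mu]_y G (x, y)))%E).
  apply: mono_integral.
  - apply: emeasurable_funM; first exact/measurable_EFinP.
    apply: (measurableT_comp (measurable_poweR _)).
    have := @measurable_fun_fubini_tonelli_F _ _ _ _ _ mu _ mwkF; apply.
    by move=> z; rewrite lee_fin !mulr_ge0.
  - by move=> x; rewrite mule_ge0 ?lee_fin// poweR_ge0.
  - exact: measurable_funeM.
  - exact: pw.
rewrite ge0_integralZl//; last by move=> x _; exact: integral_ge0.
rewrite EFinM -muleA; apply: lee_wpmul2l => //.
have -> : (\int[mu]_x \int[mu]_y G (x, y) = \int[mu]_y \int[mu]_x G (x, y))%E.
  have := @fubini_tonelli _ _ _ _ _ mu mu G mG G0; exact.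
rewrite -ge0_integralZl//; last by move=> y _; rewrite lee_fin !mulr_ge0 ?powR_ge0.
apply: mono_integral.
- exact: measurable_inner_integral.
- by move=> y; apply: integral_ge0 => x _; exact: G0.
- exact: measurable_funeM.
move=> y.
have -> : (\int[mu]_x G (x, y) = (w y * (F y / h y) `^ p)%:E * \int[mu]_x (w x * k (x, y) * h x `^ p)%:E)%E.
  have c1 : 0 <= w y * (F y / h y) `^ p by rewrite mulr_ge0 ?powR_ge0.
  have mf : measurable_fun setT (fun x => (w x * k (x, y) * h x `^ p)%:E).
    apply/measurable_EFinP; apply: measurable_funM; last exact: measurable_powR_comp.
    by apply: measurable_funM => //; exact: measurable_slice'.
  have f0 x : (0 <= (w x * k (x, y) * h x `^ p)%:E)%E.
    by rewrite lee_fin !mulr_ge0 ?powR_ge0.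
  rewrite -(scale_integral c1 mf f0).
  by apply: eq_integral => x _; rewrite /G /= -EFinM; congr (_%:E); ring.
apply: (le_trans (lee_wpmul2l _ (H2 y))); first by rewrite lee_fin mulr_ge0 ?powR_ge0.
rewrite -!EFinM lee_fin.
have -> : w y * (F y / h y) `^ p * (C2 * h y `^ p) = (C2 * w y) * ((F y / h y) `^ p * h y `^ p) by ring.
rewrite [leRHS]mulrA ler_wpM2l ?mulr_ge0//.
have [->|hy] := eqVneq (h y) 0; first by rewrite powR0 ?(gt_eqF p0)// mulr0 powR_ge0.
by rewrite -powRM ?divr_ge0// divfK.
Qed.

End Schur.

Section PlaneSigmaFinite.
Context {R : realType}.
Notation leb := (@lebesgue_measure R).
Notation mR := (measurableTypeR R).

(** Area under a name of its own, which carries the structure of a sigma-finite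
    measure. *)
Definition plane_measure : set (mR * mR) -> \bar R := (leb \x leb)%E.

HB.instance Definition _ := Measure.copy plane_measure (leb \x leb)%E.

Lemma sigma_finite_plane : sigma_finite setT plane_measure.
Proof.
exists (fun n => [set z : mR * mR | (sqnorm (z : R * R) < n%:R)%R]).
  apply/seteqP; split=> // z _; exists (Num.truncn (sqnorm (z : R * R))).+1 => //=.
  exact: truncnS_gt.
move=> n; split; first exact: measurable_lt_sqnorm.
apply: (@le_lt_trans _ _ ((Num.max n%:R 0)%:E * @disc_area R)%E); first by rewrite -area_lt_sqnorm.
by rewrite lte_mul_pinfty ?lee_fin ?le_max ?lexx ?orbT// disc_area_lty.
Qed.

HB.instance Definition _ := Measure_isSigmaFinite.Build _ _ _ plane_measure sigma_finite_plane.

End PlaneSigmaFinite.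

Section BergmanSchur.
Context {R : realType}.
Notation leb := (@lebesgue_measure R).
Notation area := (@lebesgue_measure R \x @lebesgue_measure R)%E.
Implicit Types (a b c s p q M : R) (z w : R * R).

Lemma eq_ler (x y : R) : x = y -> x <= y.
Proof. by move=> ->. Qed.

Lemma eq_lee (x y : \bar R) : x = y -> (x <= y)%E.
Proof. by move=> ->. Qed.

(** [|1 - z w^*|^2] in real coordinates. *)
Definition cdist z w : R :=
  (1 - (z.1 * w.1 + z.2 * w.2)) ^+ 2 + (z.2 * w.1 - z.1 * w.2) ^+ 2.

Lemma cdistC z w : cdist z w = cdist w z.
Proof. by rewrite /cdist; ring. Qed.

Lemma cdistE z w : cdist z w = cabs (1 - plane z * (plane w)^*) ^+ 2.
Proof. by rewrite cabs_sqr /cdist /plane /=; ring. Qed.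

Lemma measurable_cdist : measurable_fun setT (fun v : (R * R) * (R * R) => cdist v.1 v.2).
Proof.
have m11 : measurable_fun setT (fun v : (R * R) * (R * R) => v.1.1).
  by apply: (measurableT_comp (@measurable_fst _ _ _ _)); exact: measurable_fst.
have m12 : measurable_fun setT (fun v : (R * R) * (R * R) => v.1.2).
  by apply: (measurableT_comp (@measurable_snd _ _ _ _)); exact: measurable_fst.
have m21 : measurable_fun setT (fun v : (R * R) * (R * R) => v.2.1).
  by apply: (measurableT_comp (@measurable_fst _ _ _ _)); exact: measurable_snd.
have m22 : measurable_fun setT (fun v : (R * R) * (R * R) => v.2.2).
  by apply: (measurableT_comp (@measurable_snd _ _ _ _)); exact: measurable_snd.
rewrite /cdist; apply: measurable_funD; apply: measurable_funX; apply: measurable_funB.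
- exact: measurable_cst.
- by apply: measurable_funD; apply: measurable_funM.
- exact: measurable_funM.
- exact: measurable_funM.
Qed.

Lemma sqnorm_ge0 z : 0 <= sqnorm z.
Proof. by rewrite /sqnorm addr_ge0// sqr_ge0. Qed.

Lemma polar_dir z : exists r c s, [/\ 0 <= r, r ^+ 2 = sqnorm z, c ^+ 2 + s ^+ 2 = 1 & z = (r * c, r * s)].
Proof.
pose r := Num.sqrt (sqnorm z); have r2 : r ^+ 2 = sqnorm z by rewrite sqr_sqrtr// sqnorm_ge0.
have r0 : 0 <= r by exact: sqrtr_ge0.
have [re|rN] := eqVneq r 0.
  exists r, 1, 0; split => //; first by ring.
  move: r2; rewrite re expr0n /= /sqnorm => /esym/eqP.
  rewrite paddr_eq0 ?sqr_ge0// !sqrf_eq0 => /andP[/eqP z1 /eqP z2].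
  by case: z z1 z2 {r r0 re} => x y /= -> ->; rewrite !mul0r.
exists r, (z.1 / r), (z.2 / r); split => //.
  by rewrite !expr_div_n -mulrDl -/(sqnorm z) -r2 divff// sqrf_eq0.
by rewrite [LHS]surjective_pairing ![r * _]mulrC !divfK.
Qed.

Lemma sqnorm_rot c s w : c ^+ 2 + s ^+ 2 = 1 -> sqnorm (rot c s w) = sqnorm w.
Proof.
move=> cs; rewrite /sqnorm /rot /linmap /=.
transitivity ((c ^+ 2 + s ^+ 2) * (w.1 ^+ 2 + w.2 ^+ 2)); first by ring.
by rewrite cs mul1r.
Qed.

(** A rotation moves the pole of the kernel to the positive real axis. *)
Lemma forelli_rudin a c s : c < 1 -> -1 < s -> s < a -> exists2 K : R, 0 <= K &
  forall z, sqnorm z < 1 ->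
  (\int[area]_w ((sqnorm w < 1)%R%:R * (sqnorm w `^ (- c) * (1 - sqnorm w) `^ s * cdist z w `^ (- (1 + a / 2))))%:E
    <= (K * (1 - sqnorm z) `^ (s - a))%:E)%E.
Proof.
move=> c1 s1 sa; have [K K0 hK] := forelli_rudin_real c1 s1 sa; exists K => // z z1.
have [r [u [v [r0 r2 uv zE]]]] := polar_dir z.
have r1 : 0 <= r < 1 by rewrite r0 /=; move: z1; rewrite -r2 => h; nra.
have := hK _ r1; rewrite r2.
set G := fun w : R * R => ((sqnorm w < 1)%R%:R * (sqnorm w `^ (- c) * (1 - sqnorm w) `^ s * ray_dist r w `^ (- (1 + a / 2))))%:E.
have uv' : u ^+ 2 + (- v) ^+ 2 = 1 by rewrite sqrrN.
have msq := @measurable_sqnorm R.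
have mrd := @measurable_ray_dist R r.
have mG : measurable_fun setT G by apply/measurable_EFinP; mfun.
have G0 w : (0 <= G w)%E by rewrite lee_fin !mulr_ge0// powR_ge0.
rewrite -(preserving_rot uv' mG G0); apply: le_trans; rewrite le_eqVlt; apply/orP; left; apply/eqP.
apply: eq_integral => w _; rewrite /G (sqnorm_rot w uv'); congr (_ * (_ * _ `^ _))%:E.
by rewrite /ray_dist /rot /linmap /cdist zE /=; ring.
Qed.

Definition wt a b w : R := (sqnorm w < 1)%R%:R * (sqnorm w `^ b * (1 - sqnorm w) `^ a).

Lemma wt_ge0 a b w : 0 <= wt a b w.
Proof. by rewrite /wt !mulr_ge0// powR_ge0. Qed.

Lemma measurable_wt a b : measurable_fun setT (wt a b).
Proof. by have msq := @measurable_sqnorm R; rewrite /wt; mfun. Qed.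

(** With [M = m / 2] this dominates the projection kernel ([kern_bound]). The gates
    leave out the origin, where real powers take conventional values. *)
Definition absker a M (v : (R * R) * (R * R)) : R :=
  (0 < sqnorm v.1 < 1)%R%:R * (0 < sqnorm v.2 < 1)%R%:R *
  (sqnorm v.1 `^ (- M) * sqnorm v.2 `^ (- M) * cdist v.1 v.2 `^ (- (1 + a / 2))).

Lemma absker_ge0 a M v : 0 <= absker a M v.
Proof. by rewrite /absker !mulr_ge0// powR_ge0. Qed.

Lemma absker_sym a M z w : absker a M (z, w) = absker a M (w, z).
Proof. by rewrite /absker /= cdistC; ring. Qed.

Lemma measurable_absker a M : measurable_fun setT (absker a M).
Proof.
have m1 : measurable_fun setT (fun v : (R * R) * (R * R) => sqnorm v.1).
  by apply: (measurableT_comp (@measurable_sqnorm R)); exact: measurable_fst.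
have m2 : measurable_fun setT (fun v : (R * R) * (R * R) => sqnorm v.2).
  by apply: (measurableT_comp (@measurable_sqnorm R)); exact: measurable_snd.
have m3 := measurable_cdist.
by rewrite /absker; mfun.
Qed.

(** The comparison function of the Schur test. *)
Definition schur_weight (sg t : R) w : R := sqnorm w `^ (- sg) * (1 - sqnorm w) `^ (- t).

Lemma powR_schur_weight sg t e w : sqnorm w <= 1 ->
  schur_weight sg t w `^ e = sqnorm w `^ (- (sg * e)) * (1 - sqnorm w) `^ (- (t * e)).
Proof. by move=> w1; rewrite /schur_weight powRM ?powR_ge0// -!powRrM !mulNr. Qed.

Lemma schur_weight_bound a b M sg t e : 0 < e ->
  M <= sg * e -> M + sg * e < b + 1 -> 0 < t * e -> t * e < a + 1 ->
  exists2 K : R, 0 <= K & forall z,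
  (\int[area]_w (wt a b w * absker a M (z, w) * schur_weight sg t w `^ e)%:E <=
     (K * schur_weight sg t z `^ e)%:E)%E.
Proof.
move=> e0 h1 h2 h3 h4; pose c := M + sg * e - b; pose s := a - t * e.
have c1 : c < 1 by rewrite /c; lra.
have s1 : -1 < s by rewrite /s; lra.
have sa : s < a by rewrite /s; lra.
have [K K0 hK] := forelli_rudin c1 s1 sa; exists K => // z.
have [/andP[z0 z1]|zN] := boolP (0 < sqnorm z < 1); last first.
  rewrite (_ : (\int[area]_w _)%E = 0%E) ?lee_fin ?mulr_ge0 ?powR_ge0//.
  by apply: integral0_eq => w _; rewrite /absker /= (negbTE zN) !(mul0r, mulr0).
pose G w : \bar R := ((sqnorm w < 1)%R%:R * (sqnorm w `^ (- c) * (1 - sqnorm w) `^ s * cdist z w `^ (- (1 + a / 2))))%:E.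
have msq := @measurable_sqnorm R.
have mcd : measurable_fun setT (cdist z).
  by apply: (measurableT_comp measurable_cdist (pair1_measurable z)).
have mG : measurable_fun setT G by apply/measurable_EFinP; mfun.
have G0 w : (0 <= G w)%E by rewrite lee_fin !mulr_ge0// powR_ge0.
apply: (@le_trans _ _ (\int[area]_w ((sqnorm z `^ (- M))%:E * G w))%E).
  apply: area_le_integral.
  - have m1 := measurable_slice z (measurable_absker a M).
    apply/measurable_EFinP; apply: measurable_funM.
      by apply: measurable_funM => //; exact: measurable_wt.
    by apply: measurable_powR_comp; rewrite /schur_weight; mfun.
  - by move=> w; rewrite lee_fin !mulr_ge0 ?wt_ge0 ?absker_ge0 ?powR_ge0.
  - exact: measurable_funeM.
  move=> w; rewrite /G -EFinM lee_fin /wt /absker /= z0 z1 mul1r.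
  have [w1|w1] := ltP (sqnorm w) 1; last by rewrite !(mul0r, mulr0).
  rewrite andbT; have [w0|w0] := ltP 0 (sqnorm w); last first.
    by rewrite !(mul0r, mulr0) !mulr_ge0 ?powR_ge0.
  have w1' : 0 < 1 - sqnorm w by rewrite subr_gt0.
  rewrite (@powR_schur_weight sg t e w (ltW w1)) /= !mul1r; apply: eq_ler.
  have -> : - c = b + (- M + - (sg * e)) by rewrite /c; ring.
  have -> : s = a + - (t * e) by rewrite /s.
  rewrite (@powRD _ _ b) ?(gt_eqF w0) ?implybT// (@powRD _ _ (- M)) ?(gt_eqF w0) ?implybT//.
  by rewrite (@powRD _ _ a) ?(gt_eqF w1') ?implybT//; ring.
rewrite (area_integralZl (powR_ge0 _ _) mG G0).
apply: (le_trans (lee_wpmul2l _ (hK _ z1))); first by rewrite lee_fin powR_ge0.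
rewrite -EFinM lee_fin mulrCA (powR_schur_weight sg t e (ltW z1)); apply: ler_wpM2l => //.
have -> : s - a = - (t * e) by rewrite /s; ring.
rewrite ler_wpM2r ?powR_ge0//.
rewrite [- (sg * e)](_ : _ = - M + - (sg * e - M)); last by ring.
rewrite powRD ?(gt_eqF z0) ?implybT// ler_peMr ?powR_ge0//.
apply: (@le_trans _ _ (1 `^ (- (sg * e - M)))); first by rewrite powR1.
by apply: powR_anti; lra.
Qed.

(** The comparison function carries the exponent [M / p] or [M / q], whichever is
    larger, at the origin, and a small positive exponent at the circle. *)
Theorem bergman_schur a b p q M : -1 < a -> -1 < b -> 1 < p -> p^-1 + q^-1 = 1 ->
  0 <= M -> M * p < b + 1 -> M * q < b + 1 ->
  exists2 C : R, 0 <= C & forall F : R * R -> R,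
  measurable_fun setT F -> (forall w, 0 <= F w) ->
  (\int[area]_z ((wt a b z)%:E * (\int[area]_w (wt a b w * absker a M (z, w) * F w)%:E) `^ p) <=
   C%:E * \int[area]_w (wt a b w * F w `^ p)%:E)%E.
Proof.
move=> a1 b1 p1 pq M0 Mp Mq.
have p0 : 0 < p by lra.
have q0 : 0 < q.
  have : 0 < q^-1 by have : p^-1 < 1 by [rewrite invf_lt1]; lra.
  by rewrite invr_gt0.
have pqE : p * q = p + q.
  have : p * q * (p^-1 + q^-1) = p * q by rewrite pq mulr1.
  by move=> <-; field; rewrite !gt_eqF.
pose t := (a + 1) / (2 * (p + q)).
have pq0 : 0 < p + q by lra.
have t0 : 0 < t by rewrite /t divr_gt0//; lra.
have tpq : t * (p + q) = (a + 1) / 2 by rewrite /t; field; rewrite gt_eqF.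
have [sg [sp sq sp' sq']] : exists sg, [/\ M <= sg * p, M <= sg * q, M + sg * p < b + 1 & M + sg * q < b + 1].
  have [lpq|lqp] := leP p q.
    exists (M / p); have E : M / p * p = M by field; rewrite gt_eqF.
    have E' : M / p * q = M * q - M.
      have : q = p * q - p by rewrite pqE; ring.
      move=> /(congr1 (fun x => M / p * x)); rewrite mulrBr E => ->.
      by rewrite mulrA E.
    have Mpq : M * p <= M * q by rewrite ler_wpM2l.
    by split; rewrite ?E ?E'; nra.
  exists (M / q); have E : M / q * q = M by field; rewrite gt_eqF.
  have E' : M / q * p = M * p - M.
    have : p = q * p - q by rewrite [q * p]mulrC pqE; ring.
    move=> /(congr1 (fun x => M / q * x)); rewrite mulrBr E => ->.
    by rewrite mulrA E.
  have Mpq : M * q <= M * p by rewrite ler_wpM2l// ltW.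
  by split; rewrite ?E ?E'; nra.
have tp : t * p < a + 1 by nra.
have tq : t * q < a + 1 by nra.
have [C1 C10 hC1] := @schur_weight_bound a b M sg t q q0 sq sq' (mulr_gt0 t0 q0) tq.
have [C2 C20 hC2] := @schur_weight_bound a b M sg t p p0 sp sp' (mulr_gt0 t0 p0) tp.
exists (C1 `^ (p / q) * C2); first by rewrite mulr_ge0 ?powR_ge0.
move=> F mF F0.
have msq := @measurable_sqnorm R.
have mh : measurable_fun setT (schur_weight sg t) by rewrite /schur_weight; mfun.
have h0 w : 0 <= schur_weight sg t w by rewrite /schur_weight mulr_ge0 ?powR_ge0.
have hk z w : schur_weight sg t w = 0 -> absker a M (z, w) = 0.
  rewrite /schur_weight /absker /=.
  have [/andP[w0 w1]|] := boolP (0 < sqnorm w < 1); last by rewrite !(mulr0, mul0r).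
  move=> /eqP; rewrite mulf_eq0 !powR_eq0 (gt_eqF w0) /= => /andP[/eqP h _].
  by move: w1; rewrite -subr_gt0 h ltxx.
have H2 w : (\int[area]_z (wt a b z * absker a M (z, w) * schur_weight sg t z `^ p)%:E <=
    (C2 * schur_weight sg t w `^ p)%:E)%E.
  apply: le_trans (hC2 w); apply: eq_lee.
  by apply: eq_integral => z _; rewrite absker_sym.
exact: (@schur_test R _ _ plane_measure (absker a M) (wt a b) (schur_weight sg t) F p q C1 C2
  p0 q0 pq C10 C20 (measurable_absker a M) (measurable_wt a b) mh mF
  (absker_ge0 a M) (wt_ge0 a b) h0 F0 hk hC1 H2).
Qed.

End BergmanSchur.

(** * Integrals of complex-valued functions *)
Section ComplexIntegral.
Context {R : realType} d (T : measurableType d) (mu : {measure set T -> \bar R}).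
Implicit Types (D : set T) (G H : T -> R[i]).

Definition cmeas D G : Prop := measurable_fun D (fun x => complex.Re (G x)) /\
  measurable_fun D (fun x => complex.Im (G x)).

Definition cintegrable D G : Prop := mu.-integrable D (EFin \o (fun x => complex.Re (G x))) /\
  mu.-integrable D (EFin \o (fun x => complex.Im (G x))).

Definition cint D G : R[i] :=
  (\int[mu]_(x in D) complex.Re (G x)) +i* (\int[mu]_(x in D) complex.Im (G x)).

Lemma measurable_powR_on D (f : T -> R) (p : R) :
  measurable_fun D f -> measurable_fun D (fun x => f x `^ p).
Proof. by move=> mf; exact: (measurableT_comp (measurable_powR p) mf). Qed.

Lemma cmeas_cabs D G : cmeas D G -> measurable_fun D (fun x => cabs (G x)).
Proof.
move=> [mr mi].
have -> : (fun x => cabs (G x)) = (fun x => (complex.Re (G x) ^+ 2 + complex.Im (G x) ^+ 2) `^ 2^-1).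
  by apply/funext => x; rewrite powR12_sqrt ?addr_ge0 ?sqr_ge0// cabsE.
apply: measurable_powR_on.
by apply: measurable_funD; exact: measurable_funX.
Qed.

Lemma cmeasD D G H : cmeas D G -> cmeas D H -> cmeas D (fun x => G x + H x).
Proof. by move=> [gr gi] [hr hi]; split; under eq_fun do rewrite ?ReD ?ImD; exact: measurable_funD. Qed.

Lemma cmeasM D G H : cmeas D G -> cmeas D H -> cmeas D (fun x => G x * H x).
Proof.
move=> [gr gi] [hr hi]; split.
  have -> : (fun x => complex.Re (G x * H x)) = (fun x => complex.Re (G x) * complex.Re (H x) - complex.Im (G x) * complex.Im (H x)).
    by apply/funext => x; rewrite ReM.
  by apply: measurable_funB; exact: measurable_funM.
have -> : (fun x => complex.Im (G x * H x)) = (fun x => complex.Re (G x) * complex.Im (H x) + complex.Im (G x) * complex.Re (H x)).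
  by apply/funext => x; rewrite ImM.
by apply: measurable_funD; exact: measurable_funM.
Qed.

Lemma cmeas_cst D c : cmeas D (fun=> c).
Proof. by split; exact: measurable_cst. Qed.

Lemma cmeas_real D (f : T -> R) : measurable_fun D f -> cmeas D (fun x => (f x)%:C).
Proof. by move=> mf; split => //=; exact: measurable_cst. Qed.

Lemma cmeasN D G : cmeas D G -> cmeas D (fun x => - G x).
Proof.
move=> h; have -> : (fun x => - G x) = (fun x => (-1) * G x) by apply/funext => x; rewrite mulN1r.
by apply: cmeasM => //; exact: cmeas_cst.
Qed.

Lemma cmeasX D G n : cmeas D G -> cmeas D (fun x => G x ^+ n).
Proof.
move=> h; elim: n => [|n IH]; first exact: cmeas_cst.
by have := cmeasM h IH; under eq_fun do rewrite -exprS.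
Qed.

Lemma cmeas_sum D (F : nat -> T -> R[i]) n : (forall k, cmeas D (F k)) ->
  cmeas D (fun x => \sum_(0 <= k < n) F k x).
Proof.
move=> h; elim: n => [|n IH].
  by have -> : (fun x => \sum_(0 <= k < 0) F k x) = (fun=> 0); [apply/funext => x; rewrite big_nil | exact: cmeas_cst].
have -> : (fun x => \sum_(0 <= k < n.+1) F k x) = (fun x => (\sum_(0 <= k < n) F k x) + F n x).
  by apply/funext => x; rewrite big_nat_recr.
exact: cmeasD.
Qed.

Lemma cmeasJ D G : cmeas D G -> cmeas D (fun x => (G x)^*).
Proof.
move=> [gr gi]; split.
  have -> : (fun x => complex.Re ((G x)^*)) = (fun x => complex.Re (G x)).
    by apply/funext => x; case: (G x).
  by [].
have -> : (fun x => complex.Im ((G x)^*)) = (fun x => 0 - complex.Im (G x)).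
  by apply/funext => x; rewrite sub0r; case: (G x).
by apply: measurable_funB => //; exact: measurable_cst.
Qed.

Lemma cmeasV D G : cmeas D G -> cmeas D (fun x => (G x)^-1).
Proof.
move=> h; have -> : (fun x => (G x)^-1) = (fun x => (G x)^* * (cabs (G x) `^ (- 2))%:C).
  apply/funext => x; rewrite powRN (powR_mulrn 2 (cabs_ge0 _)).
  have [->|g0] := eqVneq (G x) 0; first by rewrite invr0 rmorph0 mul0r.
  apply: (mulfI g0); rewrite mulfV// mulrA mulzJ -rmorphM /= mulfV ?rmorph1//.
  by rewrite sqrf_eq0 cabs_eq0.
apply: cmeasM; first exact: cmeasJ.
by apply: cmeas_real; apply: measurable_powR_on; exact: cmeas_cabs.
Qed.

(** Limits need to exist only pointwise in the sense of distances. *)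
Lemma cmeas_lim D (F : nat -> T -> R[i]) G : (forall n, cmeas D (F n)) ->
  (forall x, D x -> (fun n => cabs (F n x - G x)) @ \oo --> (0 : R)) -> cmeas D G.
Proof.
move=> mF lim.
have key (u : nat -> R) (l : R) (b : nat -> R) : (forall n, `|u n - l| <= b n) ->
    b @ \oo --> (0 : R) -> u @ \oo --> l.
  move=> ub b0; have h0 : (fun n => `|u n - l|) @ \oo --> (0 : R).
    by apply: (squeeze0 _ b0) => n; rewrite normr_ge0 ub.
  apply/cvgrPdist_lt => e e0; move/cvgrPdist_lt: h0 => /(_ _ e0); apply: filterS => n.
  by rewrite sub0r normrN normr_id distrC.
split; [apply: (@measurable_fun_cvg _ _ _ _ (fun n x => complex.Re (F n x)))
  |apply: (@measurable_fun_cvg _ _ _ _ (fun n x => complex.Im (F n x)))].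
- by move=> n; have [] := mF n.
- by move=> x Dx; apply: key (lim x Dx) => n; rewrite -ReB; exact: cabs_Re.
- by move=> n; have [] := mF n.
- by move=> x Dx; apply: key (lim x Dx) => n; rewrite -ImB; exact: cabs_Im.
Qed.

Variables (D : set T) (mD : measurable D).

Lemma le_abs_integral (u c : T -> R) : measurable_fun D u -> measurable_fun D c ->
  (forall x, `|u x| <= c x) ->
  (\int[mu]_(x in D) `|(EFin \o u) x| <= \int[mu]_(x in D) (c x)%:E)%E.
Proof.
move=> mu' mc h; apply: ge0_le_integral => //.
- by apply: measurableT_comp => //; exact/measurable_EFinP.
- exact/measurable_EFinP.
- by move=> x _ /=; rewrite lee_fin.
Qed.

Lemma cintegrableP G : cmeas D G -> (\int[mu]_(x in D) (cabs (G x))%:E < +oo)%E -> cintegrable D G.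
Proof.
move=> mG fin; have mc := cmeas_cabs mG; have [mr mi] := mG.
split; apply/integrableP; split; try exact/measurable_EFinP; apply: le_lt_trans fin.
  exact: (le_abs_integral mr mc (fun x => cabs_Re (G x))).
exact: (le_abs_integral mi mc (fun x => cabs_Im (G x))).
Qed.

Lemma cintegrableD G H : cintegrable D G -> cintegrable D H -> cintegrable D (fun x => G x + H x).
Proof.
move=> [gr gi] [hr hi]; split.
  have -> : EFin \o (fun x => complex.Re (G x + H x)) = (EFin \o (fun x => complex.Re (G x))) \+ (EFin \o (fun x => complex.Re (H x))).
    by apply/funext => x /=; rewrite ReD.
  exact: integrableD.
have -> : EFin \o (fun x => complex.Im (G x + H x)) = (EFin \o (fun x => complex.Im (G x))) \+ (EFin \o (fun x => complex.Im (H x))).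
  by apply/funext => x /=; rewrite ImD.
exact: integrableD.
Qed.

Let integrable_lin (f g : T -> R) (k l : R) : mu.-integrable D (EFin \o f) -> mu.-integrable D (EFin \o g) ->
  mu.-integrable D (EFin \o (fun x => k * f x)) /\
  mu.-integrable D (EFin \o (fun x => l * g x)) /\
  mu.-integrable D (EFin \o (fun x => k * f x + l * g x)) /\
  \int[mu]_(x in D) (k * f x + l * g x) = k * \int[mu]_(x in D) f x + l * \int[mu]_(x in D) g x.
Proof.
move=> hf hg.
have h1 : mu.-integrable D (EFin \o (fun x => k * f x)).
  by have := integrableZl mD k hf; apply: eq_integrable => // x _; rewrite /= EFinM.
have h2 : mu.-integrable D (EFin \o (fun x => l * g x)).
  by have := integrableZl mD l hg; apply: eq_integrable => // x _; rewrite /= EFinM.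
split => //; split => //; split.
  have -> : EFin \o (fun x => k * f x + l * g x) = (EFin \o (fun x => k * f x)) \+ (EFin \o (fun x => l * g x)) by [].
  exact: integrableD.
by rewrite RintegralD// !RintegralZl.
Qed.

Lemma cintegrableZ G c : cintegrable D G -> cintegrable D (fun x => c * G x).
Proof.
move=> [gr gi]; split.
  have -> : (fun x => complex.Re (c * G x)) = (fun x => complex.Re c * complex.Re (G x) + (- complex.Im c) * complex.Im (G x)).
    by apply/funext => x; rewrite ReM mulNr.
  by have [_ [_ []]] := integrable_lin (complex.Re c) (- complex.Im c) gr gi.
have -> : (fun x => complex.Im (c * G x)) = (fun x => complex.Re c * complex.Im (G x) + complex.Im c * complex.Re (G x)).
  by apply/funext => x; rewrite ImM.
by have [_ [_ []]] := integrable_lin (complex.Re c) (complex.Im c) gi gr.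
Qed.

Lemma cintD G H : cintegrable D G -> cintegrable D H ->
  cint D (fun x => G x + H x) = cint D G + cint D H.
Proof.
move=> [gr gi] [hr hi]; apply: complex_eq; rewrite /cint ?ReD ?ImD /=.
  rewrite -RintegralD//; apply: eq_Rintegral => x _; exact: ReD.
rewrite -RintegralD//; apply: eq_Rintegral => x _; exact: ImD.
Qed.

Lemma cintZ G c : cintegrable D G -> cint D (fun x => c * G x) = c * cint D G.
Proof.
move=> [gr gi]; apply: complex_eq; rewrite /cint ?ReM ?ImM /=.
  have [_ [_ [_ E]]] := integrable_lin (complex.Re c) (- complex.Im c) gr gi.
  rewrite mulNr in E; rewrite -E.
    by apply: eq_Rintegral => x _; rewrite ReM mulNr.
have [_ [_ [_ <-]]] := integrable_lin (complex.Re c) (complex.Im c) gi gr.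
by apply: eq_Rintegral => x _; rewrite ImM.
Qed.

Lemma cint_sum (F : nat -> T -> R[i]) n : (forall k, cintegrable D (F k)) ->
  cintegrable D (fun x => \sum_(0 <= k < n) F k x) /\
  cint D (fun x => \sum_(0 <= k < n) F k x) = \sum_(0 <= k < n) cint D (F k).
Proof.
move=> h; elim: n => [|n [IH1 IH2]].
  have -> : (fun x => \sum_(0 <= k < 0) F k x) = (fun x => 0 * F 0%N x).
    by apply/funext => x; rewrite big_nil mul0r.
  by split; [exact: cintegrableZ | rewrite cintZ// mul0r big_nil].
have -> : (fun x => \sum_(0 <= k < n.+1) F k x) = (fun x => (\sum_(0 <= k < n) F k x) + F n x).
  by apply/funext => x; rewrite big_nat_recr.
by split; [exact: cintegrableD | rewrite cintD// IH2 big_nat_recr].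
Qed.

Lemma eq_cint G H : (forall x, D x -> G x = H x) -> cint D G = cint D H.
Proof.
by move=> e; rewrite /cint; congr (_ +i* _); apply: eq_Rintegral => x; rewrite inE => Dx; rewrite e.
Qed.

(** The constant [2] comes from estimating real and imaginary parts separately. *)
Lemma cabs_cint G : cmeas D G ->
  ((cabs (cint D G))%:E <= 2%:E * \int[mu]_(x in D) (cabs (G x))%:E)%E.
Proof.
move=> mG; have [fin|] := ltP (\int[mu]_(x in D) (cabs (G x))%:E)%E +oo%E; last first.
  by rewrite leye_eq => /eqP ->; rewrite gt0_muley ?lte_fin// leey.
have mc := cmeas_cabs mG; have [mr mi] := mG; have [ir ii] := cintegrableP mG fin.
apply: (@le_trans _ _ (`|\int[mu]_(x in D) complex.Re (G x)|%:E + `|\int[mu]_(x in D) complex.Im (G x)|%:E)%E).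
  by rewrite -EFinD lee_fin; exact: cabs_ReIm.
rewrite mule_natl mule2n !EFin_normr_Rintegral//.
apply: leeD.
  apply: (le_trans (le_abse_integral _ mD _)); first exact/measurable_EFinP.
  exact: (le_abs_integral mr mc (fun x => cabs_Re (G x))).
apply: (le_trans (le_abse_integral _ mD _)); first exact/measurable_EFinP.
exact: (le_abs_integral mi mc (fun x => cabs_Im (G x))).
Qed.

End ComplexIntegral.

(** * The kernel of the projection *)
Section PowerSeriesTail.
Context {R : realType}.
Implicit Types (a : nat -> R[i]) (z : R[i]).

Lemma csum_finite a N : (forall n, (N <= n)%N -> a n = 0) -> csum a = \sum_(0 <= n < N) a n.
Proof.
move=> h.
have E M : (N <= M)%N -> \sum_(0 <= n < M) a n = \sum_(0 <= n < N) a n.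
  move=> NM; rewrite (big_cat_nat (leq0n N) NM)/= [X in _ + X]big_nat_cond [X in _ + X]big1 ?addr0// => n.
  by rewrite andbT => /andP[+ _] => /h.
have sm : abs_summable a.
  have hh n : (N <= n)%N -> cabs (a n) = 0 by move=> /h ->; rewrite cabs0.
  apply/cvg_ex; exists (\sum_(0 <= n < N) cabs (a n)).
  apply: cvg_near_cst; exists N => // M /= NM.
  rewrite /series /= (big_cat_nat (leq0n N) NM)/= [X in _ + X]big_nat_cond [X in _ + X]big1 ?addr0// => n.
  by rewrite andbT => /andP[+ _] => /hh.
apply: csum_unique => //; apply: cvg_near_cst; exists N => // M /= NM.
by rewrite E// subrr cabs0.
Qed.

(** The square in the hypothesis leaves a factor [s ^+ N] after summation. *)
Lemma pser_tail a (r C s : R) : 0 <= r -> 0 <= C -> 0 < s < 1 ->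
  (forall k, cabs (a k) * r ^+ k <= C * s ^+ k ^+ 2) ->
  forall z N, cabs z <= r ->
  cabs (pser a z - \sum_(0 <= k < N) a k * z ^+ k) <= C / (1 - s) * s ^+ N.
Proof.
move=> r0 C0 /andP[s0 s1] h z N zr.
have s01 : 0 <= s < 1 by rewrite ltW.
have hz k : cabs (a k * z ^+ k) <= C * s ^+ k ^+ 2.
  apply: le_trans (h k); rewrite cabsM cabsX ler_wpM2l ?cabs_ge0//.
  by rewrite lerXn2r// nnegrE ?cabs_ge0.
have sk k : 0 <= s ^+ k by rewrite exprn_ge0// ltW.
have sk1 k : s ^+ k <= 1 by rewrite exprn_ile1// ltW.
have gs := @cvg_geom R C s s01.
pose u k := a k * z ^+ k; pose v k := if (k < N)%N then u k else 0.
have su : abs_summable u.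
  apply: (abs_summable_le _ gs) => k; apply: (le_trans (hz k)).
  by rewrite ler_wpM2l// expr2 ler_piMl.
have sv : abs_summable v.
  apply: (abs_summable_le _ gs) => k; rewrite /v; case: ifP => _.
    by apply: (le_trans (hz k)); rewrite ler_wpM2l// expr2 ler_piMl.
  by rewrite cabs0 mulr_ge0.
have -> : \sum_(0 <= k < N) a k * z ^+ k = csum v.
  rewrite (@csum_finite v N); last by move=> n; rewrite leqNgt /v => /negbTE ->.
  by apply: eq_big_nat => k /andP[_ kN]; rewrite /v kN.
rewrite /pser -csumB//.
have -> : C / (1 - s) * s ^+ N = limn (series (fun k => C * s ^+ k)) * s ^+ N.
  congr (_ * _); apply/esym/cvg_lim => //.
  by have := @cvg_geometric_series _ C s; rewrite ger0_norm ?(ltW s0)//; apply.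
apply: csum_leM => // k; rewrite /v; have [kN|kN] := ltnP k N.
  by rewrite subrr cabs0 !mulr_ge0.
rewrite subr0; apply: (le_trans (hz k)); rewrite -mulrA ler_wpM2l// expr2.
by rewrite ler_wpM2l// -(subnK kN) exprD ler_piMl.
Qed.

Lemma subexp_tail a (r : R) : subexp a -> 0 <= r < 1 ->
  exists2 s : R, 0 < s < 1 & exists2 C : R, 0 <= C &
  forall z N, cabs z <= r ->
  cabs (pser a z - \sum_(0 <= k < N) a k * z ^+ k) <= C * s ^+ N.
Proof.
move=> sa r01; have [q /andP[q0 q1] [C C0 hC]] := subexp_geom sa r01.
pose s := Num.sqrt q.
have s2 : s ^+ 2 = q by rewrite sqr_sqrtr// ltW.
have s0 : 0 < s by rewrite sqrtr_gt0.
have s1 : s < 1 by rewrite -sqrtr1 ltr_sqrt.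
exists s; first by rewrite s0.
exists (C / (1 - s)); first by rewrite divr_ge0// subr_ge0 ltW.
have /andP[r0 _] := r01.
apply: pser_tail => //; first by rewrite s0.
by move=> k; rewrite -exprM mulnC exprM s2.
Qed.

End PowerSeriesTail.

Section Kernel.
Context {R : realType}.
Variables (a b0 : R) (m : nat).
Hypotheses (a1 : -1 < a) (b1 : -1 < b0) (b00 : b0 <= 0).
Let b := b0 + m%:R.
Local Notation h := (fun n : nat => (hcoef a b0 n)%:C : R[i]).

Lemma BetaE (x y : R) : Beta (x + 1) (y + 1) = fine (betaint x y).
Proof. by rewrite /Beta /betaint /Rintegral !addrK. Qed.

Lemma Beta_gt0 (x y : R) : -1 < x -> -1 < y -> 0 < Beta (x + 1) (y + 1).
Proof. by move=> x1 y1; rewrite BetaE fine_gt0// betaint_gt0//= betaint_lty. Qed.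

Lemma bnat : (b \is a Num.nat) = (b0 == 0).
Proof.
move: b1 b00 => b1' b00'; apply/idP/eqP => [/natrP[n bn]|b0E]; last by rewrite /b b0E add0r natr_nat.
have e : b0 = n%:R - m%:R by rewrite -bn /b addrK.
have [nm|nm] := leqP n m; last by move: nm; rewrite -(ltr_nat R); lra.
have [mn|mn] := leqP m n; first by rewrite e (_ : n = m) ?subrr//; apply/eqP; rewrite eqn_leq nm.
by move: mn; rewrite -(ler_nat R) -(natr1 n); lra.
Qed.

Lemma int_part_b : int_part b = m.
Proof. exact: int_partE. Qed.

Lemma frac_part_b : frac_part b = b0.
Proof. by rewrite /frac_part int_part_b /b addrK. Qed.

Lemma bgt : -1 < b.
Proof. by move: b1 => b1'; rewrite /b; have := ler0n R m; lra. Qed.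

Lemma Q_nonnat xi : b0 != 0 -> disc xi ->
  Q a b xi = (Beta (a + 1) (b + 1) / Beta (a + 1) (b0 + 1))%:C * pser (qcoef a b0) xi.
Proof.
move=> b0n xi1; rewrite /Q bnat (negbTE b0n) frac_part_b; congr (_ * _).
have sq := subexp_abs_summable (@subexp_qcoef R a b0 b1 b0n) xi1.
rewrite /pser -(csum_limn sq); apply: (congr1 (fun u : nat -> R[i]^o => limn u)).
apply/funext => N; apply: eq_bigr => n _.
rewrite /qcoef; have -> : binc (a + 1) n = (-1) ^+ n * (gbinom (a + 1) n)%:C by rewrite /binc rmorphM rmorphXn rmorphN rmorph1.
rewrite [(- xi) ^+ n]exprNn; set u := (-1) ^+ n; set v := (_ + _)^-1; set y := (gbinom _ _)%:C.
by ring.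
Qed.

(** The quotient of [Q] by the power of [1 - xi] has positive coefficients. *)
Lemma Q_kernel : exists2 k : R, 0 < k & forall xi, disc xi ->
  Q a b xi = k%:C * (pser h xi * cpow (1 - xi) (2 + a)).
Proof.
have B1 := Beta_gt0 a1 bgt; have B2 := Beta_gt0 a1 b1.
have [b0E|b0n] := eqVneq b0 0.
  exists ((a + 1) * Beta (a + 1) (b + 1)).
    by apply: mulr_gt0 B1; rewrite -ltrBlDr sub0r.
  by move=> xi xi1; rewrite /Q bnat b0E eqxx [2 + a]addrC kernel_series0// mulr1.
exists (Beta (a + 1) (b + 1) / Beta (a + 1) (b0 + 1)); first exact: divr_gt0 B1 B2.
by move=> xi xi1; rewrite Q_nonnat// [2 + a]addrC kernel_seriesN.
Qed.

(** The exponent [a + 1] of the binomial series is positive, so its coefficients are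
    summable. *)
Lemma Q_bounded : exists2 C : R, 0 <= C & forall xi, disc xi -> cabs (Q a b xi) <= C.
Proof.
have [b0E|b0n] := eqVneq b0 0.
  exists `|(a + 1) * Beta (a + 1) (b + 1)| => // xi _.
  by rewrite /Q bnat b0E eqxx cabsR.
have a10 : 0 < a + 1 by move: a1 => a1'; lra.
have [K K0 hK] := @qcoef_le R a b0 b1 b0n.
have cs : cvgn (series (fun n => K * cabs (binc (a + 1) n))).
  have := @is_cvg_seriesZ R _ K (binc_summable a10); exact.
exists (`|Beta (a + 1) (b + 1) / Beta (a + 1) (b0 + 1)| * limn (series (fun n => K * cabs (binc (a + 1) n)))).
  rewrite mulr_ge0//; apply: limr_ge => //; apply: nearW => n.
  by apply: sumr_ge0 => i _; rewrite mulr_ge0 ?cabs_ge0.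
move=> xi xi1; rewrite Q_nonnat// cabsM cabsR ler_wpM2l//.
apply: csum_le cs => n; rewrite cabsM; apply: le_trans (hK n).
by rewrite ler_piMr ?cabs_ge0// cabsX exprn_ile1 ?cabs_ge0 ?ltW.
Qed.

End Kernel.

(** * The projection *)
Section Density.
Context {R : realType}.
Notation area := (@lebesgue_measure R \x @lebesgue_measure R)%E.
Variables (a b : R).
Hypotheses (a1 : -1 < a) (b1 : -1 < b).
Implicit Types (z w : R * R) (F : R[i] -> R[i]).

(** The factor between [wt] and [density]. *)
Definition kap : R := (Beta (a + 1) (b + 1))^-1 / pi.

Lemma kap_gt0 : 0 < kap.
Proof. by rewrite divr_gt0 ?pi_gt0// invr_gt0 Beta_gt0. Qed.

Definition dens w : R := kap * wt a b w.

Lemma densE w : dens w = kap * wt a b w.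
Proof. by []. Qed.

Lemma dens_ge0 w : 0 <= dens w.
Proof. by rewrite mulr_ge0 ?wt_ge0// ltW// kap_gt0. Qed.

Lemma measurable_dens : measurable_fun setT dens.
Proof. by apply: measurable_funM; [exact: measurable_cst | exact: measurable_wt]. Qed.

Lemma sqnormE w : sqnorm w = cabs (plane w) ^+ 2.
Proof. by rewrite cabs_sqr. Qed.

Lemma disc_xyE w : (w \in (disc_xy : set (R * R))) = (sqnorm w < 1).
Proof.
rewrite sqnormE; apply/idP/idP.
  by rewrite inE => w1; rewrite exprn_ilt1 ?cabs_ge0.
move=> w1; rewrite inE /disc_xy /disc /=; have := cabs_ge0 (plane w); nra.
Qed.

Lemma dens_disc w : (w \in (disc_xy : set (R * R)))%:R * density a b (plane w) = dens w.
Proof.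
rewrite disc_xyE /dens /wt /density /kap sqnormE (powR_sqr _ (cabs_ge0 _)).
by ring.
Qed.

Lemma dens_out w : ~~ (sqnorm w < 1) -> dens w = 0.
Proof. by rewrite /dens /wt => /negbTE ->; rewrite mul0r mulr0. Qed.

Definition npow p (G : R * R -> R[i]) : \bar R := (\int[area]_w (dens w * cabs (G w) `^ p)%:E)%E.

Lemma bnormE p F : bnorm a b p F = (npow p (F \o plane) `^ p^-1)%E.
Proof.
congr (_ `^ _)%E; rewrite integral_gate; apply: eq_integral => w _ /=.
by rewrite -dens_disc; congr (_%:E); ring.
Qed.

Lemma cintegralE F : cintegral a b F = cint area setT (fun w => (dens w)%:C * F (plane w)).
Proof.
rewrite /cintegral /cint; congr (_ +i* _); rewrite Rintegral_mkcond;
  apply: eq_Rintegral => w _; rewrite patchE ?ReM ?ImM /= -dens_disc;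
  by case: ifP => _; rewrite ?mul1r ?mul0r ?subr0 ?addr0// mulrC.
Qed.

Lemma radial_beta_pos c s : -1 < c -> -1 < s ->
  (\int[area]_z ((0 < sqnorm z < 1)%R%:R * (sqnorm z `^ c * (1 - sqnorm z) `^ s))%:E = @disc_area R * betaint c s)%E.
Proof.
move=> c2 s1.
have mg : measurable_fun setT (fun t : R => ((0 < t < 1)%R%:R * (t `^ c * (1 - t) `^ s))%:E).
  by apply/measurable_EFinP; mfun.
rewrite (integral_radial mg); last by move=> t; rewrite lee_fin !mulr_ge0// powR_ge0.
have mg0 : measurable_fun (`]0, +oo[%classic : set R) (fun t : R => ((0 < t < 1)%R%:R * (t `^ c * (1 - t) `^ s))%:E).
  exact: measurable_funTS.
rewrite -(@integral_itv_obnd_cbnd R 0 +oo%O _ mg0) betaintE integral_gate; congr (_ * _)%E.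
by apply: eq_integral => t _; rewrite mem_setE in_itv /= andbT mulrA -natrM mulnb andbA andbb.
Qed.

Lemma dens_powerE c : -1 < b + c ->
  (\int[area]_w ((0 < sqnorm w)%R%:R * (dens w * sqnorm w `^ c))%:E =
   kap%:E * (@disc_area R * betaint (b + c) a))%E.
Proof.
move=> bc; rewrite -(radial_beta_pos bc a1).
have msq := @measurable_sqnorm R.
have mf : measurable_fun setT (fun z : R * R => ((0 < sqnorm z < 1)%R%:R * (sqnorm z `^ (b + c) * (1 - sqnorm z) `^ a))%:E).
  by apply/measurable_EFinP; mfun.
have f0 (z : R * R) : (0 <= ((0 < sqnorm z < 1)%R%:R * (sqnorm z `^ (b + c) * (1 - sqnorm z) `^ a))%:E)%E.
  by rewrite lee_fin !mulr_ge0// powR_ge0.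
rewrite -(area_integralZl (ltW kap_gt0) mf f0); apply: eq_integral => w _.
rewrite -EFinM; congr (_%:E); rewrite /dens /wt.
have [w0|w0] /= := ltP 0 (sqnorm w); last by rewrite !(mul0r, mulr0).
by rewrite powRD ?(gt_eqF w0) ?implybT//; ring.
Qed.

Lemma dens_power_fin c : -1 < b + c -> exists2 K : R, 0 < K &
  (\int[area]_w ((0 < sqnorm w)%R%:R * (dens w * sqnorm w `^ c))%:E = K%:E)%E.
Proof.
move=> bc; rewrite dens_powerE//.
have bfin : betaint (b + c) a \is a fin_num.
  by rewrite ge0_fin_numE ?betaint_ge0// betaint_lty.
have dfin : @disc_area R \is a fin_num.
  by rewrite ge0_fin_numE ?disc_area_lty// ltW// disc_area_gt0.
exists (kap * (fine (@disc_area R) * fine (betaint (b + c) a))); last by rewrite !EFinM !fineK.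
apply: mulr_gt0 kap_gt0 _; apply: mulr_gt0; apply: fine_gt0.
  by rewrite disc_area_gt0 disc_area_lty.
by rewrite betaint_gt0// betaint_lty.
Qed.

End Density.

Ltac pos := repeat first [ assumption | by apply: dens_ge0 | exact: wt_ge0 | exact: absker_ge0
  | exact: cabs_ge0 | exact: powR_ge0 | exact: ler0n | apply: mulr_ge0 ].

Section Projection.
Context {R : realType}.
Notation area := (@lebesgue_measure R \x @lebesgue_measure R)%E.
Variables (a b0 : R) (m : nat).
Hypotheses (a1 : -1 < a) (b1 : -1 < b0) (b00 : b0 <= 0).
Let b := b0 + m%:R.
Let M : R := m%:R / 2.
Let b1' : -1 < b := bgt m b1.
Local Notation dens := (dens a b).
Local Notation npow := (npow a b).
Implicit Types (z w : R * R) (F : R[i] -> R[i]).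

Definition kern z w : R[i] := Q a b (plane z * (plane w)^*) /
  ((plane z * (plane w)^*) ^+ m * cpow (1 - plane z * (plane w)^*) (2 + a)).

Lemma projectionE F z :
  projection a b F (plane z) = cint area setT (fun w => (dens w)%:C * (F (plane w) * kern z w)).
Proof. by rewrite /projection cintegralE /kern int_partE. Qed.

Lemma cabs_prod_lt1 z w : sqnorm z < 1 -> sqnorm w < 1 -> cabs (plane z * (plane w)^*) < 1.
Proof.
rewrite !sqnormE cabsM cabsJ => z1 w1.
by have := cabs_ge0 (plane z); have := cabs_ge0 (plane w); nra.
Qed.

Lemma cdist_gt0 z w : sqnorm z < 1 -> sqnorm w < 1 -> 0 < cdist z w.
Proof.
by move=> z1 w1; rewrite cdistE exprn_gt0// cabs_gt0 one_minus_neq0// cabs_prod_lt1.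
Qed.

Lemma cdist_le4 z w : sqnorm z < 1 -> sqnorm w < 1 -> cdist z w <= 4.
Proof.
move=> z1 w1; have h := cabs_prod_lt1 z1 w1; rewrite cdistE.
have h2 : cabs (1 - plane z * (plane w)^*) <= 2.
  by have := cabsD 1 (- (plane z * (plane w)^*)); rewrite cabs1 cabsN; lra.
by have := cabs_ge0 (1 - plane z * (plane w)^*); nra.
Qed.

Lemma sqnorm_powM z : cabs (plane z ^+ m)^-1 = sqnorm z `^ (- M).
Proof.
rewrite cabsV cabsX sqnormE (powR_sqr _ (cabs_ge0 _)).
have -> : 2 * - M = - m%:R by rewrite /M; field.
by rewrite powRN (powR_mulrn m (cabs_ge0 _)).
Qed.

(** A bound for [Q] is a bound for the kernel relative to [absker]. *)
Lemma kern_bound : exists2 C : R, 0 <= C & forall z w, 0 < sqnorm z < 1 -> 0 < sqnorm w < 1 ->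
  cabs (kern z w) <= C * absker a M (z, w).
Proof.
have [C C0 hC] := Q_bounded m a1 b1 b00; exists C => // z w hz hw.
rewrite /absker /= hz hw !mul1r /kern.
have [/andP[z0 z1] /andP[w0 w1]] := (hz, hw).
rewrite exprMn invfM [(plane z ^+ m * _)^-1]invfM !cabsM sqnorm_powM.
have -> : cabs ((plane w)^* ^+ m)^-1 = sqnorm w `^ (- M).
  by rewrite cabsV cabsX cabsJ -cabsX -cabsV; exact: sqnorm_powM.
rewrite cabsV cabs_cpow -powRN.
have -> : cabs (1 - plane z * (plane w)^*) `^ (- (2 + a)) = cdist z w `^ (- (1 + a / 2)).
  rewrite cdistE (powR_sqr _ (cabs_ge0 _)); congr (_ `^ _); by field.
rewrite ler_wpM2r ?mulr_ge0 ?powR_ge0//.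
by apply: hC; exact: cabs_prod_lt1.
Qed.

Lemma cmeas_plane : cmeas setT (@plane R).
Proof. by split => /=; [exact: measurable_fst | exact: measurable_snd]. Qed.

Lemma kern_pser : exists2 k : R, 0 < k & forall z w, sqnorm z < 1 -> sqnorm w < 1 ->
  kern z w = k%:C * pser (fun n => (hcoef a b0 n)%:C) (plane z * (plane w)^*) /
    (plane z * (plane w)^*) ^+ m.
Proof.
have [k k0 hk] := Q_kernel m a1 b1 b00; exists k => // z w z1 w1.
have d1 := cabs_prod_lt1 z1 w1; rewrite /kern hk//.
set xi := plane z * (plane w)^*; set c := cpow _ _; set p := pser _ _.
have c0 : c != 0 by rewrite /c cpow_neq0// one_minus_neq0.
rewrite invfM; set x := (xi ^+ m)^-1; set c' := c^-1.
transitivity (k%:C * p * x * (c * c')); first by ring.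
by rewrite /c' mulfV// mulr1.
Qed.

Lemma cmeas_kern z : sqnorm z < 1 -> cmeas setT (fun w => (dens w)%:C * kern z w).
Proof.
move=> z1; have [k k0 hk] := kern_pser.
pose h : nat -> R[i] := fun n => (hcoef a b0 n)%:C.
pose xi w := plane z * (plane w)^*.
have mxi : cmeas setT xi by apply: cmeasM; [exact: cmeas_cst | apply: cmeasJ; exact: cmeas_plane].
have md : cmeas setT (fun w => (dens w)%:C) by apply: cmeas_real; exact: measurable_dens.
have sh := subexp_hcoef a1 b1.
have mps : cmeas setT (fun w => (dens w)%:C * pser h (xi w)).
  apply: (@cmeas_lim _ _ _ _ (fun N w => (dens w)%:C * \sum_(0 <= n < N) h n * xi w ^+ n)).
    move=> N; apply: cmeasM => //; apply: (@cmeas_sum _ _ _ _ (fun n w => h n * xi w ^+ n)) => n.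
    by apply: cmeasM; [exact: cmeas_cst | exact: cmeasX].
  move=> w _; have [w1|w1] := boolP (sqnorm w < 1); last first.
    rewrite (dens_out _ _ w1); apply: cvg_near_cst; apply: nearW => n.
    by rewrite !mul0r subrr cabs0.
  have lim := csum_cvg (subexp_abs_summable sh (cabs_prod_lt1 z1 w1)).
  have : (fun N => dens w * cabs (\sum_(0 <= n < N) h n * xi w ^+ n - csum (fun n => h n * xi w ^+ n))) @ \oo --> dens w * 0.
    by apply: cvgM lim; exact: cvg_cst.
  rewrite mulr0; apply: cvg_trans; apply: near_eq_cvg; apply: nearW => N.
  by rewrite -mulrBr cabsM cabsR ger0_norm// dens_ge0.
have -> : (fun w => (dens w)%:C * kern z w) = (fun w => (k%:C * ((dens w)%:C * pser h (xi w))) * (xi w ^+ m)^-1).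
  apply/funext => w; have [w1|w1] := boolP (sqnorm w < 1); last by rewrite (dens_out _ _ w1) !(mul0r, mulr0).
  by rewrite hk// -/(xi w) -/h !mulrA [(dens w)%:C * _]mulrC.
apply: cmeasM; last by apply: cmeasV; exact: cmeasX.
by apply: cmeasM => //; exact: cmeas_cst.
Qed.

Lemma cmeas_integrand F z : sqnorm z < 1 -> cmeas setT (F \o @plane R) ->
  cmeas setT (fun w => (dens w)%:C * (F (plane w) * kern z w)).
Proof.
move=> z1 mF; have := cmeasM mF (cmeas_kern z1).
by under eq_fun do rewrite /= mulrCA.
Qed.

Lemma projection_abs : exists2 C : R, 0 <= C & forall F z, cmeas setT (F \o @plane R) -> F 0 = 0 ->
  0 < sqnorm z < 1 ->
  ((cabs (projection a b F (plane z)))%:E <=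
   C%:E * \int[area]_w (dens w * absker a M (z, w) * cabs (F (plane w)))%:E)%E.
Proof.
have [C C0 hC] := kern_bound; exists (2 * C); first by rewrite mulr_ge0.
move=> F z mF F0 hz; have /andP[z0 z1] := hz.
have mi := cmeas_integrand z1 mF.
rewrite projectionE; apply: (le_trans (@cabs_cint _ _ _ area setT measurableT _ mi)).
rewrite EFinM -muleA; apply: lee_wpmul2l; first by rewrite lee_fin.
have mc := cmeas_cabs mF.
have mk := measurable_slice z (measurable_absker a M).
have md := measurable_dens a b.
have mg : measurable_fun setT (fun w => (dens w * absker a M (z, w) * cabs (F (plane w)))%:E).
  apply/measurable_EFinP; apply: measurable_funM mc; exact: measurable_funM.
have g0 w : (0 <= (dens w * absker a M (z, w) * cabs (F (plane w)))%:E)%E.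
  by rewrite lee_fin; pos.
rewrite -(area_integralZl C0 mg g0); apply: area_le_integral.
- by apply/measurable_EFinP; exact: cmeas_cabs mi.
- by move=> w; rewrite lee_fin cabs_ge0.
- exact: measurable_funeM.
move=> w; rewrite -EFinM lee_fin cabsM cabsR ger0_norm ?dens_ge0// cabsM.
have [w1|w1] := boolP (sqnorm w < 1); last by rewrite (dens_out _ _ w1) !(mul0r, mulr0).
have [w0|w0] := ltP 0 (sqnorm w); last first.
  have w00 : plane w = 0.
    by apply/eqP; rewrite -cabs_eq0 -sqrf_eq0 -sqnormE eq_le w0 sqnorm_ge0.
  by rewrite w00 F0 cabs0 !(mul0r, mulr0).
have hw : 0 < sqnorm w < 1 by rewrite w0.
have d0 : 0 <= dens w by exact: dens_ge0.
apply: (le_trans (ler_wpM2l d0 (ler_wpM2l (cabs_ge0 _) (hC _ _ hz hw)))).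
by apply: eq_ler; ring.
Qed.

Variables (p q : R).
Hypotheses (p1 : 1 < p) (pq : p^-1 + q^-1 = 1) (Mp : M * p < b + 1) (Mq : M * q < b + 1).

Lemma schur_dens : exists2 C : R, 0 <= C & forall F : R * R -> R,
  measurable_fun setT F -> (forall w, 0 <= F w) ->
  (\int[area]_z ((dens z)%:E * (\int[area]_w (dens w * absker a M (z, w) * F w)%:E) `^ p) <=
   C%:E * \int[area]_w (dens w * F w `^ p)%:E)%E.
Proof.
have M0 : 0 <= M by rewrite /M divr_ge0.
have [C C0 hC] := bergman_schur a1 b1' p1 pq M0 Mp Mq.
pose K := kap a b; have K0 : 0 < K by exact: kap_gt0.
exists (K `^ p * C); first by rewrite mulr_ge0 ?powR_ge0.
move=> F mF F0; have mw := @measurable_wt R a b.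
have mk := measurable_absker a M.
have mFp : measurable_fun setT (fun w => (wt a b w * F w `^ p)%:E).
  by apply/measurable_EFinP; apply: measurable_funM => //; exact: measurable_powR_comp.
have Fp0 w : (0 <= (wt a b w * F w `^ p)%:E)%E by rewrite lee_fin mulr_ge0 ?wt_ge0 ?powR_ge0.
have -> : (\int[area]_w (dens w * F w `^ p)%:E = K%:E * \int[area]_w (wt a b w * F w `^ p)%:E)%E.
  by rewrite -(area_integralZl (ltW K0) mFp Fp0); apply: eq_integral => w _; rewrite -EFinM mulrA.
pose I z : \bar R := (\int[area]_w (wt a b w * absker a M (z, w) * F w)%:E)%E.
have I0 z : (0 <= I z)%E.
  by apply: integral_ge0 => w _; rewrite lee_fin; pos.
have Iz z : (\int[area]_w (dens w * absker a M (z, w) * F w)%:E = K%:E * I z)%E.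
  have mi : measurable_fun setT (fun w => (wt a b w * absker a M (z, w) * F w)%:E).
    apply/measurable_EFinP; apply: measurable_funM => //; apply: measurable_funM => //.
    exact: measurable_slice.
  have i0 w : (0 <= (wt a b w * absker a M (z, w) * F w)%:E)%E.
    by rewrite lee_fin; pos.
  rewrite /I -(area_integralZl (ltW K0) mi i0); apply: eq_integral => w _.
  by rewrite -EFinM; congr (_%:E); rewrite densE -/K; ring.
have mI : measurable_fun setT I.
  have mG : measurable_fun setT (fun v : (R * R) * (R * R) => (wt a b v.2 * absker a M v * F v.2)%:E).
    apply/measurable_EFinP; apply: measurable_funM.
      by apply: measurable_funM => //; apply: (measurableT_comp mw); exact: measurable_snd.
    by apply: (measurableT_comp mF); exact: measurable_snd.
  have G0 v : (0 <= (wt a b v.2 * absker a M v * F v.2)%:E)%E.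
    by rewrite lee_fin; pos.
  have := @measurable_fun_fubini_tonelli_F _ _ _ _ _ (@plane_measure R) _ mG G0; exact.
have mW : measurable_fun setT (fun z => (wt a b z)%:E * I z `^ p)%E.
  apply: emeasurable_funM; first exact/measurable_EFinP.
  exact: (measurableT_comp (measurable_poweR p) mI).
have W0 z : (0 <= (wt a b z)%:E * I z `^ p)%E by rewrite mule_ge0 ?lee_fin ?wt_ge0// poweR_ge0.
have -> : (\int[area]_z ((dens z)%:E * (\int[area]_w (dens w * absker a M (z, w) * F w)%:E) `^ p) =
   (K * K `^ p)%:E * \int[area]_z ((wt a b z)%:E * I z `^ p))%E.
  have KK : 0 <= K * K `^ p by rewrite mulr_ge0 ?powR_ge0 ?ltW.
  rewrite -(area_integralZl KK mW W0); apply: eq_integral => z _.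
  rewrite Iz poweRM ?lee_fin ?(ltW K0)// poweR_EFin !muleA -!EFinM; congr (_%:E * _)%E.
  by rewrite densE -/K; ring.
apply: (le_trans (lee_wpmul2l _ (hC _ mF F0))); first by rewrite lee_fin mulr_ge0 ?powR_ge0 ?ltW.
rewrite !muleA -!EFinM; apply: eq_lee; congr (_%:E * _)%E; ring.
Qed.

(** Its finiteness gives absolute convergence of the moments and of the projection. *)
Definition Jint F : \bar R :=
  (\int[area]_w ((0 < sqnorm w)%R%:R * (dens w * sqnorm w `^ (- M) * cabs (F (plane w))))%:E)%E.

(** The kernel is bounded below, so the estimate for the absolute kernel also
    bounds a fixed weighted mean of [F]. *)
Lemma Jint_bound : exists2 C : R, 0 <= C & forall F, cmeas setT (F \o @plane R) ->
  (Jint F `^ p <= C%:E * npow p (F \o @plane R))%E.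
Proof.
have [C C0 hC] := schur_dens.
have b10 : -1 < b + 0 by rewrite addr0.
have [D D0 hD] := dens_power_fin a1 b1' b10.
have p0 : 0 < p by apply: lt_trans p1.
pose c : R := 4 `^ (- (1 + a / 2)); have c0 : 0 < c by rewrite powR_gt0.
pose e := c `^ p * D; have e0 : 0 < e by rewrite mulr_gt0 ?powR_gt0.
exists (e^-1 * C); first by rewrite mulr_ge0// invr_ge0 ltW.
move=> F mF; have mc := cmeas_cabs mF.
pose f w := cabs (F (plane w)).
have := hC f mc (fun w => cabs_ge0 _).
rewrite -/(npow p (F \o @plane R)).
set I := (X in (X <= _)%E) => hI.
have J0 : (0 <= Jint F)%E.
  by apply: integral_ge0 => w _; rewrite lee_fin; pos.
suff : (e%:E * Jint F `^ p <= I)%E.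
  move=> h; have h2 := le_trans h hI.
  have -> : (Jint F `^ p = (e^-1)%:E * (e%:E * Jint F `^ p))%E.
    by rewrite muleA -EFinM mulVf ?gt_eqF// mul1e.
  have ei : (0 <= (e^-1)%:E)%E by rewrite lee_fin invr_ge0 ltW.
  by apply: (le_trans (lee_wpmul2l ei h2)); apply: eq_lee; rewrite muleA -EFinM.
have md := measurable_dens a b.
have msq := @measurable_sqnorm R.
have mk := measurable_absker a M.
have mg : measurable_fun setT (fun z => ((0 < sqnorm z)%R%:R * (dens z * sqnorm z `^ 0))%:E).
  by apply/measurable_EFinP; mfun.
have g0 z : (0 <= ((0 < sqnorm z)%R%:R * (dens z * sqnorm z `^ 0))%:E)%E.
  by rewrite lee_fin; pos.
have -> : (e%:E * Jint F `^ p = \int[area]_z (((c `^ p)%:E * Jint F `^ p) * ((0 < sqnorm z)%R%:R * (dens z * sqnorm z `^ 0))%:E))%E.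
  rewrite ge0_integralZl//; last by rewrite mule_ge0 ?lee_fin ?powR_ge0// poweR_ge0.
  by rewrite hD /e EFinM muleAC.
apply: area_le_integral.
- exact: measurable_funeM.
- by move=> z; rewrite mule_ge0// mule_ge0 ?lee_fin ?powR_ge0// poweR_ge0.
- apply: emeasurable_funM; first exact/measurable_EFinP.
  apply: (measurableT_comp (measurable_poweR p)).
  have mG : measurable_fun setT (fun v : (R * R) * (R * R) => (dens v.2 * absker a M v * f v.2)%:E).
    apply/measurable_EFinP; apply: measurable_funM.
      by apply: measurable_funM => //; apply: (measurableT_comp md); exact: measurable_snd.
    by apply: (measurableT_comp mc); exact: measurable_snd.
  have G0 v : (0 <= (dens v.2 * absker a M v * f v.2)%:E)%E.
    by rewrite lee_fin; pos.
  have := @measurable_fun_fubini_tonelli_F _ _ _ _ _ (@plane_measure R) _ mG G0; exact.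
move=> z; have [z0|z0] := ltP 0 (sqnorm z); last first.
  by rewrite mul0r mule0 mule_ge0 ?lee_fin ?dens_ge0// poweR_ge0.
have [z1|z1] := boolP (sqnorm z < 1); last by rewrite (dens_out _ _ z1) !(mul0r, mulr0) mule0 mul0e.
rewrite powRr0 mulr1 mul1r muleC; apply: lee_wpmul2l; first by rewrite lee_fin dens_ge0.
have -> : ((c `^ p)%:E * Jint F `^ p = (c%:E * Jint F) `^ p)%E by rewrite poweRM ?lee_fin ?(ltW c0)// poweR_EFin.
have mJ : measurable_fun setT (fun w => ((0 < sqnorm w)%R%:R * (dens w * sqnorm w `^ (- M) * f w))%:E).
  by apply/measurable_EFinP; mfun.
have J0' w : (0 <= ((0 < sqnorm w)%R%:R * (dens w * sqnorm w `^ (- M) * f w))%:E)%E.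
  by rewrite lee_fin; pos.
have mK : measurable_fun setT (fun w => (dens w * absker a M (z, w) * f w)%:E).
  apply/measurable_EFinP; apply: measurable_funM => //; apply: measurable_funM => //.
  exact: measurable_slice.
have p0' := ltW p0.
apply: gt0_ler_poweR => //; rewrite ?in_itv /= ?leey ?andbT.
- by rewrite mule_ge0// lee_fin ltW.
- by apply: integral_ge0 => w _; rewrite lee_fin; pos.
rewrite /Jint -(area_integralZl (ltW c0) mJ J0'); apply: area_le_integral.
- exact: measurable_funeM.
- by move=> w; rewrite mule_ge0// lee_fin ltW.
- exact: mK.
move=> w; rewrite -EFinM lee_fin.
have [w1|w1] := boolP (sqnorm w < 1); last by rewrite (dens_out _ _ w1) !(mul0r, mulr0).
have [w0|w0] := ltP 0 (sqnorm w); last first.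
  by rewrite mul0r mulr0; pos.
rewrite mul1r /absker /= z0 z1 w0 w1 !mul1r.
have h1 : 1 <= sqnorm z `^ (- M).
  apply: (@le_trans _ _ (1 `^ (- M))); first by rewrite powR1.
  by apply: powR_anti => //; [exact: ltW | rewrite /M divr_ge0].
have h2 : c <= cdist z w `^ (- (1 + a / 2)).
  apply: powR_anti; [exact: cdist_gt0 | exact: cdist_le4 |].
  by move: a1 => a1'; lra.
have h3 : c <= sqnorm z `^ (- M) * cdist z w `^ (- (1 + a / 2)).
  by apply: (le_trans h2); rewrite ler_peMl ?powR_ge0.
have h4 : 0 <= dens w * sqnorm w `^ (- M) * f w by pos.
apply: (le_trans (ler_wpM2r h4 h3)); apply: eq_ler; ring.
Qed.

End Projection.

Section ProjectionSeries.
Context {R : realType}.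
Notation area := (@lebesgue_measure R \x @lebesgue_measure R)%E.
Variables (a b0 : R) (m : nat).
Hypotheses (a1 : -1 < a) (b1 : -1 < b0) (b00 : b0 <= 0).
Let b := b0 + m%:R.
Let M : R := m%:R / 2.
Let b1' : -1 < b := bgt m b1.
Local Notation dens := (dens a b).
Local Notation npow := (npow a b).
Local Notation h := (fun n : nat => (hcoef a b0 n)%:C : R[i]).
Local Notation kern := (kern a b0 m).
Local Notation Jint := (Jint a b0 m).
Implicit Types (z w : R * R) (F : R[i] -> R[i]).

Lemma cvg_geom0 (c s : R) : `|s| < 1 -> (fun N => c * s ^+ N) @ \oo --> (0 : R).
Proof. by move=> s1; rewrite -[X in _ --> X](mulr0 c); apply: cvgM; [exact: cvg_cst | exact: cvg_expr]. Qed.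

Lemma plane_eq0 w : ~~ (0 < sqnorm w) -> plane w = 0.
Proof.
rewrite -leNgt => w0; apply/eqP.
by rewrite -cabs_eq0 -sqrf_eq0 -sqnormE eq_le w0 sqnorm_ge0.
Qed.

Lemma plane_neq0 w : 0 < sqnorm w -> plane w != 0.
Proof. by rewrite sqnormE -cabs_eq0 -sqrf_eq0 => /gt_eqF ->. Qed.

Lemma measurable_Jbody F : cmeas setT (F \o @plane R) -> measurable_fun setT
  (fun w => ((0 < sqnorm w)%R%:R * (dens w * sqnorm w `^ (- M) * cabs (F (plane w))))%:E).
Proof.
move=> mF; have mc := cmeas_cabs mF; have md := measurable_dens a b.
by have msq := @measurable_sqnorm R; apply/measurable_EFinP; mfun.
Qed.

(** Everything dominated by the integrand of [Jint] is integrable. *)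
Lemma dominated_J F (G : R * R -> R[i]) (c : R) : cmeas setT (F \o @plane R) ->
  (Jint F < +oo)%E -> 0 <= c -> cmeas setT G ->
  (forall w, cabs (G w) <= c * ((0 < sqnorm w)%R%:R * (dens w * sqnorm w `^ (- M) * cabs (F (plane w))))) ->
  cintegrable area setT G /\ cabs (cint area setT G) <= 2 * (c * fine (Jint F)).
Proof.
move=> mF Jfin c0 mG hG.
have mJ := measurable_Jbody mF.
have J0 w : (0 <= ((0 < sqnorm w)%R%:R * (dens w * sqnorm w `^ (- M) * cabs (F (plane w))))%:E)%E.
  by rewrite lee_fin; pos.
have Jf : Jint F \is a fin_num by rewrite ge0_fin_numE//; exact: integral_ge0.
have le : (\int[area]_w (cabs (G w))%:E <= (c * fine (Jint F))%:E)%E.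
  rewrite EFinM fineK// -(area_integralZl c0 mJ J0); apply: area_le_integral.
  - by apply/measurable_EFinP; exact: cmeas_cabs mG.
  - by move=> w; rewrite lee_fin cabs_ge0.
  - exact: measurable_funeM.
  - by move=> w; rewrite -EFinM lee_fin.
split; first by apply: (@cintegrableP _ _ _ area setT measurableT _ mG); exact: le_lt_trans le (ltry _).
rewrite -lee_fin; apply: (le_trans (@cabs_cint _ _ _ area setT measurableT _ mG)).
by rewrite EFinM; apply: lee_wpmul2l => //; rewrite lee_fin.
Qed.

(** The moment of [F] that the kernel pairs with the power [n] of [z], before division
    by [z ^ m]. *)
Definition Bcoef F (n : nat) : R[i] := cint area setT (fun w =>
  (dens w)%:C * (F (plane w) * ((plane w)^* ^+ n / (plane w)^* ^+ m))).

Lemma cmeas_Bbody F n : cmeas setT (F \o @plane R) -> cmeas setT (fun w =>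
  (dens w)%:C * (F (plane w) * ((plane w)^* ^+ n / (plane w)^* ^+ m))).
Proof.
move=> mF; have mp := cmeasJ (@cmeas_plane R).
apply: cmeasM; first by apply: cmeas_real; exact: measurable_dens.
by apply: cmeasM => //; apply: cmeasM; [exact: cmeasX | apply: cmeasV; exact: cmeasX].
Qed.

Lemma sqnorm_powMJ w : cabs ((plane w)^* ^+ m)^-1 = sqnorm w `^ (- M).
Proof. by rewrite cabsV cabsX cabsJ -cabsX -cabsV; exact: sqnorm_powM. Qed.

Lemma cabs_plane_lt1 w : sqnorm w < 1 -> cabs (plane w) < 1.
Proof. by rewrite sqnormE => w1; have := cabs_ge0 (plane w); nra. Qed.

Lemma Bbody_le F n w : F 0 = 0 ->
  cabs ((dens w)%:C * (F (plane w) * ((plane w)^* ^+ n / (plane w)^* ^+ m))) <=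
  1 * ((0 < sqnorm w)%R%:R * (dens w * sqnorm w `^ (- M) * cabs (F (plane w)))).
Proof.
move=> F0; have d0 : 0 <= dens w by exact: dens_ge0.
have [w1|w1] := boolP (sqnorm w < 1); last first.
  by rewrite (dens_out _ _ w1) !mul0r cabs0 !mulr0.
have [w0|w0] := boolP (0 < sqnorm w); last by rewrite (plane_eq0 w0) F0 mul0r mulr0 !cabs0 !mulr0.
rewrite mul1r mul1r !cabsM cabsR ger0_norm// sqnorm_powMJ cabsX cabsJ.
have wn : cabs (plane w) ^+ n <= 1.
  by rewrite exprn_ile1 ?cabs_ge0// ltW// cabs_plane_lt1.
rewrite -mulrA ler_wpM2l// mulrC ler_wpM2r ?cabs_ge0// ler_piMl ?powR_ge0//.
Qed.

Lemma Bcoef_bound F n : cmeas setT (F \o @plane R) -> F 0 = 0 -> (Jint F < +oo)%E ->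
  cabs (Bcoef F n) <= 2 * fine (Jint F).
Proof.
move=> mF F0 Jfin; have := dominated_J mF Jfin ler01 (cmeas_Bbody n mF) (fun w => Bbody_le n w F0).
by rewrite mul1r => -[].
Qed.

Lemma cintegrable_B F n : cmeas setT (F \o @plane R) -> F 0 = 0 -> (Jint F < +oo)%E ->
  cintegrable area setT (fun w => (dens w)%:C * (F (plane w) * ((plane w)^* ^+ n / (plane w)^* ^+ m))).
Proof.
by move=> mF F0 Jfin; have [] := dominated_J mF Jfin ler01 (cmeas_Bbody n mF) (fun w => Bbody_le n w F0).
Qed.

Lemma subexp_hB F : cmeas setT (F \o @plane R) -> F 0 = 0 -> (Jint F < +oo)%E ->
  subexp (fun n => h n * Bcoef F n).
Proof.
move=> mF F0 Jfin; apply: (@subexp_scale _ _ _ (2 * fine (Jint F)) (subexp_hcoef a1 b1)) => n.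
by rewrite cabsM mulrC ler_wpM2r ?cabs_ge0// Bcoef_bound.
Qed.

(** The geometric tail bound of the kernel series, uniform in [w], justifies
    integration term by term. *)
Theorem projection_series : exists2 k : R, 0 < k & forall F, cmeas setT (F \o @plane R) -> F 0 = 0 ->
  (Jint F < +oo)%E -> forall z, 0 < sqnorm z < 1 ->
  projection a b F (plane z) = k%:C * (pser (fun n => h n * Bcoef F n) (plane z) / plane z ^+ m).
Proof.
have [k k0 hk] := kern_pser m a1 b1 b00; exists k => // F mF F0 Jfin z /andP[z0 z1].
have sh := subexp_hcoef a1 b1; have shB := subexp_hB mF F0 Jfin.
have r01 : 0 <= cabs (plane z) < 1 by rewrite cabs_ge0 cabs_plane_lt1.
have [s /andP[s0 s1] [C C0 hC]] := subexp_tail sh r01.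
have zn := plane_neq0 z0; have zmn : plane z ^+ m != 0 by rewrite expf_neq0.
pose c := k%:C / plane z ^+ m.
pose G n w := (dens w)%:C * (F (plane w) * ((plane w)^* ^+ n / (plane w)^* ^+ m)).
pose S N w := \sum_(0 <= n < N) (c * (h n * plane z ^+ n)) * G n w.
pose P w := (dens w)%:C * (F (plane w) * kern z w).
have mP : cmeas setT P by exact: cmeas_integrand.
have mG n : cmeas setT (G n) by exact: cmeas_Bbody.
have iG n : cintegrable area setT (G n) by exact: cintegrable_B.
have iS N := @cint_sum _ _ _ area setT measurableT (fun n w => (c * (h n * plane z ^+ n)) * G n w) N
  (fun n => cintegrableZ measurableT _ (iG n)).
have mS N : cmeas setT (S N).
  apply: (@cmeas_sum _ _ _ _ (fun n w => (c * (h n * plane z ^+ n)) * G n w)) => n.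
  by apply: cmeasM => //; exact: cmeas_cst.
have bound N w : cabs (P w + (-1) * S N w) <= (cabs c * (C * s ^+ N)) *
    ((0 < sqnorm w)%R%:R * (dens w * sqnorm w `^ (- M) * cabs (F (plane w)))).
  have d0 : 0 <= dens w by exact: dens_ge0.
  have sN : 0 <= s ^+ N by rewrite exprn_ge0// ltW.
  have [w1|w1] := boolP (sqnorm w < 1); last first.
    rewrite /P /S big1 => [|n _]; last by rewrite /G (dens_out _ _ w1) mul0r mulr0.
    by rewrite (dens_out _ _ w1) mul0r mulr0 addr0 cabs0 !mul0r !mulr0.
  have [w0|w0] := boolP (0 < sqnorm w); last first.
    rewrite /P /S big1 => [|n _]; last by rewrite /G (plane_eq0 w0) F0 mul0r !mulr0.
    by rewrite (plane_eq0 w0) F0 mul0r !mulr0 addr0 !cabs0 !mulr0.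
  have -> : P w + (-1) * S N w = c * ((dens w)%:C * (F (plane w) * ((plane w)^* ^+ m)^-1)) *
     (pser h (plane z * (plane w)^*) - \sum_(0 <= n < N) h n * (plane z * (plane w)^*) ^+ n).
    rewrite [(-1) * _]mulN1r [RHS]mulrBr mulr_sumr /P hk// /S; congr (_ - _).
      rewrite exprMn invfM /c; set u := F _; set v := pser _ _; set x := (plane z ^+ m)^-1; set y := (_ ^+ m)^-1.
      by ring.
    by apply: eq_bigr => n _; rewrite /G exprMn; ring.
  set Y := pser h _ - _; set W := ((plane w)^* ^+ m)^-1.
  have -> : cabs (c * ((dens w)%:C * (F (plane w) * W)) * Y) =
      cabs c * (`|dens w| * (cabs (F (plane w)) * sqnorm w `^ (- M))) * cabs Y.
    by rewrite -sqnorm_powMJ -/W -cabsR -!cabsM.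
  rewrite (ger0_norm d0) [true%:R * _]mul1r.
  have zw : cabs (plane z * (plane w)^*) <= cabs (plane z).
    by rewrite cabsM cabsJ ler_piMr ?cabs_ge0// ltW// cabs_plane_lt1.
  have Q0 : 0 <= cabs c * (dens w * (cabs (F (plane w)) * sqnorm w `^ (- M))) by pos.
  apply: (le_trans (ler_wpM2l Q0 (hC _ N zw))).
  by apply: eq_ler; ring.
have iP : cintegrable area setT P.
  have c00 : 0 <= cabs c * (C * s ^+ 0) by pos; rewrite exprn_ge0// ltW.
  have [] // := @dominated_J F P _ mF Jfin c00 mP.
  by move=> w; have := bound 0%N w; rewrite /S big_nil mulr0 addr0.
have dist N : cabs (projection a b F (plane z) - \sum_(0 <= n < N) (c * (h n * plane z ^+ n)) * Bcoef F n) <=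
    (2 * (cabs c * C * fine (Jint F))) * s ^+ N.
  have cN : 0 <= cabs c * (C * s ^+ N) by pos; rewrite exprn_ge0// ltW.
  have mPS : cmeas setT (fun w => P w + (-1) * S N w).
    by apply: cmeasD => //; apply: cmeasM => //; exact: cmeas_cst.
  have [_] := @dominated_J F (fun w => P w + (-1) * S N w) _ mF Jfin cN mPS (bound N).
  have [iS1 iS2] := iS N.
  rewrite (@cintD _ _ _ area setT measurableT _ _ iP (cintegrableZ measurableT (-1) iS1)).
  rewrite (@cintZ _ _ _ area setT measurableT _ (-1) iS1) iS2 mulN1r projectionE// -/P.
  rewrite (eq_bigr (fun n => (c * (h n * plane z ^+ n)) * Bcoef F n)); last first.
    by move=> n _; rewrite (@cintZ _ _ _ area setT measurableT _ _ (iG n)).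
  by move=> H; apply: (le_trans H); apply: eq_ler; ring.
have cn : c != 0.
  rewrite /c mulf_neq0 ?invr_eq0//.
  by rewrite -cabs_eq0 cabsR normr_eq0 gt_eqF.
have -> : pser (fun n => h n * Bcoef F n) (plane z) = projection a b F (plane z) / c.
  have z1' := cabs_plane_lt1 z1.
  apply: csum_unique; first exact: subexp_abs_summable shB z1'.
  have s01 : `|s| < 1 by rewrite ger0_norm ?ltW.
  apply: (@squeeze0 _ _ (fun N => (cabs c)^-1 * (2 * (cabs c * C * fine (Jint F))) * s ^+ N)).
    move=> N; rewrite cabs_ge0 /= -mulrA.
    have -> : \sum_(0 <= n < N) h n * Bcoef F n * plane z ^+ n - projection a b F (plane z) / c =
       - c^-1 * (projection a b F (plane z) - \sum_(0 <= n < N) (c * (h n * plane z ^+ n)) * Bcoef F n).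
      rewrite mulNr -mulrN opprB mulrBr mulr_sumr; congr (_ - _); last by rewrite mulrC.
      by apply: eq_bigr => n _; set B := Bcoef F n; set x := plane z ^+ n; field.
    rewrite cabsM cabsN cabsV ler_wpM2l ?invr_ge0 ?cabs_ge0//.
  exact: cvg_geom0.
rewrite /c; field; rewrite zmn /=.
by rewrite -cabs_eq0 cabsR normr_eq0 gt_eqF.
Qed.

End ProjectionSeries.

Section LaurentHolomorphic.
Context {R : realType}.
Implicit Types (z w : R[i]) (A : nat -> R[i]) (f : R[i] -> R[i]).

(** Complex derivatives in the form that suits direct estimates. *)
Definition cderiv f z (l : R[i]) : Prop := forall e : R, 0 < e -> exists2 d : R, 0 < d &
  forall h, cabs h < d -> cabs (f (z + h) - f z - l * h) <= e * cabs h.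

Lemma cderivP f z : (exists l, cderiv f z l) <->
  derivable (f : R[i]^o -> R[i]^o) (z : R[i]^o) (1 : R[i]^o).
Proof.
split=> [[l hl]|]; last exact: derivable_cderiv.
by apply: (@cderiv_derivable _ _ _ l) => e e0; have [d d0 hd] := hl e e0; exists d => // h _; exact: hd.
Qed.

Lemma cderiv_near f g z l (r : R) : 0 < r -> (forall h, cabs h < r -> g (z + h) = f (z + h)) ->
  cderiv f z l -> cderiv g z l.
Proof.
move=> r0 gf hf e e0; have [d d0 hd] := hf e e0.
exists (Num.min d r) => [|h]; first by rewrite lt_min d0.
rewrite lt_min => /andP[h1 h2]; have g0 : g z = f z by have := gf 0; rewrite addr0; apply; rewrite cabs0.
by rewrite gf// g0 hd.
Qed.

Lemma cderiv_cst c z : cderiv (fun=> c) z 0.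
Proof. by move=> e e0; exists 1 => // h _; rewrite subrr sub0r mul0r oppr0 cabs0 mulr_ge0 ?cabs_ge0// ltW. Qed.

Lemma cderivM f g z l k : cderiv f z l -> cderiv g z k ->
  cderiv (fun w => f w * g w) z (l * g z + f z * k).
Proof.
move=> hf hg e e0; pose S := cabs (f z) + cabs (g z) + 1.
pose L := (cabs l + 1) * (cabs k + 1).
have f0 := cabs_ge0 (f z); have g0 := cabs_ge0 (g z); have l0 := cabs_ge0 l; have k0 := cabs_ge0 k.
have S0 : 0 < S by rewrite /S; lra.
have L0 : 0 < L by rewrite /L mulr_gt0//; lra.
pose e' := Num.min 1 (e / (2 * S)).
have e'0 : 0 < e' by rewrite /e' lt_min ltr01 divr_gt0// mulr_gt0.
have e'1 : e' <= 1 by rewrite /e' ge_min lexx.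
have e'S : e' * S <= e / 2.
  apply: (@le_trans _ _ (e / (2 * S) * S)); first by rewrite ler_wpM2r ?(ltW S0)// /e' ge_min lexx orbT.
  by apply: eq_ler; field; rewrite gt_eqF.
have [d1 d10 h1] := hf e' e'0; have [d2 d20 h2] := hg e' e'0.
exists (Num.min d1 (Num.min d2 (e / (2 * L)))).
  by rewrite !lt_min d10 d20 divr_gt0// mulr_gt0.
move=> h; rewrite !lt_min => /andP[hd1 /andP[hd2 hd3]].
set A := f (z + h) - f z - l * h; set B := g (z + h) - g z - k * h.
have -> : f (z + h) * g (z + h) - f z * g z - (l * g z + f z * k) * h =
    f z * B + A * g z + (l * h + A) * (k * h + B) by rewrite /A /B; ring.
have hA : cabs A <= e' * cabs h by exact: h1.
have hB : cabs B <= e' * cabs h by exact: h2.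
have hh := cabs_ge0 h; have A0 := cabs_ge0 A; have B0 := cabs_ge0 B.
have b1 : cabs (l * h + A) <= (cabs l + 1) * cabs h.
  by apply: (le_trans (cabsD _ _)); rewrite cabsM; nra.
have b2 : cabs (k * h + B) <= (cabs k + 1) * cabs h.
  by apply: (le_trans (cabsD _ _)); rewrite cabsM; nra.
have b3 : cabs (l * h + A) * cabs (k * h + B) <= L * cabs h * cabs h.
  have := ler_pM (cabs_ge0 _) (cabs_ge0 _) b1 b2; move=> H; apply: (le_trans H).
  by apply: eq_ler; rewrite /L; ring.
have Lh : L * cabs h <= e / 2.
  apply: (@le_trans _ _ (L * (e / (2 * L)))); first by rewrite ler_wpM2l ?(ltW L0)// ltW.
  by apply: eq_ler; field; rewrite gt_eqF.
apply: (le_trans (cabsD _ _)); apply: (le_trans (lerD (cabsD _ _) (lexx _))).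
rewrite !cabsM.
have b4 : cabs (f z) * cabs B + cabs A * cabs (g z) <= e' * S * cabs h by rewrite /S; nra.
have b5 : e' * S * cabs h <= e / 2 * cabs h by rewrite ler_wpM2r.
have b6 : L * cabs h * cabs h <= e / 2 * cabs h by rewrite ler_wpM2r.
lra.
Qed.

Lemma cderiv_inv c z : z != c -> cderiv (fun w => (w - c)^-1) z (- (z - c) ^- 2).
Proof.
move=> zc e e0; pose u := z - c; have u0 : u != 0 by rewrite subr_eq0.
have cu : 0 < cabs u by rewrite cabs_gt0.
exists (Num.min (cabs u / 2) (e * cabs u ^+ 3 / 2)).
  by rewrite lt_min !divr_gt0 ?mulr_gt0 ?exprn_gt0.
move=> h; rewrite lt_min => /andP[h1 h2].
have uh : cabs u / 2 <= cabs (u + h).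
  by have := cabsB_ge u (- h); rewrite opprK cabsN; lra.
have cuh : 0 < cabs (u + h) by apply: lt_le_trans uh; rewrite divr_gt0.
have uhn : u + h != 0 by rewrite -cabs_gt0.
have -> : (z + h - c)^-1 - (z - c)^-1 - - (z - c) ^- 2 * h = h ^+ 2 / (u ^+ 2 * (u + h)).
  have -> : z + h - c = u + h by rewrite /u; ring.
  by rewrite -/u; set c' := h; field; rewrite u0 uhn.
rewrite !cabsM cabsV cabsM !cabsX ler_pdivrMr ?mulr_gt0 ?exprn_gt0//.
rewrite expr2 mulrC [leRHS]mulrAC ler_wpM2r ?cabs_ge0//.
apply: (@le_trans _ _ (e * (cabs u ^+ 2 * (cabs u / 2)))).
  by move: h2 => /ltW h2; apply: (le_trans h2); apply: eq_ler; field.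
by rewrite (ler_pM2l e0) -expr2 ler_wpM2l ?exprn_ge0 ?cabs_ge0.
Qed.

Lemma cderiv_expV z m : z != 0 -> exists l, cderiv (fun w => (w ^+ m)^-1) z l.
Proof.
move=> z0; elim: m => [|m [l IH]].
  exists 0; have -> : (fun w : R[i] => (w ^+ 0)^-1) = (fun=> 1) by apply/funext => w; rewrite expr0 invr1.
  exact: cderiv_cst.
have := cderivM (cderiv_inv z0) IH => /= H; eexists.
have -> : (fun w => (w ^+ m.+1)^-1) = (fun w : R[i] => (w - 0)^-1 * (w ^+ m)^-1).
  by apply/funext => w; rewrite subr0 exprS invfM.
exact: H.
Qed.

Lemma laurent_holomorphic A m f : subexp A ->
  (forall z, punctured_disc z -> f z = pser A z / z ^+ m) -> holomorphic_on punctured_disc f.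
Proof.
move=> sA hf z [z1 z0].
have [l1 hl1] := (cderivP _ _).2 (pser_derivable sA z1).
have [l2 hl2] := cderiv_expV m z0.
have cz : 0 < cabs z by rewrite cabs_gt0.
apply/cderivP; eexists.
have z1' : cabs z < 1 := z1.
have r0 : 0 < Num.min (cabs z) (1 - cabs z) by rewrite lt_min cz subr_gt0.
apply: (cderiv_near r0) (cderivM hl1 hl2) => h.
rewrite lt_min => /andP[hd2 hd3]; rewrite hf//; split.
- by rewrite /disc /=; apply: (le_lt_trans (cabsD _ _)); rewrite -ltrBrDl.
- apply/eqP => zh; move: hd2; have -> : h = - z by apply/eqP; rewrite -addr_eq0 addrC zh.
  by rewrite cabsN ltxx.
Qed.

Lemma de_moivre (t : R) n : (cos t +i* sin t) ^+ n = cos (n%:R * t) +i* sin (n%:R * t).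
Proof.
elim: n => [|n IH]; first by rewrite expr0 mul0r cos0 sin0.
rewrite exprS IH -(natr1 n) mulrDl mul1r cosD sinD; apply: complex_eq; rewrite ?ReM ?ImM /=; ring.
Qed.

End LaurentHolomorphic.

Section ProjectionNorm.
Context {R : realType}.
Notation area := (@lebesgue_measure R \x @lebesgue_measure R)%E.
Variables (a b0 : R) (m : nat).
Hypotheses (a1 : -1 < a) (b1 : -1 < b0) (b00 : b0 <= 0).
Let b := b0 + m%:R.
Let M : R := m%:R / 2.
Let b1' : -1 < b := bgt m b1.
Variables (p q : R).
Hypotheses (p1 : 1 < p) (pq : p^-1 + q^-1 = 1) (Mp : M * p < b + 1) (Mq : M * q < b + 1).
Local Notation dens := (dens a b).
Local Notation npow := (npow a b).
Local Notation h := (fun n : nat => (hcoef a b0 n)%:C : R[i]).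
Local Notation Jint := (Jint a b0 m).
Implicit Types (z w : R * R) (F : R[i] -> R[i]).

Lemma Jint_fin F : cmeas setT (F \o @plane R) -> (npow p (F \o @plane R) < +oo)%E -> (Jint F < +oo)%E.
Proof.
move=> mF Nfin; have [C C0 hC] := Jint_bound a1 b1 p1 pq Mp Mq.
have pn : p != 0 by rewrite gt_eqF// (lt_trans ltr01).
apply: (lty_poweRy pn); apply: (le_lt_trans (hC F mF)).
by rewrite lte_mul_pinfty.
Qed.

Lemma plane_disc z : punctured_disc (plane z) -> 0 < sqnorm z < 1.
Proof.
move=> [z1 z0]; rewrite sqnormE exprn_gt0 ?cabs_gt0//= exprn_ilt1 ?cabs_ge0//.
Qed.

Lemma planeK (z : R[i]) : plane (complex.Re z, complex.Im z) = z.
Proof. by case: z. Qed.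

(** The kernel is dominated by [absker], to which Schur's test applies. *)
Theorem projection_norm : exists2 C : R, 0 <= C & forall F G, cmeas setT (F \o @plane R) ->
  cmeas setT (G \o @plane R) -> F 0 = 0 -> G 0 = 0 ->
  (forall z : R[i], punctured_disc z -> G z = projection a b F z) ->
  (npow p (G \o @plane R) <= C%:E * npow p (F \o @plane R))%E.
Proof.
have [K K0 hK] := projection_abs m a1 b1 b00.
have [C C0 hC] := schur_dens a1 b1 p1 pq Mp Mq.
exists (K `^ p * C); first by rewrite mulr_ge0 ?powR_ge0.
move=> F G mF mG F0 G0 hG; have mcF := cmeas_cabs mF; have mcG := cmeas_cabs mG.
have p0 : 0 < p by apply: lt_trans p1.
pose I z : \bar R := (\int[area]_w (dens w * absker a M (z, w) * cabs (F (plane w)))%:E)%E.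
have I0 z : (0 <= I z)%E by apply: integral_ge0 => w _; rewrite lee_fin; pos.
have md := measurable_dens a b.
have mI : measurable_fun setT I.
  have mG' : measurable_fun setT (fun v : (R * R) * (R * R) => (dens v.2 * absker a M v * cabs (F (plane v.2)))%:E).
    apply/measurable_EFinP; apply: measurable_funM.
      apply: measurable_funM; last exact: measurable_absker.
      by apply: (measurableT_comp md); exact: measurable_snd.
    by apply: (measurableT_comp mcF); exact: measurable_snd.
  have G0' v : (0 <= (dens v.2 * absker a M v * cabs (F (plane v.2)))%:E)%E.
    by rewrite lee_fin; pos.
  have := @measurable_fun_fubini_tonelli_F _ _ _ _ _ (@plane_measure R) _ mG' G0'; exact.
have mW : measurable_fun setT (fun z => (dens z)%:E * I z `^ p)%E.
  apply: emeasurable_funM; first exact/measurable_EFinP.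
  exact: (measurableT_comp (measurable_poweR p) mI).
have W0 z : (0 <= (dens z)%:E * I z `^ p)%E.
  by rewrite mule_ge0 ?poweR_ge0// lee_fin; pos.
rewrite EFinM -muleA; apply: le_trans (lee_wpmul2l _ (hC _ mcF (fun w => cabs_ge0 _))); last first.
  by rewrite lee_fin powR_ge0.
rewrite -(area_integralZl (powR_ge0 _ _) mW W0); apply: area_le_integral.
- apply/measurable_EFinP; apply: measurable_funM => //; exact: measurable_powR_comp.
- by move=> w; rewrite lee_fin; pos.
- exact: measurable_funeM.
move=> z; rewrite EFinM muleCA.
have d0 : (0 <= (dens z)%:E)%E by rewrite lee_fin; pos.
have [z1|z1] := boolP (sqnorm z < 1); last by rewrite (dens_out _ _ z1) !mul0e.
apply: lee_wpmul2l => //.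
have -> : ((K `^ p)%:E * I z `^ p = (K%:E * I z) `^ p)%E by rewrite poweRM ?lee_fin// poweR_EFin.
rewrite -poweR_EFin; have p0' := ltW p0.
apply: gt0_ler_poweR => //; rewrite ?in_itv /= ?leey ?andbT ?lee_fin ?cabs_ge0//.
  by rewrite mule_ge0.
have [z0|z0] := boolP (0 < sqnorm z); last by rewrite (plane_eq0 z0) G0 cabs0 mule_ge0.
have hz : 0 < sqnorm z < 1 by rewrite z0.
by rewrite hG; [exact: hK | split; [exact: cabs_plane_lt1 | exact: plane_neq0]].
Qed.

End ProjectionNorm.

(** * The projection of a polynomial *)
Section MomentNumbers.
Context {R : realType}.

Lemma beta_rec (x y : R) : -1 < x -> -1 < y ->
  (x + 1) * fine (betaint x y) = (x + y + 2) * fine (betaint (x + 1) y).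
Proof.
move=> x1 y1; have x11 : -1 < x + 1 by lra.
have y11 : -1 < y + 1 by lra.
have fin (u v : R) : -1 < u -> -1 < v -> exists r, betaint u v = r%:E.
  by move=> hu hv; exists (fine (betaint u v)); rewrite fineK// ge0_fin_numE ?betaint_ge0// betaint_lty.
have := betaint_parts x1 y1; have := betaint_split x1 y1.
have [X ->] := fin _ _ x1 y1; have [Y ->] := fin _ _ x11 y1; have [Z ->] := fin _ _ x1 y11.
rewrite -EFinD -!EFinM => -[XE] [E] /=.
by rewrite -XE mulrDr E; ring.
Qed.

Lemma shift_neq0 n (x : R) : -1 < x -> n%:R + 1 + x != 0.
Proof. by move=> x1; rewrite gt_eqF//; have := ler0n R n; lra. Qed.

Lemma shift2_neq0 n (x y : R) : -1 < x -> -1 < y -> n%:R + x + y + 2 != 0.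
Proof. by move=> x1 y1; rewrite gt_eqF//; have := ler0n R n; lra. Qed.

End MomentNumbers.

Section Monomials.
Context {R : realType}.
Notation area := (@lebesgue_measure R \x @lebesgue_measure R)%E.
Variables (a b0 : R) (m : nat).
Hypotheses (a1 : -1 < a) (b1 : -1 < b0) (b00 : b0 <= 0).
Let b := b0 + m%:R.
Let b1' : -1 < b := bgt m b1.
Local Notation dens := (dens a b).
Local Notation h := (fun n : nat => (hcoef a b0 n)%:C : R[i]).
Local Notation Jint := (Jint a b0 m).
Local Notation Bcoef := (Bcoef a b0 m).
Implicit Types (z w : R * R) (F : R[i] -> R[i]).

(** The functions are extended by [0] at the puncture. *)
Definition mono k (w : R[i]) : R[i] := (w != 0)%:R * w ^+ k.

Lemma cint_rot (G : R * R -> R[i]) c s : c ^+ 2 + s ^+ 2 = 1 -> cmeas setT G ->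
  cint area setT (fun w => G (rot c s w)) = cint area setT G.
Proof.
move=> cs [mr mi]; have := preserving_rot cs => pr.
have key (u : R * R -> R) : measurable_fun setT u ->
    (\int[area]_w (u (rot c s w))%:E = \int[area]_w (u w)%:E)%E.
  move=> mu; have mu' : measurable_fun setT (fun w => (u w)%:E) by exact/measurable_EFinP.
  have := @integral_preserved R _ _ (@plane_measure R) (rot c s) _ _ mu'; apply.
  by move=> f mf f0; exact: pr.
by congr (_ +i* _); apply: (congr1 fine); [exact: (key (fun w => complex.Re (G w))) | exact: (key (fun w => complex.Im (G w)))].
Qed.

Lemma plane_rot c s w : plane (rot c s w) = (c +i* s) * plane w.
Proof. by apply: complex_eq; rewrite ?ReM ?ImM /plane /rot /linmap /=; ring. Qed.

Lemma fix_mul (U x : R[i]) : x = U * x -> U != 1 -> x = 0.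
Proof.
move=> /eqP; rewrite -subr_eq0 -{1}[x]mul1r -mulrBl mulf_eq0 subr_eq0 eq_sym.
by move=> /orP[->|/eqP].
Qed.

Lemma mono_mul (u x : R[i]) k n : u != 0 ->
  mono k (u * x) * ((u * x)^* ^+ n / (u * x)^* ^+ m) =
  (u ^+ k * (u^* ^+ n / u^* ^+ m)) * (mono k x * (x^* ^+ n / x^* ^+ m)).
Proof.
move=> u0; rewrite /mono mulf_eq0 (negbTE u0) /=.
have -> : ((u * x)^* = u^* * x^*)%R by rewrite rmorphM.
by rewrite !exprMn invfM; set x1 := (_ ^+ m)^-1; set x2 := (_ ^+ m)^-1; ring.
Qed.

Lemma mono_plane_cmeas k : cmeas setT (mono k \o @plane R).
Proof.
have -> : mono k \o @plane R = (fun w => ((0 < sqnorm w)%R%:R)%:C * plane w ^+ k).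
  apply/funext => w /=; rewrite /mono; have [w0|w0] := boolP (0 < sqnorm w).
    by rewrite plane_neq0// rmorph1.
  by rewrite (plane_eq0 w0) eqxx rmorph0.
apply: cmeasM; last by apply: cmeasX; exact: cmeas_plane.
by apply: cmeas_real; have msq := @measurable_sqnorm R; mfun.
Qed.

Definition moment (k : nat) : R :=
  \int[area]_w ((0 < sqnorm w)%R%:R * (dens w * sqnorm w `^ k%:R)).

Lemma cint_real (u : R * R -> R) : cint area setT (fun w => (u w)%:C) = (\int[area]_w u w)%:C.
Proof. by apply: complex_eq => //=; rewrite /Rintegral integral0. Qed.

Lemma Bcoef_mono_diag k : Bcoef (mono k) (m + k) = (moment k)%:C.
Proof.
rewrite -cint_real; apply: eq_cint => w _.
have [w0|w0] := boolP (0 < sqnorm w); last first.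
  by rewrite /mono (plane_eq0 w0) eqxx !(mul0r, mulr0).
have wn := plane_neq0 w0; have wjn : (plane w)^* != 0 by rewrite -cabs_eq0 cabsJ cabs_eq0.
rewrite [true%:R * _]mul1r /mono wn [true%:R * _]mul1r.
have -> : (dens w * sqnorm w `^ k%:R)%:C = (dens w)%:C * (sqnorm w `^ k%:R)%:C by rewrite rmorphM.
congr (_ * _).
have -> : (plane w)^* ^+ (m + k) / (plane w)^* ^+ m = (plane w)^* ^+ k.
  by rewrite exprD mulrAC mulfV ?mul1r// expf_neq0.
rewrite -exprMn mulzJ -sqnormE -rmorphXn /=; congr (_%:C).
by rewrite powR_mulrn// sqnorm_ge0.
Qed.

(** Functions whose projection is an absolutely convergent integral. *)
Definition okF F : Prop := [/\ cmeas setT (F \o @plane R), F 0 = 0 & (Jint F < +oo)%E].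

Lemma okF_mono k : okF (mono k).
Proof.
split; [exact: mono_plane_cmeas | by rewrite /mono eqxx mul0r | ].
have M0 : -1 < b + (- (m%:R / 2) + k%:R / 2).
  have := b1; have := ler0n R m; have := ler0n R k; rewrite /b => k0 m0 hb.
  by move: hb k0 m0; set x := m%:R; set y := k%:R => *; lra.
have [K K0 hK] := dens_power_fin a1 b1' M0.
apply: le_lt_trans (ltry K); rewrite -hK; apply: eq_lee; apply: eq_integral => w _; congr (_%:E).
have [w0|w0] := boolP (0 < sqnorm w); last by rewrite !mul0r.
rewrite !mul1r -mulrA; congr (_ * _); rewrite powRD ?(gt_eqF w0) ?implybT//; congr (_ * _).
rewrite /mono plane_neq0// mul1r cabsX -[cabs (plane w)](ger0_norm (cabs_ge0 _)) -sqrtr_sqr -sqnormE.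
by rewrite -powR12_sqrt ?sqnorm_ge0// -powR_mulrn ?powR_ge0// -powRrM mulrC.
Qed.

Lemma okF_lin F G c : okF F -> okF G -> okF (fun x => F x + c * G x).
Proof.
move=> [mF F0 JF] [mG G0 JG]; have mL : cmeas setT ((fun x => F x + c * G x) \o @plane R).
  by apply: cmeasD => //; apply: cmeasM => //; exact: cmeas_cst.
split => //; first by rewrite F0 G0 mulr0 addr0.
have mJF := measurable_Jbody a b0 m mF; have mJG := measurable_Jbody a b0 m mG.
have JF0 w : (0 <= ((0 < sqnorm w)%R%:R * (dens w * sqnorm w `^ (- (m%:R / 2)) * cabs (F (plane w))))%:E)%E.
  by rewrite lee_fin; pos.
have JG0 w : (0 <= ((0 < sqnorm w)%R%:R * (dens w * sqnorm w `^ (- (m%:R / 2)) * cabs (G (plane w))))%:E)%E.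
  by rewrite lee_fin; pos.
apply: (@le_lt_trans _ _ (Jint F + (cabs c)%:E * Jint G)%E); last first.
  by rewrite lte_add_pinfty// lte_mul_pinfty ?lee_fin ?cabs_ge0.
have mcG : measurable_fun setT (fun w => (cabs c)%:E * ((0 < sqnorm w)%R%:R * (dens w * sqnorm w `^ (- (m%:R / 2)) * cabs (G (plane w))))%:E)%E.
  exact: measurable_funeM.
have cG0 w : (0 <= (cabs c)%:E * ((0 < sqnorm w)%R%:R * (dens w * sqnorm w `^ (- (m%:R / 2)) * cabs (G (plane w))))%:E)%E.
  by rewrite mule_ge0// lee_fin cabs_ge0.
rewrite /Jint -(area_integralZl (cabs_ge0 c) mJG JG0) -(area_integralD mJF JF0 mcG cG0).
apply: area_le_integral.
- exact: (measurable_Jbody a b0 m mL).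
- by move=> w; rewrite lee_fin; pos.
- exact: emeasurable_funD.
move=> w; rewrite -EFinM -EFinD lee_fin.
have Q0 : 0 <= (0 < sqnorm w)%R%:R * (dens w * sqnorm w `^ (- (m%:R / 2))) by pos.
have hD : cabs (F (plane w) + c * G (plane w)) <= cabs (F (plane w)) + cabs c * cabs (G (plane w)).
  by apply: (le_trans (cabsD _ _)); rewrite cabsM.
rewrite mulrA; apply: (le_trans (ler_wpM2l Q0 hD)).
by apply: eq_ler; ring.
Qed.

Lemma kern_integrable F z : okF F -> 0 < sqnorm z < 1 ->
  cintegrable area setT (fun w => (dens w)%:C * (F (plane w) * kern a b0 m z w)).
Proof.
move=> [mF F0 JF] hz; have /andP[z0 z1] := hz.
have [C C0 hC] := kern_bound m a1 b1 b00.
have mP := cmeas_integrand m a1 b1 b00 z1 mF.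
pose r := (1 - cabs (plane z)) ^+ 2; have z1' := cabs_plane_lt1 z1.
have r0 : 0 < r by rewrite /r exprn_gt0// subr_gt0.
pose c := C * (sqnorm z `^ (- (m%:R / 2)) * r `^ (- (1 + a / 2))).
have c0 : 0 <= c by rewrite /c; pos.
have [] // := dominated_J a1 b1 mF JF c0 mP.
move=> w; have d0 : 0 <= dens w by exact: dens_ge0.
have [w1|w1] := boolP (sqnorm w < 1); last by rewrite (dens_out _ _ w1) !(mul0r, mulr0) cabs0.
have [w0|w0] := boolP (0 < sqnorm w); last by rewrite (plane_eq0 w0) F0 !(mul0r, mulr0) cabs0.
have hw : 0 < sqnorm w < 1 by rewrite w0.
rewrite [true%:R * _]mul1r (cabsM (dens w)%:C) (cabsM (F _)) cabsR (ger0_norm d0).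
have hk : cabs (kern a b0 m z w) <= c * sqnorm w `^ (- (m%:R / 2)).
  apply: (le_trans (hC _ _ hz hw)); rewrite /absker /= hz hw !mul1r /c -!mulrA ler_wpM2l//.
  rewrite ler_wpM2l ?powR_ge0// mulrC ler_wpM2r ?powR_ge0//; apply: powR_anti => //.
    rewrite cdistE /r; have := cabsB_ge 1 (plane z * (plane w)^*); rewrite cabs1 cabsM cabsJ.
    have w1' := cabs_plane_lt1 w1; have := cabs_ge0 (plane z); have := cabs_ge0 (plane w).
    move=> h1 h2 h3; rewrite ler_pXn2r ?nnegrE ?cabs_ge0 ?subr_ge0 ?(ltW z1')//; nra.
  by have a1' := a1; lra.
apply: (le_trans (ler_wpM2l d0 (ler_wpM2l (cabs_ge0 _) hk))); apply: eq_ler; ring.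
Qed.

Lemma projection_lin F G c (z : R[i]) : okF F -> okF G -> punctured_disc z ->
  projection a b (fun x => F x + c * G x) z = projection a b F z + c * projection a b G z.
Proof.
move=> oF oG hz; have hz' : 0 < sqnorm (complex.Re z, complex.Im z) < 1 by apply: plane_disc; rewrite planeK.
rewrite -(planeK z) !projectionE//.
have iF := kern_integrable oF hz'; have iG := kern_integrable oG hz'.
rewrite -(@cintZ _ _ _ area setT measurableT _ c iG).
rewrite -(@cintD _ _ _ area setT measurableT _ _ iF (cintegrableZ measurableT c iG)).
by apply: eq_cint => w _; ring.
Qed.

(** Some rotation multiplies the integral by a number other than [1]. *)
Lemma Bcoef_mono_off k n : n != (m + k)%N -> Bcoef (mono k) n = 0.
Proof.
move=> nk; have [mF F0 JF] := okF_mono k.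
pose G w := (dens w)%:C * (mono k (plane w) * ((plane w)^* ^+ n / (plane w)^* ^+ m)).
have mG : cmeas setT G by exact: cmeas_Bbody.
have iG : cintegrable area setT G by exact: cintegrable_B.
suff [c [s [cs]]] : exists c s : R, c ^+ 2 + s ^+ 2 = 1 /\
    (c +i* s) ^+ k * (((c +i* s)^*) ^+ n / ((c +i* s)^*) ^+ m) != 1.
  set u := c +i* s; set U := u ^+ k * _ => U1.
  have u0 : u != 0.
    by rewrite -cabs_eq0 -sqrf_eq0 cabs_sqr /= cs oner_eq0.
  have E : cint area setT (fun w => G (rot c s w)) = U * cint area setT G.
    rewrite -(@cintZ _ _ _ area setT measurableT _ U iG); apply: eq_cint => w _.
    have -> : G (rot c s w) = (dens w)%:C * (mono k (u * plane w) * ((u * plane w)^* ^+ n / (u * plane w)^* ^+ m)).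
      by rewrite /G plane_rot /dens /wt sqnorm_rot.
    rewrite mono_mul// -/U /G; set A := mono k (plane w) * _; by rewrite mulrCA.
  have H := etrans (esym (cint_rot cs mG)) E; exact: (fix_mul H U1).
have em (d : nat) : (0 < d)%N -> (cos (pi / d%:R) +i* sin (pi / d%:R)) ^+ d = -1 :> R[i].
  move=> d0; rewrite de_moivre mulrC divfK ?pnatr_eq0 ?gt_eqF// cospi sinpi.
  by apply: complex_eq => /=; rewrite ?oppr0.
have uJ (t : R) : ((cos t +i* sin t)^* = (cos t +i* sin t)^-1)%R.
  have u0 : cos t +i* sin t != 0 :> R[i] by rewrite -cabs_eq0 cos_sin_cabs oner_eq0.
  by apply: (mulfI u0); rewrite mulfV// mulzJ cos_sin_cabs expr1n.
pose d := (if (n < m + k)%N then m + k - n else n - (m + k))%N.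
have d0 : (0 < d)%N by rewrite /d; case: (ltnP n (m + k)) => h; rewrite subn_gt0// ltn_neqAle eq_sym nk h.
exists (cos (pi / d%:R)), (sin (pi / d%:R)); split; first by rewrite cos2Dsin2.
rewrite uJ; have := em _ d0; set u := cos _ +i* sin _ => ud.
have u0 : u != 0 by rewrite -cabs_eq0 cos_sin_cabs oner_eq0.
have -> : u ^+ k * (u^-1 ^+ n / u^-1 ^+ m) = u ^+ (m + k) / u ^+ n.
  by rewrite !exprVn invrK exprD; ring.
have N1 : (-1 : R[i]) != 1 by rewrite eq_sym -addr_eq0 -mulr2n pnatr_eq0.
move: ud; rewrite /d; case: ltnP => h ud.
  by rewrite -(subnK (ltnW h)) exprD ud mulfK ?expf_neq0.
have -> : u ^+ n = u ^+ (n - (m + k)) * u ^+ (m + k) by rewrite -exprD subnK.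
rewrite ud mulN1r invrN mulrN mulfV ?expf_neq0//.
Qed.

Lemma momentE k : moment k = kap a b * (fine (@disc_area R) * fine (betaint (b + k%:R) a)).
Proof.
have bk : -1 < b + k%:R by have := b1'; have := ler0n R k; lra.
rewrite /moment /Rintegral (dens_powerE a1 b1' bk).
have bfin : betaint (b + k%:R) a \is a fin_num.
  by rewrite ge0_fin_numE ?betaint_ge0// betaint_lty.
have dfin : @disc_area R \is a fin_num.
  by rewrite ge0_fin_numE ?disc_area_lty// ltW// disc_area_gt0.
by rewrite !fineM// fin_numM.
Qed.

Lemma moment_gt0 k : 0 < moment k.
Proof.
have bk : -1 < b + k%:R by have := b1'; have := ler0n R k; lra.
rewrite momentE; apply: mulr_gt0 (kap_gt0 a1 b1') _; apply: mulr_gt0; apply: fine_gt0.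
  by rewrite disc_area_gt0 disc_area_lty.
by rewrite betaint_gt0// betaint_lty.
Qed.

Lemma moment_rec k : (k%:R + b + 1) * moment k = (k%:R + a + b + 2) * moment k.+1.
Proof.
have bk : -1 < b + k%:R by have := b1'; have := ler0n R k; lra.
rewrite !momentE -(natr1 k) [b + (k%:R + 1)]addrA; have := beta_rec bk a1.
move: (fine (betaint (b + k%:R) a)) (fine (betaint (b + k%:R + 1) a)) (kap a b) (fine (@disc_area R)) => X Y K D E.
transitivity (K * D * ((b + k%:R + 1) * X)); first by ring.
by rewrite E; ring.
Qed.

(** The two first order recursions compensate each other. *)
Lemma hcoef_moment k : hcoef a b0 (m + k) * moment k = hcoef a b0 m * moment 0.
Proof.
elim: k => [|k IH]; first by rewrite addn0.
rewrite -IH addnS; have hr := hcoefS a (m + k) b1; have mr := moment_rec k.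
have x0 := shift_neq0 (m + k) b1; have y0 := shift2_neq0 k a1 b1'.
apply: (mulfI (mulf_neq0 x0 y0)).
transitivity (((m + k)%:R + 1 + b0) * hcoef a b0 (m + k).+1 * ((k%:R + a + b + 2) * moment k.+1)); first by ring.
by rewrite hr -mr /b natrD; ring.
Qed.

Definition cpoly (c : nat -> R[i]) K (x : R[i]) : R[i] := (x != 0)%:R * \sum_(0 <= j < K) c j * x ^+ j.

Theorem projection_poly : exists2 l : R, 0 < l & forall c K, okF (cpoly c K) /\
  forall z : R[i], punctured_disc z -> projection a b (cpoly c K) z = l%:C * cpoly c K z.
Proof.
have [k k0 hk] := projection_series m a1 b1 b00.
pose l := k * (hcoef a b0 m * moment 0).
have l0 : 0 < l by rewrite /l !mulr_gt0 ?moment_gt0 ?hcoef_gt0.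
have pm j (z : R[i]) : punctured_disc z -> projection a b (mono j) z = l%:C * z ^+ j.
  move=> hz; have [z1 z0] := hz; have [mF F0 JF] := okF_mono j.
  have hz' : 0 < sqnorm (complex.Re z, complex.Im z) < 1 by apply: plane_disc; rewrite planeK.
  have := hk _ mF F0 JF _ hz'; rewrite planeK => ->.
  rewrite /pser (@csum_term _ _ (m + j)); last by move=> n nj; rewrite Bcoef_mono_off// mulr0 mul0r.
  rewrite Bcoef_mono_diag -rmorphM /= hcoef_moment exprD /l rmorphM /=.
  by field; rewrite expf_neq0.
exists l => // c; elim=> [|K [IH1 IH2]].
  have E : cpoly c 0 = (fun x => mono 0 x + (-1) * mono 0 x).
    by apply/funext => x; rewrite /cpoly big_nil mulr0 mulN1r subrr.
  split; first by rewrite E; apply: okF_lin; exact: okF_mono.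
  move=> z hz; rewrite {1}E (projection_lin (-1) (okF_mono 0) (okF_mono 0) hz).
  by rewrite /cpoly big_nil !mulr0 mulN1r subrr.
have E : cpoly c K.+1 = (fun x => cpoly c K x + c K * mono K x).
  by apply/funext => x; rewrite /cpoly /mono big_nat_recr//=; ring.
split; first by rewrite E; exact: okF_lin IH1 (okF_mono K).
move=> z hz; rewrite {1}E (projection_lin (c K) IH1 (okF_mono K) hz).
have [_ z0] := hz; rewrite IH2// pm// E /= /mono z0 [true%:R * _]mul1r; ring.
Qed.

End Monomials.

(** * Continuity, measurability and compactness of the disc *)
Section Continuity.
Context {R : realType}.
Implicit Types (f : R[i] -> R[i]) (z h : R[i]) (w : R * R).

Definition ccont f z : Prop := forall e : R, 0 < e -> exists2 d : R, 0 < d &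
  forall h, cabs h < d -> cabs (f (z + h) - f z) <= e.

Lemma holomorphic_ccont (U : set R[i]) f z : holomorphic_on U f -> U z -> ccont f z.
Proof.
move=> hf Uz e e0; have [l hl] := (cderivP f z).2 (hf z Uz).
have [d d0 hd] := hl _ ltr01; have l0 := cabs_ge0 l.
have l1 : 0 < cabs l + 1 by lra.
exists (Num.min d (e / (cabs l + 1))) => [|h]; first by rewrite lt_min d0 divr_gt0.
rewrite lt_min ltr_pdivlMr// => /andP[h1 h2].
have -> : f (z + h) - f z = (f (z + h) - f z - l * h) + l * h by ring.
apply: (le_trans (cabsD _ _)); rewrite cabsM; have := hd h h1; rewrite mul1r => h3.
by apply: (le_trans (lerD h3 (lexx _))); lra.
Qed.

Lemma ccontM f g z : ccont f z -> ccont g z -> ccont (fun x => f x * g x) z.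
Proof.
move=> hf hg e e0; have f0 := cabs_ge0 (f z); have g0 := cabs_ge0 (g z).
pose S := cabs (f z) + cabs (g z) + 1; have S0 : 0 < S by rewrite /S; lra.
pose e' := Num.min 1 (e / S); have e'0 : 0 < e' by rewrite lt_min ltr01 divr_gt0.
have e'1 : e' <= 1 by rewrite ge_min lexx.
have e'S : e' * S <= e by rewrite -ler_pdivlMr// ge_min lexx orbT.
have [d1 d10 h1] := hf _ e'0; have [d2 d20 h2] := hg _ e'0.
exists (Num.min d1 d2) => [|h]; first by rewrite lt_min d10.
rewrite lt_min => /andP[hd1 hd2]; have {}h1 := h1 h hd1; have {}h2 := h2 h hd2.
set A := f (z + h) - f z in h1 *; set B := g (z + h) - g z in h2 *.
have -> : f (z + h) * g (z + h) - f z * g z = f z * B + A * g z + A * B by rewrite /A /B; ring.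
apply: (le_trans (cabsD _ _)); apply: (le_trans (lerD (cabsD _ _) (lexx _))); rewrite !cabsM.
have A0 := cabs_ge0 A; have B0 := cabs_ge0 B; apply: le_trans e'S; rewrite /S.
have : cabs A * cabs B <= e' * 1 by apply: ler_pM => //; exact: le_trans e'1.
by nra.
Qed.

Lemma floor_dist (c x : R) : 0 < c -> `|(Num.floor (c * x))%:~R / c - x| <= c^-1.
Proof.
move=> c0; have h1 := floor_le (c * x); have h2 := floorD1_gt (c * x).
move: h1 h2; rewrite intrD /=; set y := (_%:~R : R) => h1 h2.
have -> : y / c - x = (y - c * x) / c by field; rewrite gt_eqF.
rewrite normrM [`|c^-1|]gtr0_norm ?invr_gt0// -[leRHS]mul1r ler_wpM2r ?invr_ge0 ?(ltW c0)//.
by rewrite ler_norml; apply/andP; split; lra.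
Qed.

Lemma measurable_floor_grid (c : R) (u : int -> int -> R) :
  measurable_fun [set: R * R] (fun w => u (Num.floor (c * w.1)) (Num.floor (c * w.2))).
Proof.
move=> _ Y mY; rewrite setTI.
pose Fl (k : int * int) : set (R * R) :=
  [set w | [&& u k.1 k.2 \in Y, k.1%:~R <= c * w.1 < (k.1 + 1)%:~R & k.2%:~R <= c * w.2 < (k.2 + 1)%:~R]].
have -> : (fun w : R * R => u (Num.floor (c * w.1)) (Num.floor (c * w.2))) @^-1` Y = \bigcup_k Fl k.
  apply/seteqP; split=> [w /= Yw|w [k _ /= /and3P[Yk h1 h2]]].
    exists (Num.floor (c * w.1), Num.floor (c * w.2)) => //=.
    by rewrite /Fl /= !floor_le !floorD1_gt !andbT inE.
  by rewrite (floor_def h1) (floor_def h2); rewrite inE in Yk.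
apply: countable_bigcupT_measurable => // k.
have mset (b : R * R -> bool) : measurable_fun setT b -> measurable [set w | b w].
  by move=> mb; have := mb measurableT [set true] I; rewrite setTI.
by apply: mset; mfun.
Qed.

(** Sampling on finer and finer grids exhibits a continuous function as a
    pointwise limit of measurable ones. *)
Lemma cmeas_ccont f : (forall z, punctured_disc z -> ccont f z) ->
  (forall z, ~ punctured_disc z -> f z = 0) -> cmeas setT (f \o @plane R).
Proof.
move=> cf f0; pose sn n (x : R) : R := (Num.floor (n.+1%:R * x))%:~R / n.+1%:R.
pose G n w : R[i] := ((0 < sqnorm w < 1)%R%:R : R)%:C * f (sn n w.1 +i* sn n w.2).
have msq := @measurable_sqnorm R.
apply: (@cmeas_lim _ _ _ setT G) => [n|w _].
  apply: cmeasM; first by apply: cmeas_real; mfun.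
  split.
    exact: (@measurable_floor_grid n.+1%:R (fun i j => complex.Re (f ((i%:~R / n.+1%:R) +i* (j%:~R / n.+1%:R))))).
  exact: (@measurable_floor_grid n.+1%:R (fun i j => complex.Im (f ((i%:~R / n.+1%:R) +i* (j%:~R / n.+1%:R))))).
have [hw|hw] := boolP (0 < sqnorm w < 1); last first.
  have -> : (fun n => cabs (G n w - (f \o @plane R) w)) = fun=> 0.
    apply/funext => n; rewrite /G (negbTE hw) mul0r /= f0 ?subrr ?cabs0//.
    by move/plane_disc => h; move: hw; rewrite h.
  exact: cvg_cst.
have pw : punctured_disc (plane w).
  have /andP[w0 w1] := hw; split; [exact: cabs_plane_lt1 | exact: plane_neq0].
apply/cvgrPdist_le => e e0; have [d d0 hd] := cf _ pw e e0.
have aux (t : R) : t < d / 2 -> t + t < d by lra.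
near=> n; rewrite sub0r normrN ger0_norm ?cabs_ge0// /G hw rmorph1 mul1r /=.
have n0 : (0 : R) < n.+1%:R by rewrite ltr0n.
pose h : R[i] := (sn n w.1 - w.1) +i* (sn n w.2 - w.2).
have -> : sn n w.1 +i* sn n w.2 = plane w + h.
  by apply: complex_eq; rewrite ?ReD ?ImD /=; ring.
apply: hd; apply: (le_lt_trans (cabs_ReIm _)) => /=.
apply: (le_lt_trans (lerD (floor_dist _ n0) (floor_dist _ n0))).
have : `|0 - n.+1%:R^-1| < d / 2 :> R.
  near: n; have /cvgrPdist_lt := @cvg_harmonic R; apply; lra.
by rewrite sub0r normrN gtr0_norm ?invr_gt0//; exact: aux.
Unshelve. all: by end_near. Qed.

Lemma within_ccont f : {within (closed_disc : set R[i]^o), continuous (f : R[i]^o -> R[i]^o)} ->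
  forall z, cabs z <= 1 -> forall e : R, 0 < e -> exists2 d : R, 0 < d &
  forall h, cabs h < d -> cabs (z + h) <= 1 -> cabs (f (z + h) - f z) <= e.
Proof.
move=> /subspace_continuousP cf z z1 e e0.
have e0' : 0 < e%:C :> R[i] by rewrite ltcR.
have /cvgrPdist_le /(_ _ e0') := cf z z1.
move=> [_ /gt0_complexR[d d0 ->] hd]; exists d => // h hh zh.
have := hd (z + h); rewrite /= opprD addrA subrr sub0r normrN normCabs ltcR => /(_ hh zh).
by rewrite normCabs lecR cabsBC.
Qed.

(** Local statements that hold eventually hold uniformly on the closed disc. *)
Lemma disc_uniform (P : nat -> R[i] -> Prop) :
  (forall z, cabs z <= 1 -> exists2 d : R, 0 < d & exists N, forall n h, (N <= n)%N ->
     cabs h < d -> cabs (z + h) <= 1 -> P n (z + h)) ->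
  exists N, forall z, cabs z <= 1 -> P N z.
Proof.
move=> hP; pose K : set (R * R) := `[-1, 1]%classic `*` `[-1, 1]%classic.
have cK : compact K by apply: compact_setX; exact: segment_compact.
have /compact_near_coveringP nK := cK.
have := nK nat \oo (fun n w => cabs (plane w) <= 1 -> P n (plane w)) _.
have hyp : forall w, K w -> \forall w' \near w & n \near \oo, cabs (plane w') <= 1 -> P n (plane w').
  move=> w _; have [d d0 [N hd]] : exists2 d : R, 0 < d & exists N, forall n h, (N <= n)%N ->
      cabs h < d -> cabs (plane w + h) <= 1 -> P n (plane w + h).
    have [w1|w1] := leP (cabs (plane w)) 1; first exact: hP.
    exists (cabs (plane w) - 1); first by rewrite subr_gt0.
    exists 0%N => n h _ hh hw; have := cabsB_ge (plane w) (- h).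
    by rewrite opprK cabsN; lra.
  exists (ball w (d / 2), [set n | (N <= n)%N]) => /=.
    by split; [apply: nbhsx_ballx; lra | exists N].
  move=> [w' n] /= [[b1 b2] Nn] hw'.
  have -> : plane w' = plane w + plane (w'.1 - w.1, w'.2 - w.2).
    by apply: complex_eq; rewrite ?ReD ?ImD /=; ring.
  apply: hd => //; last first.
    by move: hw'; congr (cabs _ <= 1); apply: complex_eq; rewrite ?ReD ?ImD /=; ring.
  apply: (le_lt_trans (cabs_ReIm _)) => /=; rewrite distrC [X in _ + X]distrC.
  by move: b1 b2; rewrite /ball /=; lra.
move=> /(_ _ hyp)[N _ hN]; exists N => z z1.
have := hN N (leqnn N) (complex.Re z, complex.Im z); rewrite /= planeK; apply => //.
by split; rewrite /= in_itv /= -ler_norml; [apply: le_trans (cabs_Re _) _ | apply: le_trans (cabs_Im _) _].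
Qed.

Lemma closed_disc_bounded f : {within (closed_disc : set R[i]^o), continuous (f : R[i]^o -> R[i]^o)} ->
  exists2 K : R, 0 < K & forall z, cabs z <= 1 -> cabs (f z) <= K.
Proof.
move=> /within_ccont cf; have [|N hN] := @disc_uniform (fun n z => cabs (f z) <= n%:R).
  move=> z z1; have [d d0 hd] := cf z z1 1 ltr01; exists d => //.
  exists (Num.truncn (cabs (f z) + 1)).+1 => n h hn hh zh.
  apply: (@le_trans _ _ (cabs (f z) + 1)).
    by have := cabsB_ge (f (z + h)) (f z); have := hd h hh zh; lra.
  apply: (le_trans (ltW (truncnS_gt _))); by rewrite ler_nat.
by exists (N%:R + 1) => [|z z1]; [have := ler0n R N; lra | have := hN z z1; lra].
Qed.

Lemma boundary_small f : {within (closed_disc : set R[i]^o), continuous (f : R[i]^o -> R[i]^o)} ->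
  (forall z, unit_circle z -> f z = 0) -> forall e : R, 0 < e ->
  exists2 rho : R, 0 < rho < 1 & forall z, rho < cabs z < 1 -> cabs (f z) <= e.
Proof.
move=> /within_ccont cf f0 e e0.
(* The radius [1 - n.+2^-1] is positive for every [n]. *)
have [|N hN] := @disc_uniform (fun n z => 1 - n.+2%:R^-1 < cabs z -> cabs (f z) <= e).
  move=> z z1; have [/f0 fz|zn] := eqVneq (cabs z) 1.
    have [d d0 hd] := cf z z1 e e0; exists d => //; exists 0%N => n h _ hh zh _.
    by have := hd h hh zh; rewrite fz subr0.
  have z1' : cabs z < 1 by rewrite lt_neqAle zn.
  pose d := (1 - cabs z) / 2; have d0 : 0 < d by rewrite /d; lra.
  exists d => //; exists (Num.truncn d^-1).+1 => n h hn hh zh hz.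
  have : n.+2%:R^-1 <= d.
    rewrite -[d]invrK lef_pV2 ?posrE ?invr_gt0//.
    by apply: (le_trans (ltW (truncnS_gt _))); rewrite ler_nat (leq_trans hn)// -addn2 leq_addr.
  have := cabsD z h; move: hh hz; rewrite /d; move: (n.+2%:R^-1) => t *; lra.
exists (1 - N.+2%:R^-1) => [|z /andP[h1 h2]]; last by apply: hN => //; exact: ltW.
rewrite subr_gt0 gtrBl invr_gt0 ltr0n andbT invf_lt1 ?ltr0n//.
by rewrite ltr1n.
Qed.

End Continuity.

(** * The quasi-norm *)
Section QuasiNorm.
Context {R : realType}.
Notation area := (@lebesgue_measure R \x @lebesgue_measure R)%E.
Variables (a b p : R).
Hypotheses (a1 : -1 < a) (b1 : -1 < b) (p0 : 0 < p).
Local Notation dens := (dens a b).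
Local Notation npow := (npow a b p).
Implicit Types (F G : R * R -> R[i]).

Lemma npow_ge0 F : (0 <= npow F)%E.
Proof. by apply: integral_ge0 => w _; rewrite lee_fin; pos. Qed.

Lemma measurable_npow F : cmeas setT F -> measurable_fun setT (fun w => (dens w * cabs (F w) `^ p)%:E).
Proof.
by move=> mF; have mc := cmeas_cabs mF; have md := measurable_dens a b; apply/measurable_EFinP; mfun.
Qed.

Lemma le_npow F G : cmeas setT F -> cmeas setT G ->
  (forall w, 0 < dens w -> cabs (F w) <= cabs (G w)) -> (npow F <= npow G)%E.
Proof.
move=> mF mG h; apply: area_le_integral; [exact: measurable_npow | | exact: measurable_npow | ].
  by move=> w; rewrite lee_fin; pos.
move=> w; rewrite lee_fin; have := dens_ge0 a1 b1 w; rewrite le_eqVlt => /orP[/eqP <-|d0].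
  by rewrite !mul0r.
by rewrite (ler_pM2l d0); apply: ge0_ler_powR; rewrite ?nnegrE ?cabs_ge0 ?(ltW p0)//; exact: h.
Qed.

Lemma npowZ F (c : R[i]) : cmeas setT F ->
  npow (fun w => c * F w) = ((cabs c `^ p)%:E * npow F)%E.
Proof.
move=> mF; rewrite -(area_integralZl _ (measurable_npow mF)) ?powR_ge0//; last first.
  by move=> w; rewrite lee_fin; pos.
by apply: eq_integral => w _; rewrite -EFinM cabsM powRM ?cabs_ge0//; congr (_%:E); ring.
Qed.

Lemma powRD_le (x y : R) : 0 <= x -> 0 <= y -> (x + y) `^ p <= 2 `^ p * (x `^ p + y `^ p).
Proof.
move=> x0 y0; wlog xy : x y x0 y0 / x <= y.
  by move=> H; have [/H->//|/ltW/H] := leP x y; rewrite addrC [y `^ p + _]addrC; apply.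
apply: (@le_trans _ _ ((2 * y) `^ p)).
  by apply: ge0_ler_powR; rewrite ?nnegrE ?(ltW p0)// ?addr_ge0 ?mulr_ge0//; lra.
by rewrite powRM// ler_wpM2l ?powR_ge0// lerDr powR_ge0.
Qed.

Lemma npowD F G : cmeas setT F -> cmeas setT G ->
  (npow (fun w => (F w + G w)%R) <= (2 `^ p)%:E * (npow F + npow G))%E.
Proof.
move=> mF mG; have nF := measurable_npow mF; have nG := measurable_npow mG.
have F0 w : (0 <= (dens w * cabs (F w) `^ p)%:E)%E by rewrite lee_fin; pos.
have G0 w : (0 <= (dens w * cabs (G w) `^ p)%:E)%E by rewrite lee_fin; pos.
have := @ge0_integralD _ _ R area setT measurableT _ _ (fun w _ => F0 w) nF (fun w _ => G0 w) nG => E.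
rewrite /npow -E.
rewrite -(area_integralZl _ (emeasurable_funD nF nG)) ?powR_ge0//; last first.
  by move=> w; rewrite adde_ge0.
apply: area_le_integral.
- by apply: measurable_npow; exact: cmeasD.
- by move=> w; rewrite lee_fin; pos.
- by apply: emeasurable_funM; [exact: measurable_cst | exact: emeasurable_funD].
move=> w; rewrite -EFinD -EFinM lee_fin -mulrDr mulrCA ler_wpM2l ?dens_ge0//.
apply: le_trans (powRD_le (cabs_ge0 _) (cabs_ge0 _)).
by apply: ge0_ler_powR; rewrite ?nnegrE ?cabs_ge0 ?addr_ge0 ?cabs_ge0 ?(ltW p0)//; exact: cabsD.
Qed.

Lemma npow_fatou (H : nat -> R * R -> R[i]) G (e : R) : (forall j, cmeas setT (H j)) ->
  cmeas setT G -> (forall w, 0 < dens w -> (fun j => cabs (H j w - G w)) @ \oo --> (0 : R)) ->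
  (\forall j \near \oo, (npow (H j) <= e%:E)%E) -> (npow G <= e%:E)%E.
Proof.
move=> mH mG lim bound.
have mf j : measurable_fun setT (fun w => (dens w * cabs (H j w) `^ p)%:E) by exact: measurable_npow.
have h0 j w : setT w -> (0 <= (dens w * cabs (H j w) `^ p)%:E)%E by move=> _; rewrite lee_fin; pos.
have := @fatou _ _ R (@plane_measure R) setT measurableT _ mf h0.
have lower w : limn_einf (fun j => (dens w * cabs (H j w) `^ p)%:E) = (dens w * cabs (G w) `^ p)%:E.
  suff h : (fun j => (dens w * cabs (H j w) `^ p)%:E) @ \oo --> (dens w * cabs (G w) `^ p)%:E.
    by have [-> _] := cvg_limn_einf_sup h.
  have := dens_ge0 a1 b1 w; rewrite le_eqVlt => /orP[/eqP d0|d0].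
    by rewrite -d0 mul0r; under eq_fun do rewrite mul0r; exact: cvg_cst.
  apply: cvg_EFin; first by near=> j.
  apply: cvgM; first exact: cvg_cst.
  have lim' : (fun j => cabs (H j w)) @ \oo --> cabs (G w).
    apply/cvgrPdist_le => e' e'0; move/cvgrPdist_le : (lim w d0) => /(_ e' e'0); apply: filterS => j.
    rewrite sub0r normrN ger0_norm ?cabs_ge0// => h; apply: le_trans h.
    by rewrite ler_norml; apply/andP; split; [have := cabsB_ge (H j w) (G w) | have := cabsB_ge (G w) (H j w)];
      rewrite ?[cabs (G w - _)]cabsBC; lra.
  have [G0|G0] := eqVneq (cabs (G w)) 0; last first.
    have G0' : 0 < cabs (G w) by rewrite lt_neqAle eq_sym G0 cabs_ge0.
    exact: (continuous_cvg _ (@continuous_powR R p _ G0') lim').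
  rewrite G0 in lim' *; rewrite powR0 ?gt_eqF//.
  apply/cvgrPdist_le => e' e'0; have d'0 : 0 < e' `^ p^-1 by rewrite powR_gt0.
  move/cvgrPdist_le : lim' => /(_ _ d'0); apply: filterS => j.
  rewrite !sub0r !normrN !ger0_norm ?cabs_ge0 ?powR_ge0// => h.
  have -> : e' = (e' `^ p^-1) `^ p by rewrite -powRrM mulVf ?gt_eqF// powRr1// ltW.
  by apply: ge0_ler_powR; rewrite ?nnegrE ?cabs_ge0 ?powR_ge0 ?(ltW p0).
have -> : (\int[@plane_measure R]_(x in setT) limn_einf (fun j => (dens x * cabs (H j x) `^ p)%:E) = npow G)%E.
  by apply: eq_integral => w _; rewrite lower.
move=> h; apply: (le_trans h); rewrite limn_einf_lim.
apply: lime_le; first exact: is_cvg_einfs.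
apply: filterS bound => n hn; apply: le_trans hn.
by apply: ereal_inf_lbound; exists n => //=.
Unshelve. all: by end_near. Qed.

End QuasiNorm.

(** * Compactness in quasi-metric spaces *)
Section QuasiMetric.
Context {R : realType} {T : topologicalType}.
Variables (d : T -> T -> R) (k : R).
Hypotheses (d_sym : forall x y, d x y = d y x).
Hypotheses (k1 : 1 <= k) (d_tri : forall x y z, d x z <= k * (d x y + d y z)).
Hypothesis (d_nbhs : forall x (U : set T), nbhs x U <-> exists2 e : R, 0 < e & forall y, d x y < e -> U y).

Lemma ultra_bounded_lim (I : Type) (F : set_system I) (K : set I) (v : I -> R) (C : R) :
  UltraFilter F -> F K -> (forall i, K i -> `|v i| <= C) ->
  exists l : R, forall e : R, 0 < e -> F [set i | `|v i - l| < e].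
Proof.
move=> UF FK vC.
have cC : compact `[- C, C] := @segment_compact R _ _.
have FC : (v @ F) `[- C, C]%classic.
  by apply: (@filterS _ F _ K) => // i Ki; have := vC i Ki; rewrite ler_norml => h; rewrite /= in_itv.
have [l [_ cl]] := cC (v @ F) _ FC.
exists l => e e0; have [//|nF] := in_ultra_setVsetC [set i | `|v i - l| < e] UF.
have vF : (v @ F) [set t | ~ `|t - l| < e] by [].
have lb : nbhs l (ball l e) by exact: nbhsx_ballx.
by have [t [/= nt]] := cl _ _ vF lb; rewrite /ball /= distrC => /nt.
Qed.

(** Room for three distances in a row, see [d_tri3]. *)
Lemma quasi_small (e : R) : 0 < e -> exists2 e1 : R, 0 < e1 & k * (e1 + k * (e1 + e1)) <= e.
Proof.
move=> e0; have k0 : 0 < k by exact: lt_le_trans k1.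
exists (e / (3 * k ^+ 2)); first by rewrite divr_gt0// mulr_gt0// exprn_gt0.
set e1 := e / _; have e10 : 0 < e1 by rewrite divr_gt0// mulr_gt0// exprn_gt0.
have -> : e = 3 * k ^+ 2 * e1 by rewrite /e1; field; rewrite gt_eqF.
have : k * e1 <= k * k * e1 by rewrite ler_wpM2r ?(ltW e10)// ler_peMl// ltW.
by rewrite expr2; lra.
Qed.

Lemma d_tri3 x y z t e : d x y <= e -> d y z <= e -> d z t <= e -> d x t <= k * (e + k * (e + e)).
Proof.
move=> h1 h2 h3; have k0 : 0 < k by exact: lt_le_trans k1.
apply: (le_trans (d_tri x y t)); rewrite ler_wpM2l ?(ltW k0)// lerD//.
by apply: (le_trans (d_tri y z t)); rewrite ler_wpM2l ?(ltW k0)// lerD.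
Qed.

(** Along an ultrafilter each of finitely many bounded functions converges; since
    they control the distance, the ultrafilter contains sets of small diameter.
    Points of the closure are replaced by nearby points of the set itself, so that
    completeness is required of sequences in the set only. *)
Lemma compact_closure_image (I : Type) (B : set I) (y : I -> T) :
  (forall e : R, 0 < e -> exists N, exists u : nat -> I -> R, exists C : R, exists2 dl : R, 0 < dl &
     (forall i n, B i -> `|u n i| <= C) /\
     forall i j, B i -> B j -> (forall n, (n < N)%N -> `|u n i - u n j| <= dl) -> d (y i) (y j) <= e) ->
  (forall s : nat -> I, (forall j, B (s j)) ->
     (forall e : R, 0 < e -> exists J, forall i j, (J <= i)%N -> (J <= j)%N -> d (y (s i)) (y (s j)) <= e) ->
     exists g, forall e : R, 0 < e -> exists J, forall j, (J <= j)%N -> d (y (s j)) g <= e) ->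
  compact (closure (y @` B)).
Proof.
move=> tb compl; rewrite compact_ultra => F UF FK; set K := closure (y @` B) in FK *.
have near_ x (e : R) : K x -> 0 < e -> exists i, B i /\ d x (y i) < e.
  move=> Kx e0; have [|t [[i Bi <-] h]] := Kx [set t | d x t < e]; first by apply/d_nbhs; exists e.
  by exists i.
have [x0 Kx0] := filter_ex FK; have [i0 Bi0] := near_ x0 1 Kx0 ltr01.
have sel (e : R) : 0 < e -> exists s : T -> I, forall x, K x -> B (s x) /\ d x (y (s x)) < e.
  move=> e0; suff /choice[s hs] : forall x, exists i, K x -> B i /\ d x (y i) < e by exists s.
  move=> x; have [Kx|nKx] := pselect (K x); last by exists i0.
  by have [i hi] := near_ x e Kx e0; exists i.
(* Points of [K] have neighbours in the image of [B], where the functions [u] are defined. *)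
have cauchy (e : R) : 0 < e -> exists A, F A /\ forall x x', A x -> A x' -> K x /\ d x x' <= e.
  move=> e0; have [e1 e10 he1] := quasi_small e0.
  have [s hs] := sel e1 e10; have [N [u [C [dl dl0 [uC hu]]]]] := tb e1 e10.
  have vC n x : K x -> `|u n (s x)| <= C by move=> Kx; apply: uC; have [] := hs x Kx.
  have /choice[l hl] : forall n, exists l : R, forall e : R, 0 < e -> F [set x | `|u n (s x) - l| < e].
    by move=> n; exact: (ultra_bounded_lim UF FK (vC n)).
  pose A N := [set x | forall n, (n < N)%N -> `|u n (s x) - l n| < dl / 2].
  have FA M : F (A M).
    elim: M => [|M IH]; first by apply: filterS filterT => x _ n.
    have dl2 : 0 < dl / 2 by lra.
    apply: filterS (filterI IH (hl M _ dl2)) => x [/= h1 h2] n.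
    by rewrite ltnS leq_eqVlt => /orP[/eqP ->|/h1].
  exists (A N `&` K); split; first exact: filterI.
  move=> x x' [Ax Kx] [Ax' Kx']; split => //; apply: le_trans he1.
  have [Bx dx] := hs x Kx; have [Bx' dx'] := hs x' Kx'.
  apply: (@d_tri3 _ (y (s x)) (y (s x'))); [exact: ltW | | by rewrite d_sym ltW].
  apply: hu => // n nN; have := Ax n nN; have := Ax' n nN; rewrite !ltr_norml ler_norml.
  by move=> /andP[? ?] /andP[? ?]; apply/andP; split; lra.
have hpos j : 0 < (j.+1%:R : R)^-1 by rewrite invr_gt0.
have /choice[A hA] : forall j : nat, exists A, F A /\ forall x x', A x -> A x' -> K x /\ d x x' <= j.+1%:R^-1.
  by move=> j; exact: cauchy.
have FE j : F [set x | forall i, (i <= j)%N -> A i x].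
  elim: j => [|j IH]; first by apply: filterS (hA 0%N).1 => x A0 i; rewrite leqn0 => /eqP ->.
  apply: filterS (filterI IH (hA j.+1).1) => x [/= h1 h2] i.
  by rewrite leq_eqVlt => /orP[/eqP ->//|/h1].
have /choice[xs hxs] : forall j, exists x, forall i, (i <= j)%N -> A i x.
  by move=> j; exact: filter_ex (FE j).
have Kxs j : K (xs j) by have := hxs j j (leqnn j) => h; have [] := (hA j).2 _ _ h h.
have /choice[s hs] : forall j, exists i, B i /\ d (xs j) (y i) < j.+1%:R^-1.
  by move=> j; exact: near_.
have small (e : R) : 0 < e -> exists J : nat, forall j, (J <= j)%N -> j.+1%:R^-1 <= e.
  move=> e0; exists (Num.truncn e^-1) => j hj; rewrite -[e]invrK lef_pV2 ?posrE ?invr_gt0//.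
  by apply: (le_trans (ltW (truncnS_gt _))); rewrite ler_nat ltnS.
have [|g hg] := compl s (fun j => (hs j).1).
  move=> e e0; have [e1 e10 he1] := quasi_small e0; have [J hJ] := small e1 e10.
  exists J => i j Ji Jj; apply: le_trans he1.
  apply: (@d_tri3 _ (xs i) (xs j)).
  - by rewrite d_sym; apply: le_trans (hJ i Ji); exact: ltW (hs i).2.
  - by apply: le_trans (hJ J (leqnn J)); apply: ((hA J).2 _ _ _ _).2; apply: hxs.
  - by apply: le_trans (hJ j Jj); exact: ltW (hs j).2.
exists g; split.
  move=> U /d_nbhs[e e0 eU]; have e20 : 0 < e / 2 by lra.
  have [J hJ] := hg _ e20; exists (y (s J)); split; first by exists (s J) => //; exact: (hs J).1.
  by apply: eU; rewrite d_sym; apply: (le_lt_trans (hJ J (leqnn J))); lra.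
move=> U /d_nbhs[e e0 eU]; have e20 : 0 < e / 2 by lra.
have [e1 e10 he1] := quasi_small e20; have [J hJ] := small e1 e10; have [J' hJ'] := hg e1 e10.
pose j := maxn J J'; have jJ : (J <= j)%N by rewrite leq_maxl.
have jJ' : (J' <= j)%N by rewrite leq_maxr.
apply: filterS (hA j).1 => x Ax; apply: eU.
suff : d g x <= e / 2 by move=> h; apply: (le_lt_trans h); lra.
apply: le_trans he1; apply: (@d_tri3 _ (y (s j)) (xs j)).
- by rewrite d_sym; exact: hJ'.
- by rewrite d_sym; apply: le_trans (hJ j jJ); exact: ltW (hs j).2.
- by apply: le_trans (hJ j jJ); apply: ((hA j).2 _ _ _ _).2 => //; apply: hxs.
Qed.

(** A cluster point of the sequence, with neighbourhoods expressed by the distance. *)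
Lemma compact_cluster_seq (S : set T) (y : nat -> T) : compact (closure S) -> (forall n, S (y n)) ->
  exists g, forall (e : R) N, 0 < e -> exists2 n, (N <= n)%N & d (y n) g < e.
Proof.
move=> cS hy; have FS : (y @ \oo) (closure S) by exists 0%N => // n _; apply: subset_closure; exact: hy.
have [g [_ cg]] := cS (y @ \oo) _ FS; exists g => e N e0.
have h1 : (y @ \oo) (y @` [set n | (N <= n)%N]) by exists N => // n /= Nn; exists n.
have h2 : nbhs g [set t | d g t < e] by apply/d_nbhs; exists e.
by have [t [[n Nn <-]]] := cg _ _ h1 h2; rewrite /= d_sym; exists n.
Qed.

End QuasiMetric.

(** * The topology of the Bergman space *)
Section BergmanTopology.
Context {R : realType}.
Variables (a b p : R).
Hypotheses (a1 : -1 < a) (b1 : -1 < b) (p0 : 0 < p).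
Local Notation npow := (npow a b p).
Implicit Types (f g h : bergman a b p).

Lemma bergman_holomorphic f : holomorphic_on punctured_disc f.
Proof. by case: f. Qed.

Lemma bergman_out f z : ~ punctured_disc z -> f z = 0.
Proof. by case: f => f ? ? h; exact: h. Qed.

Lemma bergman_cmeas f : cmeas setT (f \o @plane R).
Proof.
apply: cmeas_ccont => z hz; last exact: bergman_out.
have hf := @bergman_holomorphic f.
by have := holomorphic_ccont hf hz.
Qed.

Lemma bnorm_lt_npow (F : R[i] -> R[i]) (e : R) : 0 < e -> (npow (F \o @plane R) < (e `^ p)%:E)%E ->
  (bnorm a b p F < e%:E)%E.
Proof.
move=> e0; rewrite bnormE; have := npow_ge0 p a1 b1 (F \o @plane R).
case: (npow _) => [r r0|//|//]; rewrite lte_fin => re.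
rewrite poweR_EFin lte_fin -[ltRHS]powRr1 ?ltW// -(mulfV (lt0r_neq0 p0)) powRrM.
by apply: gt0_ltr_powR; rewrite ?invr_gt0 ?nnegrE ?powR_ge0.
Qed.

Lemma npow_lt_bnorm (F : R[i] -> R[i]) (e : R) : 0 < e -> (bnorm a b p F < e%:E)%E ->
  (npow (F \o @plane R) < (e `^ p)%:E)%E.
Proof.
move=> e0; rewrite bnormE; have := npow_ge0 p a1 b1 (F \o @plane R).
case: (npow _) => [r r0|_|//]; last by rewrite poweRyr ?invr_eq0 ?gt_eqF.
rewrite poweR_EFin !lte_fin => re; rewrite -[ltLHS]powRr1// -(mulVf (lt0r_neq0 p0)) powRrM.
by apply: gt0_ltr_powR; rewrite ?nnegrE ?powR_ge0 ?(ltW e0).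
Qed.

Lemma bnorm_lty (F : R[i] -> R[i]) : (npow (F \o @plane R) < +oo)%E <-> (bnorm a b p F < +oo)%E.
Proof.
rewrite bnormE; have := npow_ge0 p a1 b1 (F \o @plane R).
case: (npow _) => [r r0|_|//]; first by rewrite poweR_EFin !ltry.
by rewrite poweRyr ?invr_eq0 ?gt_eqF.
Qed.

Lemma bnorm_le1 (F : R[i] -> R[i]) : (npow (F \o @plane R) <= 1)%E <-> (bnorm a b p F <= 1)%E.
Proof.
rewrite bnormE; have := npow_ge0 p a1 b1 (F \o @plane R).
case: (npow _) => [r|_|//]; last by rewrite poweRyr ?invr_eq0 ?gt_eqF.
rewrite lee_fin => r0; rewrite poweR_EFin !lee_fin; split=> h.
  have E : 1 `^ p^-1 = 1 :> R by rewrite powR1.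
  by rewrite -[leRHS]E; apply: ge0_ler_powR; rewrite ?nnegrE ?invr_ge0 ?(ltW p0).
have E : 1 `^ p = 1 :> R by rewrite powR1.
apply: (@le_trans _ _ ((r `^ p^-1) `^ p)); first by rewrite -powRrM mulVf ?gt_eqF// powRr1.
rewrite -[leRHS]E; apply: ge0_ler_powR; rewrite ?nnegrE ?powR_ge0 ?(ltW p0)//.
Qed.

Lemma bergman_fin f : (npow (f \o @plane R) < +oo)%E.
Proof. by apply/bnorm_lty; case: f. Qed.

Definition bdist f g : R := fine (npow ((fun z => f z - g z) \o @plane R)).

Lemma cmeasB_bergman f g : cmeas setT ((fun z => f z - g z) \o @plane R).
Proof. by apply: cmeasD; [exact: bergman_cmeas | apply: cmeasN; exact: bergman_cmeas]. Qed.

Lemma npowN (F : R * R -> R[i]) : npow (fun w => - F w) = npow F.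
Proof. by apply: eq_integral => w _; rewrite cabsN. Qed.

Lemma bdistE f g : npow ((fun z => f z - g z) \o @plane R) = (bdist f g)%:E.
Proof.
rewrite /bdist fineK// ge0_fin_numE ?npow_ge0//.
have mf := bergman_cmeas f; have mg := cmeasN (bergman_cmeas g).
apply: (le_lt_trans (npowD a1 b1 p0 mf mg)); rewrite npowN.
by rewrite lte_mul_pinfty ?lee_fin ?powR_ge0// lte_add_pinfty ?bergman_fin.
Qed.

Lemma bdistC f g : bdist f g = bdist g f.
Proof.
by rewrite /bdist -npowN; congr (fine (npow _)); apply/funext => w /=; rewrite opprB.
Qed.

Lemma bdistxx f : bdist f f = 0.
Proof.
rewrite /bdist /npow (eq_integral (fun=> 0%E)) ?integral0// => w _ /=.
by rewrite subrr cabs0 powR0 ?mulr0// gt_eqF.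
Qed.

Lemma bdist_tri f g h : bdist f h <= 2 `^ p * (bdist f g + bdist g h).
Proof.
have := npowD a1 b1 p0 (cmeasB_bergman f g) (cmeasB_bergman g h).
have -> : (fun w => ((fun z => f z - g z) \o @plane R) w + ((fun z => g z - h z) \o @plane R) w) =
  (fun z => f z - h z) \o @plane R by apply/funext => w /=; rewrite addrA subrK.
by rewrite (bdistE f h) (bdistE f g) (bdistE g h) -EFinD -EFinM lee_fin.
Qed.

Lemma bergman_ballP f g (e : R) : 0 < e -> bergman_ball f e g <-> bdist f g < e `^ p.
Proof.
move=> e0; rewrite bdistC /bergman_ball /= -lte_fin -bdistE; split.
  exact: npow_lt_bnorm.
exact: bnorm_lt_npow.
Qed.

Lemma two_powR_ge1 : 1 <= 2 `^ p :> R.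
Proof. by rewrite -[leLHS](powRr0 2); apply: ler_powR; rewrite ?ler1n// ltW. Qed.

(** Balls need not be open, but the centres of the balls inside [U] form an open set. *)
Lemma bergman_nbhs f (U : set (bergman a b p)) :
  nbhs f U <-> exists2 e : R, 0 < e & forall g, bdist f g < e -> U g.
Proof.
split=> [|[e e0 eU]].
  rewrite nbhsE => -[V [oV Vf] VU]; have [e e0 eV] := oV f Vf.
  exists (e `^ p) => [|g hg]; first by rewrite powR_gt0.
  by apply: VU; apply: eV; apply/bergman_ballP.
rewrite nbhsE; exists [set g | exists2 e : R, 0 < e & forall h, bdist g h < e -> U h]; last first.
  by move=> g [e' e'0]; apply; rewrite bdistxx.
split; last by exists e.
move=> g [e' e'0 hg]; have k1 := two_powR_ge1; set k := 2 `^ p in k1 *.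
have k0 : 0 < k by exact: lt_le_trans k1.
pose e1 := e' / (2 * k); have e10 : 0 < e1 by rewrite divr_gt0// mulr_gt0.
have e1p : (e1 `^ p^-1) `^ p = e1 by rewrite -powRrM mulVf ?gt_eqF// powRr1// ltW.
exists (e1 `^ p^-1); first by rewrite powR_gt0.
move=> g' /bergman_ballP; rewrite powR_gt0// e1p => /(_ isT) h1.
exists e1 => // h h2; apply: hg; apply: (le_lt_trans (bdist_tri g g' h)).
rewrite -/k; have -> : e' = k * (e1 + e1) by rewrite /e1; field; rewrite gt_eqF.
move: h1 h2; move: (bdist g g') (bdist g' h) => x y h1 h2.
by rewrite (ltr_pM2l k0); exact: ltrD.
Qed.

End BergmanTopology.

(** * Compactness for symbols that vanish on the circle *)
Section SeriesLimits.
Context {R : realType}.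

Lemma pser_scale (a : nat -> R[i]) (c z : R[i]) : subexp a -> cabs z < 1 ->
  pser (fun n => c * a n) z = c * pser a z.
Proof.
move=> sa z1; rewrite /pser -(csumZ c (subexp_abs_summable sa z1)).
by congr csum; apply/funext => n; rewrite mulrA.
Qed.

Lemma subexp_mul_bounded (h x : nat -> R[i]) (C : R) : subexp h ->
  (forall n, cabs (x n) <= C) -> subexp (fun n => h n * x n).
Proof.
move=> sh xC; apply: (@subexp_scale _ _ _ C sh) => n.
by rewrite cabsM mulrC ler_wpM2r ?cabs_ge0.
Qed.

(** Dominated convergence for series: the tail is small uniformly in [r], and the
    initial segment is a finite sum. *)
Lemma pser_null (h : nat -> R[i]) (x : nat -> nat -> R[i]) (C : R) (z : R[i]) : subexp h -> 0 <= C ->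
  cabs z < 1 -> (forall r n, cabs (x r n) <= C) ->
  (forall n, (fun r => cabs (x r n)) @ \oo --> (0 : R)) ->
  (fun r => cabs (pser (fun n => h n * x r n) z)) @ \oo --> (0 : R).
Proof.
move=> sh C0 z1 xC x0; have z0 := cabs_ge0 z.
have [q /andP[q0 q1] [K K0 hK]] := subexp_geom sh (introT andP (conj z0 z1)).
pose s := Num.sqrt q.
have s2 : s ^+ 2 = q by rewrite sqr_sqrtr// ltW.
have s0 : 0 < s by rewrite sqrtr_gt0.
have s1 : s < 1 by rewrite -[ltRHS]sqrtr1 ltr_sqrt.
have s01 : 0 < s < 1 by rewrite s0.
have KC : 0 <= K * C by rewrite mulr_ge0.
have tail r N : cabs (pser (fun n => h n * x r n) z - \sum_(0 <= n < N) h n * x r n * z ^+ n)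
    <= K * C / (1 - s) * s ^+ N.
  apply: (pser_tail z0 KC s01) => // n; rewrite cabsM mulrAC -exprM mulnC exprM s2.
  rewrite [K * C * _]mulrAC; apply: ler_pM; [by rewrite mulr_ge0 ?cabs_ge0 ?exprn_ge0 | exact: cabs_ge0 | exact: hK | exact: xC].
apply/cvgrPdist_le => e e0; have e20 : 0 < e / 2 by lra.
have /cvgrPdist_le /(_ _ e20)[N _ hN] : (fun N => K * C / (1 - s) * s ^+ N) @ \oo --> (0 : R).
  by apply: cvg_geom0; rewrite ger0_norm// ltW.
have {}hN := hN N (leqnn N).
have fin0 M : (fun r => \sum_(0 <= n < M) cabs (h n * z ^+ n) * cabs (x r n)) @ \oo --> (0 : R).
  elim: M => [|M IH]; first by under eq_fun do rewrite big_nil; exact: cvg_cst.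
  have h1 : (fun r => cabs (h M * z ^+ M) * cabs (x r M)) @ \oo --> cabs (h M * z ^+ M) * 0.
    by apply: cvgM; [exact: cvg_cst | exact: x0].
  have h2 : (fun r => \sum_(0 <= n < M) cabs (h n * z ^+ n) * cabs (x r n) +
      cabs (h M * z ^+ M) * cabs (x r M)) @ \oo --> 0 + cabs (h M * z ^+ M) * 0 by exact: cvgD.
  rewrite mulr0 addr0 in h2.
  by under eq_fun do rewrite big_nat_recr//=.
move/cvgrPdist_le : (fin0 N) => /(_ _ e20); apply: filterS => r.
rewrite !sub0r !normrN => h1; rewrite ger0_norm ?cabs_ge0//.
have h2 : cabs (\sum_(0 <= n < N) h n * x r n * z ^+ n) <= e / 2.
  apply: (le_trans (cabs_sum _ _ _)); apply: le_trans h1; apply: le_trans (ler_norm _).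
  by apply: ler_sum => n _; rewrite -cabsM mulrAC.
have := tail r N; have := cabsD (pser (fun n => h n * x r n) z - \sum_(0 <= n < N) h n * x r n * z ^+ n)
  (\sum_(0 <= n < N) h n * x r n * z ^+ n).
move: hN; rewrite subrK sub0r normrN => /(le_trans (ler_norm _)); lra.
Qed.

(** All coefficients converge along an ultrafilter finer than [\oo]; the [i]-th index is
    chosen so that the first [i] of them are within [1 / (i + 1)] of their limits. *)
Lemma coefficient_subsequence (x : nat -> nat -> R[i]) (C : R) : (forall j n, cabs (x j n) <= C) ->
  exists l : nat -> R[i], exists r : nat -> nat, [/\ forall i, (i <= r i)%N,
    forall n, cabs (l n) <= C + 1 &
    forall n, (fun i => cabs (x (r i) n - l n)) @ \oo --> (0 : R)].
Proof.
move=> xC; have [F [UF leF]] := @ultraFilterLemma nat \oo _.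
have FT : F setT by exact: filterT.
have /choice[l hl] : forall n, exists l : R[i], forall e : R, 0 < e -> F [set j | cabs (x j n - l) < e].
  move=> n; have [l1 h1] := @ultra_bounded_lim R _ _ _ (fun j => complex.Re (x j n)) C UF FT
    (fun j _ => le_trans (cabs_Re _) (xC j n)).
  have [l2 h2] := @ultra_bounded_lim R _ _ _ (fun j => complex.Im (x j n)) C UF FT
    (fun j _ => le_trans (cabs_Im _) (xC j n)).
  exists (l1 +i* l2) => e e0; have e20 : 0 < e / 2 by lra.
  apply: filterS (filterI (h1 _ e20) (h2 _ e20)) => j [/= hr hi].
  by apply: (le_lt_trans (cabs_ReIm _)); rewrite ReB ImB /=; lra.
have pos i : 0 < (i.+1%:R : R)^-1 by rewrite invr_gt0.
have FA i M : F [set j | forall n, (n < M)%N -> cabs (x j n - l n) < i.+1%:R^-1].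
  elim: M => [|M IH]; first by apply: filterS FT => j _ n.
  apply: filterS (filterI IH (hl M _ (pos i))) => j [/= h1 h2] n.
  by rewrite ltnS leq_eqVlt => /orP[/eqP ->|/h1].
have /choice[r hr] : forall i, exists j, (i <= j)%N /\ forall n, (n < i)%N -> cabs (x j n - l n) < i.+1%:R^-1.
  move=> i; have Fi : F [set j | (i <= j)%N] by apply: leF; exists i.
  by have [j [h1 h2]] := filter_ex (filterI Fi (FA i i)); exists j.
exists l, r; split=> [i|n|n]; first exact: (hr i).1.
  have [j hj] := filter_ex (hl n 1 ltr01); have := cabsB_ge (l n) (x j n).
  by have := xC j n; rewrite cabsBC; move: hj => /=; lra.
apply/cvgrPdist_le => e e0; near=> i; rewrite sub0r normrN ger0_norm ?cabs_ge0//.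
have ni : (n < i)%N by near: i; exists n.+1.
apply: (le_trans (ltW ((hr i).2 n ni))).
rewrite -[e]invrK lef_pV2 ?posrE ?invr_gt0//; apply: (le_trans (ltW (truncnS_gt _))).
by rewrite ler_nat ltnS; near: i; exists (Num.truncn e^-1).
Unshelve. all: by end_near. Qed.

End SeriesLimits.

Section Symbol.
Context {R : realType}.
Notation area := (@lebesgue_measure R \x @lebesgue_measure R)%E.
Variables (a b0 : R) (m : nat).
Hypotheses (a1 : -1 < a) (b1 : -1 < b0) (b00 : b0 <= 0).
Let b := b0 + m%:R.
Let M : R := m%:R / 2.
Let b1' : -1 < b := bgt m b1.
Variables (p q : R).
Hypotheses (p1 : 1 < p) (pq : p^-1 + q^-1 = 1) (Mp : M * p < b + 1) (Mq : M * q < b + 1).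
Let p0 : 0 < p := lt_trans ltr01 p1.
Local Notation dens := (dens a b).
Local Notation npow := (npow a b p).
Local Notation Jint := (Jint a b0 m).
Local Notation okF := (okF a b0 m).
Local Notation Bcoef := (Bcoef a b0 m).
Local Notation h := (fun n : nat => (hcoef a b0 n)%:C : R[i]).
Local Notation space := (bergman a b p).
Variable (phi : R[i] -> R[i]).
Hypothesis (hphi : {within (closed_disc : set R[i]^o), continuous (phi : R[i]^o -> R[i]^o)}).
Implicit Types (z w : R[i]) (F G : R[i] -> R[i]) (f g : space).

Definition times (psi F : R[i] -> R[i]) z : R[i] := psi z * F z.

Lemma dens_disc_lt1 (w : R * R) : 0 < dens w -> cabs (plane w) < 1.
Proof.
by move=> d0; apply: cabs_plane_lt1; apply: contraT => /dens_out dw; move: d0; rewrite dw ltxx.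
Qed.

Lemma interior_ccont psi z : {within (closed_disc : set R[i]^o), continuous (psi : R[i]^o -> R[i]^o)} ->
  cabs z < 1 -> ccont psi z.
Proof.
move=> /within_ccont cpsi z1 e e0; have [d d0 hd] := cpsi z (ltW z1) e e0.
exists (Num.min d (1 - cabs z)) => [|k]; first by rewrite lt_min d0 subr_gt0.
rewrite lt_min => /andP[k1 k2]; apply: hd => //; apply: (le_trans (cabsD _ _)); lra.
Qed.

Lemma symbol_cmeas f : cmeas setT ((times phi f) \o @plane R).
Proof.
apply: cmeas_ccont => z hz; last by rewrite /times (bergman_out _ hz) mulr0.
have [z1 _] := hz; apply: ccontM; first exact: interior_ccont.
have hf := @bergman_holomorphic _ _ _ _ f; have := holomorphic_ccont hf hz; exact.
Qed.

Lemma bergman_0 f : f 0 = 0.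
Proof. by apply: bergman_out => -[_]; rewrite eqxx. Qed.

Lemma npow_mul_le (psi F : R[i] -> R[i]) (K : R) : 0 <= K -> cmeas setT (F \o @plane R) ->
  cmeas setT ((times psi F) \o @plane R) ->
  (forall w, cabs w < 1 -> cabs (psi w) <= K) ->
  (npow ((times psi F) \o @plane R) <= (K `^ p)%:E * npow (F \o @plane R))%E.
Proof.
move=> K0 mF mpF hK; have mKF := cmeasM (cmeas_cst setT K%:C) mF.
have := npowZ p a1 b1' K%:C mF; rewrite cabsR ger0_norm// => <-.
apply: (le_npow a1 b1' p0 mpF mKF) => w /dens_disc_lt1 w1 /=.
by rewrite /times !cabsM cabsR ger0_norm// ler_wpM2r ?cabs_ge0// hK.
Qed.

Lemma ok_of_npow F : cmeas setT (F \o @plane R) -> F 0 = 0 -> (npow (F \o @plane R) < +oo)%E -> okF F.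
Proof. by move=> mF F0 fin; split => //; exact: (Jint_fin a1 b1 p1 pq Mp Mq). Qed.

Lemma symbol_ok f : okF (times phi f).
Proof.
have [K K0 hK] := closed_disc_bounded hphi.
have mpf := symbol_cmeas f; have mf := bergman_cmeas f.
apply: ok_of_npow => //; first by rewrite /times bergman_0 mulr0.
have hK' w : cabs w < 1 -> cabs (phi w) <= K by move=> /ltW; exact: hK.
apply: (le_lt_trans (npow_mul_le (ltW K0) mf mpf hK')).
by rewrite lte_mul_pinfty ?lee_fin ?powR_ge0 ?(bergman_fin a1 b1' p0).
Qed.

(** Elements of the space given by a Laurent series with a pole of order at most [m]. *)
Definition laurent (c : nat -> R[i]) z : R[i] :=
  ((cabs z < 1) && (z != 0))%:R * (pser c z / z ^+ m).

Lemma laurentE c z : punctured_disc z -> laurent c z = pser c z / z ^+ m.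
Proof. by move=> [z1 z0]; rewrite /laurent z1 z0 mul1r. Qed.

Lemma laurent_out c z : ~ punctured_disc z -> laurent c z = 0.
Proof.
move=> hz; rewrite /laurent; have [/andP[z1 z0]|] := boolP ((cabs z < 1) && (z != 0)); last by rewrite mul0r.
by case: hz.
Qed.

Lemma laurent_cmeas c : subexp c -> cmeas setT (laurent c \o @plane R).
Proof.
move=> sc; apply: cmeas_ccont => z hz; last exact: laurent_out.
have hl := laurent_holomorphic sc (@laurentE c); have := holomorphic_ccont hl hz; exact.
Qed.

Lemma laurent_space c : subexp c -> (npow (laurent c \o @plane R) < +oo)%E ->
  exists g, g = laurent c :> (R[i] -> R[i]).
Proof.
move=> sc fin.
by exists (@Bergman _ a b p (laurent c) (laurent_holomorphic sc (@laurentE c))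
  ((bnorm_lty a1 b1' p0 _).1 fin) (@laurent_out c)).
Qed.

Definition tcoef (k : R) F (n : nat) : R[i] := k%:C * h n * Bcoef F n.

Lemma projection_laurent : exists2 k : R, 0 < k & forall F, okF F ->
  subexp (tcoef k F) /\
  forall z, punctured_disc z -> projection a b F z = laurent (tcoef k F) z.
Proof.
have [k k0 hk] := projection_series m a1 b1 b00; exists k => // F [mF F0 JF].
have sB := subexp_hB a1 b1 mF F0 JF.
have E : (tcoef k F) = (fun n => k%:C * (h n * Bcoef F n)).
  by apply/funext => n; rewrite /tcoef mulrA.
split; first by rewrite E; apply: (@subexp_scale _ _ _ (cabs k%:C) sB) => n; rewrite [leLHS]cabsM.
move=> z hz; have [z1 _] := hz; have hz' : 0 < sqnorm (complex.Re z, complex.Im z) < 1.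
  by apply: plane_disc; rewrite planeK.
by have := hk F mF F0 JF _ hz'; rewrite planeK => ->; rewrite laurentE// E pser_scale// mulrA.
Qed.

Lemma toeplitz_exists : exists T : space -> space, is_toeplitz phi T.
Proof.
have [k k0 hk] := projection_laurent.
have [C C0 hC] := projection_norm a1 b1 b00 p1 pq Mp Mq.
suff /choice[T hT] : forall f, exists g, forall z, punctured_disc z ->
    g z = projection a b (times phi f) z by exists T.
move=> f; have oF := symbol_ok f; have [sc hproj] := hk _ oF; have [mF F0 JF] := oF.
have mL := laurent_cmeas sc.
have L0 c : laurent c 0 = 0 by rewrite /laurent eqxx andbF mul0r.
have fin : (npow (laurent (tcoef k (times phi f)) \o @plane R) < +oo)%E.
  apply: (le_lt_trans (hC _ _ mF mL F0 (L0 _) (fun z hz => esym (hproj z hz)))).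
  have [K K0 hK] := closed_disc_bounded hphi.
  have hK' w : cabs w < 1 -> cabs (phi w) <= K by move=> /ltW; exact: hK.
  rewrite lte_mul_pinfty//; apply: (le_lt_trans (npow_mul_le (ltW K0) (bergman_cmeas f) mF hK')).
  by rewrite lte_mul_pinfty ?lee_fin ?powR_ge0 ?(bergman_fin a1 b1' p0).
by have [g gE] := laurent_space sc fin; exists g => z hz; rewrite gE hproj.
Qed.

Definition chi (rho : R) z : R[i] := ((cabs z <= rho)%R%:R : R)%:C.

Lemma times_chi_ok rho F : okF F -> okF (times (chi rho) F).
Proof.
move=> [mF F0 JF]; have mc : cmeas setT (times (chi rho) F \o @plane R).
  apply: cmeasM => //; apply: cmeas_real; have mcp := cmeas_cabs (@cmeas_plane R); mfun.
split => //; first by rewrite /times F0 mulr0.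
apply: le_lt_trans JF; apply: area_le_integral.
- exact: (measurable_Jbody a b0 m mc).
- by move=> w; rewrite lee_fin; pos.
- exact: (measurable_Jbody a b0 m mF).
move=> w; rewrite lee_fin; apply: ler_wpM2l; first by pos.
apply: ler_wpM2l; first by pos.
rewrite /times cabsM /chi cabsR ger0_norm// ler_piMl ?cabs_ge0//.
by rewrite lern1 leq_b1.
Qed.

(** Each power of [w] in the moment contributes a factor at most [rho]. *)
Lemma Bcoef_cut rho F n : 0 <= rho -> okF F ->
  cabs (Bcoef (times (chi rho) F) n) <= 2 * (rho ^+ n * fine (Jint F)).
Proof.
move=> r0 oF; have [mF F0 JF] := oF; have [mc c0 Jc] := times_chi_ok rho oF.
have [] // := dominated_J a1 b1 mF JF (exprn_ge0 n r0) (cmeas_Bbody a b0 m n mc).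
move=> w; have [w0|w0] := boolP (0 < sqnorm w); last first.
  by rewrite (plane_eq0 w0) c0 mul0r mulr0 cabs0 mul0r mulr0.
have d0 := dens_ge0 a1 b1' w.
rewrite mul1r !cabsM cabsR (ger0_norm d0) sqnorm_powMJ cabsX cabsJ /chi cabsR ger0_norm//.
have s0 := powR_ge0 (sqnorm w) (- (m%:R / 2)); have F1 := cabs_ge0 (F (plane w)).
have [wr|wr] := leP (cabs (plane w)) rho; last first.
  by rewrite !mul0r mulr0 mulr_ge0 ?exprn_ge0//; pos.
have wn : cabs (plane w) ^+ n <= rho ^+ n by apply: lerXn2r; rewrite ?nnegrE ?cabs_ge0.
rewrite mul1r -/M; set A := dens w; set S := _ `^ _; set X := cabs (F _).
have -> : A * (X * (cabs (plane w) ^+ n * S)) = cabs (plane w) ^+ n * (A * S * X) by ring.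
exact: ler_wpM2r (mulr_ge0 (mulr_ge0 d0 s0) F1) _ _ wn.
Qed.

Lemma Bcoef_lin F G (c : R[i]) n : okF F -> okF G ->
  Bcoef (fun z => F z + c * G z) n = Bcoef F n + c * Bcoef G n.
Proof.
move=> [mF F0 JF] [mG G0 JG]; have iF := cintegrable_B a1 b1 n mF F0 JF.
have iG := cintegrable_B a1 b1 n mG G0 JG.
rewrite -(@cintZ _ _ _ area setT measurableT _ c iG).
rewrite -(@cintD _ _ _ area setT measurableT _ _ iF (cintegrableZ measurableT c iG)).
by apply: eq_cint => w _ /=; ring.
Qed.

(** The weight integrates [|z| ^ (- m p)], as [m p < 2 (b + 1)]. *)
Lemma laurent_npow_le : exists2 D : R, 0 < D & forall (c : nat -> R[i]) (eta : R), subexp c -> 0 <= eta ->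
  (forall z, cabs z < 1 -> cabs (pser c z) <= eta) ->
  (npow (laurent c \o @plane R) <= (eta `^ p * D)%:E)%E.
Proof.
have bM : -1 < b + - M * p by move: Mp; rewrite /M; lra.
have [D D0 hD] := dens_power_fin a1 b1' bM; exists D => // c eta sc eta0 hc.
have mL := @measurable_npow R a b p _ (laurent_cmeas sc).
have mG : measurable_fun setT (fun w : R * R => ((0 < sqnorm w)%R%:R * (dens w * sqnorm w `^ (- M * p)))%:E).
  by have md := measurable_dens a b; have msq := @measurable_sqnorm R; apply/measurable_EFinP; mfun.
rewrite EFinM -hD -(area_integralZl (powR_ge0 eta p) mG); last by move=> w; rewrite lee_fin; pos.
apply: area_le_integral => //.
- by move=> w; rewrite lee_fin; pos.
- by apply: emeasurable_funM => //; exact: measurable_cst.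
move=> w; rewrite -EFinM lee_fin /=.
have [w1|w1] := boolP (sqnorm w < 1); last by rewrite (dens_out _ _ w1) !(mul0r, mulr0).
have [w0|w0] := boolP (0 < sqnorm w); last first.
  by rewrite (plane_eq0 w0) /laurent eqxx andbF mul0r cabs0 powR0 ?gt_eqF// mulr0 mul0r mulr0.
rewrite mul1r mulrCA ler_wpM2l ?dens_ge0// laurentE; last first.
  by split; [exact: cabs_plane_lt1 | exact: plane_neq0].
rewrite cabsM sqnorm_powM powRM ?cabs_ge0 ?powR_ge0// -powRrM ler_wpM2r ?powR_ge0//.
apply: ge0_ler_powR; rewrite ?nnegrE ?cabs_ge0 ?(ltW p0)//.
exact/hc/cabs_plane_lt1.
Qed.

Lemma powR_root_small (D e : R) : 0 < D -> 0 < e -> exists2 eta : R, 0 < eta & eta `^ p * D <= e.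
Proof.
move=> D0 e0; exists ((e / D) `^ p^-1); first by rewrite powR_gt0// divr_gt0.
by rewrite -powRrM mulVf ?gt_eqF// powRr1 ?divr_ge0 ?(ltW e0) ?(ltW D0)// divfK ?gt_eqF.
Qed.

(** For a function supported in [|z| <= rho] the coefficients beyond [N] carry a factor
    [rho ^ N], so they contribute little whatever the function is. *)
Lemma cut_small (k rho J0 e : R) : 0 < k -> 0 <= rho < 1 -> 0 <= J0 -> 0 < e ->
  exists N, exists2 dl : R, 0 < dl & forall U, okF U -> fine (Jint U) <= J0 ->
  (forall n, (n < N)%N -> cabs (Bcoef (times (chi rho) U) n) <= dl) ->
  subexp (tcoef k (times (chi rho) U)) /\
  (npow (laurent (tcoef k (times (chi rho) U)) \o @plane R) <= e%:E)%E.
Proof.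
move=> k0 r01 J00 e0; have /andP[r0 r1] := r01; have [D D0 hD] := laurent_npow_le.
have [eta eta0 heta] := powR_root_small D0 e0.
have [q' /andP[q0 q1] [K K0 hK]] := subexp_geom (subexp_hcoef a1 b1) r01.
pose s := Num.sqrt q'.
have s2 : s ^+ 2 = q' by rewrite sqr_sqrtr// ltW.
have s0 : 0 < s by rewrite sqrtr_gt0.
have s1 : s < 1 by rewrite -[ltRHS]sqrtr1 ltr_sqrt.
have s01 : 0 < s < 1 by rewrite s0.
pose L := 2 * k * J0 * K; have L0 : 0 <= L by rewrite !mulr_ge0// ltW.
have eta20 : 0 < eta / 2 by lra.
have /cvgrPdist_le /(_ _ eta20)[N _ hN] : (fun N => L / (1 - s) * s ^+ N) @ \oo --> (0 : R).
  by apply: cvg_geom0; rewrite ger0_norm// ltW.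
have {hN} := hN N (leqnn N); rewrite sub0r normrN => /(le_trans (ler_norm _)) hN.
pose S := \sum_(0 <= n < N) k * cabs (h n).
have S0 : 0 <= S by apply: sumr_ge0 => n _; rewrite mulr_ge0 ?cabs_ge0// ltW.
have S1 : 0 < S + 1 by lra.
exists N; exists (eta / (2 * (S + 1))); first by rewrite divr_gt0// mulr_gt0.
set dl := eta / _ => U oU JU hB; pose c := tcoef k (times (chi rho) U).
have cb n : cabs (c n) <= L * q' ^+ n.
  rewrite /c /tcoef !cabsM cabsR (gtr0_norm k0); have := Bcoef_cut n r0 oU => h1.
  have h2 : cabs (Bcoef (times (chi rho) U) n) <= 2 * J0 * rho ^+ n.
    by apply: (le_trans h1); rewrite -mulrA [J0 * _]mulrC !ler_wpM2l ?exprn_ge0.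
  apply: (@le_trans _ _ (k * cabs (h n) * (2 * J0 * rho ^+ n))).
    by rewrite ler_wpM2l// mulr_ge0 ?cabs_ge0// ltW.
  have -> : k * cabs (h n) * (2 * J0 * rho ^+ n) = 2 * k * J0 * (cabs (h n) * rho ^+ n) by ring.
  by rewrite /L -[leRHS]mulrA ler_wpM2l// !mulr_ge0// ltW.
have sc : subexp c.
  move=> r /andP[r'0 r'1]; exists L => n; apply: (@le_trans _ _ (L * q' ^+ n * 1)).
    by apply: ler_pM; rewrite ?cabs_ge0 ?exprn_ge0 ?exprn_ile1 ?(ltW r'0) ?(ltW r'1).
  by rewrite mulr1 ler_piMr// exprn_ile1// ltW.
split => //; apply: le_trans (hD c eta sc (ltW eta0) _) _; last by rewrite lee_fin.
move=> z z1; have h1 : cabs (pser c z - \sum_(0 <= n < N) c n * z ^+ n) <= L / (1 - s) * s ^+ N.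
  apply: (pser_tail ler01 L0 s01); last exact: ltW.
  by move=> n; rewrite expr1n mulr1 -exprM mulnC exprM s2.
have h2 : cabs (\sum_(0 <= n < N) c n * z ^+ n) <= eta / 2.
  apply: (@le_trans _ _ (S * dl)).
    rewrite /S mulr_suml; apply: (le_trans (cabs_sum _ _ _)); apply: ler_sum_nat => n /andP[_ nN].
    rewrite cabsM cabsX /c /tcoef !cabsM cabsR (gtr0_norm k0) -[leRHS]mulr1.
    apply: ler_pM; rewrite ?exprn_ge0 ?cabs_ge0//; last by rewrite exprn_ile1 ?cabs_ge0// ltW.
      by rewrite !mulr_ge0 ?cabs_ge0// ltW.
    by rewrite ler_wpM2l ?hB// mulr_ge0 ?cabs_ge0// ltW.
  apply: (@le_trans _ _ ((S + 1) * dl)); first by rewrite ler_wpM2r ?lerDl// divr_ge0 ?(ltW eta0)// mulr_ge0// ltW.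
  by apply: eq_ler; rewrite /dl; field; rewrite gt_eqF.
have := cabsD (pser c z - \sum_(0 <= n < N) c n * z ^+ n) (\sum_(0 <= n < N) c n * z ^+ n).
by rewrite subrK; move: h1 h2 hN; set t := L / _ * _; lra.
Qed.

Lemma Jint_symbol_bound (E : R) : 0 <= E -> exists2 J0 : R, 0 <= J0 & forall F, okF (times phi F) ->
  cmeas setT (F \o @plane R) -> (npow (F \o @plane R) <= E%:E)%E -> fine (Jint (times phi F)) <= J0.
Proof.
move=> E0; have [C C0 hC] := Jint_bound a1 b1 p1 pq Mp Mq.
have [K K0 hK] := closed_disc_bounded hphi.
have hK' w : cabs w < 1 -> cabs (phi w) <= K by move=> /ltW; exact: hK.
exists ((C * (K `^ p * E)) `^ p^-1) => [|F [mP P0 JP] mF FE]; first exact: powR_ge0.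
have h1 := hC _ mP; have h2 := npow_mul_le (ltW K0) mF mP hK'.
have J0 : (0 <= Jint (times phi F))%E by apply: integral_ge0 => w _; rewrite lee_fin; pos.
have : (Jint (times phi F) `^ p <= (C * (K `^ p * E))%:E)%E.
  apply: (le_trans h1); rewrite EFinM; apply: lee_wpmul2l; first by rewrite lee_fin.
  apply: (le_trans h2); rewrite EFinM; apply: lee_wpmul2l; first by rewrite lee_fin powR_ge0.
  exact: FE.
move: J0 JP; case: (Jint _) => [r|//|//]; rewrite lee_fin poweR_EFin lee_fin /= => r0 _ hr.
apply: (@le_trans _ _ ((r `^ p) `^ p^-1)); first by rewrite -powRrM mulfV ?gt_eqF// powRr1.
by apply: ge0_ler_powR; rewrite ?nnegrE ?invr_ge0 ?powR_ge0 ?(ltW p0)// (le_trans (powR_ge0 _ _) hr).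
Qed.

Lemma bergman_diff_npow f g : (npow (f \o @plane R) <= 1)%E -> (npow (g \o @plane R) <= 1)%E ->
  (npow ((fun z => (f z - g z)%R) \o @plane R) <= (2 `^ p * 2)%:E)%E.
Proof.
move=> f1 g1; have mf := bergman_cmeas f; have mg := cmeasN (bergman_cmeas g).
apply: (le_trans (npowD a1 b1' p0 mf mg)); rewrite npowN EFinM.
apply: lee_wpmul2l; first by rewrite lee_fin powR_ge0.
by apply: le_trans (leeD f1 g1) _; rewrite -EFinD.
Qed.

Lemma times_sub psi f g : times psi (fun z => f z - g z) = (fun z => times psi f z + (-1) * times psi g z).
Proof. by apply/funext => z; rewrite /times; ring. Qed.

Lemma diff_ok f g : okF (times phi (fun z => f z - g z)).
Proof. by rewrite times_sub; apply: (okF_lin a1 b1); exact: symbol_ok. Qed.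

Lemma times_chi_diff rho f g : times (chi rho) (times phi (fun z => f z - g z)) =
  (fun z => times (chi rho) (times phi f) z + (-1) * times (chi rho) (times phi g) z).
Proof. by apply/funext => z; rewrite /times; ring. Qed.

Section Toeplitz.
Variable T : space -> space.
Hypothesis hT : is_toeplitz phi T.

Lemma toeplitz_diff f g z : punctured_disc z ->
  T f z - T g z = projection a b (times phi (fun z => f z - g z)) z.
Proof.
move=> hz; rewrite times_sub (projection_lin a1 b1 b00 (-1) (symbol_ok f) (symbol_ok g) hz).
by rewrite !hT// mulN1r.
Qed.

(** The contribution of [|w| > rho] is small in norm because the symbol is, and
    that of [|w| <= rho] by [cut_small]. *)
Lemma toeplitz_totally_bounded : (forall z, unit_circle z -> phi z = 0) -> forall e : R, 0 < e ->
  exists N, exists u : nat -> space -> R, exists C : R, exists2 dl : R, 0 < dl &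
   (forall f n, (npow (f \o @plane R) <= 1)%E -> `|u n f| <= C) /\
   forall f g, (npow (f \o @plane R) <= 1)%E -> (npow (g \o @plane R) <= 1)%E ->
     (forall n, (n < N)%N -> `|u n f - u n g| <= dl) -> bdist (T f) (T g) <= e.
Proof.
move=> phi0 e e0; have [k k0 hk] := projection_laurent.
have [C C0 hC] := projection_norm a1 b1 b00 p1 pq Mp Mq.
pose k2 : R := 2 `^ p; have k20 : 0 < k2 by rewrite powR_gt0.
have e20 : 0 < e / (2 * k2) by rewrite divr_gt0// mulr_gt0.
have CC0 : 0 < (C + 1) * (k2 * 2) by rewrite !mulr_gt0//; lra.
have [eps eps0 heps] := powR_root_small CC0 e20.
have [rho /andP[r0 r1] hrho] := boundary_small hphi phi0 eps0.
have r01 : 0 <= rho < 1 by rewrite ltW.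
have E0 : 0 <= k2 * 2 by rewrite mulr_ge0// ltW.
have [J0 J00 hJ0] := Jint_symbol_bound E0.
have [N [dl dl0 hcut]] := cut_small k0 r01 J00 e20.
pose B f n := Bcoef (times (chi rho) (times phi f)) n.
(* Coordinates: real parts of the moments at even indices, imaginary parts at odd ones. *)
exists N.*2; exists (fun n f => if odd n then complex.Im (B f n./2) else complex.Re (B f n./2)).
have k21 : 1 <= k2 * 2 by have := two_powR_ge1 p0; rewrite -/k2; lra.
exists (2 * J0); exists (dl / 2); first by lra.
have BJ f n : (npow (f \o @plane R) <= 1)%E -> cabs (B f n) <= 2 * J0.
  move=> f1; have oF := symbol_ok f; apply: (le_trans (Bcoef_cut n (ltW r0) oF)).
  rewrite ler_wpM2l//; have JF : fine (Jint (times phi f)) <= J0.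
    by apply: hJ0 => //; [exact: bergman_cmeas | apply: (le_trans f1); rewrite lee_fin].
  have Jp : 0 <= fine (Jint (times phi f)).
    by rewrite fine_ge0//; apply: integral_ge0 => w _; rewrite lee_fin; pos.
  by apply: le_trans JF; rewrite ler_piMl// exprn_ile1// ltW.
split=> [f n f1|f g f1 g1 hu].
  by case: ifP => _; [apply: (le_trans (cabs_Im _)) | apply: (le_trans (cabs_Re _))]; exact: BJ.
pose U := times phi (fun z => f z - g z); have oU : okF U := diff_ok f g.
have fg := bergman_diff_npow f1 g1.
have mfg := cmeasB_bergman f g.
have JU : fine (Jint U) <= J0 by apply: hJ0.
(* [U1] lives on [|w| <= rho]; on the rest, where [U2] lives, the symbol is at most [eps]. *)
pose U1 := times (chi rho) U; have oU1 : okF U1 := times_chi_ok rho oU.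
pose U2 z := U z + (-1) * U1 z; have oU2 : okF U2 := okF_lin a1 b1 (-1) oU oU1.
have BU n : Bcoef U1 n = B f n - B g n.
  have okc f' : okF (times (chi rho) (times phi f')) by exact/times_chi_ok/symbol_ok.
  by rewrite /U1 /U times_chi_diff (Bcoef_lin (-1) n (okc f) (okc g)) mulN1r.
have [|sc hL] := hcut U oU JU.
  move=> n nN; rewrite -/U1 BU; apply: (le_trans (cabs_ReIm _)).
  have n1 : (n.*2 < N.*2)%N by rewrite ltn_double.
  have n2 : (n.*2.+1 < N.*2)%N by rewrite ltn_Sdouble.
  have := hu _ n1; have := hu _ n2; rewrite [odd n.*2.+1]/= !odd_double doubleK [n.*2.+1./2]uphalf_double.
  rewrite ReB ImB; set u1 := complex.Re _; set u2 := complex.Re _; set v1 := complex.Im _; set v2 := complex.Im _.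
  by rewrite /=; lra.
have [_ hproj] := hk U1 oU1; rewrite -/U1 in sc hL.
set c := tcoef k U1 in sc hL hproj.
have mc := laurent_cmeas sc.
pose G2 z := T f z - T g z - laurent c z.
have mG2 : cmeas setT (G2 \o @plane R) by apply: cmeasD; [exact: cmeasB_bergman | exact: cmeasN].
have G20 : G2 0 = 0 by rewrite /G2 !bergman_0 /laurent eqxx andbF mul0r !subr0.
have hG2 z : punctured_disc z -> G2 z = projection a b U2 z.
  move=> hz; rewrite /G2 toeplitz_diff// -hproj//.
  by rewrite (projection_lin a1 b1 b00 (-1) oU oU1 hz) mulN1r.
have [mU2 U20 _] := oU2; have hN2 := hC _ _ mU2 mG2 U20 G20 hG2.
have U2E : U2 = times (fun w => phi w * (1 - chi rho w)) (fun z => f z - g z).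
  by apply/funext => z; rewrite /U2 /U1 /U /times; ring.
have small w : cabs w < 1 -> cabs (phi w * (1 - chi rho w)) <= eps.
  move=> w1; rewrite /chi; have [wr|wr] := leP (cabs w) rho.
    by rewrite rmorph1 subrr mulr0 cabs0 ltW.
  by rewrite rmorph0 subr0 mulr1; apply: hrho; rewrite wr.
have hU2 : (npow (U2 \o @plane R) <= (eps `^ p * (k2 * 2))%:E)%E.
  move: mU2; rewrite U2E => mU2.
  apply: (le_trans (npow_mul_le (ltW eps0) mfg mU2 small)); rewrite EFinM.
  by apply: lee_wpmul2l => //; rewrite lee_fin powR_ge0.
rewrite -lee_fin -(bdistE a1 b1' p0).
have -> : (fun z => T f z - T g z) \o @plane R = (fun w : R * R => (laurent c \o @plane R) w + (G2 \o @plane R) w).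
  by apply/funext => w; rewrite /G2 /=; ring.
apply: (le_trans (npowD a1 b1' p0 mc mG2)); rewrite -/k2.
have hG : (npow (G2 \o @plane R) <= (e / (2 * k2))%:E)%E.
  apply: (le_trans hN2); apply: (@le_trans _ _ (C%:E * (eps `^ p * (k2 * 2))%:E)%E).
    by apply: lee_wpmul2l => //; rewrite lee_fin.
  rewrite -EFinM lee_fin; apply: le_trans heps.
  have -> : eps `^ p * ((C + 1) * (k2 * 2)) = C * (eps `^ p * (k2 * 2)) + eps `^ p * (k2 * 2) by ring.
  by rewrite lerDl mulr_ge0 ?powR_ge0.
have k2e : (0 <= k2%:E)%E by rewrite lee_fin ltW.
apply: (le_trans (lee_wpmul2l k2e (leeD hL hG))); rewrite -EFinD -EFinM lee_fin.
by apply: eq_ler; field; rewrite gt_eqF.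
Qed.

Lemma toeplitz_laurent (k : R) : (forall F, okF F -> subexp (tcoef k F) /\
    forall z, punctured_disc z -> projection a b F z = laurent (tcoef k F) z) ->
  forall f, T f = laurent (tcoef k (times phi f)) :> (R[i] -> R[i]).
Proof.
move=> hk f; have [_ hL] := hk _ (symbol_ok f); apply/funext => z.
have [hz|hz] := pselect (punctured_disc z); first by rewrite hT// -hL.
by rewrite laurent_out// (bergman_out _ hz).
Qed.

(** Cauchy sequences in the image converge: along a subsequence the coefficients
    do, and Fatou's lemma turns this into convergence in norm. *)
Lemma toeplitz_complete (s : nat -> space) : (forall j, (npow (s j \o @plane R) <= 1)%E) ->
  (forall e : R, 0 < e -> exists J, forall i j, (J <= i)%N -> (J <= j)%N -> bdist (T (s i)) (T (s j)) <= e) ->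
  exists g, forall e : R, 0 < e -> exists J, forall j, (J <= j)%N -> bdist (T (s j)) g <= e.
Proof.
move=> s1 cau; have [k k0 hk] := projection_laurent.
have TE := toeplitz_laurent hk.
have [J0 J00 hJ0] := Jint_symbol_bound ler01.
pose x j n := Bcoef (times phi (s j)) n.
have xC j n : cabs (x j n) <= 2 * J0.
  have [mF F0 JF] := symbol_ok (s j); apply: (le_trans (Bcoef_bound a1 b1 n mF F0 JF)).
  by rewrite ler_wpM2l// hJ0//; exact: bergman_cmeas.
have [l [r [hr lC lim]]] := coefficient_subsequence xC.
pose hk' n : R[i] := k%:C * h n.
have sh : subexp hk'.
  by apply: (@subexp_scale _ _ _ (cabs k%:C) (subexp_hcoef a1 b1)) => n; rewrite [leLHS]cabsM.
pose c n := hk' n * l n; have sc : subexp c := subexp_mul_bounded sh lC.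
have mc := laurent_cmeas sc.
have sT j : subexp (tcoef k (times phi (s j))) := (hk _ (symbol_ok (s j))).1.
have ptw (w : R * R) : (fun i => cabs ((T (s (r i)) \o @plane R) w - (laurent c \o @plane R) w)) @ \oo --> (0 : R).
  have [hw|hw] := pselect (punctured_disc (plane w)); last first.
    have -> : (fun i => cabs ((T (s (r i)) \o @plane R) w - (laurent c \o @plane R) w)) = fun=> 0.
      by apply/funext => i /=; rewrite laurent_out// (bergman_out _ hw) subrr cabs0.
    exact: cvg_cst.
  have [w1 w0] := hw; have D0 : 0 <= 2 * J0 + (2 * J0 + 1) by lra.
  have := @pser_null _ hk' (fun i n => x (r i) n - l n) _ _ sh D0 w1.
  move=> /(_ (fun i n => le_trans (cabsD _ _) _) lim).
  have H i n : cabs (x (r i) n) + cabs (- l n) <= 2 * J0 + (2 * J0 + 1) by rewrite cabsN lerD.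
  move=> /(_ H) h1.
  have h2 : (fun i => cabs (pser (fun n => hk' n * (x (r i) n - l n)) (plane w)) *
      cabs (plane w ^+ m)^-1) @ \oo --> 0 * cabs (plane w ^+ m)^-1.
    by apply: cvgM; [exact: h1 | exact: cvg_cst].
  rewrite mul0r in h2; apply: cvg_trans h2; apply: near_eq_cvg; near=> i => /=.
  rewrite TE !laurentE// -mulrBl cabsM; congr (cabs _ * _).
  rewrite /pser -csumB; [|exact: subexp_abs_summable (sT _) w1|exact: subexp_abs_summable sc w1].
  by congr csum; apply/funext => n; rewrite /tcoef /c /hk' /x; ring.
have [C C0 hC] := projection_norm a1 b1 b00 p1 pq Mp Mq.
have [K K0 hK] := closed_disc_bounded hphi.
have hK' w : cabs w < 1 -> cabs (phi w) <= K by move=> /ltW; exact: hK.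
have mT j := bergman_cmeas (T (s j)).
have Tbound j : (npow (T (s j) \o @plane R) <= (C * K `^ p)%:E)%E.
  have [mF F0 JF] := symbol_ok (s j).
  apply: (le_trans (hC _ _ mF (mT j) F0 (bergman_0 _) (fun z hz => hT (s j) hz))).
  rewrite EFinM; apply: lee_wpmul2l; first by rewrite lee_fin.
  apply: (le_trans (npow_mul_le (ltW K0) (bergman_cmeas (s j)) mF hK')).
  rewrite -[leRHS]mule1; apply: lee_wpmul2l => //; by rewrite lee_fin powR_ge0.
have fin : (npow (laurent c \o @plane R) < +oo)%E.
  apply: le_lt_trans (ltry (C * K `^ p)).
  have H := @npow_fatou R a b p a1 b1' p0 (fun i => T (s (r i)) \o @plane R) _ (C * K `^ p)
    (fun i => mT (r i)) mc (fun (w : R * R) _ => ptw w).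
  by apply: H; exists 0%N => // i _; exact: Tbound.
have [g gE] := laurent_space sc fin; exists g => e e0; have [J hJ] := cau e e0.
exists J => j Jj; rewrite -lee_fin -(bdistE a1 b1' p0).
have mH i := cmeasB_bergman (T (s j)) (T (s (r i))).
apply: (@npow_fatou R a b p a1 b1' p0 (fun i => (fun z => T (s j) z - T (s (r i)) z) \o @plane R) _ _ mH (cmeasB_bergman _ _)).
  move=> w _; have h1 := ptw w; apply: cvg_trans h1; apply: near_eq_cvg; near=> i => /=.
  by rewrite gE -[RHS]cabsN; congr cabs; ring.
near=> i; rewrite (bdistE a1 b1' p0) lee_fin; apply: hJ => //.
by apply: leq_trans (hr i); near: i; exists J.
Unshelve. all: by end_near. Qed.

Lemma toeplitz_compact_sufficient : (forall z, unit_circle z -> phi z = 0) -> compact_operator T.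
Proof.
move=> phi0; rewrite /compact_operator.
have -> : [set f : space | (bnorm a b p f <= 1)%E] = [set f : space | (npow (f \o @plane R) <= 1)%E].
  by apply/seteqP; split=> f /= /(bnorm_le1 a1 b1' p0 _).
apply: (@compact_closure_image R space (@bdist _ a b p) (2 `^ p)).
- exact: bdistC.
- exact: two_powR_ge1.
- exact: bdist_tri.
- exact: bergman_nbhs.
- move=> e e0; have [N [u [C [dl dl0 [h1 h2]]]]] := toeplitz_totally_bounded phi0 e0.
  by exists N, u, C; exists dl.
- exact: toeplitz_complete.
Qed.

End Toeplitz.

End Symbol.

(** * Peak functions and necessity *)
Section Peak.
Context {R : realType}.
Implicit Types (z w zeta : R[i]).

(** Of modulus at most [1] on the closed disc, with equality only at [zeta]. *)
Definition edge zeta z : R[i] := (1 + (zeta^* * z)%R) / 2.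

Lemma cabs_half z : cabs (z / 2) = cabs z / 2.
Proof. by rewrite cabsM cabsV (cabs_nat 2). Qed.

Lemma edge_le zeta z : cabs zeta = 1 -> cabs (edge zeta z) <= (1 + cabs z) / 2.
Proof.
move=> z1; rewrite cabs_half ler_wpM2r ?invr_ge0//; apply: (le_trans (cabsD _ _)).
by rewrite cabs1 cabsM cabsJ z1 mul1r.
Qed.

(** Parallelogram law: away from the boundary point [zeta] the function stays
    bounded away from [1]. *)
Lemma edge_far zeta z (d : R) : cabs zeta = 1 -> cabs z <= 1 -> 0 < d <= 1 -> d <= cabs (z - zeta) ->
  cabs (edge zeta z) <= 1 - d ^+ 2 / 8.
Proof.
move=> z1 zl1 /andP[d0 d1] dz; set u := (zeta^* * z)%R.
have uE : cabs (1 - u) = cabs (z - zeta).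
  have zz : zeta * (zeta^*)%R = 1 by have := mulzJ zeta; rewrite z1 expr1n.
  have -> : z - zeta = - (zeta * (1 - u)).
    by rewrite /u mulrBr mulr1 mulrA zz mul1r opprB.
  by rewrite cabsN cabsM z1 mul1r.
have pl : cabs (1 + u) ^+ 2 + cabs (1 - u) ^+ 2 = 2 + 2 * cabs u ^+ 2.
  by rewrite !cabs_sqr; case: u {uE} => x y /=; ring.
have ul : cabs u <= 1 by rewrite /u cabsM cabsJ z1 mul1r.
rewrite cabs_half -/u; have h0 := cabs_ge0 (1 + u); have h1 := cabs_ge0 u.
have h2 : d ^+ 2 <= cabs (1 - u) ^+ 2 by rewrite uE lerXn2r ?nnegrE ?cabs_ge0// ltW.
have h3 : cabs (1 + u) ^+ 2 <= 4 - d ^+ 2 by nra.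
have h4 : d ^+ 2 <= 1 by rewrite exprn_ile1// ltW.
have h5 : 4 - d ^+ 2 <= (2 - d ^+ 2 / 4) ^+ 2 by have := sqr_ge0 (d ^+ 2); set t := d ^+ 2; nra.
have : cabs (1 + u) <= 2 - d ^+ 2 / 4.
  rewrite -(@ler_pXn2r _ 2) ?nnegrE//; first exact: le_trans h5.
  by lra.
lra.
Qed.

Lemma edge_near zeta w (r d : R) : cabs zeta = 1 -> 0 <= r -> cabs (w - r%:C * zeta) <= d ->
  (1 + r - d) / 2 <= cabs (edge zeta w).
Proof.
move=> z1 r0 wd; rewrite cabs_half ler_wpM2r ?invr_ge0//.
have zz : zeta * (zeta^*)%R = 1 by have := mulzJ zeta; rewrite z1 expr1n.
have -> : 1 + (zeta^* * w)%R = (1 + r)%:C - - ((zeta^*)%R * (w - r%:C * zeta)).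
  have -> : (1 + r)%:C = 1 + r%:C :> R[i] by rewrite rmorphD rmorph1.
  by rewrite opprK mulrBr mulrCA [(zeta^* * zeta)%R]mulrC zz mulr1; ring.
apply: le_trans (cabsB_ge _ _); rewrite cabsN cabsM cabsJ z1 mul1r cabsR ger0_norm; last by lra.
lra.
Qed.

Lemma powR_lower (u t s : R) : 0 < u -> u <= t -> t <= 1 -> Num.min 1 (u `^ s) <= t `^ s.
Proof.
move=> u0 ut t1; have t0 : 0 < t := lt_le_trans u0 ut.
have [s0|s0] := leP 0 s.
  rewrite ge_min; apply/orP; right; apply: ge0_ler_powR; rewrite ?nnegrE ?(ltW u0) ?(ltW t0)//.
rewrite ge_min; apply/orP; left; rewrite -[s]opprK powRN -[leLHS]invr1.
rewrite lef_pV2 ?posrE ?powR_gt0//.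
have E : 1 `^ (- s) = 1 :> R by rewrite powR1.
by rewrite -[leRHS]E; apply: ge0_ler_powR; rewrite ?nnegrE ?(ltW t0)// oppr_ge0 ltW.
Qed.

End Peak.

Section Necessity.
Context {R : realType}.
Notation area := (@lebesgue_measure R \x @lebesgue_measure R)%E.
Variables (a b0 : R) (m : nat).
Hypotheses (a1 : -1 < a) (b1 : -1 < b0) (b00 : b0 <= 0).
Let b := b0 + m%:R.
Let M : R := m%:R / 2.
Let b1' : -1 < b := bgt m b1.
Variables (p q : R).
Hypotheses (p1 : 1 < p) (pq : p^-1 + q^-1 = 1) (Mp : M * p < b + 1) (Mq : M * q < b + 1).
Let p0 : 0 < p := lt_trans ltr01 p1.
Local Notation dens := (dens a b).
Local Notation npow := (npow a b p).
Local Notation okF := (okF a b0 m).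
Local Notation space := (bergman a b p).
Variable zeta : R[i].
Hypothesis zeta1 : cabs zeta = 1.
Local Notation edge := (edge zeta).
Implicit Types (z : R[i]) (F G : R[i] -> R[i]) (f g : space) (w : R * R).

Definition inpd z : bool := (cabs z < 1) && (z != 0).

Lemma inpdP z : reflect (punctured_disc z) (inpd z).
Proof. by apply: (iffP andP) => -[]. Qed.

Definition peak (n : nat) z : R[i] := (inpd z)%:R * edge z ^+ n.

Lemma edge_cderiv z n : exists l, cderiv (fun x => edge x ^+ n) z l.
Proof.
have d1 : cderiv edge z ((zeta^*)%R / 2).
  move=> e e0; exists 1 => // h _; rewrite /edge.
  have -> : (1 + (zeta^* * (z + h))%R) / 2 - (1 + (zeta^* * z)%R) / 2 - (zeta^*)%R / 2 * h = 0 by ring.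
  by rewrite cabs0 mulr_ge0 ?cabs_ge0// ltW.
elim: n => [|n [l IH]]; first by exists 0; exact: cderiv_cst.
have H := cderivM d1 IH; eexists.
have -> : (fun x => edge x ^+ n.+1) = (fun x => edge x * edge x ^+ n) by apply/funext => x; rewrite exprS.
exact: H.
Qed.

Lemma peak_holomorphic n (t : R) : holomorphic_on punctured_disc (fun z => t%:C * peak n z).
Proof.
move=> z [z1 z0]; have [l hl] := edge_cderiv z n; have cz : 0 < cabs z by rewrite cabs_gt0.
have hz1 : cabs z < 1 by [].
apply/cderivP; exists (0 * edge z ^+ n + t%:C * l).
apply: (@cderiv_near R (fun x => t%:C * edge x ^+ n) _ z _ (Num.min (cabs z) (1 - cabs z))).
- by rewrite lt_min cz subr_gt0.
- move=> h; rewrite lt_min => /andP[h1 h2]; congr (_ * _).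
  rewrite /peak (_ : inpd (z + h) = true) ?mul1r//; apply/andP; split.
    by apply: (le_lt_trans (cabsD _ _)); lra.
  by rewrite -cabs_gt0; have := cabsB_ge z (- h); rewrite opprK cabsN; lra.
exact: cderivM (cderiv_cst _ _) hl.
Qed.

Lemma peak_out n (t : R) z : ~ punctured_disc z -> t%:C * peak n z = 0.
Proof. by move/inpdP => /negbTE h; rewrite /peak h mul0r mulr0. Qed.

Lemma peak_cmeas n (t : R) : cmeas setT ((fun z => t%:C * peak n z) \o @plane R).
Proof.
apply: cmeas_ccont => z hz; last exact: peak_out.
have H := @peak_holomorphic n t; have := holomorphic_ccont H hz; exact.
Qed.

Lemma peak_cmeas1 n : cmeas setT (peak n \o @plane R).
Proof. by have := peak_cmeas n 1; under eq_fun do rewrite /= mul1r. Qed.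

Lemma const_npow : exists2 m0 : R, 0 < m0 & forall F (s : R), 0 <= s -> cmeas setT (F \o @plane R) ->
  F 0 = 0 -> (forall z, punctured_disc z -> cabs (F z) <= s) ->
  (npow (F \o @plane R) <= (s `^ p * m0)%:E)%E.
Proof.
have b10 : -1 < b + 0 by rewrite addr0.
have [D D0 hD] := dens_power_fin a1 b1' b10; exists D => // F s s0 mF F0 hF.
have mL := @measurable_npow R a b p _ mF.
have mG : measurable_fun setT (fun w : R * R => ((0 < sqnorm w)%R%:R * (dens w * sqnorm w `^ 0))%:E).
  by have md := measurable_dens a b; have msq := @measurable_sqnorm R; apply/measurable_EFinP; mfun.
rewrite EFinM -hD -(area_integralZl (powR_ge0 s p) mG); last by move=> w; rewrite lee_fin; pos.
apply: area_le_integral => //.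
- by move=> w; rewrite lee_fin; pos.
- by apply: emeasurable_funM => //; exact: measurable_cst.
move=> w; rewrite -EFinM lee_fin /=.
have [w1|w1] := boolP (sqnorm w < 1); last by rewrite (dens_out _ _ w1) !(mul0r, mulr0).
have [w0|w0] := boolP (0 < sqnorm w); last first.
  by rewrite (plane_eq0 w0) F0 cabs0 powR0 ?gt_eqF// mulr0 mul0r mulr0.
rewrite mul1r powRr0 mulr1 mulrC ler_wpM2r ?dens_ge0//.
apply: ge0_ler_powR; rewrite ?nnegrE ?cabs_ge0 ?(ltW p0)//.
by apply: hF; split; [exact: cabs_plane_lt1 | exact: plane_neq0].
Qed.

Lemma peak0 n : peak n 0 = 0.
Proof. by rewrite /peak /inpd eqxx andbF mul0r. Qed.

Lemma peak_fin n : (npow (peak n \o @plane R) < +oo)%E.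
Proof.
have [m0 m00 hm] := const_npow; apply: le_lt_trans (ltry (1 `^ p * m0)).
apply: hm => //; [exact: peak_cmeas1 | exact: peak0|].
move=> z hz; have /inpdP h := hz; have [z1 _] := hz; rewrite /peak h mul1r cabsX exprn_ile1 ?cabs_ge0//.
by apply: (le_trans (edge_le z zeta1)); have hz1 : cabs z < 1 := z1; lra.
Qed.

(** The mass of the [n]-th peak decays slower than any geometric sequence: near
    the boundary point there is a square on which the base exceeds [kappa]. *)
Lemma peak_lower (kappa : R) : 0 < kappa < 1 -> exists2 c : R, 0 < c &
  forall n, ((c * (kappa ^+ n) `^ p)%:E <= npow (peak n \o @plane R))%E.
Proof.
move=> /andP[k0 k1]; pose r := (1 + kappa) / 2; pose d := (1 - kappa) / 4.
have d0 : 0 < d by rewrite /d; lra.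
have r0 : 0 < r by rewrite /r; lra.
have rd1 : r + d < 1 by rewrite /r /d; lra.
have rd0 : 0 < r - d by rewrite /r /d; lra.
have krd : kappa <= (1 + r - d) / 2 by rewrite /r /d; lra.
(* A square about [r zeta], inside the disc of radius [d]: there the base is at least
   [kappa], and the density is bounded below. *)
pose x0 := complex.Re (r%:C * zeta); pose y0 := complex.Im (r%:C * zeta).
pose S : set (R * R) := `[x0 - d / 2, x0 + d / 2]%classic `*` `[y0 - d / 2, y0 + d / 2]%classic.
have mS : measurable S by apply: measurableX; exact: measurable_itv.
have aS : area S = (d * d)%:E.
  rewrite /S product_measure1E; [|exact: measurable_itv|exact: measurable_itv].
  have lt_side x : x - d / 2 < x + d / 2 by lra.
  rewrite /= !lebesgue_measure_itv /= !lte_fin !lt_side.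
  by rewrite -!EFinB -EFinM; congr (_%:E); field.
have near_ w : S w -> cabs (plane w - r%:C * zeta) <= d.
  move=> [/=]; rewrite !in_itv /= => /andP[h1 h2] /andP[h3 h4].
  apply: (le_trans (cabs_ReIm _)); rewrite ReB ImB -/x0 -/y0 /=.
  have : `|w.1 - x0| <= d / 2 by rewrite ler_norml; apply/andP; split; lra.
  have : `|w.2 - y0| <= d / 2 by rewrite ler_norml; apply/andP; split; lra.
  lra.
have rz : cabs (r%:C * zeta) = r by rewrite cabsM zeta1 mulr1 cabsR ger0_norm// ltW.
have range w : S w -> r - d <= cabs (plane w) <= r + d.
  move=> /near_ h; apply/andP; split.
    by have := cabsB_ge (r%:C * zeta) (r%:C * zeta - plane w); rewrite rz subKr [cabs (_ - plane w)]cabsBC; lra.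
  by have := cabsD (plane w - r%:C * zeta) (r%:C * zeta); rewrite subrK rz; lra.
pose d1 := kap a b * (Num.min 1 (((r - d) ^+ 2) `^ b) * Num.min 1 ((1 - (r + d) ^+ 2) `^ a)).
have u0 : 0 < (r - d) ^+ 2 by rewrite exprn_gt0.
have u1 : 0 < 1 - (r + d) ^+ 2 by rewrite subr_gt0 exprn_ilt1//; lra.
have d10 : 0 < d1.
  by rewrite mulr_gt0 ?kap_gt0// mulr_gt0// lt_min ltr01 powR_gt0.
have hd w : S w -> d1 <= dens w.
  move=> /range /andP[h1 h2]; have c0 := cabs_ge0 (plane w).
  have s1 : (r - d) ^+ 2 <= sqnorm w by rewrite sqnormE lerXn2r ?nnegrE// ltW.
  have s2 : sqnorm w <= (r + d) ^+ 2 by rewrite sqnormE lerXn2r ?nnegrE//; lra.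
  have s3 : sqnorm w < 1 by lra.
  rewrite densE /wt s3 mul1r ler_wpM2l ?(ltW (kap_gt0 a1 b1'))//.
  have s4 : 1 - (r + d) ^+ 2 <= 1 - sqnorm w by rewrite lerD2l lerN2.
  have s5 : 1 - sqnorm w <= 1 by rewrite gerBl sqnorm_ge0.
  by apply: ler_pM; rewrite ?le_min ?ler01 ?powR_ge0//; [exact: powR_lower (ltW s3) | exact: powR_lower s5].
exists (d1 * (d * d)) => [|n]; first by rewrite mulr_gt0// mulr_gt0.
pose c1 := d1 * (kappa ^+ n) `^ p; have c10 : 0 <= c1 by rewrite mulr_ge0 ?powR_ge0// ltW.
have -> : (d1 * (d * d) * (kappa ^+ n) `^ p)%:E = (\int[area]_w (c1%:E * (\1_S w)%:E))%E.
  have mI : measurable_fun setT (fun w : R * R => (\1_S w)%:E : \bar R).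
    by apply/measurable_EFinP; exact: measurable_indic.
  rewrite (area_integralZl c10 mI); last by move=> w; rewrite lee_fin.
  by rewrite integral_indic// setIT [X in (_ * X)%E](_ : _ = (d * d)%:E)// -EFinM; congr (_%:E); rewrite /c1; ring.
apply: area_le_integral.
- by apply: emeasurable_funM; [exact: measurable_cst | apply/measurable_EFinP; exact: measurable_indic].
- by move=> w; rewrite -EFinM lee_fin mulr_ge0.
- exact: measurable_npow (peak_cmeas1 n).
move=> w; rewrite -EFinM lee_fin indicE; have [wS|wS] := boolP (w \in S); last by rewrite mulr0; pos.
rewrite mulr1; rewrite inE in wS; have /andP[h1 h2] := range w wS.
apply: ler_pM; rewrite ?powR_ge0 ?(ltW d10) ?hd//.
apply: ge0_ler_powR; rewrite ?nnegrE ?cabs_ge0 ?exprn_ge0 ?(ltW k0) ?(ltW p0)//=.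
have -> : peak n (plane w) = edge (plane w) ^+ n.
  rewrite /peak (_ : inpd _ = true) ?mul1r//; apply/andP; split; first by lra.
  by rewrite -cabs_gt0; lra.
rewrite cabsX lerXn2r ?nnegrE ?cabs_ge0 ?(ltW k0)//; apply: (le_trans krd).
exact: edge_near (ltW r0) (near_ w wS).
Qed.

Definition peak_scale n : R := (fine (npow (peak n \o @plane R))) `^ (- p^-1).

Lemma peak_mass n : exists2 N : R, 0 < N & npow (peak n \o @plane R) = N%:E.
Proof.
have [|c c0 hc] := @peak_lower (1 / 2); first by lra.
have h2 := peak_fin n; have h3 := hc n.
have Npos : (0 < npow (peak n \o @plane R))%E.
  by apply: lt_le_trans h3; rewrite lte_fin mulr_gt0 ?powR_gt0 ?exprn_gt0//; lra.
exists (fine (npow (peak n \o @plane R))); first by rewrite fine_gt0// Npos.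
by rewrite fineK// ge0_fin_numE ?ltW.
Qed.

Lemma peak_scale_gt0 n : 0 < peak_scale n.
Proof. by have [N N0 E] := peak_mass n; rewrite /peak_scale E powR_gt0. Qed.

(** By [peak_lower] the normalizing factors grow slower than any geometric sequence. *)
Lemma peak_decay (kappa : R) : 0 <= kappa < 1 ->
  (fun n => peak_scale n * kappa ^+ n) @ \oo --> (0 : R).
Proof.
move=> /andP[k0 k1]; pose k' := (1 + kappa) / 2.
have k'0 : 0 < k' by rewrite /k'; lra.
have k'01 : 0 < k' < 1 by rewrite k'0 /k'; lra.
have [c c0 hc] := peak_lower k'01.
have bound n : peak_scale n <= c `^ (- p^-1) * (k' ^- n).
  have [N N0 E] := peak_mass n; rewrite /peak_scale E /=; have := hc n; rewrite E lee_fin => h.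
  have kp : 0 < k' ^+ n by rewrite exprn_gt0.
  have cp : 0 < c * (k' ^+ n) `^ p by rewrite mulr_gt0// powR_gt0.
  have -> : k' ^- n = ((k' ^+ n) `^ p) `^ (- p^-1).
    by rewrite -powRrM mulrN mulfV ?gt_eqF// powRN powRr1// ltW.
  rewrite -powRM ?powR_ge0 ?(ltW c0)// !powRN lef_pV2 ?posrE ?powR_gt0//.
  by apply: ge0_ler_powR; rewrite ?nnegrE ?invr_ge0 ?(ltW p0) ?(ltW N0) ?(ltW cp).
have h : (fun n => c `^ (- p^-1) * (kappa / k') ^+ n) @ \oo --> (0 : R).
  apply: cvg_geom0; rewrite ger0_norm; last by apply: divr_ge0 => //; exact: ltW.
  rewrite ltr_pdivrMr//.
  by rewrite /k'; lra.
apply/cvgrPdist_le => e e0; move/cvgrPdist_le : h => /(_ e e0); apply: filterS => n.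
rewrite !sub0r !normrN => h1; apply: le_trans h1; apply: le_trans (ler_norm _).
rewrite ger0_norm ?mulr_ge0 ?exprn_ge0 ?powR_ge0//.
apply: (le_trans (ler_wpM2r (exprn_ge0 n k0) (bound n))).
by apply: eq_ler; rewrite -mulrA [k' ^- n * _]mulrC -expr_div_n.
Qed.

Lemma peak_norm1 n : npow ((fun z => (peak_scale n)%:C * peak n z) \o @plane R) = 1%E.
Proof.
have := npowZ p a1 b1' (peak_scale n)%:C (peak_cmeas1 n) => -> .
have [N N0 E] := peak_mass n.
rewrite cabsR (ger0_norm (ltW (peak_scale_gt0 n))) /peak_scale E /= -EFinM.
by rewrite -powRrM mulNr mulVf ?gt_eqF// powRN powRr1 ?(ltW N0)// mulVf ?gt_eqF.
Qed.

Lemma peak_bnorm n : (bnorm a b p (fun z => ((peak_scale n)%:C * peak n z)%R) < +oo)%E.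
Proof. by apply/(bnorm_lty a1 b1' p0); rewrite peak_norm1 ltry. Qed.

Definition peak_elt n : space :=
  @Bergman _ a b p _ (@peak_holomorphic n (peak_scale n)) (peak_bnorm n) (@peak_out n (peak_scale n)).

Lemma peak_eltE n z : peak_elt n z = (peak_scale n)%:C * peak n z.
Proof. by []. Qed.

Lemma peak_pointwise z : (fun n => cabs (peak_elt n z)) @ \oo --> (0 : R).
Proof.
have [hz|hz] := pselect (punctured_disc z); last first.
  by under eq_fun do rewrite (bergman_out _ hz) cabs0; exact: cvg_cst.
have [z1 _] := hz; have c1 : cabs z < 1 := z1; have c0 := cabs_ge0 z.
have k01 : 0 <= (1 + cabs z) / 2 < 1 by lra.
have h := peak_decay k01; apply/cvgrPdist_le => e e0; move/cvgrPdist_le : h => /(_ e e0); apply: filterS => n.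
rewrite !sub0r !normrN => h1; apply: le_trans h1; apply: le_trans (ler_norm _).
rewrite ger0_norm ?cabs_ge0// peak_eltE cabsM cabsR (ger0_norm (ltW (peak_scale_gt0 n))).
rewrite ler_wpM2l ?(ltW (peak_scale_gt0 n))//.
by have /inpdP h := hz; rewrite /peak h mul1r cabsX lerXn2r ?nnegrE ?cabs_ge0 ?edge_le//; lra.
Qed.

(** On the disc a peak agrees with a polynomial, and the projection sees nothing else. *)
Lemma projection_peak : exists2 l : R, 0 < l & forall n z, punctured_disc z ->
  projection a b (peak_elt n) z = l%:C * peak_elt n z.
Proof.
have [l l0 hl] := projection_poly m a1 b1 b00; exists l => // n z hz.
pose c j : R[i] := (peak_scale n)%:C * (2^-1 ^+ n * ((zeta^*)%R ^+ j *+ 'C(n, j))).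
have E x : cabs x < 1 -> peak_elt n x = cpoly c n.+1 x.
  move=> x1; rewrite peak_eltE /peak /cpoly /inpd x1 /=.
  rewrite mulrCA; congr (_ * _); rewrite /edge exprMn exprDn big_mkord mulr_suml mulr_sumr.
  apply: eq_bigr => j _; rewrite /c expr1n mul1r exprMn.
  rewrite -[(_ * _) *+ _]mulr_natr -[(_ ^+ j) *+ _]mulr_natr.
  set s := (peak_scale n)%:C; set u := 2^-1 ^+ n; set v := ((zeta^*)%R ^+ j); set y := x ^+ j; set d := 'C(n, j)%:R.
  by move: s u v y d => *; ring.
have [_ hc] := hl c n.+1; have [z1 _] := hz; rewrite E// -hc//.
rewrite -(planeK z) !projectionE//; apply: eq_cint => w _ /=.
have [w1|w1] := boolP (sqnorm w < 1); last by rewrite (dens_out _ _ w1) !mul0r.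
by rewrite -peak_eltE E//; exact: cabs_plane_lt1.
Qed.

Variable phi : R[i] -> R[i].
Hypothesis hphi : {within (closed_disc : set R[i]^o), continuous (phi : R[i]^o -> R[i]^o)}.

Let psi z := phi z - phi zeta.

Lemma psi_continuous : {within (closed_disc : set R[i]^o), continuous (psi : R[i]^o -> R[i]^o)}.
Proof. by move=> x; apply: continuousB; [exact: hphi | exact: cst_continuous]. Qed.

(** The peaks concentrate at [zeta], where [psi] vanishes. *)
Lemma peak_concentration (e : R) : 0 < e -> \forall n \near \oo,
  (npow (times psi (peak_elt n) \o @plane R) <= e%:E)%E.
Proof.
move=> e0; pose k2 : R := 2 `^ p; have k20 : 0 < k2 by rewrite powR_gt0.
have e20 : 0 < e / (2 * k2) by rewrite divr_gt0// mulr_gt0.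
have [eta eta0 heta] := powR_root_small p1 ltr01 e20.
have [m0 m00 hm] := const_npow.
have [s s0 hs] := powR_root_small p1 m00 e20.
have [K K0 hK] := closed_disc_bounded psi_continuous.
have z1 : cabs zeta <= 1 by rewrite zeta1.
have [d' d'0 hd'] := within_ccont psi_continuous z1 eta0.
pose d := Num.min d' 1; have d0 : 0 < d by rewrite lt_min d'0 ltr01.
have d1 : d <= 1 by rewrite ge_min lexx orbT.
have d01 : 0 < d <= 1 by rewrite d0.
pose kappa := 1 - d ^+ 2 / 8.
have dd : 0 < d ^+ 2 <= 1 by rewrite exprn_gt0// exprn_ile1// ltW.
have k01 : 0 <= kappa < 1 by rewrite /kappa; move: dd; set t := d ^+ 2 => /andP[? ?]; apply/andP; split; lra.
have sK : 0 < s / K by rewrite divr_gt0.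
have /cvgrPdist_le /(_ _ sK) := peak_decay k01.
apply: filterS => n; rewrite sub0r normrN => /(le_trans (ler_norm _)) hn.
have mE := bergman_cmeas (peak_elt n); have cE := cmeas_cabs mE.
pose F1 z : R[i] := (eta * cabs (peak_elt n z))%:C.
pose F2 z : R[i] := (s * (inpd z)%:R)%:C.
have mF1 : cmeas setT (F1 \o @plane R) by apply: cmeas_real; apply: measurable_funM => //; exact: measurable_cst.
have mF2 : cmeas setT (F2 \o @plane R).
  have -> : F2 \o @plane R = fun w : R * R => (s * (0 < sqnorm w < 1)%R%:R)%:C.
    apply/funext => w; rewrite /F2 /=; suff -> : inpd (plane w) = (0 < sqnorm w < 1) by [].
    apply/idP/idP => [/inpdP/plane_disc //|/andP[w0 w1]].
    by apply/inpdP; split; [exact: cabs_plane_lt1 | exact: plane_neq0].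
  by apply: cmeas_real; have msq := @measurable_sqnorm R; mfun.
have mP := @symbol_cmeas R a b0 m p psi psi_continuous (peak_elt n).
have mS : cmeas setT (fun w => (F1 \o @plane R) w + (F2 \o @plane R) w) by exact: cmeasD.
have ineq w : 0 < dens w -> cabs ((times psi (peak_elt n) \o @plane R) w) <=
    cabs ((F1 \o @plane R) w + (F2 \o @plane R) w).
  move=> /(@dens_disc_lt1 R a b0 m) w1 /=; set x := plane w in w1 *.
  rewrite /F1 /F2 -rmorphD cabsR ger0_norm; last by rewrite addr_ge0// mulr_ge0 ?cabs_ge0// ltW.
  rewrite /times cabsM; have E0 := cabs_ge0 (peak_elt n x).
  have [xd|xd] := ltP (cabs (x - zeta)) d.
    have : cabs (psi x) <= eta.
      have := hd' (x - zeta); rewrite [zeta + _]addrC subrK {2}/psi subrr subr0; apply; last exact: ltW.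
      by apply: (lt_le_trans xd); rewrite ge_min lexx.
    move=> h; apply: (@le_trans _ _ (eta * cabs (peak_elt n x))); first by rewrite ler_wpM2r.
    by rewrite lerDl mulr_ge0// ltW.
  apply: (@le_trans _ _ (s * (inpd x)%:R)); last by rewrite lerDr mulr_ge0// ltW.
  rewrite /peak; case: (inpd x); last by rewrite mul0r mulr0 cabs0 !mulr0.
  rewrite mul1r mulr1 cabsM cabsX cabsR (ger0_norm (ltW (peak_scale_gt0 n))).
  have h1 := edge_far zeta1 (ltW w1) d01 xd.
  apply: (@le_trans _ _ (K * (peak_scale n * kappa ^+ n))).
    apply: ler_pM; rewrite ?mulr_ge0 ?exprn_ge0 ?cabs_ge0 ?(ltW (peak_scale_gt0 n)) ?hK ?(ltW w1)//.
    rewrite ler_wpM2l ?(ltW (peak_scale_gt0 n))// lerXn2r ?nnegrE ?cabs_ge0//.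
    by case/andP: k01.
  by rewrite mulrC -ler_pdivlMr.
apply: (le_trans (le_npow a1 b1' p0 mP mS ineq)).
apply: (le_trans (npowD a1 b1' p0 mF1 mF2)); rewrite -/k2.
have h1 : (npow (F1 \o @plane R) <= (e / (2 * k2))%:E)%E.
  have mG := cmeasM (cmeas_cst setT eta%:C) mE.
  apply: (@le_trans _ _ (npow (fun w => eta%:C * (peak_elt n \o @plane R) w))).
    apply: (le_npow a1 b1' p0 mF1 mG) => w _ /=.
    by rewrite -peak_eltE /F1 cabsM !cabsR normrM [X in _ * X]ger0_norm ?cabs_ge0.
  rewrite (npowZ p a1 b1' eta%:C mE) cabsR (ger0_norm (ltW eta0)).
  by rewrite [X in (_ * X)%E](peak_norm1 n) mule1 lee_fin -[leLHS]mulr1.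
have h2 : (npow (F2 \o @plane R) <= (e / (2 * k2))%:E)%E.
  apply: le_trans (hm F2 s (ltW s0) mF2 _ _) _; last by rewrite lee_fin.
    by rewrite /F2 /inpd eqxx andbF mulr0.
  by move=> z /inpdP hz; rewrite /F2 hz mulr1 cabsR ger0_norm// ltW.
have k2e : (0 <= k2%:E)%E by rewrite lee_fin ltW.
apply: (le_trans (lee_wpmul2l k2e (leeD h1 h2))); rewrite -EFinD -EFinM lee_fin.
by apply: eq_ler; field; rewrite gt_eqF.
Qed.

(** In norm the images accumulate at some [g]. The difference of [g] and the multiple
    [c] of the peaks is small in norm and tends to [g] pointwise, so [g] has norm
    zero; but the multiples have norm [|c|]. *)
Lemma toeplitz_compact_necessary (T : space -> space) : is_toeplitz phi T -> compact_operator T ->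
  phi zeta = 0.
Proof.
move=> hT cT; have [l l0 hl] := projection_peak.
have [C C0 hC] := projection_norm a1 b1 b00 p1 pq Mp Mq.
pose k2 : R := 2 `^ p; have k20 : 0 < k2 by rewrite powR_gt0.
have k2e : (0 <= k2%:E)%E by rewrite lee_fin ltW.
pose c := phi zeta * l%:C; apply/eqP; apply: contraT => phi0.
have c0 : 0 < cabs c `^ p by rewrite powR_gt0// cabs_gt0 mulf_neq0// -cabs_eq0 cabsR ger0_norm ?gt_eqF// ltW.
pose E n := peak_elt n; have mE n := bergman_cmeas (E n); have mTE n := bergman_cmeas (T (E n)).
(* The error of the approximation of the images by multiples of the peaks. *)
pose Rm n z := T (E n) z - c * E n z.
have mcE n : cmeas setT (fun w : R * R => c * (E n \o @plane R) w) by apply: cmeasM; [exact: cmeas_cst | exact: mE].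
have mR n : cmeas setT (Rm n \o @plane R) by apply: cmeasD; [exact: mTE | apply: cmeasN; exact: mcE].
have hR n z : punctured_disc z -> Rm n z = projection a b (times psi (E n)) z.
  move=> hz; have okE : okF (E n).
    by apply: (ok_of_npow a1 b1 p1 pq Mp Mq (mE n)); [exact: bergman_0 | rewrite [X in (X < _)%E](peak_norm1 n) ltry].
  have okS := symbol_ok a1 b1 p1 pq Mp Mq psi_continuous (E n).
  rewrite /Rm hT//.
  have -> : (fun w : R[i] => phi w * E n w) = (fun w : R[i] => times psi (E n) w + phi zeta * E n w).
    by apply/funext => w; rewrite /times /psi; ring.
  by rewrite (projection_lin a1 b1 b00 (phi zeta) okS okE hz) hl// /c mulrA addrK.
have Rsmall e : 0 < e -> \forall n \near \oo, (npow (Rm n \o @plane R) <= e%:E)%E.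
  move=> e0; have C1 : 0 < C + 1 by lra.
  have eC : 0 < e / (C + 1) by rewrite divr_gt0.
  apply: filterS (peak_concentration eC) => n hn.
  have mP := @symbol_cmeas R a b0 m p psi psi_continuous (E n).
  have P0 : times psi (E n) 0 = 0 by rewrite /times bergman_0 mulr0.
  have R0 : Rm n 0 = 0 by rewrite /Rm !bergman_0 mulr0 subrr.
  apply: (le_trans (hC _ _ mP (mR n) P0 R0 (hR n))).
  have Ce : (0 <= C%:E)%E by rewrite lee_fin.
  apply: (le_trans (lee_wpmul2l Ce hn)); rewrite -EFinM lee_fin.
  by rewrite mulrCA ler_piMr ?(ltW e0)// ler_pdivrMr// mul1r lerDl.
pose B := [set f : space | (bnorm a b p f <= 1)%E].
have BE n : B (E n) by apply/(bnorm_le1 a1 b1' p0); rewrite [X in (X <= _)%E](peak_norm1 n).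
have [g hg] := @compact_cluster_seq R space (@bdist _ a b p) (@bdistC _ a b p) (bergman_nbhs a1 b1' p0)
  (T @` B) (fun n => T (E n)) cT (fun n => ex_intro2 _ _ (E n) (BE n) erefl).
have /choice[r hr] : forall i : nat, exists n, (i <= n)%N /\ bdist (T (E n)) g < i.+1%:R^-1.
  by move=> i; have [|n ? ?] := hg i.+1%:R^-1 i; [rewrite invr_gt0 | exists n].
have mg := bergman_cmeas g.
(* Small in norm, with pointwise limit [g]. *)
pose H i w : R[i] := (g \o @plane R) w - c * (E (r i) \o @plane R) w.
have mH i : cmeas setT (H i) by apply: cmeasD => //; apply: cmeasN; exact: mcE.
have Hsmall e : 0 < e -> \forall i \near \oo, (npow (H i) <= e%:E)%E.
  move=> e0; have e20 : 0 < e / (2 * k2) by rewrite divr_gt0// mulr_gt0.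
  have [J _ hJ] := Rsmall _ e20.
  exists (maxn J (Num.truncn (e / (2 * k2))^-1)) => // i; rewrite /= geq_max => /andP[Ji ti].
  have -> : H i = fun w => (((fun z => g z - T (E (r i)) z) \o @plane R) w + (Rm (r i) \o @plane R) w).
    by apply/funext => w; rewrite /H /Rm /=; ring.
  apply: (le_trans (npowD a1 b1' p0 (cmeasB_bergman _ _) (mR _))); rewrite -/k2.
  have h1 : (npow ((fun z => (g z - T (E (r i)) z)%R) \o @plane R) <= (e / (2 * k2))%:E)%E.
    rewrite (bdistE a1 b1' p0) lee_fin bdistC; apply: (le_trans (ltW (hr i).2)).
    rewrite -[leRHS]invrK lef_pV2 ?posrE ?invr_gt0//.
    by apply: (le_trans (ltW (truncnS_gt _))); rewrite ler_nat ltnS.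
  have h2 : (npow (Rm (r i) \o @plane R) <= (e / (2 * k2))%:E)%E by apply: hJ; exact: leq_trans (hr i).1.
  apply: (le_trans (lee_wpmul2l k2e (leeD h1 h2))); rewrite -EFinD -EFinM lee_fin.
  by apply: eq_ler; field; rewrite gt_eqF.
have gsmall e : 0 < e -> (npow (g \o @plane R) <= e%:E)%E.
  move=> e0; have lim w : 0 < dens w -> (fun i => cabs (H i w - (g \o @plane R) w)) @ \oo --> (0 : R).
    move=> _; have h : (fun n => cabs c * cabs (E n (plane w))) @ \oo --> (0 : R).
      rewrite -[X in _ --> X](mulr0 (cabs c)); apply: cvgM; first exact: cvg_cst.
      exact: peak_pointwise.
    apply/cvgrPdist_le => e' e'0; move/cvgrPdist_le : h => /(_ e' e'0)[J _ hJ].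
    exists J => // i Ji; have := hJ (r i) (leq_trans Ji (hr i).1).
    rewrite /= !sub0r !normrN !ger0_norm ?mulr_ge0 ?cabs_ge0// -cabsM => h1.
    have -> : H i w - g (plane w) = - (c * ((peak_scale (r i))%:C * peak (r i) (plane w))).
      by rewrite /H /=; ring.
    by rewrite cabsN.
  exact: (@npow_fatou R a b p a1 b1' p0 H _ e mH mg lim (Hsmall e e0)).
pose e := cabs c `^ p / (4 * k2); have e0 : 0 < e by rewrite divr_gt0// mulr_gt0.
have [J _ hJ] := Hsmall e e0; have h1 := hJ J (leqnn J); have h2 := gsmall e e0.
have E1 : npow (fun w => c * (E (r J) \o @plane R) w) = (cabs c `^ p)%:E.
  by rewrite (npowZ p a1 b1' c (mE _)) [X in (_ * X)%E](peak_norm1 (r J)) mule1.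
have : (npow (fun w => c * (E (r J) \o @plane R) w)%R <= (cabs c `^ p / 2)%:E)%E.
  have -> : (fun w => c * (E (r J) \o @plane R) w) = (fun w => (g \o @plane R) w + - H J w).
    by apply/funext => w; rewrite /H /=; ring.
  apply: (le_trans (npowD a1 b1' p0 mg (cmeasN (mH J)))); rewrite npowN -/k2.
  apply: (le_trans (lee_wpmul2l k2e (leeD h2 h1))); rewrite -EFinD -EFinM lee_fin.
  by apply: eq_ler; rewrite /e; field; rewrite gt_eqF.
by rewrite E1 lee_fin; lra.
Qed.

End Necessity.

(** * The characterization *)
Theorem theorem2 (R : realType) (alpha beta beta0 p : R) (m : nat)
    (phi : R[i] -> R[i])
    (halpha : -1 < alpha) (hbeta : -1 < beta)
    (hdecomp : beta = beta0 + m%:R) (hJ : J alpha beta0)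
    (hp1 : 2 * (beta + 1) / (2 * (beta + 1) - m%:R) < p)
    (hp2 : (0 < m)%N -> p < 2 * (beta + 1) / m%:R)
    (hphi : {within (closed_disc : set R[i]^o), continuous (phi : R[i]^o -> R[i]^o)}) :
  toeplitz_compact alpha beta p phi <->
  (forall z : R[i], unit_circle z -> phi z = 0).
Proof.
have [hb0 hb00 _] := hJ; subst beta.
have m0 := ler0n R m; have D0 : 0 < 2 * (beta0 + m%:R + 1) - m%:R by lra.
move: hp1; rewrite ltr_pdivrMr// => hp1'.
have p1 : 1 < p.
  rewrite ltNge; apply/negP => pl1.
  have : p * (2 * (beta0 + m%:R + 1) - m%:R) <= 1 * (2 * (beta0 + m%:R + 1) - m%:R).
    by rewrite ler_wpM2r// ltW.
  lra.
have p0 : 0 < p by exact: lt_trans p1.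
have pB : 0 < p - 1 by lra.
pose q := p / (p - 1).
have pq : p^-1 + q^-1 = 1 by rewrite /q; field; rewrite !gt_eqF.
have Mp : m%:R / 2 * p < beta0 + m%:R + 1.
  have [m00|m00] := posnP m; first by rewrite m00 !mul0r addr0; lra.
  have mp : 0 < m%:R :> R by rewrite ltr0n.
  by move: (hp2 m00); rewrite ltr_pdivlMr//; lra.
have Mq : m%:R / 2 * q < beta0 + m%:R + 1.
  have -> : m%:R / 2 * q = m%:R * p / (2 * (p - 1)) by rewrite /q; field; rewrite gt_eqF.
  by rewrite ltr_pdivrMr ?mulr_gt0//; lra.
split=> [[T hT cT] z z1|phi0].
  exact: (toeplitz_compact_necessary halpha hb0 hb00 p1 pq Mp Mq z1 hphi hT cT).
have [T hT] := toeplitz_exists halpha hb0 hb00 p1 pq Mp Mq hphi.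
by exists T => //; exact: (toeplitz_compact_sufficient halpha hb0 hb00 p1 pq Mp Mq hphi hT phi0).
Qed.
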